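(* Let $a\neq b$ be complex numbers. For $d\le 11$ we have $PCS_d=COS_d$, i.e. the parametric center set has no non-composition components. For $d\ge 12$, every component of $PCS_d$ consisting of pairs not satisfying the Composition Condition has dimension at most $\lfloor d/3\rfloor+2$.
   Context: $\mathcal{P}_d$ is the complex vector space of polynomials of degree at most $d$ vanishing at $a$ and $b$. $PCS_d\subseteq\mathcal{P}_d\times\mathcal{P}_d$ is the set of pairs $(P,Q)$ such that, with $p=P'$, $q=Q'$, for every $\epsilon\in\mathbb{C}$ every solution of $y'=p(x)y^3+\epsilon q(x)y^2$ with $|y(a)|$ sufficiently small satisfies $y(b)=y(a)$ (continuation along the segment $[a,b]$); i.e. the Abel equation $y'=py^3+qy^2$ has a parametric center on $[a,b]$. A pair $(P,Q)$ satisfies the Composition Condition on $[a,b]$ if there exist polynomials $\widetilde P,\widetilde Q,W$ with $W(a)=W(b)$ such that $P=\widetilde P\circ W$, $Q=\widetilde Q\circ W$; $COS_d\subseteq\mathcal{P}_d\times\mathcal{P}_d$ is the set of such pairs. *)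

(* Defs.v *)
From Stdlib Require Import Reals.
From Coquelicot Require Import Coquelicot.

Definition peval (c : nat -> C) (d : nat) (x : C) : C :=
  sum_n (fun i => Cmult (c i) (Cpow x i)) d.

Definition pderiv (c : nat -> C) : nat -> C :=
  fun i => Cmult (RtoC (INR (S i))) (c (S i)).

Inductive is_cpoly : (C -> C) -> Prop :=
  | cpoly_const (k : C) : is_cpoly (fun _ => k)
  | cpoly_id : is_cpoly (fun x => x)
  | cpoly_add f g : is_cpoly f -> is_cpoly g -> is_cpoly (fun x => Cplus (f x) (g x))
  | cpoly_mul f g : is_cpoly f -> is_cpoly g -> is_cpoly (fun x => Cmult (f x) (g x)).

Definition in_Pd (a b : C) (d : nat) (c : nat -> C) : Prop :=
  (forall i, (d < i)%nat -> c i = RtoC 0) /\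
  peval c d a = RtoC 0 /\ peval c d b = RtoC 0.

Definition Space : Type := ((nat -> C) * (nat -> C))%type.

Definition in_PdxPd (a b : C) (d : nat) (v : Space) : Prop :=
  in_Pd a b d (fst v) /\ in_Pd a b d (snd v).

Definition seg (a b : C) (t : R) : C := Cplus a (Cmult (RtoC t) (Cminus b a)).

(* y : [0,1] -> C is a solution of  y' = p y^3 + eps q y^2  continued along
   the segment [a,b], written in the parametrization x = a + t (b - a):
   d/dt y(t) = (b - a) * (p(x(t)) y^3 + eps q(x(t)) y^2). *)
Definition abel_sol (a b : C) (d : nat) (v : Space) (eps : C) (y : R -> C) : Prop :=
  forall t : R, 0 <= t <= 1 ->
    is_derive y t
      (Cmult (Cminus b a)
        (Cplus (Cmult (peval (pderiv (fst v)) d (seg a b t)) (Cpow (y t) 3))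
               (Cmult eps (Cmult (peval (pderiv (snd v)) d (seg a b t)) (Cpow (y t) 2))))).

Definition PCS_d (a b : C) (d : nat) (v : Space) : Prop :=
  in_PdxPd a b d v /\
  forall eps : C, exists delta : R, 0 < delta /\
    forall y : R -> C, abel_sol a b d v eps y -> Cmod (y 0) < delta -> y 1 = y 0.

Definition COS_d (a b : C) (d : nat) (v : Space) : Prop :=
  in_PdxPd a b d v /\
  exists Pt Qt W : C -> C, is_cpoly Pt /\ is_cpoly Qt /\ is_cpoly W /\ W a = W b /\
    (forall x, peval (fst v) d x = Pt (W x)) /\
    (forall x, peval (snd v) d x = Qt (W x)).

Inductive is_mpoly : (Space -> C) -> Prop :=
  | mpoly_const (k : C) : is_mpoly (fun _ => k)
  | mpoly_fst (i : nat) : is_mpoly (fun v => fst v i)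
  | mpoly_snd (i : nat) : is_mpoly (fun v => snd v i)
  | mpoly_add f g : is_mpoly f -> is_mpoly g -> is_mpoly (fun v => Cplus (f v) (g v))
  | mpoly_mul f g : is_mpoly f -> is_mpoly g -> is_mpoly (fun v => Cmult (f v) (g v)).

Definition sub (A B : Space -> Prop) : Prop := forall v, A v -> B v.

Definition zclosed (F : Space -> Prop) : Prop :=
  exists S : (Space -> C) -> Prop, (forall f, S f -> is_mpoly f) /\
    forall v, F v <-> (forall f, S f -> f v = RtoC 0).

Definition irreducible (V : Space -> Prop) : Prop :=
  (exists v, V v) /\
  forall F1 F2, zclosed F1 -> zclosed F2 -> sub V (fun v => F1 v \/ F2 v) ->
    sub V F1 \/ sub V F2.

Definition is_component (S V : Space -> Prop) : Prop :=
  sub V S /\ irreducible V /\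
  forall W, irreducible W -> sub V W -> sub W S -> sub W V.

Definition rel_closed (V W : Space -> Prop) : Prop :=
  exists F, zclosed F /\ forall v, W v <-> (V v /\ F v).

Definition strict_sub (A B : Space -> Prop) : Prop := sub A B /\ ~ sub B A.

Definition dim_le (V : Space -> Prop) (k : nat) : Prop :=
  ~ exists W : nat -> Space -> Prop,
      (forall i, (i <= S k)%nat -> irreducible (W i) /\ rel_closed V (W i)) /\
      (forall i, (i <= k)%nat -> strict_sub (W i) (W (S i))).

(* Main.v *)
(** Expanding the solutions of y' = p y^3 + eps q y^2 in a first integral
    y + phi_2 y^2 + phi_3 y^3 + ..., a center for the value eps means
    phi_k(b) = 0 for all k.  The parts of the phi_k of degree one in q, and those
    of degree one in p, give the vanishing of all the moments of P^k dQ and of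
    Q^k dP over [a,b].

    If all moments of P^k dQ vanish, then a linear relation holds between the
    values of Q on the branches of P^-1(z).  At infinity the monodromy contains a
    full cycle, so the branches form a cyclic group carrying a Schur ring, and the
    structure of such rings over cyclic groups shows that Q is a sum of polynomials
    in right factors W of P with W(a) = W(b).  Either one W suffices, which is the
    Composition Condition, or P has two such factors of coprime degrees over a
    common W0 with W0(a) <> W0(b).  In the second case the decompositions of P
    express its coefficients through few of them, at most n/6 + 1 for deg P = n,
    except when P is even about the midpoint of [a,b]; then P is determined by Q
    up to two further parameters, or both P and Q are even about the midpoint.
    Altogether a non-composition pair depends on at most d/3 + 2 parameters, and
    there is none at all when d <= 11.

    A chain of k + 2 irreducible closed sets produces k + 1 polynomial functions
    whose monomials are linearly independent on the top set, whereas more functions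
    than parameters satisfy a nontrivial polynomial relation. *)

(* Two places of the splitting field of P(x) - z over K(z) replace analytic continuation. Expansion
   at z = infinity numbers the branches by Z/n, realises the rotation as a field automorphism, and
   turns linear relations between polynomials in the branches into relations between leading
   coefficients. Expansion at z = 0 turns vanishing moments into one relation between the branches,
   with integer coefficients. Integrality makes the Schur ring rational, because such relations
   survive Galois conjugation of roots of unity; for rational rings over cyclic groups an elementary
   structure argument suffices.

   The dimension bound uses only the two moment conditions, so it is proved for every irreducible
   set of pairs satisfying them and not contained in COS. Irreducibility is applied to the union of
   COS with a hypersurface, so COS has to be Zariski closed; its equations are the moments of P^k
   d(Q^j) for all k and j, together with the linear conditions. The main term of the bound is
   reached when P and Q both have double decompositions and their parameters are counted
   separately. *)
From HB Require Import structures.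
From mathcomp Require all_boot all_order all_algebra all_fingroup cyclic pgroup sylow boolp ring all_field reals Rstruct complex closed_field zify.
From Stdlib Require Reals Lra Lia.
From Coquelicot Require Coquelicot Complex.
Require Defs.

(** * Rational Schur rings over finite abelian groups *)

Module SchurRing.
Import all_boot all_order all_algebra all_fingroup cyclic pgroup sylow.
Set Implicit Arguments. Unset Strict Implicit. Unset Printing Implicit Defensive.
Import GroupScope.

Section SRingDef.
Variables (gT : finGroupType) (e : rel gT).

Definition sinv (X : {set gT}) := forall x y, e x y -> (x \in X) = (y \in X).

(** The coefficient of [z] in the product of the group-ring elements of [X] and [Y]. *)
Definition scount (X Y : {set gT}) (z : gT) := #|[set x in X | x^-1 * z \in Y]|.

(** The classes of [e] are the basic sets of a Schur ring, and the [sinv] sets are their unions.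
    [sr_conv] says that the span of the classes is closed under the group-ring product. [sr_rat] is
    rationality: generators of the same cyclic subgroup are equivalent, so inside a cyclic group the
    class of an element depends only on its order. *)
Record sring : Prop := SRing {
  sr_abel : forall x y : gT, x * y = y * x;
  sr_refl : forall x, e x x;
  sr_sym : forall x y, e x y -> e y x;
  sr_trans : forall x y z, e x y -> e y z -> e x z;
  sr_rat : forall x y, <[x]> = <[y]> -> e x y;
  sr_one : forall x, e x 1 -> x = 1;
  sr_conv : forall X Y, sinv X -> sinv Y ->
    forall z z', e z z' -> scount X Y z = scount X Y z' }.
End SRingDef.

Section SRingTheory.
Variables (gT : finGroupType) (e : rel gT).
Hypothesis S : sring e.
Let mulC := sr_abel S.
Implicit Types (X Y : {set gT}) (x y z : gT).

Lemma sinvI X Y : sinv e X -> sinv e Y -> sinv e (X :&: Y).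
Proof. by move=> hX hY x y exy; rewrite !inE (hX _ _ exy) (hY _ _ exy). Qed.

Lemma sinvU X Y : sinv e X -> sinv e Y -> sinv e (X :|: Y).
Proof. by move=> hX hY x y exy; rewrite !inE (hX _ _ exy) (hY _ _ exy). Qed.

Lemma sinv1 : sinv e 1.
Proof.
move=> x y exy; rewrite !inE; apply/eqP/eqP => [x1|y1].
  by apply: (sr_one S); apply: (sr_sym S); rewrite -x1.
by apply: (sr_one S); rewrite -y1.
Qed.

Definition satom x := [set y | e x y].

Lemma satom_inv x : sinv e (satom x).
Proof.
move=> y z eyz; rewrite !inE; apply/idP/idP => h; first exact: (sr_trans S) h eyz.
exact: (sr_trans S) h (sr_sym S eyz).
Qed.

Lemma satom_sub x X : sinv e X -> x \in X -> satom x \subset X.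
Proof. by move=> hX xX; apply/subsetP => y; rewrite inE => /hX <-. Qed.

Lemma mem_satom x : x \in satom x. Proof. by rewrite inE (sr_refl S). Qed.

Lemma sinvV X x : sinv e X -> (x^-1 \in X) = (x \in X).
Proof. by move=> hX; apply: hX; apply: (sr_rat S); rewrite cycleV. Qed.

Lemma sinvM X Y : sinv e X -> sinv e Y -> sinv e (X * Y).
Proof.
move=> hX hY z z' ezz.
have mem w : (w \in X * Y) = (0 < scount X Y w)%N.
  apply/mulsgP/card_gt0P => [[x y xX yY ->]|[x]].
    by exists x; rewrite inE xX mulKg.
  by rewrite inE => /andP[xX yY]; exists x (x^-1 * w); rewrite ?mulKVg.
by rewrite !mem (sr_conv S hX hY ezz).
Qed.

Lemma sinv_gen X : sinv e X -> sinv e <<X>>.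
Proof.
move=> hX; have [n ->] := gen_expgs X.
have h1 : sinv e (1 |: X) by apply: sinvU => //; apply: sinv1.
elim: n => [|n IH]; first by rewrite expg0; apply: sinv1.
by rewrite expgS; apply: sinvM.
Qed.

(** Autocorrelation of [X]: the size of its intersection with the translate by [c]. *)
Definition slam X c := #|[set x in X | x * c^-1 \in X]|.

Lemma slam_inv X c c' : sinv e X -> e c c' -> slam X c = slam X c'.
Proof.
move=> hX ecc; have h w : slam X w = scount X X w.
  apply: eq_card => x; rewrite !inE; congr (_ && _).
  by rewrite -(sinvV _ hX) invMg invgK mulC.
by rewrite !h (sr_conv S hX hX ecc).
Qed.

(** The counting principle that carries translation properties along a class. [slam] is constant on
    classes, so one element whose failures are known fixes the number of failures of all the others;
    once that many are exhibited as [A], the rest of [X] must be translated into [X]. *)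
Lemma slam_max X (A : {set gT}) c : A \subset X -> (forall x, x \in A -> x * c^-1 \notin X) ->
  (slam X c + #|A| = #|X|)%N -> forall x, x \in X -> x \notin A -> x * c^-1 \in X.
Proof.
move=> sAX hA hc x xX xA.
have dis : [disjoint [set x in X | x * c^-1 \in X] & A].
  rewrite -setI_eq0; apply/eqP/setP => y; rewrite !inE; apply/negP => /andP[/andP[_ h] yA].
  by move: (hA _ yA); rewrite h.
have : [set x in X | x * c^-1 \in X] :|: A == X.
  rewrite eqEcard; apply/andP; split.
    by rewrite subUset sAX andbT; apply/subsetP => y; rewrite inE => /andP[].
  by move: (leq_card_setU [set x in X | x * c^-1 \in X] A).2; rewrite dis => /eqP ->; rewrite -hc.
move=> /eqP/setP/(_ x); rewrite !inE xX (negPf xA) orbF /=.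
by [].
Qed.

(** The radical of [X], its stabiliser under translation. It is the set where [slam] reaches #|X|,
    hence a union of classes. *)
Definition srad X := [set h | X :* h == X].

Lemma srad_group X : group_set (srad X).
Proof.
apply/group_setP; split; first by rewrite inE rcoset1.
by move=> x y; rewrite !inE rcosetM => /eqP -> /eqP ->.
Qed.
Canonical srad_gp X := Group (srad_group X).

Lemma srad_inv X : sinv e X -> sinv e (srad X).
Proof.
move=> hX x y exy.
have h w : (w \in srad X) = (slam X w == #|X|).
  rewrite inE; apply/eqP/eqP => [hw|hw].
    rewrite /slam; apply: eq_card => z; rewrite inE -mem_rcoset hw andbb //.
  have /eqP : [set x in X | x * w^-1 \in X] == X.
    by rewrite eqEcard -/(slam X w) hw leqnn andbT; apply/subsetP => z; rewrite inE => /andP[].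
  move=> hz; apply/eqP; rewrite eq_sym eqEcard card_rcoset leqnn andbT.
  by apply/subsetP => z; rewrite -{1}hz inE mem_rcoset => /andP[].
by rewrite !h (slam_inv hX exy).
Qed.

Lemma sradP X c : (forall x, x \in X -> x * c \in X) -> c \in srad X.
Proof.
move=> h; rewrite inE eqEcard card_rcoset leqnn andbT.
by apply/subsetP => z /rcosetP[x xX ->]; apply: h.
Qed.


Lemma fun_inv_conv (f h : gT -> nat) :
  (forall x y, e x y -> f x = f y) -> (forall x y, e x y -> h x = h y) ->
  forall z z', e z z' -> (\sum_x f x * h (x^-1 * z)%g = \sum_x f x * h (x^-1 * z')%g)%N.
Proof.
move=> hf hh z z' ezz.
pose N := (\sum_x f x + \sum_x h x).+1.
(* Both functions are sums of the indicators of their superlevel sets, which reduces the claim to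
   [sr_conv]. *)
have layer w : (\sum_x f x * h (x^-1 * w)%g =
    \sum_(i < N) \sum_(j < N) scount [set x | i < f x]%N [set x | j < h x]%N w)%N.
  have lay a : (a < N)%N -> a = (\sum_(i < N) (i < a)%N)%N.
    move=> aN; rewrite -(big_mkord xpredT (fun i => nat_of_bool (i < a)%N)).
    rewrite (big_cat_nat (n := a)) //=; last exact: ltnW.
    rewrite [X in (_ + X)%N]big1_seq ?addn0; last first.
      by move=> i; rewrite mem_index_iota => /andP[_ /andP[ai _]]; rewrite ltnNge ai.
    rewrite (eq_big_nat _ _ (F2 := fun _ => 1%N)); last by move=> i /andP[_ ->].
    by rewrite sum_nat_const_nat subn0 muln1.
  have fN x : (f x < N)%N by rewrite ltnS (bigD1 x) //= -addnA leq_addr.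
  have hN x : (h x < N)%N by rewrite ltnS [X in (_ + X)%N](bigD1 x) //= addnCA leq_addr.
  transitivity (\sum_x \sum_(i < N) \sum_(j < N) (i < f x) * (j < h (x^-1 * w)%g))%N.
    apply: eq_bigr => x _.
    rewrite {1}(lay _ (fN x)) {1}(lay _ (hN (x^-1 * w))) big_distrl /=.
    by apply: eq_bigr => i _; rewrite big_distrr.
  rewrite exchange_big /=; apply: eq_bigr => i _.
  rewrite exchange_big /=; apply: eq_bigr => j _.
  rewrite /scount -sum1_card [RHS]big_mkcond /=; apply: eq_bigr => x _.
  by rewrite !inE; case: (_ < _)%N; case: (_ < _)%N.
rewrite !layer; apply: eq_bigr => i _; apply: eq_bigr => j _.
by apply: sr_conv ezz => // x y exy; rewrite !inE ?(hf _ _ exy) ?(hh _ _ exy).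
Qed.

Definition tupset X k (z : gT) : {set k.-tuple gT} :=
  [set t : k.-tuple gT | all (mem X) t && (\prod_(x <- t) x == z)].

Lemma card_tupset0 X z : #|tupset X 0 z| = (z == 1) :> nat.
Proof.
case: eqP => [->|hz].
  rewrite (_ : tupset _ _ _ = [set [tuple]]) ?cards1 //.
  by apply/setP => t; rewrite !inE tuple0 /= big_nil !eqxx.
apply/eqP; rewrite cards_eq0; apply/eqP/setP => t; rewrite !inE tuple0 /= big_nil eq_sym.
by apply/eqP.
Qed.

Lemma card_tupsetS X k z :
  #|tupset X k.+1 z| = (\sum_x (x \in X) * #|tupset X k (x^-1 * z)%g|)%N.
Proof.
rewrite -sum1_card.
rewrite (reindex (fun p : gT * k.-tuple gT => [tuple of p.1 :: p.2])) /=; last first.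
  exists (fun t => (thead t, [tuple of behead t])) => [[x t] _|t _] /=.
    by congr (_, _); apply: val_inj.
  by rewrite [RHS]tuple_eta; apply: val_inj.
rewrite (eq_bigl (fun p => (xpredT p.1) && ((p.1 \in X) && (p.2 \in tupset X k (p.1^-1 * z))))); last first.
  move=> [x t] /=; rewrite !inE /= big_cons -andbA; congr (_ && (_ && _)).
  by rewrite -(can2_eq (mulKg x) (mulKVg x)).
rewrite -(pair_big_dep xpredT (fun x t => (x \in X) && (t \in tupset X k (x^-1 * z))) (fun _ _ => 1%N)) /=.
apply: eq_bigr => x _; case: (x \in X) => /=; first by rewrite sum1_card mul1n.
by rewrite big_pred0.
Qed.

Lemma card_tupset_inv X k z z' : sinv e X -> e z z' -> #|tupset X k z| = #|tupset X k z'|.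
Proof.
move=> hX; elim: k z z' => [|k IH] z z' ezz.
  by rewrite !card_tupset0; congr nat_of_bool; move: (sinv1 ezz); rewrite !inE.
rewrite !card_tupsetS.
by apply: (@fun_inv_conv (fun x => x \in X) (fun w => #|tupset X k w|)) ezz => // x y /hX ->.
Qed.

Let prodnseq k x : \prod_(y <- nseq k x) y = x ^+ k.
Proof. by elim: k => [|k IH]; rewrite /= ?big_nil // big_cons IH expgS. Qed.

(* Frobenius: rotating the [p]-tuples with product [z] leaves the constant ones fixed. *)
Lemma card_pth_root_inv X p z z' : prime p -> sinv e X -> e z z' ->
  #|[set x in X | x ^+ p == z]| = #|[set x in X | x ^+ p == z']| %[mod p].
Proof.
move=> p_pr hX ezz.
suff h w : #|tupset X p w| = #|[set x in X | x ^+ p == w]| %[mod p].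
  by rewrite -!h (card_tupset_inv _ hX ezz).
have rot_inj : injective (fun t : p.-tuple gT => [tuple of rot 1 t]).
  by move=> t u /(congr1 val) /= /rot_inj /val_inj.
pose r := perm rot_inj.
have rX k t : val ((r ^+ k) t) = iter k (rot 1) (val t).
  by elim: k t => [|k IH] t; rewrite ?expg0 ?perm1 // expgSr permM permE /= IH.
have rp : r ^+ p = 1.
  apply/permP => t; apply: val_inj; rewrite rX perm1.
  have it k : k <= p -> iter k (rot 1) (val t) = rot k (val t).
    elim: k => [|k IH] kp; first by rewrite rot0.
    by rewrite iterS IH ?(ltnW kp) // -rotS // size_tuple.
  by rewrite it // -{1}(size_tuple t) rot_size.
have pG : p.-group <[r]>.
  by apply: (@pnat_dvd _ p); rewrite ?pnat_id // order_dvdn rp.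
have acts : [acts <[r]>, on tupset X p w | 'P].
  rewrite cycle_subG; apply/astabsP => t.
  rewrite /= apermE permE !inE /= (perm_all _ (permEl (perm_rot 1 _))); congr (_ && _).
  case: t => [[|x s] sz] //=; rewrite rot1_cons -cats1 big_cat /= !big_cons big_nil mulg1.
  by rewrite mulC.
rewrite (pgroup_fix_mod pG acts).
rewrite afix_cycle; congr (_ %% _).
have p0 : (0 < p)%N := prime_gt0 p_pr.
have fixP (t : p.-tuple gT) : t \in 'Fix_'P[r] -> val t = nseq p (head 1 t).
  move/afix1P; rewrite /= apermE permE => /(congr1 val) /=.
  case: t => [[|x s] sz] /=; first by rewrite -(eqP sz) in p0.
  rewrite rot1_cons -(eqP sz) /= => {sz}; elim: s => //= y s IH [-> h].
  by rewrite -IH.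
rewrite -(card_imset (mem [set x in X | x ^+ p == w]) (_ : injective (fun x => [tuple of nseq p x]))); last first.
  by move=> x y /(congr1 val) /= /(congr1 (head 1)); case: (p) p0.
apply: eq_card => t; rewrite in_setI; apply/andP/imsetP.
  case=> + /fixP tE; rewrite inE => /andP[tX /eqP tw]; exists (head 1 t); last by apply: val_inj.
  move: (head 1 t) tE tX tw => x ->; rewrite prodnseq all_nseq eqn0Ngt p0 /= => xX xw; rewrite inE xw eqxx andbT; exact: xX.
case=> x; rewrite inE => /andP[xX /eqP xp] ->; rewrite inE prodnseq xp eqxx andbT all_nseq /= xX orbT.
split=> //; apply/afix1P; apply: val_inj; rewrite /= apermE permE /=.
by case: (p) => // k; rewrite rot1_cons; elim: k => //= k ->.
Qed.

End SRingTheory.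
End SchurRing.

(** * The quotient of a Schur ring by an invariant subgroup *)

Module SchurQuotient.
Import all_boot all_order all_algebra all_fingroup cyclic pgroup sylow.
Import SchurRing.
Set Implicit Arguments. Unset Strict Implicit. Unset Printing Implicit Defensive.
Import GroupScope.

Section Quo.
Variables (gT : finGroupType) (e : rel gT).
Hypothesis S : sring e.
Let mulC := sr_abel S.
Variable R : {group gT}.
Hypothesis hR : sinv e R.

Definition sinvb (X : {set gT}) := [forall x, forall y, e x y ==> ((x \in X) == (y \in X))].

Lemma sinvP X : reflect (sinv e X) (sinvb X).
Proof.
apply: (iffP forallP) => [h x y exy | h x].
  by move/forallP/(_ y)/implyP/(_ exy)/eqP: (h x).
by apply/forallP => y; apply/implyP => /h ->.
Qed.

(** Defined by non-separation: no set of cosets with invariant preimage tells the two cosets apart.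
    In this form it is an equivalence relation at once, and its invariant sets are those with
    invariant preimage. *)
Definition qrel : rel (coset_of R) := fun u v =>
  [forall X : {set coset_of R}, sinvb (coset R @^-1: X) ==> ((u \in X) == (v \in X))].

Lemma qrelP u v : reflect (forall X : {set coset_of R}, sinv e (coset R @^-1: X) ->
   (u \in X) = (v \in X)) (qrel u v).
Proof.
apply: (iffP forallP) => [h X /sinvP hX | h X].
  by move/implyP/(_ hX)/eqP: (h X).
by apply/implyP => /sinvP /h ->.
Qed.

Lemma abel_norm (x : gT) : x \in 'N(R).
Proof.
apply/normP; apply/eqP; rewrite eqEcard cardJg leqnn andbT.
by apply/subsetP => _ /imsetP[y yR ->]; rewrite conjgE mulC -mulgA mulgV mulg1.
Qed.

Lemma cosetM (x y : gT) : coset R (x * y) = coset R x * coset R y.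
Proof. by rewrite morphM ?abel_norm. Qed.

Lemma qrel_coset x y : e x y -> qrel (coset R x) (coset R y).
Proof. by move=> exy; apply/qrelP => X /(_ x y exy); rewrite !inE. Qed.

Lemma sinv_preim (X : {set coset_of R}) : sinv qrel X -> sinv e (coset R @^-1: X).
Proof. by move=> hX x y exy; rewrite !inE; apply: hX; apply: qrel_coset. Qed.

Lemma card_preim_coset (A : {set coset_of R}) : #|coset R @^-1: A| = (#|A| * #|R|)%N.
Proof.
rewrite -sum1_card (partition_big (coset R) (mem A)) /=; last by move=> x; rewrite inE.
rewrite -sum_nat_const; apply: eq_bigr => u uA.
have [x _ ux] := cosetP u; rewrite -(card_rcoset R x) -sum1_card; apply: eq_bigl => y.
rewrite inE mem_rcoset; apply/andP/idP => [[_ /eqP yu]|yR].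
  apply: (coset_idr (abel_norm _)).
  by rewrite cosetM morphV ?abel_norm // yu ux mulgV.
suff -> : coset R y = u by rewrite eqxx.
by rewrite -(mulgKV x y) cosetM (coset_id yR) mul1g.
Qed.

Lemma quo_sring : sring qrel.
Proof.
split.
- move=> u v; have [x _ ->] := cosetP u; have [y _ ->] := cosetP v.
  by rewrite -!cosetM mulC.
- by move=> u; apply/qrelP.
- by move=> u v /qrelP h; apply/qrelP => X /h.
- by move=> u v w /qrelP h /qrelP h'; apply/qrelP => X hX; rewrite h // h'.
- move=> u v cuv; apply/qrelP => X hX.
  have [x _ ux] := cosetP u.
  (* Rationality does not lift along an arbitrary representative. The part of [x] at the primes of
     #[u] still maps to [u], and for it a generator u^m of <u> lifts to a generator y^m of <y>. *)
  pose y := x.`_(\pi(#[u])).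
  have uy : u = coset R y.
    have -> : coset R y = (coset R x).`_(\pi(#[u])) by rewrite -morph_constt ?abel_norm.
    by rewrite -ux constt_p_elt // /p_elt pnat_pi.
  have yg : \pi(#[u]).-nat #[y] by apply: p_elt_constt.
  have /cycleP [m vm] : v \in <[u]> by rewrite cuv cycle_id.
  have co : coprime #[u] m.
    by have := generator_cycle v; rewrite -cuv vm generator_coprime.
  have coy : coprime #[y] m.
    have [m0|m0] := posnP m; last first.
      by apply: (pnat_coprime yg); rewrite -coprime_pi'.
    move: co; rewrite m0 /coprime gcdn0 => /eqP u1; move: yg; rewrite u1 => yg.
    by rewrite gcdn0; apply/eqP/(pnat_1 yg); apply/pnatP => // p p_pr; rewrite !inE.
  have vy : v = coset R (y ^+ m).
    rewrite vm uy; elim: (m) => [|k IH]; first by rewrite !expg0 (coset_id (group1 R)).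
    by rewrite !expgS cosetM IH.
  have exy : e y (y ^+ m).
    by apply: (sr_rat S); apply/eqP; rewrite -[_ == _]/(generator _ _) generator_coprime.
  by have := hX _ _ exy; rewrite !inE -uy -vy.
- move=> u /qrelP /(_ [set 1]); rewrite !inE eqxx => h; apply/eqP; rewrite h // => x y exy.
  have hc (z : gT) : (z \in coset R @^-1: [set 1]) = (z \in R).
    rewrite !inE; apply/eqP/idP => [|zR]; last exact: coset_id.
    by move/coset_idr; apply; apply: abel_norm.
  by rewrite [in LHS]hc [in RHS]hc; apply: hR.
- move=> X Y hX hY u u' /qrelP h; pose m := scount X Y u.
  have hh := h [set w | scount X Y w == m]; rewrite !inE eqxx in hh.
  apply/esym/eqP; rewrite -hh // {hh h}.
  have cnt z : (scount X Y (coset R z) * #|R|)%N = scount (coset R @^-1: X) (coset R @^-1: Y) z.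
    rewrite /scount -card_preim_coset; apply: eq_card => x.
    by rewrite !inE cosetM morphV ?abel_norm.
  move=> z z' ezz; rewrite !inE.
  rewrite -(eqn_pmul2r (cardG_gt0 R)) -[in RHS](eqn_pmul2r (cardG_gt0 R)) !cnt.
  by rewrite (sr_conv S (sinv_preim hX) (sinv_preim hY) ezz).
Qed.
End Quo.
End SchurQuotient.

(** * Structure of rational Schur rings over cyclic groups *)

Module SchurCyclic.
Import all_boot all_order all_algebra all_fingroup cyclic pgroup sylow.
Import SchurRing SchurQuotient.
Set Implicit Arguments. Unset Strict Implicit. Unset Printing Implicit Defensive.
Import GroupScope.

Section Core.
Variables (gT : finGroupType) (e : rel gT).
Hypothesis S : sring e.
Let mulC := sr_abel S.
Variables (G : {group gT}) (g : gT).
Hypotheses (hG : sinv e G) (Gg : G :=: <[g]>).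
Variable T1 : {set gT}.
Hypotheses (iT1 : sinv e T1) (T1G : T1 \subset G) (gT1 : g \in T1).
Hypothesis T1min : forall X x, sinv e X -> x \in T1 -> x \in X -> T1 \subset X.
Hypothesis rad1 : forall c, c \in srad T1 -> c = 1.
Let gG : g \in G. Proof. by rewrite Gg cycle_id. Qed.
Let cycG : cyclic G. Proof. by rewrite Gg cycle_cyclic. Qed.

Lemma e_order x y : x \in G -> y \in G -> #[x] = #[y] -> e x y.
Proof.
move=> xG yG oxy; apply: (sr_rat S); apply/eqP.
by rewrite (eq_subG_cyclic cycG) ?cycle_subG //; apply/eqP.
Qed.

Variables (p : nat) (h : gT).
Hypotheses (p_pr : prime p) (hhG : h \in G) (oh : #[h] = p).

Let inE_E x : x \in G -> x ^+ p = 1 -> x \in <[h]>.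
Proof.
move=> xG xp; rewrite -cycle_subG.
have : <[x]> \subset G by rewrite cycle_subG.
have hs : <[h]> \subset G by rewrite cycle_subG.
move=> xs; rewrite -(cardSg_cyclic cycG xs hs) -!orderE oh order_dvdn; exact/eqP.
Qed.

Let ordM y x : y \in G -> coprime #[y] p -> x \in <[h]> -> x != 1 -> #[y * x] = (#[y] * p)%N.
Proof.
move=> yG co xE x1.
have ox : #[x] = p.
  have : #[x] %| p by rewrite -oh order_dvdG.
  by move/(primeP p_pr).2/orP => -[/eqP|/eqP //]; move/eqP; rewrite order_eq1 (negPf x1).
by rewrite orderM ?ox //; apply: mulC.
Qed.

(* the p'-elements over which [T1] is not a union of cosets of <h> *)
Definition unbal := [set y in G | coprime #[y] p && ((y \in T1) (+) (y * h \in T1))].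

Let hE : h \in <[h]>. Proof. exact: cycle_id. Qed.
Let h1 : h != 1. Proof. by rewrite -order_eq1 oh neq_ltn prime_gt1 ?orbT. Qed.
Let EG x : x \in <[h]> -> x \in G.
Proof. by move: x; apply/subsetP; rewrite cycle_subG. Qed.
Let p0 : (0 < p)%N. Proof. exact: prime_gt0. Qed.
Let Ep x : x \in <[h]> -> x ^+ p = 1.
Proof. by move=> xE; apply/eqP; rewrite -order_dvdn -oh order_dvdG. Qed.

Let satT x y : x \in T1 -> x \in G -> y \in G -> #[x] = #[y] -> y \in T1.
Proof. by move=> xT xG yG o; rewrite -(iT1 (e_order xG yG o)). Qed.

Let T1yf (y f : gT) : y \in G -> coprime #[y] p -> f \in <[h]> -> f != 1 ->
  (y * f \in T1) = (y * h \in T1).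
Proof.
move=> yG co fE f1; apply: iT1; apply: e_order.
- by rewrite groupM // EG.
- by rewrite groupM.
- by rewrite !ordM.
Qed.

Let T1xf (x f : gT) : x \in T1 -> (forall f, f \in <[h]> -> #[x * f] = #[x]) ->
  f \in <[h]> -> x * f \in T1.
Proof.
move=> xT hx fE; have xG := subsetP T1G _ xT.
apply: (satT xT) => //.
  by apply: groupM => //; apply: EG.
by rewrite (hx _ fE).
Qed.

(** The dichotomy is whether p^2 divides #[x]. If it does, multiplication by an element of <h> keeps
    the order, hence the class; if not, x is a p'-element times an element of <h>. *)
Let split_p x : x \in G ->
  (forall f, f \in <[h]> -> #[x * f] = #[x]) \/
  (exists y f, [/\ x = y * f, y \in G, coprime #[y] p & f \in <[h]>]).
Proof.
move=> xG; have [px|px] := boolP (p %| #[x ^+ p]).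
  left=> f fE.
  have xfp : (x * f) ^+ p = x ^+ p.
    by rewrite expgMn ?(Ep fE) ?mulg1 //; apply: mulC.
  rewrite -[p]expn1 in px.
  have o1 : #[x] = (p ^ 1 * #[x ^+ (p ^ 1)])%N by apply: orderXpfactor; rewrite ?expn1 in px *.
  by rewrite o1; apply: orderXpfactor; rewrite ?expn1 ?xfp // in px *.
right; exists x.`_p^', x.`_p; split; first by rewrite mulC consttC.
- by rewrite groupX.
- by rewrite coprime_sym prime_coprime // -p'natE //; apply: p_elt_constt.
- apply: inE_E; first by rewrite groupX.
  by rewrite -consttX; apply/constt1P; rewrite /p_elt p'natE.
Qed.

Let fib (z : gT) := [set x in T1 | x ^+ p == z].

Let coprimeX (y : gT) : coprime #[y] p -> exists2 m, y ^+ (m * p) = y & coprime #[y] m.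
Proof.
move=> co; have [m hm] : exists m, m * p = 1 %[mod #[y]].
  move: co; rewrite coprime_sym => /(coprimeP _ p0)[[u v] /= uv]; exists u.
  have vu : (v * #[y] <= u * p)%N by rewrite ltnW // -subn_gt0 uv.
  by rewrite -(subnK vu) uv addnC modnMDl.
exists m; first by apply/eqP; rewrite -[X in _ == X]expg1 eq_expg_mod_order hm.
have : coprime #[y] (m * p) by rewrite -coprime_modr hm coprime_modr coprimen1.
by rewrite coprimeMr => /andP[].
Qed.

Lemma unbal_order (y z : gT) : y \in unbal -> z \in G -> #[y] = #[z] -> z \in unbal.
Proof.
rewrite !inE => /and3P[yG co hy] zG o; rewrite zG -o co /=.
have -> : (z \in T1) = (y \in T1) by apply: iT1; apply: e_order.
have -> // : (z * h \in T1) = (y * h \in T1).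
by apply: iT1; apply: e_order; rewrite ?groupM // !ordM // -o.
Qed.

Let orderXp (y : gT) m : coprime #[y] m -> #[y ^+ m] = #[y].
Proof. by move=> co; rewrite orderXgcd (eqP co) divn1. Qed.

(** Invariance comes from counting p-th roots in [T1] modulo p, which is a class function. The roots
    of z fill part of one coset of <h>: one or p - 1 elements if the coset is unbalanced, none or
    all p otherwise. *)
Lemma unbal_inv : sinv e unbal.
Proof.
suff fibE z : z \in unbal = (#|fib z| %% p != 0)%N.
  by move=> z z' ezz; rewrite !fibE (card_pth_root_inv S p_pr iT1 ezz).
apply/idP/idP => [zU|].
  move: (zU); rewrite inE => /and3P[zG co _].
  have [m ym cm] := coprimeX co; set y := z ^+ m.
  have yU : y \in unbal by apply: unbal_order zU _ _; rewrite ?groupX // orderXp.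
  have yG : y \in G by rewrite groupX.
  have yp : y ^+ p = z by rewrite -expgM.
  have coy : coprime #[y] p by rewrite orderXp.
  have fE : fib z = [set x in y *: <[h]> | x \in T1].
    apply/setP => x; rewrite !inE andbC; apply: andb_id2r => xT; rewrite mem_lcoset.
    apply/eqP/idP => [xp|xE]; last first.
      by rewrite -[x](mulKVg y) expgMn ?(Ep xE) ?mulg1 //; apply: mulC.
    apply: inE_E; first by rewrite groupM ?groupV // (subsetP T1G).
    by rewrite expgMn ?expgVn ?xp ?yp ?mulVg //; apply: mulC.
  have : (y \in T1) (+) (y * h \in T1) by move: yU; rewrite inE => /and3P[].
  have yE f : f \in <[h]> -> f != 1 -> (y * f \in T1) = (y * h \in T1).
    exact: T1yf.
  rewrite fE; case yT: (y \in T1); case yhT: (y * h \in T1) => //= _.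
    rewrite (_ : [set _ in _ | _] = [set y]) ?cards1 ?modn_small ?prime_gt1 //.
    apply/setP => x; rewrite !inE; apply/andP/eqP => [[/lcosetP[f fE' ->]]|->].
      by have [->|f1] := eqVneq f 1; [rewrite mulg1|rewrite yE // yhT].
    by rewrite lcoset_refl.
  rewrite (_ : [set _ in _ | _] = (y *: <[h]>) :\ y); last first.
    apply/setP => x; rewrite !inE; apply/andP/andP => [[/lcosetP[f fE' ->]]|[xy /lcosetP[f fE' xE]]].
      move=> yfT; split; last by apply/lcosetP; exists f.
      by apply: contraTneq yfT => ->; rewrite yT.
    split; first by apply/lcosetP; exists f.
    by rewrite xE yE //; apply: contra xy => /eqP f1; rewrite xE f1 mulg1.
  have := cardsD1 y (y *: <[h]>); rewrite lcoset_refl card_lcoset -orderE oh add1n => pE.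
  by rewrite -(eqn_add2l 1) in pE *; rewrite modn_small ?[in X in _ < X]pE //; move: p_pr; rewrite pE; case: #|_|.
move=> nz.
have [x] : exists x, x \in fib z.
  by apply/set0Pn; apply: contra nz => /eqP ->; rewrite cards0 mod0n.
rewrite inE => /andP[xT /eqP xp]; have xG := subsetP T1G _ xT.
have fibx : fib z = [set w in x *: <[h]> | w \in T1].
  apply/setP => w; rewrite !inE andbC; apply: andb_id2r => wT; rewrite mem_lcoset.
  apply/eqP/idP => [wp|wE]; last first.
    by rewrite -[w](mulKVg x) expgMn ?(Ep wE) ?mulg1 //; apply: mulC.
  apply: inE_E; first by rewrite groupM ?groupV // (subsetP T1G).
  by rewrite expgMn ?expgVn ?xp ?wp ?mulVg //; apply: mulC.
have full : (forall w, w \in x *: <[h]> -> w \in T1) -> (#|fib z| %% p = 0)%N.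
  move=> hw; rewrite fibx (_ : [set _ in _ | _] = x *: <[h]>) ?card_lcoset -?orderE ?oh ?modnn //.
  by apply/setP => w; rewrite inE; apply: andb_idr => /hw.
have [hx|[y [f [xE yG co fE]]]] := split_p xG.
  move/eqP: nz; case; apply: full => _ /lcosetP[f fE ->].
  by apply: T1xf.
have cosE : x *: <[h]> = y *: <[h]>.
  by apply/lcoset_eqP; rewrite mem_lcoset xE mulKg.
have zE : z = y ^+ p.
  by rewrite -xp xE expgMn ?(Ep fE) ?mulg1 //; apply: mulC.
apply: (@unbal_order y); rewrite ?zE ?groupX ?orderXp //.
rewrite inE yG co /=; case bal: (_ (+) _) => //; move/eqP: nz; case; apply: full.
have yE f' : f' \in <[h]> -> f' != 1 -> (y * f' \in T1) = (y * h \in T1).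
  exact: T1yf.
have yT : y \in T1.
  have [f1|f1] := eqVneq f 1; first by rewrite -[y]mulg1 -f1 -xE.
  by move: xT; rewrite xE yE //; move: bal; case: (y \in T1); case: (y * h \in T1).
rewrite cosE => _ /lcosetP[f' f'E ->].
have [->|f1] := eqVneq f' 1; first by rewrite mulg1.
by rewrite yE //; move: bal; rewrite yT; case: (y * h \in T1).
Qed.

Let G1 : h \notin srad T1.
Proof. by apply: contra h1 => /rad1 ->. Qed.

(** Otherwise [T1] would be a union of cosets of <h>, and [h] would lie in its trivial radical. *)
Lemma unbal_n0 : exists y, y \in unbal.
Proof.
apply/set0Pn; apply: contra G1 => /eqP U0; apply: sradP => x xT.
have xG := subsetP T1G _ xT.
have bal y : y \in G -> coprime #[y] p -> (y \in T1) = (y * h \in T1).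
  move=> yG co; have : y \notin unbal by rewrite U0 inE.
  by rewrite inE yG co /=; case: (y \in T1); case: (y * h \in T1).
have [hx|[y [f [xE yG co fE]]]] := split_p xG.
  by apply: T1xf.
have yT : y \in T1.
  have [f1|f1] := eqVneq f 1; first by rewrite -[y]mulg1 -f1 -xE.
  by rewrite bal // -(T1yf yG co fE f1) -xE.
have all f' : f' \in <[h]> -> y * f' \in T1.
  move=> f'E; have [->|f1] := eqVneq f' 1; first by rewrite mulg1.
  have yh : y * h \in T1 by rewrite -bal.
  by rewrite T1yf.
by rewrite xE -mulgA; apply: all; rewrite groupM.
Qed.

Let K : {group gT} := <<unbal>>%G.
Let iK : sinv e K. Proof. exact/sinv_gen/unbal_inv. Qed.
Lemma unbal_gen_sub : <<unbal>> \subset G.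
Proof. by rewrite gen_subG; apply/subsetP => y; rewrite inE => /andP[]. Qed.

Let KG : K \subset G. Proof. exact: unbal_gen_sub. Qed.

Lemma unbal_gen_coprime (y : gT) : y \in <<unbal>> -> coprime #[y] p.
Proof.
have gset : group_set [set x in G | coprime #[x] p].
  apply/group_setP; split; first by rewrite inE group1 order1 coprime1n.
  move=> x z; rewrite !inE => /andP[xG cx] /andP[zG cz]; rewrite groupM //=.
  have : coprime (#[x] * #[z]) p by rewrite coprimeMl cx cz.
  apply: coprime_dvdl.
  rewrite order_dvdn expgMn; last exact: mulC.
  by rewrite expgM expg_order expg1n mul1g mulnC expgM expg_order expg1n.
have : K \subset Group gset.
  by rewrite gen_subG; apply/subsetP => x; rewrite !inE => /and3P[-> -> _].
by move/subsetP => sK /sK; rewrite inE => /andP[].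
Qed.

Let Kp (y : gT) : y \in K -> coprime #[y] p. Proof. exact: unbal_gen_coprime. Qed.

Let Kh f : f \in <[h]> -> f \in K -> f = 1.
Proof.
move=> fE /Kp; apply: contraTeq => f1.
have := @ordM 1 f (group1 G); rewrite order1 mul1g mul1n => -> //; last exact: coprime1n.
by rewrite /coprime gcdnn neq_ltn prime_gt1 ?orbT.
Qed.

Lemma unbal_gen_notin : g \notin <<unbal>>.
Proof.
apply/negP => /Kp; rewrite orderE -Gg coprime_sym prime_coprime //.
by rewrite -oh order_dvdG.
Qed.

Let gK : g \notin K. Proof. exact: unbal_gen_notin. Qed.

Let T1K x : x \in T1 -> x \notin K.
Proof. by move=> xT; apply: contra gK => xK; apply: (subsetP (T1min iK xT xK)). Qed.

Let KE x : reflect (exists2 k, k \in K & exists2 f, f \in <[h]> & x = k * f) (x \in K * <[h]>).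
Proof. by apply: (iffP mulsgP) => [[k f ? ? ->]|[k ? [f ? ->]]]; [exists k => //; exists f|exists k f]. Qed.

(** Every unbalanced element lies in [K], so outside K<h> the set [T1] is a union of cosets of
    <h>. *)
Let T1E x f : x \in T1 -> x \notin K * <[h]> -> f \in <[h]> -> x * f \in T1.
Proof.
move=> xT xKE fE; have xG := subsetP T1G _ xT.
have [hx|[y [f' [xE yG co f'E]]]] := split_p xG.
  by apply: T1xf.
have yK : y \notin K by apply: contra xKE => yK; apply/KE; exists y => //; exists f'.
have yU : y \notin unbal by apply: contra yK; apply: mem_gen.
have bal : (y \in T1) = (y * h \in T1).
  by move: yU; rewrite inE yG co /=; case: (y \in T1); case: (y * h \in T1).
have yT : y \in T1.
  have [f1|f1] := eqVneq f' 1; first by rewrite -[y]mulg1 -f1 -xE.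
  by rewrite bal // -(T1yf yG co f'E f1) -xE.
rewrite xE -mulgA; have [->|f1] := eqVneq (f' * f) 1; first by rewrite mulg1.
have yh : y * h \in T1 by rewrite -bal.
by rewrite T1yf ?groupM.
Qed.


Let y0 := xchoose unbal_n0.
Let y0U : y0 \in unbal. Proof. exact: xchooseP. Qed.
Let y0K : y0 \in K. Proof. exact: mem_gen. Qed.
Let y0hT : y0 * h \in T1.
Proof.
move: y0U; rewrite inE => /and3P[_ _]; case y0T: (y0 \in T1) => //= _.
by move: (T1K y0T); rewrite y0K.
Qed.
Let y0f f : f \in <[h]> -> f != 1 -> y0 * f \in T1.
Proof. by move: y0U; rewrite inE => /and3P[y0G co _] fE f1; rewrite T1yf. Qed.
Let y0G : y0 \in G. Proof. exact: (subsetP KG). Qed.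

Let X := T1 * K.
Let iX : sinv e X. Proof. exact: sinvM. Qed.
Let XP x : reflect (exists2 t, t \in T1 & exists2 k, k \in K & x = t * k) (x \in X).
Proof. by apply: (iffP mulsgP) => [[t k ? ? ->]|[t ? [k ? ->]]]; [exists t => //; exists k|exists t k]. Qed.
Let XK x : x \in X -> x \notin K.
Proof. by case/XP => t tT [k kK ->]; rewrite groupMr // T1K. Qed.
Let XMK x k : x \in X -> k \in K -> x * k \in X.
Proof. by case/XP => t tT [k' kK' ->] kK; apply/XP; exists t => //; exists (k' * k); rewrite ?groupM ?mulgA. Qed.
Let T1X x : x \in T1 -> x \in X.
Proof. by move=> xT; apply/XP; exists x => //; exists 1; rewrite ?mulg1. Qed.

Let hX f : f \in <[h]> -> f != 1 -> f \in X.
Proof.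
move=> fE f1; rewrite -(mulKg y0 f) mulC; apply: XMK; last by rewrite groupV.
by apply: T1X; apply: y0f.
Qed.


Let mulAC (x y z : gT) : x * y * z = x * z * y.
Proof. by rewrite -!mulgA [y * z]mulC. Qed.

(** Translation by h^-1 carries hK into [K], which [X] avoids, and keeps the rest of [X] inside [X].
    This fixes the number of failures for every t in [T1], because t is equivalent to y0 h and [X]
    is invariant under [K]. *)
Let slamXh : (slam X h + #|h *: K| = #|X|)%N.
Proof.
rewrite /slam.
have -> : [set x in X | x * h^-1 \in X] = X :\: (h *: K).
  apply/setP => x; rewrite !inE mem_lcoset andbC; apply: andb_id2r => xX.
  apply/idP/idP => [|nK].
    by move/XK; rewrite mulC.
  case/XP: (xX) => t tT [k kK xE].
  have [tKE|tKE] := boolP (t \in K * <[h]>); last first.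
    by rewrite xE mulAC; apply: XMK => //; apply: T1X; apply: T1E; rewrite ?groupV.
  case/KE: tKE => k' k'K [f fE tE].
  have f1 : f != 1 by apply: contraTneq (T1K tT) => f1; rewrite tE f1 mulg1 k'K.
  have [fh|fh] := eqVneq f h.
    by case/negP: nK; rewrite xE tE fh [k' * h]mulC -mulgA mulKg groupM.
  have : f * h^-1 \in X.
    by apply: hX; rewrite ?groupM ?groupV // -eq_mulgV1.
  move=> fX; rewrite xE tE.
  have -> : k' * f * k * h^-1 = f * h^-1 * (k' * k).
    by rewrite [k' * f]mulC -!mulgA; congr (_ * _); rewrite mulgA mulC.
  by apply: XMK => //; rewrite groupM.
rewrite -(cardsID (h *: K) X) addnC; congr (_ + _)%N; apply: eq_card => x; rewrite inE.
rewrite andb_idl //  => /lcosetP[k kK ->]; apply: XMK => //; exact: hX.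
Qed.


Let T1level (f : gT -> nat) : (forall x y, e x y -> f x = f y) ->
  forall t t', t \in T1 -> t' \in T1 -> f t = f t'.
Proof.
move=> hf t t' tT t'T; have i : sinv e [set c | f c == f t'].
  by move=> x y exy; rewrite !inE (hf _ _ exy).
have := T1min i t'T; rewrite inE eqxx => /(_ isT)/subsetP/(_ _ tT).
by rewrite inE => /eqP.
Qed.

Let slamXK c k : k \in K -> slam X (c * k) = slam X c.
Proof.
move=> kK; apply: eq_card => x; rewrite !inE; congr (_ && _); rewrite invMg mulgA mulAC.
apply/idP/idP => h'; last by apply: XMK; rewrite ?groupV.
by rewrite -(mulgKV k (x * c^-1)); apply: XMK.
Qed.

Let slamXt t : t \in T1 -> forall x, x \in X -> x \notin t *: K -> x * t^-1 \in X.
Proof.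
move=> tT; apply: slam_max => [|x|].
- by apply/subsetP => _ /lcosetP[k kK ->]; apply: XMK => //; apply: T1X.
- by case/lcosetP => k kK ->; apply: contraL kK; rewrite mulAC mulgV mul1g; apply: XK.
- rewrite (T1level (fun x y => @slam_inv _ _ S X x y iX) tT y0hT) mulC slamXK //.
  by rewrite card_lcoset -(card_lcoset K h) slamXh.
Qed.

(** By [slamXt] the union of [X] and [K] is closed under division; it contains the generator [g], so
    it is all of [G]. *)
Let GX x : x \in G -> x \notin K -> x \in X.
Proof.
have gset : group_set (X :|: K).
  apply/group_setP; split; first by rewrite inE group1 orbT.
  suff dv : forall x' y', x' \in X :|: K -> y' \in X :|: K -> x' * y'^-1 \in X :|: K.
    move=> x' y' hx' hy'; rewrite -[y']invgK; apply: (dv) => //.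
    by rewrite -[y'^-1]mul1g; apply: (dv) => //; rewrite inE group1 orbT.
  move=> x' y'; rewrite !inE => /orP[xX|xK] /orP[yX|yK]; last by rewrite groupM ?groupV ?orbT.
  - case/XP: (yX) => t tT [k kK yE].
    have -> : x' * y'^-1 = x' * t^-1 * k^-1 by rewrite yE invMg mulgA mulAC.
    have [xt|xt] := boolP (x' \in t *: K); last by rewrite XMK ?groupV // slamXt.
    case/lcosetP: xt => k' k'K ->; rewrite [t * k' * _]mulAC mulgV mul1g.
    by rewrite groupM ?groupV ?orbT.
  - by rewrite XMK ?groupV.
  - rewrite mulC XMK // (sinvV S) //.
have sG : G \subset Group gset by rewrite Gg cycle_subG !inE T1X.
by move/(subsetP sG); rewrite !inE => /orP[//|->].
Qed.


(* for [K = 1] this already says that every nontrivial element of [G] lies in [T1] *)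
Lemma unbal_trivial_case s : K :=: 1 -> s \in G -> s != 1 -> s \in T1.
Proof.
move=> K1 sG s1; have : s \in X by apply: GX => //; rewrite K1 inE.
by case/XP => t tT [k]; rewrite K1 inE => /eqP -> ->; rewrite mulg1.
Qed.

Hypothesis p3 : (2 < p)%N.
Let q := #|T1 :&: h *: K|.
Let T1cap c : c \in G -> c \notin K -> #|T1 :&: c *: K| = q.
Proof.
have cE d : #|T1 :&: d *: K| = scount T1 K d.
  apply: eq_card => x; rewrite !inE mem_lcoset; congr (_ && _).
  by rewrite -(sinvV S _ iK) invMg invgK mulC.
have cK d k : k \in K -> (d * k) *: K = d *: K.
  by move=> kK; rewrite lcosetM lcoset_id.
move=> cG /(GX cG)/XP[t tT [k kK ->]]; rewrite cK // cE.
rewrite (T1level (fun x y => sr_conv S iT1 iK (z:=x) (z':=y)) tT y0hT) -cE.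
by rewrite [y0 * h]mulC cK.
Qed.

Let slamT1h : (slam T1 h + #|T1 :&: h *: K| = #|T1|)%N.
Proof.
rewrite /slam.
have -> : [set x in T1 | x * h^-1 \in T1] = T1 :\: (h *: K).
  apply/setP => x; rewrite !inE mem_lcoset andbC; apply: andb_id2r => xT.
  apply/idP/idP => [/T1K|nK]; first by rewrite mulC.
  have [xKE|xKE] := boolP (x \in K * <[h]>); last by apply: T1E; rewrite ?groupV.
  case/KE: xKE => k kK [f fE xE].
  have f1 : f != 1 by apply: contraTneq (T1K xT) => f1; rewrite xE f1 mulg1 kK.
  have [fh|fh] := eqVneq f h.
    by case/negP: nK; rewrite xE fh [k * h]mulC mulKg.
  have kG := subsetP KG _ kK.
  rewrite xE -mulgA T1yf //; last 1 first.
  - by rewrite -eq_mulgV1.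
  - by rewrite -(T1yf kG (Kp kK) fE f1) -xE.
  - exact: Kp.
  - by rewrite groupM ?groupV.
by rewrite -(cardsID (h *: K) T1) addnC; congr (_ + _)%N.
Qed.

Let T0 := satom e h.
Let iT0 : sinv e T0. Proof. exact: satom_inv. Qed.
Let hT0 : h \in T0. Proof. exact: mem_satom. Qed.
Let hK : h \notin K. Proof. by apply: contra h1 => /(Kh hE) ->. Qed.
Let T0G : T0 \subset G. Proof. exact: satom_sub. Qed.
Let T0K t : t \in T0 -> t \notin K. Proof. by rewrite inE => /iK <-. Qed.
Let T0V t : (t^-1 \in T0) = (t \in T0). Proof. exact: (sinvV S). Qed.

Let T0T1 t x : t \in T0 -> x \in T1 -> x \notin t *: K -> x * t^-1 \in T1.
Proof.
move=> tT xT xt; apply: (@slam_max _ T1 (T1 :&: t *: K)) => //.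
- exact: subsetIl.
- move=> z /setIP[_ /lcosetP[k kK ->]]; apply: contraL kK; rewrite mulAC mulgV mul1g.
  exact: T1K.
- rewrite T1cap ?(subsetP T0G) ?T0K // -(slam_inv S iT1 (_ : e h t)) ?slamT1h //.
  by rewrite inE in tT.
by rewrite inE negb_and xt orbT.
Qed.

Let T0X c : c \in G -> c \notin K -> exists2 t, t \in T0 & exists2 k, k \in K & c = t * k.
Proof.
have i : sinv e (T0 * K) by apply: sinvM.
have y0hTK : y0 * h \in T0 * K by rewrite mulC mem_mulg.
move=> cG /(GX cG)/XP[t1 t1T [k kK ->]].
have /mulsgP[t k' tT k'K ->] := subsetP (T1min i y0hT y0hTK) _ t1T.
by exists t => //; exists (k' * k); rewrite ?groupM ?mulgA.
Qed.


Let T1stab x t k : t \in T0 -> k \in K -> t * k \in T0 -> x \in T1 -> x * k \in T1.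
Proof.
move=> tT kK tkT; have tkE z : z * k = z * t^-1 * (t * k) by rewrite !mulgA mulgKV.
have case1 z : z \in T1 -> z \notin t *: K -> z * k \in T1.
  move=> zT zt; rewrite tkE -[t * k]invgK; apply: T0T1; rewrite ?T0V //; first exact: T0T1.
  apply: contra (T1K zT); rewrite mem_lcoset invgK => h'.
  have -> : z = t * k * (z * t^-1) * k^-1 by rewrite [t * k * _]mulC !mulgA mulgKV mulgK.
  by rewrite groupM ?groupV.
move=> xT; have [xt|xt] := boolP (x \in t *: K); last exact: case1.
(* For x in tK the direct translation by t^-1 fails, so x is first moved by another u of [T0]
   outside tK. One of h and h^-1 serves: if both were in tK then h^2 would lie in [K], impossible
   for odd p. *)
have [u uT ut] : exists2 u, u \in T0 & u \notin t *: K.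
  have [ht|] := boolP (h \in t *: K); last by exists h.
  exists h^-1; first by rewrite T0V.
  apply/negP => ht'; have : h * h \in K.
    move: ht ht'; rewrite !mem_lcoset => a b.
    have -> : h * h = (t^-1 * h) * (t^-1 * h^-1)^-1.
      by rewrite invMg !invgK [RHS]mulC !mulgA mulgK.
    by rewrite groupM ?groupV.
  have hhE : h * h \in <[h]> by rewrite groupM.
  move/(Kh hhE)/eqP; rewrite -expg2 -order_dvdn oh => /(dvdn_leq (isT : (0 < 2)%N)).
  by rewrite leqNgt p3.
have xu : x \notin u *: K.
  apply: contra ut => /lcosetP[k1 k1K xE]; case/lcosetP: xt => k2 k2K; rewrite xE => uE.
  apply/lcosetP; exists (k2 * k1^-1); rewrite ?groupM ?groupV //.
  by rewrite mulgA -uE mulgK.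
have xuT := T0T1 uT xT xu.
have xut : x * u^-1 \notin t *: K.
  apply: contra (T0K uT); case/lcosetP: xt => k2 k2K ->.
  by rewrite mem_lcoset !mulgA mulVg mul1g groupMl // groupV.
have xukT := case1 _ xuT xut.
have -> : x * k = x * u^-1 * k * (u^-1)^-1 by rewrite invgK mulAC mulgKV.
apply: T0T1; rewrite ?T0V //; apply: contra (T1K xT).
by rewrite mem_lcoset invgK mulC mulAC mulgKV groupMr.
Qed.

(** Two members of [T0] in one coset of [K] differ by an element that stabilises [T1] by [T1stab],
    and the radical is trivial. *)
Let T0uniq t t' : t \in T0 -> t' \in T0 -> t^-1 * t' \in K -> t = t'.
Proof.
move=> tT t'T kK; apply/eqP; rewrite eq_mulVg1; apply/eqP.
apply: rad1; apply: sradP => x xT; apply: (T1stab tT kK) => //.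
by rewrite mulKVg.
Qed.

Let T0uniqK t t' k k' : t \in T0 -> t' \in T0 -> k \in K -> k' \in K -> k * t = k' * t' ->
  t = t' /\ k = k'.
Proof.
move=> tT t'T kK k'K eq.
have tt : t = t'.
  apply: T0uniq => //; have -> : t^-1 * t' = k * k'^-1.
    apply: (mulgI t); rewrite mulKVg; apply: (mulIg k').
    by rewrite mulgA mulgKV [t' * k']mulC -eq mulC.
  by rewrite groupM ?groupV.
by split=> //; move: eq; rewrite tt => /mulIg.
Qed.

Let R1 := satom e y0.
Let iR1 : sinv e R1. Proof. exact: satom_inv. Qed.
Let y0R1 : y0 \in R1. Proof. exact: mem_satom. Qed.
Let R1K : R1 \subset K. Proof. exact: satom_sub. Qed.

Let T1R1 t1 : t1 \in T1 -> exists2 r, r \in R1 & exists2 t, t \in T0 & t1 = r * t.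
Proof.
have i : sinv e (R1 * T0) by apply: sinvM.
move=> t1T; have := subsetP (T1min i y0hT (mem_mulg y0R1 hT0)) _ t1T.
by case/mulsgP => r t rR tT ->; exists r => //; exists t.
Qed.

Let unbalK k : k \in K -> (k \in unbal) = (k * h \in T1).
Proof.
move=> kK; rewrite inE Kp // (subsetP KG) //=.
by rewrite (negPf (contraL (@T1K k) kK)).
Qed.

Let unbalR1 : unbal = R1.
Proof.
apply/eqP; rewrite eqEsubset; apply/andP; split; last by apply: satom_sub => //; apply: unbal_inv.
apply/subsetP => k kU; have kK : k \in K by apply: mem_gen.
move: (kU); rewrite unbalK // => /T1R1[r rR [t tT eq]].
by have [_ ->] := T0uniqK hT0 tT kK (subsetP R1K _ rR) eq.
Qed.

Let T1capE t : t \in T0 -> T1 :&: t *: K = t *: R1.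
Proof.
move=> tT; apply/eqP; rewrite eqEcard; apply/andP; split.
  apply/subsetP => x /setIP[/T1R1[r rR [t' t'T ->]]] /lcosetP[k kK]; rewrite [t * k]mulC => eq.
  have [<- _] := T0uniqK t'T tT (subsetP R1K _ rR) kK eq.
  by rewrite mem_lcoset mulC mulgK.
rewrite T1cap ?(subsetP T0G) ?T0K // card_lcoset.
rewrite -(card_lcoset R1 h); apply: subset_leq_card; apply/subsetP => _ /lcosetP[r rR ->].
have rK := subsetP R1K _ rR.
by rewrite inE mem_lcoset mulKg rK andbT mulC -unbalK // unbalR1.
Qed.

Let R1T0 r t : r \in R1 -> t \in T0 -> r * t \in T1.
Proof.
move=> rR tT; have : t * r \in t *: R1 by apply/lcosetP; exists r.
by rewrite -T1capE // => /setIP[]; rewrite mulC.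
Qed.

Let T0h x : x \in T0 -> x != h -> x * h^-1 \in T0.
Proof.
move=> xT xh; have xG := subsetP T0G _ xT.
have [xKE|xKE] := boolP (x \in K * <[h]>).
  case/KE: xKE => k kK [f fE xE].
  have f1 : f != 1 by apply: contraTneq (T0K xT) => f1; rewrite xE f1 mulg1 kK.
  have fT f' : f' \in <[h]> -> f' != 1 -> f' \in T0.
    move=> f'E f'1; rewrite inE; apply: e_order => //; first exact: EG.
    have := @ordM 1 f' (group1 G); rewrite order1 mul1g mul1n oh => -> //; exact: coprime1n.
  have [xf _] : x = f /\ 1 = k.
    by apply: T0uniqK => //; [exact: fT|rewrite mul1g].
  by rewrite xf; apply: fT; rewrite ?groupM ?groupV // -eq_mulgV1 -xf.
have xhK : x * h^-1 \notin K.
  by apply: contra xKE => hh; apply/KE; exists (x * h^-1) => //; exists h => //; rewrite mulgKV.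
have xhG : x * h^-1 \in G by rewrite groupM ?groupV.
have [t tT [k kK xhE]] := T0X xhG xhK.
suff k1 : k = 1 by rewrite xhE k1 mulg1.
apply: rad1; apply: sradP => y /T1R1[r rR [t' t'T ->]]; rewrite mulAC; apply: R1T0 => //.
have rx : r * x * h^-1 \in T1.
  apply: T1E; rewrite ?groupV //; first exact: R1T0.
  apply: contra xKE => /KE[k' k'K [f fE eq]]; apply/KE.
  exists (r^-1 * k'); first by rewrite groupM ?groupV // (subsetP R1K).
  by exists f => //; rewrite -mulgA -eq mulKg.
have rxE : r * x * h^-1 = t * (r * k) by rewrite -mulgA xhE !mulgA [r * t]mulC.
have : r * x * h^-1 \in T1 :&: t *: K.
  by rewrite inE rx mem_lcoset rxE mulKg groupM // (subsetP R1K).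
by rewrite T1capE // mem_lcoset rxE mulKg.
Qed.

(** For [h] the only failure of translation inside [T0] is [h] itself, and [slam] transports this to
    all of [T0]. The resulting group meets [K] trivially, and [T1] decomposes as [R1] times [T0]:
    the ring splits as a product over [K] and this complement. *)
Let T0g : group_set (1 |: T0).
Proof.
have slh : (slam T0 h + #|[set h]| = #|T0|)%N.
  rewrite /slam (_ : [set _ in _ | _] = T0 :\ h) ?cards1 ?addn1.
    by rewrite (cardsD1 h T0) hT0.
  apply/setP => x; rewrite in_set in_setD1 andbC; apply: andb_id2r => xT.
  apply/idP/idP => [|xh]; last exact: T0h.
  by apply: contraTneq => ->; rewrite mulgV; apply: contraL (group1 K) => t1; apply: T0K.
have dv1 t x : t \in T0 -> x \in T0 -> x != t -> x * t^-1 \in T0.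
  move=> tT xT xt; apply: (@slam_max _ T0 [set t]) => //.
  - by rewrite sub1set.
  - move=> z /set1P ->; rewrite mulgV; apply: contraL (group1 K); exact: T0K.
  - by rewrite cards1 -(cards1 h) -slh -(slam_inv S iT0 (_ : e h t)) //; rewrite inE in tT.
  - by rewrite inE.
apply/group_setP; split; first by rewrite !inE eqxx.
move=> x t /setU1P[->|xT]; first by rewrite mul1g.
move/setU1P=> [->|tT]; first by rewrite mulg1; apply/setU1P; right.
have [->|xt] := eqVneq x t^-1; first by rewrite mulVg setU11.
by apply/setU1P; right; rewrite -[t]invgK; apply: dv1; rewrite ?T0V.
Qed.
Let Z : {group gT} := Group T0g.
Let iZ : sinv e Z. Proof. by apply: sinvU => //; apply: sinv1. Qed.

Let KZ k z : k \in K -> z \in Z -> k * z \in K -> z = 1.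
Proof. by move=> kK /setU1P[//|zT]; rewrite groupMl // => zK; case/negP: (T0K zT). Qed.

(** If k t lies in no proper invariant subgroup of [G], neither does k in [K]: from an invariant H
    containing k, the product of its intersection with [K] and of [Z] is an invariant subgroup
    containing k t. *)
Let R1min (H : {group gT}) : sinv e H -> forall k t, k \in K -> t \in T0 ->
  (forall H' : {group gT}, sinv e H' -> k * t \in H' -> G \subset H') -> k \in H -> K \subset H.
Proof.
move=> iH k t kK tT hyp kH.
have gs : group_set ((H :&: K) * Z).
  by apply/comm_group_setP; apply: centC; apply/centsP => x _ y _; apply: mulC.
have : G \subset Group gs.
  apply: hyp; first by apply: sinvM => //; apply: sinvI.
  by apply: mem_mulg; [rewrite in_setI kH kK|apply/setU1P; right].
move=> sG; apply/subsetP => k1 k1K; have := subsetP sG _ (subsetP KG _ k1K).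
case/mulsgP => h2 z /setIP[h2H h2K] zZ k1E; move: k1K; rewrite k1E => /(KZ h2K zZ) ->.
by rewrite mulg1.
Qed.

(* the inductive hypothesis on the proper S-subgroup [K] *)
Hypothesis IH : forall g1 s1, K :=: <[g1]> -> s1 \in K ->
  (forall H : {group gT}, sinv e H -> s1 \in H -> K \subset H) -> e g1 s1.

(** Write s = k t with k in [K] and t in [T0]. Both k and [y0] lie in no proper invariant subgroup
    of [K], so the inductive hypothesis puts them in one class [R1], and [R1] times [T0] lies in
    [T1]. *)
Lemma core_case s : s \in G ->
  (forall H : {group gT}, sinv e H -> s \in H -> G \subset H) -> s \in T1.
Proof.
move=> sG smin.
have sK : s \notin K by apply: contra gK => /(smin K iK)/subsetP; apply.
have [t tT [k kK sE]] := T0X sG sK; rewrite mulC in sE.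
have /cyclicP[g1 Kg1] : cyclic K by apply: cyclicS cycG.
have e1 : e g1 k by apply: IH => // H iH; apply: (R1min iH kK tT); rewrite -sE.
have e2 : e g1 y0.
  apply: IH => // H iH; apply: (R1min iH y0K hT0) => H' iH' hH'.
  by rewrite Gg cycle_subG; apply: (subsetP (T1min iH' y0hT hH')).
rewrite sE; apply: R1T0 => //; rewrite inE.
exact: (sr_trans S (sr_sym S e2) e1).
Qed.

End Core.

(** Induction on the order of [G]. A nontrivial radical of the class of [g] is divided out, since
    that class is the full preimage of its image; with trivial radical the preceding section applies
    for a suitable prime. *)
Lemma sring_same_atom n (gT : finGroupType) (e : rel gT) (S : sring e) (G : {group gT}) g s :
  (#|G| < n)%N -> sinv e G -> G :=: <[g]> -> s \in G ->
  (forall H : {group gT}, sinv e H -> s \in H -> G \subset H) -> e g s.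
Proof.
elim: n gT e S G g s => // n IHn gT e S G g s Gn hG Gg sG smin.
have mulC := sr_abel S.
pose T1 := satom e g.
have iT1 : sinv e T1 := satom_inv S g.
have gG : g \in G by rewrite Gg cycle_id.
have T1G : T1 \subset G := satom_sub hG gG.
have gT1 : g \in T1 := mem_satom S g.
have T1min X x : sinv e X -> x \in T1 -> x \in X -> T1 \subset X.
  by move=> iX; rewrite inE => /iX xX xX'; apply: satom_sub => //; rewrite xX.
suff : s \in T1 by rewrite inE.
have [rad1|] := boolP [forall c in srad T1, c == 1]; last first.
  rewrite negb_forall_in => /exists_inP[c cR c1].
  pose R := srad_gp T1; have iR : sinv e R := srad_inv S iT1.
  have RG : R \subset G.
    apply/subsetP => x; rewrite inE => /eqP hx.
    have : g * x \in T1 by rewrite -hx; apply/rcosetP; exists g.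
    by move/(subsetP T1G); rewrite groupMl.
  have nR : G \subset 'N(R) by apply/subsetP => x _; apply: (abel_norm S).
  have qS := quo_sring S iR.
  have preE (A : {set gT}) : (forall x r, x \in A -> r \in R -> x * r \in A) ->
      coset R @^-1: [set coset R y | y in A] = A.
    move=> hA; apply/setP => x; rewrite inE; apply/imsetP/idP => [[y yA xy]|xA]; last by exists x.
    rewrite -(mulKVg y x); apply: hA => //; apply: (coset_idr (abel_norm S R _)).
    by rewrite (cosetM S) (morphV _ (abel_norm S R y)) /= xy mulVg.
  have TR : coset R @^-1: [set coset R y | y in T1] = T1.
    apply: preE => x r xT; rewrite inE => /eqP rT.
    have : x * r \in T1 :* r by apply/rcosetP; exists x.
    by rewrite rT.
  have : qrel e (coset R g) (coset R s).
    apply: (IHn _ _ qS (quotient_group G R)).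
    - rewrite -ltnS; apply: leq_trans Gn; rewrite ltnS; apply: ltn_quotient => //.
      by apply/trivgPn; exists c.
    - move=> u v /qrelP; apply.
      suff -> : coset R @^-1: (quotient G R) = G by [].
      have -> : quotient G R = [set coset R y | y in G].
        apply/setP => w; apply/morphimP/imsetP => [[x _ xG ->]|[x xG ->]]; first by exists x.
        by exists x => //; apply: (abel_norm S).
      by rewrite preE // => x r xG rR; rewrite groupM // (subsetP RG).
    - by rewrite /= Gg quotient_cycle // (abel_norm S).
    - by rewrite mem_quotient.
    move=> H iH sH; rewrite sub_quotient_pre //; apply: (smin (coset R @*^-1 H)%G).
      move=> x y exy; rewrite /= !morphpreE !in_setI !(abel_norm S) /=.
      exact: (sinv_preim iH exy).
    by rewrite mem_morphpre // (abel_norm S).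
  move/qrelP/(_ [set coset R y | y in T1]); rewrite TR => /(_ iT1).
  rewrite imset_f // => /esym sTR.
  by rewrite -TR inE.
have rad1' c : c \in srad T1 -> c = 1 by move=> cR; apply/eqP; move/forall_inP: rad1; apply.
have [G1|G1] := eqVneq (#|G|) 1%N.
  move: sG gT1 gG; rewrite (card1_trivg G1) !inE => /eqP -> gT1 /eqP <- //.
have Gc p : prime p -> p %| #|G| -> exists2 h, h \in G & #[h] = p.
  by move=> p_pr pG; have [h hG' oh] := Cauchy p_pr pG; exists h.
have [p [p_pr pG pp]] : exists p, [/\ prime p, p %| #|G| & (2 < p)%N \/ 2.-group G].
  have [G2|nG2] := boolP (2.-group G).
    have Glt : (1 < #|G|)%N by rewrite ltn_neqAle eq_sym G1 cardG_gt0.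
    by exists (pdiv #|G|); split; [exact: pdiv_prime|exact: pdiv_dvd|right].
  move: nG2; rewrite /pgroup /pnat cardG_gt0 /= => /allPn[p]; rewrite mem_primes => /and3P[p_pr _ pG] p2.
  exists p; split=> //; left; rewrite ltn_neqAle prime_gt1 // andbT eq_sym; exact: p2.
have [h hhG oh] := Gc p p_pr pG.
have s1 : s != 1.
  apply: contra_neq G1 => s1; apply/eqP; rewrite -trivg_card1; apply/eqP/trivgP.
  by apply: (smin 1%G (sinv1 S)); rewrite s1 inE.
have [p3|p2] := leqP 3 p; last first.
  apply: (unbal_trivial_case S Gg iT1 T1G gT1 T1min rad1' p_pr hhG oh) => //.
  have p2' : p = 2%N by apply/eqP; rewrite eqn_leq prime_gt1 // -ltnS p2.
  case: pp => [|G2]; first by rewrite p2'.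
  apply/trivgP/subsetP => y yK; rewrite inE -order_eq1 -dvdn1.
  have yG := subsetP (unbal_gen_sub G T1 p h) _ yK.
  have := unbal_gen_coprime S yK; rewrite p2' => co.
  have : 2.-nat #[y] by apply: mem_p_elt yG.
  move/p_natP => [[|k] yk]; first by rewrite yk.
  by move: co; rewrite yk expnS coprimeMl.
apply: (core_case S hG Gg iT1 T1G gT1 T1min rad1' p_pr hhG oh p3) => // g1 s1' Kg1 s1K smin1.
apply: (IHn _ _ S <<unbal G T1 p h>>%G) => //; last first.
  by apply: sinv_gen => //; apply: (unbal_inv S Gg).
rewrite -ltnS; apply: leq_trans Gn; rewrite ltnS; apply: proper_card; rewrite properE unbal_gen_sub /=.
apply/subsetPn; exists g => //; exact: (unbal_gen_notin S Gg T1 p_pr hhG oh).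
Qed.

(** Take the smallest invariant subgroup containing x. It is cyclic, and x lies in no smaller one,
    so x is equivalent to its generators. *)
Theorem sring_gen (gT : finGroupType) (e : rel gT) (S : sring e) :
  cyclic [set: gT] -> forall x, exists y, [/\ e x y, sinv e <[y]> & x \in <[y]>].
Proof.
move=> cyc x.
pose P := [pred H : {group gT} | sinvb e H & x \in H].
have P1 : P [set: gT]%G.
  by rewrite /= in_setT andbT; apply/sinvP => y z _; rewrite !inE.
case: (@arg_minnP _ [set: gT]%G P (fun H : {group gT} => #|H|) P1) => H /andP[/sinvP iH xH] Hmin.
have /cyclicP[y Hy] : cyclic H by apply: cyclicS cyc; rewrite subsetT.
exists y; rewrite -Hy; split=> //; apply: (sr_sym S).
apply: (@sring_same_atom _ _ _ S H _ _ (ltnSn _)) => // H' iH' xH'.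
have : P (H :&: H')%G.
  by apply/andP; split; [apply/sinvP; apply: sinvI|rewrite inE xH].
move/Hmin => le; apply/setIidPl/eqP; rewrite eqEcard subsetIl /=; exact: le.
Qed.
End SchurCyclic.

(** * Formal power series over a field and Hensel's lemma *)

Module PowerSeries.
Import all_boot all_order all_algebra.
Import boolp ring.
Set Implicit Arguments. Unset Strict Implicit. Unset Printing Implicit Defensive.
Import GRing.Theory.
Local Open Scope ring_scope.

Record fps (K : Type) := Fps { fcoef : nat -> K }.

Lemma fpsP (K : Type) (f g : fps K) : (forall i, fcoef f i = fcoef g i) -> f = g.
Proof. by case: f g => [f] [g] /= h; congr Fps; apply: funext. Qed.

HB.instance Definition _ (K : Type) := gen_eqMixin (fps K).
HB.instance Definition _ (K : Type) := gen_choiceMixin (fps K).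

Section FpsRing.
Variable K : fieldType.
Implicit Types f g h : fps K.
Notation "f `@ i" := (fcoef f i) (at level 8, i at level 2, format "f `@ i").

Definition fps0 : fps K := Fps (fun _ => 0).
Definition fps_add f g := Fps (fun i => f`@i + g`@i).
Definition fps_opp f := Fps (fun i => - f`@i).
Definition fpsC (c : K) := Fps (fun i => if i is 0%N then c else 0).
Definition fps_mul f g := Fps (fun k => \sum_(i < k.+1) f`@i * g`@(k - i)).

Definition ftr n f : {poly K} := \poly_(i < n) f`@i.

Lemma fps_addA : associative fps_add.
Proof. by move=> f g h; apply: fpsP => i /=; rewrite addrA. Qed.
Lemma fps_addC : commutative fps_add.
Proof. by move=> f g; apply: fpsP => i /=; rewrite addrC. Qed.
Lemma fps_add0 : left_id fps0 fps_add.
Proof. by move=> f; apply: fpsP => i /=; rewrite add0r. Qed.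
Lemma fps_addN : left_inverse fps0 fps_opp fps_add.
Proof. by move=> f; apply: fpsP => i /=; rewrite addNr. Qed.

HB.instance Definition _ := GRing.isZmodule.Build (fps K) fps_addA fps_addC fps_add0 fps_addN.

Lemma fps_mul_tr n f g k : (k < n)%N -> (fps_mul f g)`@k = (ftr n f * ftr n g)`_k.
Proof.
move=> kn; rewrite coefM; apply: eq_bigr => i _.
rewrite !coef_poly; have -> : (i < n)%N by apply: leq_trans (ltn_ord i) kn.
have -> : (k - i < n)%N by apply: leq_ltn_trans (leq_subr _ _) kn.
by [].
Qed.

Lemma fps_mulA : associative fps_mul.
Proof.
move=> f g h; apply: fpsP => k.
have aux u v w : (fps_mul u (fps_mul v w))`@k = (ftr k.+1 u * (ftr k.+1 v * ftr k.+1 w))`_k.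
  rewrite coefM; apply: eq_bigr => i _; rewrite coef_poly ltn_ord; congr (_ * _).
  by rewrite (@fps_mul_tr k.+1) // ltnS leq_subr.
have comm u v : fps_mul u v = fps_mul v u.
  by apply: fpsP => j; rewrite !(@fps_mul_tr j.+1) // mulrC.
by rewrite aux (comm _ h) aux mulrA mulrC.
Qed.
Lemma fps_mulC : commutative fps_mul.
Proof. by move=> f g; apply: fpsP => j; rewrite !(@fps_mul_tr j.+1) // mulrC. Qed.
Lemma fps_mul1 : left_id (fpsC 1) fps_mul.
Proof.
move=> f; apply: fpsP => k /=; rewrite big_ord_recl /= subn0 mul1r big1 ?addr0 // => i _.
by rewrite mul0r.
Qed.
Lemma fps_mulD : left_distributive fps_mul fps_add.
Proof.
move=> f g h; apply: fpsP => k /=; rewrite -big_split; apply: eq_bigr => i _.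
by rewrite mulrDl.
Qed.
Lemma fps_10 : fpsC 1 != fps0.
Proof. by apply/eqP => /(congr1 (fun f => f`@0)) /= /eqP; rewrite oner_eq0. Qed.

HB.instance Definition _ := GRing.Zmodule_isComNzRing.Build (fps K)
  fps_mulA fps_mulC fps_mul1 fps_mulD fps_10.

(** Inverses are picked by choice: the integral domain structure, and through it the field of
    Laurent series as a fraction field, is what the sequel relies on. *)
Definition fps_unit : pred (fps K) := fun f => `[< exists g, g * f = 1 >].
Definition fps_inv f : fps K :=
  if pselect (exists g, g * f = 1) is left e then projT1 (cid e) else f.
Lemma fps_mulVr : {in fps_unit, left_inverse 1 fps_inv *%R}.
Proof.
move=> f /asboolP fu; rewrite /fps_inv; case: pselect => // e.
by case: (cid e).
Qed.
Lemma fps_unitP f g : g * f = 1 -> fps_unit f.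
Proof. by move=> e; apply/asboolP; exists g. Qed.
Lemma fps_inv_out : {in [predC fps_unit], fps_inv =1 id}.
Proof.
move=> f /negP fu; rewrite /fps_inv; case: pselect => // e.
by case: fu; apply/asboolP.
Qed.
HB.instance Definition _ := GRing.ComNzRing_hasMulInverse.Build (fps K)
  fps_mulVr fps_unitP fps_inv_out.

Lemma fcoefM f g k : (f * g)`@k = \sum_(i < k.+1) f`@i * g`@(k - i). Proof. by []. Qed.
Lemma fcoefD f g k : (f + g)`@k = f`@k + g`@k. Proof. by []. Qed.
Lemma fcoefB f g k : (f - g)`@k = f`@k - g`@k. Proof. by []. Qed.
Lemma fcoef0 k : (0 : fps K)`@k = 0. Proof. by []. Qed.
Lemma fcoef1 k : (1 : fps K)`@k = (k == 0)%:R. Proof. by case: k. Qed.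
Lemma fcoefC c k : (fpsC c)`@k = if k is 0 then c else 0. Proof. by []. Qed.
Lemma fcoef_sum (I : Type) (r : seq I) (F : I -> fps K) k :
  (\sum_(i <- r) F i)`@k = \sum_(i <- r) (F i)`@k.
Proof. by elim/big_rec2: _ => //= i x y _ <-. Qed.

Lemma fcoefM0 f g : (f * g)`@0 = f`@0 * g`@0.
Proof. by rewrite fcoefM big_ord1. Qed.

Definition ford m f := forall i, (i < m)%N -> f`@i = 0.

Lemma fps_n0 f : f != 0 -> exists2 m, ford m f & f`@m != 0.
Proof.
move=> f0; have ex : exists i, f`@i != 0.
  apply: contrapT => /forallNP h; case/eqP: f0; apply: fpsP => i.
  by apply/eqP/negPn/negP/h.
exists (ex_minn ex); case: ex_minnP => m fm min //.
by move=> i im; apply/eqP/negPn/negP => /min; rewrite leqNgt im.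
Qed.

Lemma fordM_coef m1 m2 f g : ford m1 f -> ford m2 g ->
  ford (m1 + m2) (f * g) /\ (f * g)`@(m1 + m2) = f`@m1 * g`@m2.
Proof.
move=> hf hg; split=> [k km|].
  rewrite fcoefM big1 // => i _; have [im|im] := ltnP i m1; first by rewrite hf ?mul0r.
  by rewrite hg ?mulr0 // ltn_subLR ?(leq_trans km) ?leq_add2r // -ltnS.
rewrite fcoefM (bigD1 (inord m1)) //= inordK ?ltnS ?leq_addr // addKn big1 ?addr0 // => i im.
have [i1|i1] := ltnP i m1; first by rewrite hf ?mul0r.
rewrite hg ?mulr0 // ltn_subLR; last by rewrite -ltnS.
rewrite ltn_add2r ltn_neqAle i1 andbT; apply: contra im => /eqP i1'.
by apply/eqP/val_inj; rewrite /= inordK ?ltnS ?leq_addr.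
Qed.

Lemma fps_idom : GRing.integral_domain_axiom (fps K).
Proof.
move=> f g fg0; apply/norP => -[/fps_n0[m1 h1 f1] /fps_n0[m2 h2 g2]].
have [_] := fordM_coef h1 h2; rewrite fg0 => /esym/eqP; rewrite mulf_eq0.
by rewrite (negPf f1) (negPf g2).
Qed.
HB.instance Definition _ := GRing.ComUnitRing_isIntegral.Build (fps K) fps_idom.

Lemma fpsC_is_zmod : zmod_morphism fpsC.
Proof. by move=> a b; apply: fpsP => -[|k] //=; rewrite subr0. Qed.
Lemma fpsC_is_monoid : monoid_morphism fpsC.
Proof.
split=> // a b; apply: fpsP => -[|k]; first by rewrite fcoefM0.
by rewrite fcoefM big1 // => -[[|i] hi] _; [rewrite subn0 /= mulr0|rewrite /= mul0r].
Qed.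
HB.instance Definition _ := GRing.isZmodMorphism.Build K (fps K) fpsC fpsC_is_zmod.
HB.instance Definition _ := GRing.isMonoidMorphism.Build K (fps K) fpsC fpsC_is_monoid.

Lemma fcoefCM c f k : (fpsC c * f)`@k = c * f`@k.
Proof. by rewrite fcoefM big_ord_recl /= subn0 big1 ?addr0 // => i _; rewrite mul0r. Qed.

Definition fX : fps K := Fps (fun i => (i == 1)%:R).
Lemma fcoefXM f k : (fX * f)`@k = if k is k'.+1 then f`@k' else 0.
Proof.
case: k => [|k]; first by rewrite fcoefM0 mul0r.
rewrite fcoefM big_ord_recl mul0r add0r big_ord_recl mul1r /= subn1 /= big1 ?addr0 // => i _.
by rewrite mul0r.
Qed.
Lemma fcoefXnM n f k : (fX ^+ n * f)`@k = if (k < n)%N then 0 else f`@(k - n).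
Proof.
elim: n k => [|n IH] k; first by rewrite mul1r subn0.
rewrite exprS -mulrA fcoefXM; case: k => [|k] //; by rewrite IH ltnS subSS.
Qed.
Lemma fcoefXn n k : (fX ^+ n)`@k = (k == n)%:R.
Proof.
rewrite -[_ ^+ _]mulr1 fcoefXnM fcoef1; case: ltnP => kn; first by rewrite ltn_eqF.
by rewrite subn_eq0 eqn_leq kn andbT.
Qed.
Lemma fX_neq0 : fX != 0.
Proof. by apply/eqP => /(congr1 (fun f => f`@1)) /= /eqP; rewrite oner_eq0. Qed.

Lemma fordP m f : ford m f <-> exists g, f = fX ^+ m * g.
Proof.
split=> [hf|[g ->] i im]; last by rewrite fcoefXnM im.
exists (Fps (fun i => f`@(i + m))); apply: fpsP => k; rewrite fcoefXnM.
by case: ltnP => km; [apply: hf|rewrite /= subnK].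
Qed.

(** The substitution t -> w t. *)
Definition frot (w : K) f := Fps (fun i => w ^+ i * f`@i).
Lemma frot_is_zmod w : zmod_morphism (frot w).
Proof. by move=> f g; apply: fpsP => k /=; rewrite mulrBr. Qed.
Lemma frot_is_monoid w : monoid_morphism (frot w).
Proof.
split=> [|f g]; apply: fpsP => k; first by case: k => [|k]; rewrite /= ?mul1r // mulr0.
rewrite [RHS]fcoefM -[LHS]/(w ^+ k * (f * g)`@k) fcoefM mulr_sumr; apply: eq_bigr => i _ /=.
by rewrite mulrACA -exprD subnKC // -ltnS.
Qed.
HB.instance Definition _ w := GRing.isZmodMorphism.Build _ _ (frot w) (frot_is_zmod w).
HB.instance Definition _ w := GRing.isMonoidMorphism.Build _ _ (frot w) (frot_is_monoid w).
Lemma frotC w c : frot w (fpsC c) = fpsC c.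
Proof. by apply: fpsP => -[|k] /=; rewrite ?mul1r ?mulr0. Qed.
Lemma frotX w : frot w fX = fpsC w * fX.
Proof. by apply: fpsP => k; rewrite fcoefCM /=; case: eqP => [->|]; rewrite ?expr1 // !mulr0. Qed.

(** The Euler operator t d/dt; [horner_feul] is its chain rule. *)
Definition feul f := Fps (fun i => f`@i *+ i).
Lemma feul_is_zmod : zmod_morphism feul.
Proof. by move=> f g; apply: fpsP => k /=; rewrite mulrnBl. Qed.
HB.instance Definition _ := GRing.isZmodMorphism.Build _ _ feul feul_is_zmod.
Lemma feulD f g : feul (f + g) = feul f + feul g.
Proof. by apply: fpsP => k /=; rewrite mulrnDl. Qed.
Lemma feulM f g : feul (f * g) = feul f * g + f * feul g.
Proof.
apply: fpsP => k; rewrite fcoefD -[LHS]/((f * g)`@k *+ k) !fcoefM -big_split /= -sumrMnl; apply: eq_bigr => i _.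
by rewrite mulrnAl mulrnAr -mulrnDr subnKC // -ltnS.
Qed.
Lemma feulC c : feul (fpsC c) = 0.
Proof. by apply: fpsP => -[|k] //=; rewrite mul0rn. Qed.
Lemma fcoefMn f n k : (f *+ n)`@k = f`@k *+ n.
Proof. by elim: n => [|n IH]; rewrite ?mulr0n // !mulrS fcoefD IH. Qed.
Lemma feulXn n : feul (fX ^+ n) = fX ^+ n *+ n.
Proof. by apply: fpsP => k; rewrite fcoefMn /= fcoefXn; case: eqP => [->|]; rewrite ?mul0rn. Qed.

Lemma horner_feul (p : {poly K}) f :
  feul (map_poly fpsC p).[f] = (map_poly fpsC p^`()).[f] * feul f.
Proof.
elim/poly_ind: p => [|p c IH]; first by rewrite deriv0 !rmorph0 !horner0 raddf0 mul0r.
rewrite rmorphD rmorphM /= map_polyX map_polyC !hornerE /= feulD feulM IH feulC addr0.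
rewrite derivD derivM derivX derivC addr0 mulr1 rmorphD rmorphM /= map_polyX !hornerE.
by rewrite mulrDl mulrAC.
Qed.

Definition fcong m f g := ford m (f - g).

Lemma fcong_refl m f : fcong m f f. Proof. by move=> i _; rewrite subrr. Qed.
Lemma fcongD m f f' g g' : fcong m f f' -> fcong m g g' -> fcong m (f + g) (f' + g').
Proof. by move=> h h' i im; rewrite opprD addrACA fcoefD h // h' // addr0. Qed.
Lemma fordMl m f g : ford m f -> ford m (g * f).
Proof. by case/fordP => f' ->; apply/fordP; exists (g * f'); rewrite mulrCA. Qed.
Lemma fordD m f g : ford m f -> ford m g -> ford m (f + g).
Proof. by move=> h h' i im; rewrite fcoefD h // h' // addr0. Qed.
Lemma fcongM m f f' g g' : fcong m f f' -> fcong m g g' -> fcong m (f * g) (f' * g').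
Proof.
move=> h h'; rewrite /fcong (_ : _ - _ = g * (f - f') + f' * (g - g')).
  by apply: fordD; apply: fordMl.
by ring.
Qed.
Lemma fcong_horner m (p : {poly (fps K)}) f g : fcong m f g -> fcong m p.[f] p.[g].
Proof.
move=> h; elim/poly_ind: p => [|p c IH]; first by rewrite !horner0; apply: fcong_refl.
by rewrite !hornerE; apply: fcongD; [apply: fcongM|apply: fcong_refl].
Qed.

Lemma horner_taylor2 (R : comNzRingType) (p : {poly R}) (x u : R) :
  exists r, p.[x + u] = p.[x] + u * p^`().[x] + u ^+ 2 * r.
Proof.
elim/poly_ind: p => [|p c [r IH]].
  by exists 0; rewrite deriv0 !horner0 !mulr0 !addr0.
exists (p^`().[x] + r * (x + u)).
rewrite derivD derivM derivX derivC addr0 mulr1 !hornerE IH.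
by ring.
Qed.

(* Hensel's lemma: the coefficients of the root are found one at a time by Newton's correction *)
Lemma fps_hensel (p : {poly (fps K)}) (c : K) :
  p.[fpsC c]`@0 = 0 -> p^`().[fpsC c]`@0 != 0 -> exists2 y, y`@0 = c & root p y.
Proof.
move=> pc dpc; pose d := p^`().[fpsC c]`@0.
pose step k (y : fps K) := y - fpsC (p.[y]`@k.+1 / d) * fX ^+ k.+1.
pose Y := fix Y k := if k is k'.+1 then step k' (Y k') else fpsC c.
have step_coef k y i : (i < k.+1)%N -> (step k y)`@i = y`@i.
  by move=> ik; rewrite fcoefB fcoefCM fcoefXn (ltn_eqF ik) mulr0 subr0.
have YS k : Y k.+1 = step k (Y k) by [].
have Y0 k : (Y k)`@0 = c by elim: k => [|k IH] //; rewrite YS step_coef.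
have Yst k j i : (i < k.+1)%N -> (Y (k + j)%N)`@i = (Y k)`@i.
  move=> ik; elim: j => [|j IH]; rewrite ?addn0 // addnS YS step_coef //.
  by rewrite (leq_trans ik) // ltnS leq_addr.
have dY k : p^`().[Y k]`@0 = d.
  have /(_ 0%N isT) : fcong 1 p^`().[Y k] p^`().[fpsC c].
    by apply: fcong_horner => -[|//] _; rewrite fcoefB Y0 subrr.
  by rewrite fcoefB => /eqP; rewrite subr_eq0 => /eqP.
have Yr k : ford k.+1 p.[Y k].
  elim: k => [|k IH]; first by case.
  rewrite YS /step -mulNr -rmorphN /=; set e := - _.
  have [r ->] := horner_taylor2 p (Y k) (fpsC e * fX ^+ k.+1).
  have uk : ford k.+1 (fpsC e * fX ^+ k.+1) by apply/fordP; exists (fpsC e); rewrite mulrC.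
  have [uu _] := fordM_coef uk uk; rewrite -expr2 in uu.
  have u2 i : (i < k.+2)%N -> (((fpsC e * fX ^+ k.+1) ^+ 2) * r)`@i = 0.
    move=> ik; rewrite mulrC; have := @fordMl _ _ r uu; move/(_ i); apply.
    by rewrite (leq_trans ik) // addSn ltnS leq_addl.
  move=> i ik; rewrite 2!fcoefD u2 // addr0 -mulrA fcoefCM fcoefXnM.
  move: ik; rewrite ltnS leq_eqVlt => /orP[/eqP ->|ik]; last by rewrite IH // ik mulr0 addr0.
  rewrite ltnn subnn dY.
  by rewrite /e mulNr divfK ?subrr.
pose y := Fps (fun k => (Y k)`@k).
have yY k : fcong k.+1 y (Y k).
  move=> i ik; rewrite fcoefB /=; apply/eqP; rewrite subr_eq0; apply/eqP.
  by rewrite -[in RHS](subnKC (ik : (i <= k)%N)) Yst.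
exists y => //; apply/eqP/fpsP => k; rewrite fcoef0.
have := fcong_horner p (yY k) (ltnSn k); rewrite fcoefB Yr // subr0 => ->.
by [].
Qed.

End FpsRing.
Notation "f `@ i" := (fcoef f i) (at level 8, i at level 2, format "f `@ i").
End PowerSeries.

(** * Polynomial moments, and cancelling a factor P *)

Module Moments.
Import all_boot all_order all_algebra.
Import boolp ring.
Import PowerSeries.
Set Implicit Arguments. Unset Strict Implicit. Unset Printing Implicit Defensive.
Import GRing.Theory.
Local Open Scope ring_scope.

Section Integral.
Variable K : fieldType.
Hypothesis charK : [pchar K] =i pred0.
Variables a b : K.

Lemma natr_c0 n : (n%:R == 0 :> K) = (n == 0)%N.
Proof. by move: n; apply/pcharf0P. Qed.

Lemma natr_c0_inj : injective (fun n => n%:R : K).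
Proof.
have le m n : (m <= n)%N -> m%:R = n%:R :> K -> m = n.
  move=> mn /esym/eqP; rewrite -subr_eq0 -natrB // natr_c0 subn_eq0 => nm.
  by apply/eqP; rewrite eqn_leq mn.
move=> m n /= e; case/orP: (leq_total m n) => h; first exact: le.
by apply/esym; apply: le.
Qed.

(** At i = 0 the entry is h_0 / 0, which is 0, so this antiderivative has no constant term. *)
Definition prim (h : {poly K}) : {poly K} := \poly_(i < (size h).+1) (h`_i.-1 / i%:R).

Lemma coef_prim h i : (prim h)`_i = h`_i.-1 / i%:R.
Proof.
rewrite coef_poly; case: ltnP => // hi.
case: i hi => // i hi; rewrite nth_default ?mul0r //.
Qed.

Lemma prim_is_zmod : zmod_morphism prim.
Proof. by move=> p q; apply/polyP => i; rewrite coefB !coef_prim coefB mulrBl. Qed.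
Lemma prim_is_scalable : scalable prim.
Proof. by move=> c p; apply/polyP => i; rewrite coefZ !coef_prim coefZ mulrA. Qed.
HB.instance Definition _ := GRing.isZmodMorphism.Build _ _ prim prim_is_zmod.
HB.instance Definition _ := GRing.isScalable.Build _ _ _ _ prim prim_is_scalable.

Definition pint (h : {poly K}) : K := (prim h).[b] - (prim h).[a].
Lemma pint_is_zmod : zmod_morphism pint.
Proof. by move=> p q; rewrite /pint raddfB /= !hornerE; ring. Qed.
Lemma pintZ c p : pint (c *: p) = c * pint p.
Proof. by rewrite /pint linearZ /= !hornerE mulrBr. Qed.
HB.instance Definition _ := GRing.isZmodMorphism.Build _ _ pint pint_is_zmod.

Lemma prim_deriv p : prim p^`() = p - (p`_0)%:P.
Proof.
apply/polyP => -[|i]; rewrite coef_prim coefB coefC /= ?subrr ?invr0 ?mulr0 // subr0 coef_deriv.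
by rewrite -[p`_i.+1 *+ _]mulr_natr mulfK // natr_c0.
Qed.

Lemma pint_deriv p : pint p^`() = p.[b] - p.[a].
Proof. by rewrite /pint prim_deriv !hornerE; ring. Qed.
End Integral.

Section Moments.
Variable K : closedFieldType.
Hypothesis charK : [pchar K] =i pred0.
Variables (a b : K) (P : {poly K}).
Hypotheses (Pa : P.[a] = 0) (Pb : P.[b] = 0) (P0 : P != 0).
Local Notation I := (pint a b).
Let n0 i : (i.+1%:R : K) != 0. Proof. by rewrite (natr_c0 charK). Qed.

Definition mom k (Y : {poly K}) : K := I (P ^+ k * Y^`()).

Lemma mom_is_zmod k : zmod_morphism (mom k).
Proof. by move=> p q; rewrite /mom derivB mulrBr raddfB. Qed.
HB.instance Definition _ k := GRing.isZmodMorphism.Build _ _ (mom k) (mom_is_zmod k).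
Lemma momZ k c p : mom k (c *: p) = c * mom k p.
Proof. by rewrite /mom derivZ -scalerAr; apply: pintZ. Qed.
Lemma mom0 Y : mom 0 Y = Y.[b] - Y.[a].
Proof. by rewrite /mom mul1r (pint_deriv charK). Qed.

Definition allmom Y := forall k, mom k Y = 0.

(** Integration by parts against P^(k+1), whose boundary terms vanish because P(a) = P(b) = 0. *)
Lemma mom_mulP k Y : k.+1%:R * mom k (P * Y) = k%:R * mom k.+1 Y.
Proof.
have h : I (P ^+ k.+1 * Y)^`() = 0.
  by rewrite (pint_deriv charK) // !hornerM !horner_exp Pa Pb !expr0n /= !mul0r subrr.
have e : (P ^+ k.+1 * Y)^`() = P ^+ k.+1 * Y^`() + k.+1%:R *: (P ^+ k * P^`() * Y).
  rewrite derivM deriv_exp /= scaler_nat; ring.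
move: h; rewrite e raddfD /= pintZ => h.
have -> : mom k (P * Y) = mom k.+1 Y + I (P ^+ k * P^`() * Y).
  by rewrite /mom -raddfD /= derivM; congr I; rewrite exprS; ring.
by rewrite mulrDr; move/eqP: h; rewrite addrC addr_eq0 => /eqP ->; rewrite -/(mom k.+1 Y) -[k.+1%:R]natr1; ring.
Qed.

(* a vector field [g d/dx] that lifts [delta(z) z d/dz] through [z = P(x)] *)
Variables (g dl : {poly K}).
Hypothesis gE : g * P^`() = (dl \Po P) * P.
Hypotheses (ga : g.[a] = 0) (gb : g.[b] = 0).
Let d0 := dl`_0.
Hypothesis d00 : d0 != 0.
Definition eul (Y : {poly K}) := g * Y^`().

Lemma mom_eul k Y : mom k (eul Y) = - k%:R * \sum_(i < size dl) dl`_i * mom (k + i) Y.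
Proof.
have e : (P ^+ k * (g * Y^`()))^`() =
    P ^+ k * (g * Y^`())^`() + k%:R *: (P ^+ k * (dl \Po P) * Y^`()).
  rewrite derivM deriv_exp -[X in X * (g * _)]mulr_natl; case: k  => [|k].
    by rewrite mulr0n scale0r !mul0r add0r addr0.
  rewrite /= scaler_nat -mulr_natl.
  transitivity ((k.+1%:R * P ^+ k * Y^`()) * (g * P^`()) + P ^+ k.+1 * (g * Y^`())^`()); first by ring.
  by rewrite gE exprS; ring.
have h : I (P ^+ k * (g * Y^`()))^`() = 0.
  by rewrite (pint_deriv charK) // !hornerM ga gb !(mul0r, mulr0) subrr.
move: h; rewrite e raddfD /= pintZ /mom /eul => /eqP; rewrite addr_eq0 => /eqP ->.
rewrite mulNr; congr (- (_ * _)); rewrite comp_polyE mulr_sumr mulr_suml raddf_sum /=.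
apply: eq_bigr => i _; rewrite -scalerAr -scalerAl pintZ; congr (_ * I _).
by rewrite exprD.
Qed.

Definition momW m Y := forall k, (m <= k)%N -> mom k Y = 0.

Lemma momW_P m Y : momW m Y -> momW m (P * Y).
Proof.
move=> h k mk; apply: (mulfI (n0 k)); rewrite mulr0 mom_mulP h ?mulr0 //.
exact: leq_trans (leqnSn k).
Qed.
Lemma momW_unP m Y : (0 < m)%N -> momW m (P * Y) -> momW m.+1 Y.
Proof.
move=> m0 h [|k] // mk; have k0 : (0 < k)%N := leq_trans m0 mk.
case: k k0 mk => // k _ mk.
by apply: (mulfI (n0 k)); rewrite mulr0 -mom_mulP h ?mulr0.
Qed.
Lemma momW_eul m Y : momW m Y -> momW m (eul Y).
Proof.
move=> h k mk; rewrite mom_eul big1 ?mulr0 // => i _; rewrite h ?mulr0 //.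
exact: leq_trans (leq_addr _ _).
Qed.
Lemma momWB m Y Z : momW m Y -> momW m Z -> momW m (Y - Z).
Proof. by move=> h h' k mk; rewrite raddfB /= h // h' // subrr. Qed.
Lemma momWZ m c Y : momW m Y -> momW m (c *: Y).
Proof. by move=> h k mk; rewrite momZ h // mulr0. Qed.
Lemma momWS m m' Y : (m <= m')%N -> momW m Y -> momW m' Y.
Proof. by move=> mm h k mk; apply: h; apply: leq_trans mk. Qed.

Lemma mom_eul_lead m Y : momW m.+1 Y -> mom m (eul Y) = - m%:R * d0 * mom m Y.
Proof.
move=> h; rewrite mom_eul -mulrA; congr (_ * _).
have s0 : (0 < size dl)%N.
  by rewrite lt0n size_poly_eq0; apply: contraNneq d00 => e; rewrite /d0 e coef0.
case: (size dl) s0 => // s _; rewrite big_ord_recl addn0 big1 ?addr0 // => i _.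
by rewrite h ?mulr0 // addnS ltnS leq_addr.
Qed.

(** The composite of the operators [eul] - e; the exponents e will be those that make its image,
    after one more [eul], divisible by [P]. *)
Definition eulops (es : seq K) (Y : {poly K}) := foldl (fun Z e => eul Z - e *: Z) Y es.

Lemma momW_eulops m es Y : momW m Y -> momW m (eulops es Y).
Proof.
elim: es Y => //= e es IH Y h; apply: IH; apply: momWB; last exact: momWZ.
exact: momW_eul.
Qed.

Lemma eulops_eigen (S : {poly K} -> Prop) (la : {poly K} -> K) (mu : K) es :
  (forall Y, S Y -> S (eul Y)) -> (forall c Y, S Y -> S (c *: Y)) ->
  (forall Y Z, S Y -> S Z -> S (Y - Z)) ->
  (forall c Y, la (c *: Y) = c * la Y) -> (forall Y Z, la (Y - Z) = la Y - la Z) ->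
  (forall Y, S Y -> la (eul Y) = mu * la Y) ->
  forall Y, S Y -> S (eulops es Y) /\ la (eulops es Y) = \prod_(e <- es) (mu - e) * la Y.
Proof.
move=> Se Sz Sb lz lb le; elim: es => [|e es IH] Y SY; first by rewrite big_nil mul1r.
have SY' : S (eul Y - e *: Y) by apply: Sb; [apply: Se|apply: Sz].
have [S1 l1] := IH _ SY'; split=> //=; rewrite -/(eulops _ _) l1 lb lz le // big_cons.
ring.
Qed.

(* the exponents [i / d_c], [0 < i < d_c], of the fibre [P = 0] *)
Variable es : seq K.
Hypothesis es_frac : forall e, e \in es -> exists i d, [/\ (0 < i < d)%N & e = d0 * (i%:R / d%:R)].
Hypothesis es_kill : forall Y, exists Z, eul (eulops es Y) = P * Z.

(** The exponents are non-integral multiples of [d0], so they avoid the eigenvalues of [eul] on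
    moments and on power series coefficients, which are integral multiples. This is why the factors
    (mu - e) can be cancelled. *)
Lemma es_neq m e : e \in es -> d0 * m%:R != e /\ - m%:R * d0 != e.
Proof.
move=> /es_frac[i [d [/andP[i0 id] ->]]].
have dn : (d%:R : K) != 0 by rewrite (natr_c0 charK) -lt0n (leq_trans _ id).
split; apply/negP => /eqP h.
  have : d0 * (m * d)%:R = d0 * i%:R.
    by rewrite natrM mulrA h -mulrA divfK.
  move/(mulfI d00)/(natr_c0_inj charK); case: (m) => [|m'] e0; first by rewrite -e0 in i0.
  by move: id; rewrite -e0 ltnNge mulSn leq_addr.
have : d0 * (m * d + i)%:R = 0.
  rewrite natrD natrM mulrDr; have -> : d0 * i%:R = d0 * (i%:R / d%:R) * d%:R.
    by rewrite -mulrA divfK.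
  by rewrite -h; ring.
move/eqP; rewrite mulf_eq0 (negPf d00) /= (natr_c0 charK) addn_eq0 => /andP[_ /eqP i00].
by rewrite i00 in i0.
Qed.

Definition momoo Y := exists m, momW m Y.

Lemma momoo_unP Y : momoo (P * Y) -> momoo Y.
Proof.
by case=> m h; exists m.+2; apply: momW_unP => //; apply: momWS h.
Qed.


Lemma momooB Y Z : momoo Y -> momoo Z -> momoo (Y - Z).
Proof.
case=> m h [m' h']; exists (maxn m m'); apply: momWB.
  by apply: momWS h; apply: leq_maxl.
by apply: momWS h'; apply: leq_maxr.
Qed.
Lemma momoo_PX k Y m : momW m Y -> momW m (P ^+ k * Y).
Proof. by move=> h; elim: k => [|k IH]; rewrite ?mul1r // exprS -mulrA; apply: momW_P. Qed.

(* [momoo] is a finitely generated module over [K[P]]: one generator per degree class *)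
Lemma momoo_bound : exists m0, forall Y, momoo Y -> momW m0 Y.
Proof.
pose n := (size P).-1.
have sP : (1 < size P)%N by apply: (@root_size_gt1 _ a); rewrite // /root Pa.
have n_gt0 : (0 < n)%N by rewrite /n -ltnS prednK // ltnW.
have /choice[D hD] r : exists Ym : {poly K} * nat, momW Ym.2 Ym.1 /\ forall Y, momoo Y -> Y != 0 ->
    ((size Y).-1 %% n = r)%N -> [/\ Ym.1 != 0, ((size Ym.1).-1 %% n = r)%N & (size Ym.1 <= size Y)%N].
  pose Q k := `[< exists Y, [/\ momoo Y, Y != 0, ((size Y).-1 %% n = r)%N & size Y = k] >].
  have [ex|nex] := pselect (exists k, Q k); last first.
    exists (0, 0%N); split=> [|Y oY Y0 Yr]; first by move=> k _; rewrite raddf0.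
    by case: nex; exists (size Y); apply/asboolP; exists Y.
  case: (ex_minnP ex) => k /asboolP[Z [[m Zm] Z0 Zr Zk]] min.
  exists (Z, m); split=> //= Y oY Y0 Yr; split=> //.
  by rewrite Zk; apply: min; apply/asboolP; exists Y.
pose m0 := (\max_(r < n) (D r).2)%N.
exists m0 => Y; have [s] := ubnP (size Y); elim: s Y => // s IH Y; rewrite ltnS => sY oY.
have [->|Y0] := eqVneq Y 0; first by move=> k _; rewrite raddf0.
pose r := ((size Y).-1 %% n)%N; have rn : (r < n)%N by rewrite ltn_pmod.
have [Dr /(_ Y oY Y0 erefl)[D0 Dmod Dle]] := hD r.
set Z := (D r).1 in Dr D0 Dmod Dle.
have Zm0 : momW m0 Z.
  apply: momWS Dr; rewrite /m0 (bigmax_sup (Ordinal rn)) //.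
have sZ0 : (0 < size Z)%N by rewrite lt0n size_poly_eq0.
have sY0 : (0 < size Y)%N by rewrite lt0n size_poly_eq0.
have [q hq] : exists q, ((size Y).-1 = q * n + (size Z).-1)%N.
  have le : ((size Z).-1 <= (size Y).-1)%N by rewrite -ltnS !prednK.
  exists (((size Y).-1 - (size Z).-1) %/ n)%N; rewrite divnK ?subnK //.
  by rewrite -eqn_mod_dvd // Dmod.
have PqZ0 : P ^+ q * Z != 0 by rewrite mulf_neq0 // expf_neq0.
have sPqZ : size (P ^+ q * Z) = size Y.
  rewrite size_mul ?expf_neq0 // -(prednK sY0) hq -(prednK sZ0) addnS /=.
  have := size_exp P q; rewrite -/n => e; rewrite -addSn mulnC -e prednK //.
  by rewrite lt0n size_poly_eq0 expf_neq0.
pose c := lead_coef Y / lead_coef (P ^+ q * Z).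
have oPqZ : momW m0 (c *: (P ^+ q * Z)) by apply: momWZ; apply: momoo_PX.
have -> : Y = (Y - c *: (P ^+ q * Z)) + c *: (P ^+ q * Z) by rewrite subrK.
suff h : momW m0 (Y - c *: (P ^+ q * Z)).
  by move=> k mk; rewrite raddfD /= h // oPqZ // addr0.
have oY' : momoo (Y - c *: (P ^+ q * Z)) by apply: momooB => //; exists m0.
apply: IH => //; apply: leq_trans sY.
rewrite -(prednK sY0) ltnS; apply/leq_sizeP => i; rewrite leq_eqVlt => /orP[/eqP <-|iY].
  rewrite coefB coefZ -lead_coefE -sPqZ -lead_coefE /c divfK ?subrr //.
  by rewrite lead_coef_eq0.
rewrite coefB coefZ !nth_default ?mulr0 ?subrr ?sPqZ //; by rewrite -(prednK sY0).
Qed.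

Lemma momoo_eulops_kill Y : momoo Y ->
  exists Z, [/\ momoo Z, eul (eulops es Y) = P * Z & momoo (eulops es Y)].
Proof.
move=> [m Ym]; have [Z eZ] := es_kill Y.
have h : momW m (eulops es Y) by apply: momW_eulops.
exists Z; split=> //; last by exists m.
by apply: momoo_unP; exists m; rewrite -eZ; apply: momW_eul.
Qed.

Lemma prod_es (mu : K) : (forall e, e \in es -> mu != e) -> \prod_(e <- es) (mu - e) != 0.
Proof.
elim: es => [|e s IH] h; first by rewrite big_nil oner_eq0.
rewrite big_cons mulf_neq0 ?subr_eq0 ?h ?mem_head // IH // => e' e's.
by apply: h; rewrite inE e's orbT.
Qed.

(** Write [eul] of [eulops es Y] as P Z. Moment m+1 of P Z is proportional to moment m+2 of Z, which
    vanishes; on the other hand it is a nonzero multiple of moment m+1 of Y. So the uniform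
    threshold goes down by one. *)
Lemma momoo_descend m : (forall Y, momoo Y -> momW m.+2 Y) -> forall Y, momoo Y -> momW m.+1 Y.
Proof.
move=> h Y oY k; rewrite leq_eqVlt => /orP[/eqP <-|km]; last by apply: h.
have [Z [oZ eZ oE]] := momoo_eulops_kill oY.
have oE' Y' : momoo Y' -> momoo (eul Y') by case=> j hj; exists j; apply: momW_eul.
have oZ' c Y' : momoo Y' -> momoo (c *: Y') by case=> j hj; exists j; apply: momWZ.
have [_ lam] := @eulops_eigen momoo (mom m.+1) (- m.+1%:R * d0) es
  oE' oZ'
  momooB (momZ m.+1) (raddfB (mom m.+1)) (fun Y oY => mom_eul_lead (h Y oY)) Y oY.
have : mom m.+1 (eul (eulops es Y)) = 0.
  rewrite eZ; apply: (mulfI (n0 m.+1)); rewrite mulr0 mom_mulP h ?mulr0 //.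
rewrite mom_eul_lead; last exact: h.
rewrite lam => /eqP; rewrite !mulf_eq0 oppr_eq0 (negPf (n0 _)) (negPf d00) /=.
rewrite (negPf (prod_es _)) /= => [/eqP//|e /(es_neq m.+1)[_ //]].
Qed.

Lemma momoo_allmom Y : momoo Y -> allmom Y.
Proof.
have W1 : forall Y, momoo Y -> momW 1 Y.
  have [m0] := momoo_bound; elim: m0 => [|m IH] h; first by move=> Z /h; apply: momWS.
  by case: m IH h => [|m] IH h //; apply: IH; apply: momoo_descend.
move=> oY [|k]; last by apply: W1.
have [Z [oZ eZ oE]] := momoo_eulops_kill oY.
have e0 Z' : mom 0 (eul Z') = 0 * mom 0 Z' by rewrite mom_eul oppr0 !mul0r.
have [_ lam] := @eulops_eigen (fun _ => True) (mom 0) 0 es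
  (fun _ _ => Logic.I) (fun _ _ _ => Logic.I) (fun _ _ _ _ => Logic.I)
  (momZ 0) (raddfB (mom 0)) (fun Y _ => e0 Y) Y Logic.I.
(* [eul] annihilates moment 0, so the descent gives nothing here. Instead Z P' = dl(P) (eulops Y)',
   whose integral is [d0] times moment 0 of [eulops es Y], while the integral of Z P' is minus the
   first moment of Z. *)
have : mom 0 (eulops es Y) = 0.
  have ZP : Z * P^`() = (dl \Po P) * (eulops es Y)^`().
    apply: (mulfI P0); rewrite !mulrA -eZ [P * _]mulrC -gE /eul; ring.
  have IZ : I (Z * P^`()) = 0.
    have := pint_deriv charK a b (P * Z); rewrite !hornerM Pa Pb !mul0r subrr derivM raddfD /=.
    have := W1 Z oZ 1%N isT; rewrite /mom expr1 => ->; rewrite addr0 mulrC //.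
  have : I (Z * P^`()) = d0 * mom 0 (eulops es Y).
    rewrite ZP comp_polyE mulr_suml raddf_sum /=.
    have s0 : (0 < size dl)%N.
      by rewrite lt0n size_poly_eq0; apply: contraNneq d00 => e; rewrite /d0 e coef0.
    case: (size dl) s0 => // s _; rewrite big_ord_recl big1 ?addr0 => [|i _].
      by rewrite -scalerAl pintZ.
    by rewrite -scalerAl pintZ -/(mom (lift ord0 i) _) (W1 _ oE) ?mulr0.
  by rewrite IZ => /esym/eqP; rewrite mulf_eq0 (negPf d00) => /eqP.
rewrite lam => /eqP; rewrite mulf_eq0 (negPf (prod_es _)) /= => [/eqP//|e /(es_neq 0)[]].
by rewrite mulr0.
Qed.

(** Moments of P Y give those of Y only up to finitely many; the descent removes the exceptions. It
    is the induction step for the coefficients at z = 0. *)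
Lemma allmom_unP Y : allmom (P * Y) -> allmom Y.
Proof. by move=> h; apply: momoo_allmom; apply: momoo_unP; exists 0%N => k _; apply: h. Qed.

End Moments.
End Moments.

(** * The relation between branches over z = 0 *)

Module MomentBranches.
Import all_boot all_order all_algebra.
Import boolp ring.
Import PowerSeries Moments.
Set Implicit Arguments. Unset Strict Implicit. Unset Printing Implicit Defensive.
Import GRing.Theory.
Local Open Scope ring_scope.
Local Notation "p ^^" := (map_poly (@fpsC _) p) (at level 2, format "p ^^").

Section LocalField.
Variable K : closedFieldType.
Hypothesis charK : [pchar K] =i pred0.
Variable d : K -> nat.
Implicit Types (cs : seq K) (c : K).

Definition powprod cs : {poly K} := \prod_(c <- cs) ('X - c%:P) ^+ d c.
Definition radprod cs : {poly K} := \prod_(c <- cs) ('X - c%:P).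
(** The numerator of the logarithmic derivative of [powprod] over the denominator [radprod]. *)
Fixpoint sumprod cs : {poly K} :=
  if cs is c :: cs' then (d c)%:R *: radprod cs' + ('X - c%:P) * sumprod cs' else 0.

Lemma deriv_powprod cs : (forall c, c \in cs -> (0 < d c)%N) ->
  (powprod cs)^`() * radprod cs = powprod cs * sumprod cs.
Proof.
elim: cs => [|c cs IH] hd; first by rewrite /powprod big_nil mulr0 -[1]/(1%:P) derivC mul0r.
have dc : (0 < d c)%N by apply: hd; rewrite mem_head.
have /IH e : forall c', c' \in cs -> (0 < d c')%N by move=> c' h; apply: hd; rewrite inE h orbT.
rewrite /powprod /radprod !big_cons -/(powprod cs) -/(radprod cs) /= derivM deriv_exp derivXsubC mul1r.
case: (d c) dc => // k _; rewrite /= scaler_nat.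
transitivity (('X - c%:P) ^+ k.+1 * (k.+1%:R * (powprod cs * radprod cs) + ('X - c%:P) * ((powprod cs)^`() * radprod cs))).
  by rewrite -mulr_natl exprS; ring.
by rewrite e -[radprod cs *+ _]mulr_natl; ring.
Qed.

Lemma sumprod_at cs c : uniq cs -> c \in cs -> exists h,
  [/\ radprod cs = ('X - c%:P) * h, h.[c] != 0 & (sumprod cs).[c] = (d c)%:R * h.[c]].
Proof.
elim: cs => // c' cs IH /= /andP[nc' ucs]; rewrite inE => /predU1P[->|cin].
  exists (radprod cs); rewrite /radprod big_cons; split=> //.
    rewrite horner_prod prodf_seq_neq0; apply/allP => x xcs /=.
    by rewrite !hornerE subr_eq0; apply: contraNneq nc' => ->.
  by rewrite !hornerE subrr mul0r addr0.
have [h [e1 h0 e2]] := IH ucs cin.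
exists (('X - c'%:P) * h); rewrite /radprod big_cons -/(radprod cs) e1; split.
- by rewrite mulrCA.
- by rewrite hornerM mulf_neq0 // !hornerE subr_eq0; apply: contraNneq nc' => <-.
- rewrite /= hornerD hornerM e2 hornerZ !hornerM !hornerXsubC subrr; ring.
Qed.

Lemma powprod_dvd cs Y : uniq cs ->
  (forall c, c \in cs -> ('X - c%:P) ^+ d c %| Y) -> powprod cs %| Y.
Proof.
elim: cs => [|c cs IH] /=; first by rewrite /powprod big_nil dvd1p.
case/andP=> nc ucs h; rewrite /powprod big_cons -/(powprod cs) Gauss_dvdp.
  by rewrite h ?mem_head // IH // => x xcs; apply: h; rewrite inE xcs orbT.
rewrite coprimep_expl // coprimep_sym coprimep_XsubC /root horner_prod prodf_seq_neq0.
apply/allP => x xcs /=; rewrite horner_exp expf_neq0 // !hornerE subr_eq0.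
by apply: contraNneq nc => ->.
Qed.

Section Kill.
Variables (g : {poly K}) (d0 : K).
Definition euls (c : K) := [seq d0 * (i%:R / (d c)%:R) | i <- iota 1 (d c).-1].

Lemma eul_dvd c i Z e : ('X - c%:P) %| g -> ('X - c%:P) ^+ i %| Z ->
  ('X - c%:P) ^+ i %| eul g Z - e *: Z.
Proof.
move=> /dvdpP[gc ->] hZ; apply: dvdp_sub; last by rewrite -mul_polyC dvdp_mull.
case/dvdpP: hZ => W ->; rewrite /eul derivM deriv_exp derivXsubC mul1r.
case: i => [|i]; first by rewrite dvd1p.
rewrite /= mulrDr dvdp_add //; first by rewrite !mulrA dvdp_mull.
by rewrite -mulr_natl; apply/dvdpP; exists (gc * W * i.+1%:R); rewrite exprS; ring.
Qed.

Lemma eulops_dvd c i Z s : ('X - c%:P) %| g -> ('X - c%:P) ^+ i %| Z ->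
  ('X - c%:P) ^+ i %| eulops g s Z.
Proof. by move=> hg; elim: s Z => //= e s IH Z hZ; apply: IH; apply: eul_dvd. Qed.

Lemma eulops_cat s1 s2 Z : eulops g (s1 ++ s2) Z = eulops g s2 (eulops g s1 Z).
Proof. by rewrite /eulops foldl_cat. Qed.

Lemma eulops_eul s Z : eul g (eulops g s Z) = eulops g s (eul g Z).
Proof.
elim: s Z => //= e s IH Z; rewrite -/(eulops _ _ _) IH -/(eulops _ _ _); congr eulops.
by rewrite /eul derivB derivZ mulrBr scalerAr.
Qed.

(** Since [g] has the zero c with slope d0 / d_c, [eul] acts on the term (x - c)^i with eigenvalue
    d0 i / d_c; subtracting it raises the order of vanishing by one. *)
Lemma eul_raise c gc i Z : g = ('X - c%:P) * gc -> gc.[c] = d0 / (d c)%:R ->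
  ('X - c%:P) ^+ i %| Z -> ('X - c%:P) ^+ i.+1 %| eul g Z - (d0 * (i%:R / (d c)%:R)) *: Z.
Proof.
move=> -> gcc /dvdpP[W ->]; rewrite /eul derivM deriv_exp derivXsubC mul1r.
have [q eq] : exists q, gc - (gc.[c])%:P = q * ('X - c%:P).
  by apply/factor_theorem; rewrite /root !hornerE subrr.
have -> : d0 * (i%:R / (d c)%:R) = gc.[c] * i%:R by rewrite gcc; ring.
rewrite -mul_polyC polyCM polyC_natr.
have {eq} -> : (gc.[c])%:P = gc - q * ('X - c%:P) by rewrite -eq; ring.
apply/dvdpP; exists (W^`() * gc + q * i%:R * W).
case: i => [|i]; first by rewrite !mulr0n expr1 expr0; ring.
by rewrite /= -[_ ^+ i *+ i.+1]mulr_natl !exprS; ring.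
Qed.

Lemma euls_kill c gc Z : (0 < d c)%N -> g = ('X - c%:P) * gc -> gc.[c] = d0 / (d c)%:R ->
  'X - c%:P %| Z -> ('X - c%:P) ^+ d c %| eulops g (euls c) Z.
Proof.
move=> dc eg egc hZ.
have gen k m Y : ('X - c%:P) ^+ m %| Y ->
    ('X - c%:P) ^+ (m + k) %| eulops g [seq d0 * (i%:R / (d c)%:R) | i <- iota m k] Y.
  elim: k m Y => [|k IH] m Y hY; first by rewrite addn0.
  by rewrite addnS -addSn; apply: IH; apply: eul_raise egc hY.
by rewrite -[X in _ ^+ X](prednK dc) -add1n; apply: gen; rewrite expr1.
Qed.

Lemma eulops_kill cs Z : uniq cs ->
  (forall c, c \in cs -> (0 < d c)%N /\ exists2 gc, g = ('X - c%:P) * gc & gc.[c] = d0 / (d c)%:R) ->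
  powprod cs %| eul g (eulops g (flatten [seq euls c | c <- cs]) Z).
Proof.
move=> ucs hc; rewrite eulops_eul.
have key c : c \in cs -> ('X - c%:P) ^+ d c %| eulops g (flatten [seq euls c | c <- cs]) (eul g Z).
  move=> cin; have [dc [gc eg egc]] := hc _ cin.
  have dg : 'X - c%:P %| g by rewrite eg dvdp_mulr.
  have : 'X - c%:P %| eul g Z by rewrite /eul dvdp_mulr.
  move: (eul g Z); elim: cs cin {ucs hc} => // c' cs IH; rewrite inE [flatten _]/=.
  move=> /predU1P[<-|cin] Y hY; rewrite eulops_cat; first by apply: eulops_dvd => //; apply: euls_kill egc hY.
  by apply: IH => //; rewrite -[_ - _]expr1; apply: eulops_dvd; rewrite ?expr1.
by apply: powprod_dvd => // c /key; rewrite -eulops_eul.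
Qed.
End Kill.

End LocalField.

Section VectorField.
Variable K : closedFieldType.
Hypothesis charK : [pchar K] =i pred0.
(** With rad the radical of P and S the numerator [sumprod] one has P' rad = P S. Taking g = h rad
    with S h = dl(P) gives g P' = dl(P) P, and the zeros of g include those of P. *)
Lemma vector_field (a b : K) (P : {poly K}) : P.[a] = 0 -> P.[b] = 0 -> P != 0 ->
  exists g dl es, [/\ g * P^`() = (dl \Po P) * P, g.[a] = 0, g.[b] = 0, dl`_0 != 0 &
   (forall e, e \in es -> exists i d, [/\ (0 < i < d)%N & e = dl`_0 * (i%:R / d%:R)]) /\
   (forall Y, exists Z, eul g (eulops g es Y) = P * Z)].
Proof.
move=> Pa Pb P0; have [r eP] := closed_field_poly_normal P.
have lc0 : lead_coef P != 0 by rewrite lead_coef_eq0.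
pose d c := count_mem c r; pose cs := undup r.
have ucs : uniq cs by apply: undup_uniq.
have rc c : (P.[c] == 0) = (c \in cs).
  rewrite mem_undup eP hornerZ mulf_eq0 (negPf lc0) /= -[LHS]/(root _ c).
  by rewrite root_prod_XsubC.
have dpos c : c \in cs -> (0 < d c)%N by rewrite mem_undup -has_pred1 has_count.
have {}eP : P = lead_coef P *: powprod d cs by rewrite [LHS]eP /powprod prodr_undup_exp_count.
have eP' : P^`() * radprod cs = P * sumprod d cs.
  by rewrite eP derivZ -!scalerAl (deriv_powprod dpos).
have Sc c : c \in cs -> (sumprod d cs).[c] != 0.
  move=> cin; have [h [_ hc ->]] := sumprod_at d ucs cin.
  by rewrite mulf_neq0 // (natr_c0 charK) -lt0n dpos.
set S := sumprod d cs in eP' Sc.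
have S0 : S != 0.
  by apply: contraNneq (Sc a _) => [->|]; rewrite ?horner0 // -rc Pa.
have [rs eS] := closed_field_poly_normal S.
(* The roots of S are critical points off the fibre P = 0. Letting [dl] vanish at their critical
   values makes S divide dl(P), and keeps dl(0) nonzero. *)
pose dl : {poly K} := \prod_(x <- rs) ('X - (P.[x])%:P).
have [h eh] : exists h, dl \Po P = S * h.
  suff [h e] : exists h, dl \Po P = \prod_(x <- rs) ('X - x%:P) * h.
    exists ((lead_coef S)^-1 *: h); rewrite [X in _ = X * _]eS -scalerAl -scalerAr scalerA mulfV ?scale1r ?lead_coef_eq0 //.
  rewrite /dl; elim: (rs) => [|x s [h e]]; first by exists 1; rewrite !big_nil comp_polyC mulr1.
  have [q eq] : exists q, P - (P.[x])%:P = q * ('X - x%:P).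
    by apply/factor_theorem; rewrite /root !hornerE subrr.
  exists (q * h); rewrite !big_cons comp_polyM e comp_polyB comp_polyX comp_polyC eq; ring.
exists (h * radprod cs), dl, (flatten [seq euls d (dl`_0) c | c <- cs]); split.
- by rewrite eh -mulrA [radprod _ * _]mulrC eP'; ring.
- have [h' [-> _ _]] : exists h', [/\ radprod cs = ('X - a%:P) * h', h'.[a] != 0 & S.[a] = (d a)%:R * h'.[a]].
    by apply: sumprod_at => //; rewrite -rc Pa.
  by rewrite !hornerM hornerXsubC subrr mul0r mulr0.
- have [h' [-> _ _]] : exists h', [/\ radprod cs = ('X - b%:P) * h', h'.[b] != 0 & S.[b] = (d b)%:R * h'.[b]].
    by apply: sumprod_at => //; rewrite -rc Pb.
  by rewrite !hornerM hornerXsubC subrr mul0r mulr0.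
- rewrite -horner_coef0 /dl horner_prod prodf_seq_neq0; apply/allP => x xrs /=.
  rewrite hornerXsubC sub0r oppr_eq0 rc; apply: contraL (_ : root S x); first exact: Sc.
  by rewrite eS rootZ ?lead_coef_eq0 // root_prod_XsubC.
- split=> [e|Y].
  move=> /flattenP[s /mapP[c cin ->]] /mapP[i]; rewrite mem_iota => /andP[i0 id] ->.
  exists i, (d c); split=> //; rewrite i0 /=; move: id; rewrite add1n prednK //; exact: dpos.
  suff /dvdpP[Z eZ] : P %| eul (h * radprod cs) (eulops (h * radprod cs)
      (flatten [seq euls d (dl`_0) c | c <- cs]) Y) by exists Z; rewrite eZ mulrC.
  rewrite eP dvdpZl //; apply: eulops_kill => // c cin; split; first exact: dpos.
  have [h' [e1 h0 e2]] := sumprod_at d ucs cin.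
  exists (h * h'); first by rewrite e1 mulrCA.
  have dc0 : ((d c)%:R : K) != 0 by rewrite (natr_c0 charK) -lt0n dpos.
  apply: (mulIf dc0); rewrite divfK // hornerM -horner_coef0.
  move: cin; rewrite -rc => /eqP Pc.
  have := congr1 (fun p => p.[c]) eh; rewrite horner_comp Pc hornerM -/S e2 => ->; ring.
Qed.


End VectorField.

Lemma fcoef_horner0 (K : fieldType) (R : {poly K}) f : (R^^.[f])`@0 = R.[f`@0].
Proof.
elim/poly_ind: R => [|p c IH]; first by rewrite rmorph0 !horner0.
by rewrite rmorphD rmorphM /= map_polyX map_polyC /= !hornerE fcoefD fcoefM0 IH.
Qed.

Section Branch.
Variable K : closedFieldType.
Hypothesis charK : [pchar K] =i pred0.

(** Substitute y = c + t^M v and P = R (X - c)^d: the equation becomes v^d R(c + t^M v) = 1, which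
    has a simple solution at t = 0. The free factor M lets branches at different zeros share one
    parameter t. *)
Lemma branch (P : {poly K}) c d M : (0 < d)%N -> (0 < M)%N -> ('X - c%:P) ^+ d %| P ->
  ~~ (('X - c%:P) ^+ d.+1 %| P) ->
  exists2 y : fps K, y`@0 = c & P^^.[y] = fX K ^+ (M * d).
Proof.
move=> d0 M0 /dvdpP[R eR] nd.
have Rc : R.[c] != 0.
  apply: contraNneq nd => /eqP/factor_theorem[R' eR']; apply/dvdpP; exists R'.
  by rewrite eR eR' exprS mulrA.
pose q : {poly fps K} := 'X^d * (R^^ \Po (fX K ^+ M *: 'X + (fpsC c)%:P)) - 1.
have [v0 hv] : exists v0, v0 ^+ d * R.[c] = 1.
  have /closed_rootP[v0] : size ('X^d - (R.[c]^-1)%:P) != 1%N.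
    by rewrite size_XnsubC // eqSS -lt0n.
  rewrite /root !hornerE subr_eq0 => /eqP e; exists v0; rewrite e mulVf //.
have v00 : v0 != 0.
  by apply: contra_eq_neq hv => ->; rewrite expr0n eqn0Ngt d0 mul0r eq_sym oner_eq0.
have XM0 : (fX K ^+ M)`@0 = 0 by rewrite fcoefXn; case: M M0 {q}.
have in0 f : (fX K ^+ M * f + fpsC c)`@0 = c by rewrite fcoefD fcoefM0 XM0 mul0r add0r.
have [v e0 rv] : exists2 v, v`@0 = v0 & root q v.
  apply: fps_hensel.
    rewrite /q !hornerE horner_comp !hornerE fcoefB fcoefM0 fcoef_horner0 in0.
    by rewrite -rmorphXn /= hv subrr.
  rewrite /q derivB -[1]/(1%:P) derivC subr0 derivM derivXn deriv_comp derivD derivC derivZ derivX addr0.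
  have eX : (fX K ^+ M *: 1 : {poly fps K}).[fpsC v0] = fX K ^+ M by rewrite hornerZ hornerE mulr1.
  rewrite hornerD !hornerM !horner_comp eX !hornerD !hornerZ !hornerX !hornerC fcoefD !fcoefM0 XM0 !mulr0 addr0 fcoef_horner0 in0.
  rewrite mulf_neq0 // hornerMn fcoefMn hornerXn -rmorphXn /= -mulr_natr mulf_neq0 ?expf_neq0 //.
  by rewrite (natr_c0 charK) -lt0n.
exists (fX K ^+ M * v + fpsC c) => //.
move: rv; rewrite /root /q !hornerE horner_comp !hornerE subr_eq0 => /eqP rv.
rewrite eR rmorphM rmorphXn rmorphB /= map_polyX map_polyC /= hornerM !hornerE ?horner_exp ?hornerE ?addrK.
by rewrite exprMn -exprM mulrCA [_ * v ^+ d]mulrC rv mulr1.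
Qed.

(** Only integral powers of z = t^N are compared, that is the branches at a and b averaged over
    their local monodromy. Induction on the exponent l: for l = 0 the difference is moment 0. In the
    next step [eul] acts on the difference with eigenvalue d0 (l+1), [eul] of [eulops es R] is P Z,
    and its coefficient l+1 is coefficient l of Z, whose moments vanish by [allmom_unP]. *)
Theorem mom_relation (a b : K) (P : {poly K}) : P.[a] = 0 -> P.[b] = 0 -> P != 0 ->
  exists N (ya yb : fps K), [/\ (0 < N)%N, ya`@0 = a, yb`@0 = b,
    P^^.[ya] = fX K ^+ N /\ P^^.[yb] = fX K ^+ N &
    forall R, allmom a b P R -> forall l, (R^^.[yb])`@(N * l) = (R^^.[ya])`@(N * l)].
Proof.
move=> Pa Pb P0.
have mult c : P.[c] = 0 -> exists d, [/\ (0 < d)%N, ('X - c%:P) ^+ d %| P & ~~ (('X - c%:P) ^+ d.+1 %| P)].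
  move=> Pc; have [d [Q nr eQ]] := multiplicity_XsubC P c; rewrite P0 /= in nr.
  exists d; split.
  - by case: d eQ => // eQ; move: nr; rewrite /root -Pc eQ expr0 mulr1 eqxx.
  - by apply/dvdpP; exists Q.
  - apply: contra nr => /dvdpP[Q' e].
    have : Q * ('X - c%:P) ^+ d = (Q' * ('X - c%:P)) * ('X - c%:P) ^+ d by rewrite -eQ e exprS mulrA.
    move/mulIf => ->; first by rewrite rootM root_XsubC eqxx orbT.
    by rewrite expf_neq0 // polyXsubC_eq0.
have [da [da0 da1 da2]] := mult a Pa; have [db [db0 db1 db2]] := mult b Pb.
have [ya ya0 yaP] := branch da0 db0 da1 da2; have [yb yb0 ybP] := branch db0 da0 db1 db2.
have [g [dl [es [gE ga gb d00 [fr kl]]]]] := vector_field charK Pa Pb P0.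
rewrite mulnC in yaP; exists (da * db)%N, ya, yb; split=> //; first by rewrite muln_gt0 da0.
set N := (da * db)%N in yaP ybP *; have N0 : (0 < N)%N by rewrite muln_gt0 da0.
have NK : (N%:R : K) != 0 by rewrite (natr_c0 charK) -lt0n.
pose u l R := (R^^.[yb])`@(N * l) - (R^^.[ya])`@(N * l).
have uB l X Y : u l (X - Y) = u l X - u l Y.
  by rewrite /u !rmorphB /= !hornerD !hornerN !fcoefB; ring.
have uZ l c Y : u l (c *: Y) = c * u l Y.
  by rewrite /u -mul_polyC !rmorphM /= !map_polyC /= !hornerM !hornerC !fcoefCM; ring.
have uP l Y : u l.+1 (P * Y) = u l Y.
  rewrite /u !rmorphM /= !hornerM ybP yaP !fcoefXnM mulnS.
  by rewrite ltnNge leq_addr /= addKn.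
(* the lift of [dl(z) z d/dz] acts on branches as [dl(t^N) t d/dt / N] *)
have eulE y R k : P^^.[y] = fX K ^+ N ->
    N%:R * ((eul g R)^^.[y])`@(N * k) = \sum_(i < size dl | (i <= k)%N) dl`_i * ((N * (k - i))%:R * (R^^.[y])`@(N * (k - i))).
  move=> yP.
  have e1 : P^`()^^.[y] * feul y = fX K ^+ N *+ N by rewrite -horner_feul yP feulXn.
  have e1n : P^`()^^.[y] != 0.
    apply/eqP => e; move: e1; rewrite e mul0r => /(congr1 (fun f => f`@N)).
    rewrite fcoef0 fcoefMn fcoefXn eqxx => /esym/eqP; by rewrite (negPf NK).
  have e2 : g^^.[y] * P^`()^^.[y] = dl^^.[fX K ^+ N] * fX K ^+ N.
    by rewrite -hornerM -rmorphM /= gE rmorphM /= map_comp_poly hornerM horner_comp yP.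
  have e3 : g^^.[y] *+ N = dl^^.[fX K ^+ N] * feul y.
    rewrite -mulr_natl in e1; rewrite -mulr_natl; apply: (mulfI e1n).
    transitivity (N%:R * (g^^.[y] * P^`()^^.[y])); first by ring.
    rewrite e2; transitivity (dl^^.[fX K ^+ N] * (N%:R * fX K ^+ N)); first by ring.
    by rewrite -e1; ring.
  have e4 : (eul g R)^^.[y] *+ N = dl^^.[fX K ^+ N] * feul R^^.[y].
    by rewrite /eul rmorphM /= hornerM -mulrnAl e3 horner_feul; ring.
  have e5 := congr1 (fun f => f`@(N * k)) e4; rewrite mulr_natl -fcoefMn e5 {e5}.
  rewrite horner_coef size_map_poly mulr_suml fcoef_sum [RHS]big_mkcond; apply: eq_bigr => i _.
  rewrite coef_map -mulrA fcoefCM -exprM fcoefXnM ltn_mul2l N0 andTb ltnNge.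
  case: leqP => // ik; last by rewrite mulr0.
  by rewrite -mulnBr /= mulr_natl.
suff H l R : allmom a b P R -> u l R = 0 by move=> R MR l; apply/eqP; rewrite -subr_eq0; apply/eqP/H.
elim/ltn_ind: l R => -[_|l IH] R MR.
  by rewrite /u muln0 !fcoef_horner0 ya0 yb0 -(mom0 charK a b P); apply: MR.
have mE Y : allmom a b P Y -> allmom a b P (eul g Y).
  move=> h k; rewrite (mom_eul charK gE ga gb) big1 ?mulr0 // => i _; by rewrite h mulr0.
have uE Y : allmom a b P Y -> u l.+1 (eul g Y) = dl`_0 * l.+1%:R * u l.+1 Y.
  move=> MY; apply: (mulfI NK); rewrite /u mulrBr !eulE //.
  have s0 : (0 < size dl)%N.
    by rewrite lt0n size_poly_eq0; apply: contraNneq d00 => e; rewrite e coef0.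
  case: (size dl) s0 => // s _; rewrite [X in X - _]big_mkcond [X in _ - X]big_mkcond !big_ord_recl /= !subn0.
  rewrite opprD addrACA -sumrB big1 ?addr0 => [|i _]; first by rewrite natrM; ring.
  rewrite /bump /=; case: ifP => hi; last by rewrite subrr.
  have := IH (l.+1 - (1 + i))%N; rewrite ltn_subrL /= => /(_ isT _ MY)/eqP.
  by rewrite /u subr_eq0 => /eqP ->; rewrite subrr.
have mZ c Y : allmom a b P Y -> allmom a b P (c *: Y).
  by move=> h k; rewrite momZ h mulr0.
have mB Y Z : allmom a b P Y -> allmom a b P Z -> allmom a b P (Y - Z).
  by move=> h h' k; rewrite raddfB /= h h' subrr.
have [mO lO] := @eulops_eigen _ g (allmom a b P) (u l.+1) (dl`_0 * l.+1%:R) es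
  mE mZ mB (uZ l.+1) (uB l.+1) uE R MR.
have [Z eZ] := kl R.
have MZ : allmom a b P Z.
  apply: (allmom_unP charK Pa Pb P0 gE ga gb d00 fr kl); rewrite -eZ; exact: mE.
have := uE _ mO; rewrite eZ uP IH // lO => /esym/eqP.
rewrite !mulf_eq0 (negPf d00) (natr_c0 charK) /= => /orP[|/eqP //].
by rewrite (negPf (prod_es _)) // => e /(es_neq charK d00 fr l.+1)[].
Qed.
End Branch.
End MomentBranches.

(** * Splitting fields and extension of field embeddings *)

Module FieldEmbedding.
Import all_boot all_order all_algebra all_field.
Import boolp ring.
Set Implicit Arguments. Unset Strict Implicit. Unset Printing Implicit Defensive.
Import GRing.Theory.
Local Open Scope ring_scope.
Local Open Scope quotient_scope.

Lemma mk_rmorph (A B : nzRingType) (g : A -> B) : zmod_morphism g -> monoid_morphism g ->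
  exists h : {rmorphism A -> B}, h =1 g.
Proof.
move=> gz gm; pose gA := GRing.isZmodMorphism.Build A B g gz.
pose gM := GRing.isMonoidMorphism.Build A B g gm.
by exists (HB.pack g gA gM : {rmorphism A -> B}).
Qed.

Section Fraction.
Variables (D : idomainType) (E : fieldType).
Local Notation F := {fraction D}.

Lemma frac_numden (x : F) : exists n d : D, d != 0 /\ x = tofrac n / tofrac d.
Proof.
elim/quotW: x => x; exists \n_x, \d_x; split; first exact: denom_ratioP.
have d0 : tofrac (\d_x : D) != 0 by rewrite tofrac_eq0 denom_ratioP.
apply: (canRL (mulfK d0)).
rewrite !piE; apply/eqmodP; rewrite /= FracField.equivfE /FracField.mulf.
by rewrite !numden_Ratio ?mulf_neq0 ?oner_eq0 ?denom_ratioP // !mulr1 mulrC.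
Qed.

Lemma frac_lift (f : {rmorphism D -> E}) : (forall d, f d = 0 -> d = 0) ->
  exists g : {rmorphism F -> E}, forall d, g (tofrac d) = f d.
Proof.
move=> inj.
have /choice[N hN] (x : F) : exists nd : D * D, nd.2 != 0 /\ x = tofrac nd.1 / tofrac nd.2.
  by have [n [d [h e]]] := frac_numden x; exists (n, d).
have f0 d : d != 0 -> f d != 0 by apply: contra_neq => /inj.
pose g x := f (N x).1 / f (N x).2.
have gE x n d : d != 0 -> x = tofrac n / tofrac d -> g x = f n / f d.
  move=> d0 ex; have [d0' ex'] := hN x; apply/eqP.
  rewrite /g eqr_div ?f0 // -!rmorphM /=; apply/eqP; congr (f _).
  apply/eqP; rewrite -tofrac_eq !tofracM -eqr_div ?tofrac_eq0 //.
  by rewrite -ex' -ex.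
have g1 d : g (tofrac d) = f d.
  by rewrite (gE _ d 1) ?oner_eq0 ?tofrac1 ?divr1 // rmorph1 divr1.
have [||h hE] := @mk_rmorph F E g; last by exists h => d; rewrite hE.
- move=> x y; have [dx ex] := hN x; have [dy ey] := hN y.
  have e : x - y = tofrac ((N x).1 * (N y).2 - (N y).1 * (N x).2) / tofrac ((N x).2 * (N y).2).
    by rewrite [in LHS]ex [X in _ - X]ey tofracB !tofracM -!mulNr addf_div ?tofrac_eq0.
  rewrite (gE _ _ _ _ e) ?mulf_neq0 // rmorphB !rmorphM /= -!mulNr -addf_div ?f0 //.
- split=> [|x y]; first by rewrite -tofrac1 g1 rmorph1.
  have [dx ex] := hN x; have [dy ey] := hN y.
  have e : x * y = tofrac ((N x).1 * (N y).1) / tofrac ((N x).2 * (N y).2).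
    by rewrite [X in X * _]ex [X in _ * X]ey !tofracM mulf_div.
  by rewrite (gE _ _ _ _ e) ?mulf_neq0 // !rmorphM /= -mulf_div.
Qed.
End Fraction.

Lemma irreducible_factor (F : fieldType) (p : {poly F}) : (1 < size p)%N ->
  exists2 r, r %| p & irreducible_poly r.
Proof.
move=> sp; pose A k := `[< exists r : {poly F}, [/\ r %| p, (1 < size r)%N & size r = k] >].
have exA : exists k, A k by exists (size p); apply/asboolP; exists p.
case: (ex_minnP exA) => k /asboolP[r [rp sr rk]] min; exists r => //; split=> // q q1 qr.
have r0 : r != 0 by rewrite -size_poly_gt0 ltnW.
have q0 : q != 0 by apply: contraNneq r0 => q0; move: qr; rewrite q0 dvd0p.
rewrite -dvdp_size_eqp // eqn_leq dvdp_leq //= rk; apply: min; apply/asboolP.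
exists q; split=> //; first exact: dvdp_trans rp.
by rewrite ltn_neqAle eq_sym q1 size_poly_gt0.
Qed.

Local Notation "p ^%:A" := (map_poly (in_alg _) p) (at level 2, format "p ^%:A").

(** The base field changes during the induction: after one root is adjoined the quotient is split
    over the larger field, and the tower is then read over the original one. *)
Lemma split_ext n : forall (F : fieldType) (p : {poly F}), p != 0 -> (size p <= n)%N ->
  exists (L : fieldExtType F) (ys : seq L), p^%:A %= \prod_(y <- ys) ('X - y%:P).
Proof.
elim: n => [|n IH] F p p0; first by rewrite leqn0 size_poly_eq0 (negPf p0).
move=> sp; have [p1|p1] := leqP (size p) 1.
  exists F^o, [::]; rewrite big_nil -size_poly_eq1 size_map_poly eqn_leq p1.
  by rewrite size_poly_gt0.
have [r rp /irredp_FAdjoin[E _ [x rx _]]] := irreducible_factor p1.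
have /factor_theorem[q Dp] : root p^%:A x.
  by rewrite -(divpK rp) rmorphM rootM rx orbT.
have q0 : q != 0.
  apply: contraNneq p0 => q0; move/eqP: Dp; rewrite q0 mul0r map_poly_eq0; exact.
have sq : (size q <= n)%N.
  have : size (map_poly (in_alg E) p) = size p by rewrite size_map_poly.
  by rewrite Dp size_mul ?polyXsubC_eq0 // size_XsubC addn2 /= => e; rewrite -ltnS e.
have [L [ys eL]] := IH E q q0 sq.
suffices h : exists zs : seq L, map_poly (in_alg L) p^%:A %= \prod_(y <- zs) ('X - y%:P).
  move: h; rewrite -map_poly_comp.
  rewrite -(eq_map_poly (fun a : F => baseField_scaleE a 1)) => -[zs hz].
  by exists (baseFieldType L), zs.
exists (x%:A :: ys); rewrite big_cons Dp mulrC rmorphM rmorphB /= map_polyX map_polyC /=.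
by rewrite eqp_mull.
Qed.

Lemma split_field (F : fieldType) (p : {poly F}) : p != 0 ->
  exists (L : splittingFieldType F) (ys : seq L),
    p^%:A %= \prod_(y <- ys) ('X - y%:P) /\ <<1 & ys>>%VS = fullv.
Proof.
move=> p0; have [L [ys Dp]] := split_ext p0 (leqnn _).
pose Lp := subvs_of <<1 & ys>>; pose toL := linfun (vsval : Lp -> L).
have toLE u : toL u = val u by rewrite lfunE.
have [zs Dys] : exists zs, map toL zs = ys.
  exists (map (vsproj _) ys); rewrite -map_comp map_id_in // => y ysy /=.
  by rewrite toLE /= vsprojK ?seqv_sub_adjoin.
have e1 : map_poly (in_alg Lp) p %= \prod_(y <- zs) ('X - y%:P).
  suffices: map_poly toL p^%:A %= map_poly toL (\prod_(y <- zs) ('X - y%:P)) by rewrite eqp_map.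
  rewrite -Dys big_map in Dp; apply: etrans Dp; apply: congr2.
    by rewrite -map_poly_comp; apply: eq_map_poly => x; apply: rmorph_alg.
  by rewrite rmorph_prod; apply: eq_bigr => z _; rewrite rmorphB /= map_polyX map_polyC.
have e2 : <<1 & zs>>%VS = fullv.
  apply/eqP; rewrite eqEsubv subvf /=; apply/subvP => u _.
  have : val u \in (toL @: <<1 & zs>>)%VS by rewrite aimg_adjoin_seq aimg1 Dys (valP u).
  by case/memv_imgP => v hv; rewrite toLE => /val_inj->.
have sax : splitting_field_axiom Lp.
  exists (p^%:A); first by apply/polyOver1P; exists p.
  by exists zs.
pose M := HB.pack_for (splittingFieldType F) Lp (FieldExt_isSplittingField.Build F Lp sax).
by exists M, zs.
Qed.

(** In characteristic 0 L has a primitive element t. Adjoin to W a root w of an irreducible factor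
    of the image of its minimal polynomial, and send q(t) to q(w). *)
Lemma embed_ext (F W : fieldType) (L : fieldExtType F) (i : {rmorphism F -> W}) :
  [pchar F] =i pred0 ->
  exists (M : fieldExtType W) (h : {rmorphism L -> M}), forall c, h (c%:A) = (i c)%:A.
Proof.
move=> c0.
have cL : [pchar L] =i pred0 by move=> x; rewrite pchar_lalg c0.
have [t tE] : exists t : L, <<1; t>>%VS = fullv.
  exists (separable_generator 1 {:L}); apply/esym/eq_adjoin_separable_generator; last exact: sub1v.
  by apply/separableP => x _; apply: pcharf0_separable.
have /polyOver1P[m mE] := minPolyOver 1 t.
have m1 : (1 < size m)%N.
  by rewrite -(size_map_poly (in_alg L)) -mE size_minPoly ltnS.
have [|r rm /irredp_FAdjoin[M _ [w rw _]]] := @irreducible_factor W (map_poly i m).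
  by rewrite size_map_poly.
have key q : (q^%:A).[t] = 0 -> ((map_poly i q)^%:A).[w] = 0.
  move=> qt; have : map_poly (in_alg L) m %| map_poly (in_alg L) q.
    by rewrite -mE minPoly_dvdp //; [apply/polyOver1P; exists q | apply/rootP].
  rewrite dvdp_map => mq; have /dvdpP[u ->] : r %| map_poly i q.
    by apply: dvdp_trans rm _; rewrite dvdp_map.
  by rewrite rmorphM hornerM (rootP rw) mulr0.
have /choice[Q hQ] (x : L) : exists q : {poly F}, (q^%:A).[t] = x.
  have : x \in <<1; t>>%VS by rewrite tE memvf.
  by case/Fadjoin_polyP => p /polyOver1P[q ->] ->; exists q.
pose g x := ((map_poly i (Q x))^%:A).[w].
have gE x q : (q^%:A).[t] = x -> g x = ((map_poly i q)^%:A).[w].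
  move=> qx; apply/eqP; rewrite -subr_eq0 /g -!hornerN -hornerD -!rmorphN -!rmorphD /=.
  by apply/eqP/key; rewrite rmorphB hornerD hornerN hQ qx subrr.
exists M; have [||h hE] := @mk_rmorph L M g; last first.
- exists h => c; rewrite hE (gE _ c%:P) ?map_polyC ?hornerC //=.
- split=> [|x y].
    by rewrite (gE _ 1) ?rmorph1 ?hornerC // ?[LHS]hornerC.
  by rewrite (gE _ (Q x * Q y)) ?rmorphM ?hornerM ?hQ.
- move=> x y; rewrite (gE _ (Q x - Q y)) ?rmorphB ?hornerD ?hornerN ?hQ //.
Qed.
End FieldEmbedding.

(** * The splitting field of P(x) - z and its place at infinity *)

Module Monodromy.
Import all_boot all_order all_algebra all_field.
Import cyclic boolp ring.
Import PowerSeries Moments MomentBranches FieldEmbedding.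
Set Implicit Arguments. Unset Strict Implicit. Unset Printing Implicit Defensive.
Import GRing.Theory.
Local Open Scope ring_scope.
Local Notation "p ^^" := (map_poly (@fpsC _) p) (at level 2, format "p ^^").

Lemma gen_ind (F : fieldType) (L : fieldExtType F) (zs : seq L) (C : L -> Prop) :
  (forall c : F, C c%:A) -> (forall x, x \in zs -> C x) ->
  (forall x y, C x -> C y -> C (x + y)) -> (forall x y, C x -> C y -> C (x * y)) ->
  forall u, u \in <<1 & zs>>%VS -> C u.
Proof.
move=> C1 Cz CD CM; elim/last_ind: zs Cz => [|s x IH] Cz u.
  by rewrite adjoin_nil subfield_closed => /vlineP[c ->].
rewrite adjoin_rcons => /Fadjoin_polyP[p /polyOverP ps ->].
have Cx : C x by apply: Cz; rewrite mem_rcons mem_head.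
rewrite horner_coef; apply: (big_ind C) => //; first by rewrite -(scale0r 1); apply: C1.
move=> i _; apply: (CM); first by apply: IH => // y ys; apply: Cz; rewrite mem_rcons inE ys orbT.
by elim: (nat_of_ord i) => [|k IHk]; [rewrite expr0 -[1](scale1r 1); apply: C1|rewrite exprS; apply: CM].
Qed.

Lemma frot_comp (K : fieldType) (u v : K) f : frot u (frot v f) = frot (u * v) f.
Proof. by apply: fpsP => k; rewrite /= mulrA exprMn. Qed.
Lemma frot1 (K : fieldType) (f : fps K) : frot 1 f = f.
Proof. by apply: fpsP => k; rewrite /= expr1n mul1r. Qed.
Lemma frot_horner (K : fieldType) (u : K) (R : {poly K}) f : frot u (R^^.[f]) = R^^.[frot u f].
Proof.
rewrite -horner_map -map_poly_comp; congr (_.[_]).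
by apply: eq_map_poly => c /=; rewrite frotC.
Qed.

Lemma prim_root_ex (K : closedFieldType) n : [pchar K] =i pred0 -> (0 < n)%N ->
  exists z : K, n.-primitive_root z.
Proof.
move=> charK n0; have [rs e] := closed_field_poly_normal ('X^n - 1 : {poly K}).
have l1 : lead_coef ('X^n - 1 : {poly K}) = 1 by apply/eqP; rewrite -monicE monicXnsubC.
rewrite l1 scale1r in e.
have u : uniq rs.
  by rewrite -separable_prod_XsubC -e separable_Xn_sub_1 // natr_c0 // -lt0n.
have srs : size rs = n by apply/eqP; rewrite -eqSS -(size_prod_XsubC rs id) -e size_XnsubC.
have /hasP[z _ hz] : has n.-primitive_root rs.
  apply: has_prim_root => //; last by rewrite srs.
  by apply/allP => z zrs; rewrite /root_of_unity e root_prod_XsubC.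
by exists z.
Qed.

Lemma expf_sub (F : fieldType) (x : F) k D : x != 0 -> (k <= D)%N -> x ^+ (D - k) = x ^+ D / x ^+ k.
Proof. by move=> x0 kD; rewrite -{2}(subnK kD) exprD mulfK // expf_neq0. Qed.

(* [hom D R w = t^D R(w/t)] *)
Section Hom.
Variable K : fieldType.
Definition hom D (R : {poly K}) (w : fps K) := \sum_(i < D.+1) fpsC R`_i * (w ^+ i * fX K ^+ (D - i)).
Lemma hom0 D (R : {poly K}) (w : fps K) : (hom D R w)`@0 = R`_D * (w`@0) ^+ D.
Proof.
rewrite /hom big_ord_recr fcoefD fcoef_sum big1 ?add0r => [|i _].
  rewrite subnn expr0 mulr1 fcoefCM; congr (_ * _).
  by elim: D => [|D IH]; rewrite ?expr0 ?fcoef1 // !exprS fcoefM0 IH.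
rewrite fcoefCM fcoefM0 fcoefXn; have := ltn_ord i; rewrite -subn_gt0.
by case: (D - i)%N => // k _; rewrite !mulr0.
Qed.
Lemma homE D (R : {poly K}) (w : fps K) : (size R <= D.+1)%N ->
  (map_poly (@tofrac (fps K) \o @fpsC K) R).[tofrac w / tofrac (fX K)] * tofrac (fX K) ^+ D = tofrac (hom D R w).
Proof.
move=> sR; have X0 : tofrac (fX K) != 0 by rewrite tofrac_eq0 fX_neq0.
rewrite (horner_coef_wide _ (_ : (_ <= D.+1)%N)); last by apply: leq_trans sR; apply: size_poly.
rewrite mulr_suml rmorph_sum; apply: eq_bigr => i _; rewrite coef_map /= !rmorphM !rmorphXn /=.
rewrite -mulrA; congr (_ * _); rewrite expr_div_n mulrAC -mulrA; congr (_ * _).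
by rewrite expf_sub // 1?mulrC // -ltnS.
Qed.
End Hom.

Lemma hom_frot (K : fieldType) D (R : {poly K}) (u : K) w : u != 0 ->
  hom D R (fpsC u * frot u^-1 w) = fpsC (u ^+ D) * frot u^-1 (hom D R w).
Proof.
move=> u0; rewrite /hom rmorph_sum mulr_sumr; apply: eq_bigr => i _.
rewrite !rmorphM !rmorphXn /= frotC frotX exprMn [(fpsC u^-1 * _) ^+ _]exprMn -!rmorphXn /=.
have e : fpsC (u ^+ D) * fpsC (u^-1 ^+ (D - i)) = fpsC (u ^+ i).
  by rewrite -rmorphM /=; congr (fpsC _); rewrite exprVn expf_sub -1?ltnS // invf_div mulrC divfK // expf_neq0.
by rewrite -e; ring.
Qed.

(** [hom n P v = 1] says P(v/t) = t^-n, so v/t is the expansion at infinity of one branch, with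
    local parameter t where z = t^-n. *)
Lemma inf_branch (K : closedFieldType) (charK : [pchar K] =i pred0) (P : {poly K}) n :
  size P = n.+1 -> (0 < n)%N -> exists2 v : fps K, v`@0 != 0 & hom n P v = 1.
Proof.
move=> sP n0.
have Pn : P`_n != 0 by rewrite -[n]/(n.+1.-1) -sP -lead_coefE lead_coef_eq0 -size_poly_eq0 sP.
have [v0 hv] : exists v0, P`_n * v0 ^+ n = 1.
  have /closed_rootP[v0] : size ('X^n - ((P`_n)^-1)%:P) != 1%N.
    by rewrite size_XnsubC // eqSS -lt0n.
  by rewrite /root !hornerE subr_eq0 => /eqP e; exists v0; rewrite e mulfV.
have v00 : v0 != 0.
  by apply: contra_eq_neq hv => ->; rewrite expr0n eqn0Ngt n0 mulr0 eq_sym oner_eq0.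
pose q : {poly fps K} := \poly_(i < n.+1) (fpsC P`_i * fX K ^+ (n - i)) - 1.
have qE w : q.[w] = hom n P w - 1.
  rewrite /q hornerD hornerN -[1]/(1%:P) hornerC horner_poly; congr (_ - _).
  by apply: eq_bigr => i _; rewrite -mulrA [_ * w ^+ i]mulrC.
have [v e0 rv] : exists2 v, v`@0 = v0 & root q v.
  apply: fps_hensel; first by rewrite qE fcoefB hom0 fcoef1 /= hv subrr.
  rewrite /q derivB -[1]/(1%:P) derivC subr0.
  rewrite (horner_coef_wide _ (_ : (_ <= n)%N)); last first.
    apply: leq_trans (size_poly _ _) _; rewrite -subn1 leq_subLR add1n; exact: size_poly.
  case: n {q qE sP} n0 Pn hv => // m _ Pn hv; rewrite big_ord_recr fcoefD fcoef_sum big1 ?add0r => [|i _].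
    rewrite coef_deriv coef_poly ltnS leqnn subnn expr0 mulr1 -rmorphXn fcoefM0 fcoefMn /=.
    by rewrite mulf_neq0 ?expf_neq0 // -mulr_natr mulf_neq0 // (natr_c0 charK).
  rewrite coef_deriv coef_poly !ltnS (ltnW (ltn_ord i)) fcoefM0 fcoefMn fcoefM0 fcoefXn.
  rewrite subSS; have := ltn_ord i; rewrite -subn_gt0; case: (m - i)%N => // k _.
  by rewrite !(mulr0, mul0rn, mul0r).
exists v; first by rewrite e0.
by apply/eqP; rewrite -subr_eq0 -qE.
Qed.

Section Package.
Variable K : closedFieldType.
Hypothesis charK : [pchar K] =i pred0.
Variables (P : {poly K}) (n' : nat).
Local Notation n := n'.+2.
Hypothesis sP : size P = n.+1.
Local Notation KK := {fraction {poly K}}.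
Local Notation tf := (@tofrac {poly K}).

Section Places.
Variables (L : fieldExtType KK).
Definition iK : {rmorphism K -> L} := in_alg L \o (tf \o polyC).
Definition zL : L := (tf 'X)%:A.
Definition ev (R : {poly K}) (x : L) := (map_poly iK R).[x].

Lemma tfL (p : {poly K}) : (tf p)%:A = (map_poly iK p).[zL] :> L.
Proof.
elim/poly_ind: p => [|p c IH]; first by rewrite !rmorph0 horner0 scale0r.
rewrite !rmorphD !rmorphM /= map_polyX map_polyC hornerD hornerM hornerX hornerC -IH.
by rewrite scalerDl /zL -scalerAl mul1r scalerA.
Qed.

(** Since K is algebraically closed, the hypothesis says that z0 is transcendental: a nonzero
    polynomial is a product of linear factors, none of which vanishes at z0. Hence z -> z0 extends
    to K(z) and then to L. *)
Lemma place (W : fieldType) (k : {rmorphism K -> W}) (z0 : W) : (forall r, z0 != k r) ->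
  exists (M : fieldExtType W) (h : {rmorphism L -> M}),
    (forall p : {poly K}, h (tf p)%:A = ((map_poly k p).[z0])%:A) /\
    (forall R x y, h x = y%:A -> h (ev R x) = ((map_poly k R).[y])%:A).
Proof.
move=> tr.
have [|i iE] := @frac_lift _ W (horner_eval z0 \o map_poly k : {rmorphism {poly K} -> W}).
  move=> d /= /eqP; apply: contraTeq => d0; have [rs ->] := closed_field_poly_normal d.
  rewrite /horner_eval map_polyZ hornerZ mulf_neq0 //; first by rewrite fmorph_eq0 lead_coef_eq0.
  rewrite rmorph_prod horner_prod prodf_seq_neq0; apply/allP => x _ /=.
  by rewrite rmorphB /= map_polyX map_polyC hornerXsubC subr_eq0 tr.
have cK : [pchar KK] =i pred0.
  move=> q; rewrite (fmorph_pchar (tf \o polyC : {rmorphism K -> KK})).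
  exact: charK.
have [M [h hE]] := embed_ext L i cK; exists M, h.
have h1 p : h (tf p)%:A = ((map_poly k p).[z0])%:A by rewrite hE iE.
split=> // R x y hxy; rewrite /ev -horner_map hxy -map_poly_comp.
have -> : map_poly (h \o iK) R = map_poly (in_alg M) (map_poly k R).
  rewrite -map_poly_comp; apply: eq_map_poly => c.
  by rewrite /= h1 map_polyC hornerC.
by rewrite horner_map.
Qed.
End Places.

Definition PF : {poly KK} := map_poly (tf \o polyC) P - (tf 'X)%:P.
Lemma PF_neq0 : PF != 0.
Proof.
rewrite -size_poly_gt0 /PF size_polyDl ?size_map_poly ?sP //.
by rewrite size_polyN size_polyC; case: (_ != 0).
Qed.

Section Roots.
Variables (L : splittingFieldType KK) (zs : seq L).
Hypothesis eL : map_poly (in_alg L) PF %= \prod_(y <- zs) ('X - y%:P).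
Hypothesis gL : <<1 & zs>>%VS = fullv.

Lemma PF_horner (x : L) : (map_poly (in_alg L) PF).[x] = ev P x - zL L.
Proof.
rewrite /PF rmorphB /= map_polyC hornerD hornerN hornerC /= -map_poly_comp.
by congr (_ - _).
Qed.

Lemma mem_zs x : (x \in zs) = (ev P x == zL L).
Proof. by rewrite -root_prod_XsubC -(eqp_root eL) /root PF_horner subr_eq0. Qed.

Lemma lift_root (W : fieldType) (k : {rmorphism K -> W}) (z0 : W) (M : fieldExtType W)
    (h : {rmorphism L -> M}) :
  (forall p : {poly K}, h (tf p)%:A = ((map_poly k p).[z0])%:A) ->
  forall y, (map_poly k P).[y] = z0 -> exists2 x, x \in zs & h x = y%:A.
Proof.
move=> h1 y hy; have /eqpP[[c1 c2] /= /andP[c10 c20] ec] := eL.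
have : (map_poly h (\prod_(y <- zs) ('X - y%:P))).[y%:A] = 0.
  suff e : (map_poly h (map_poly (in_alg L) PF)).[y%:A] = 0.
    apply/eqP; have := congr1 (fun q => (map_poly h q).[y%:A]) ec.
    rewrite /= !map_polyZ !hornerZ e mulr0 => /esym/eqP.
    by rewrite mulf_eq0 fmorph_eq0 (negPf c20).
  rewrite /PF !rmorphB /= !map_polyC hornerD hornerN hornerC /= h1 map_polyX hornerX.
  rewrite -!map_poly_comp; have -> : map_poly ((h \o in_alg L) \o (tf \o polyC)) P
      = map_poly (in_alg M) (map_poly k P).
    rewrite -map_poly_comp; apply: eq_map_poly => c /=.
    by rewrite h1 map_polyC hornerC.
  by rewrite horner_map hy subrr.
rewrite rmorph_prod horner_prod => /eqP; rewrite prodf_seq_eq0 => /hasP[x xz /=].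
rewrite rmorphB /= map_polyX map_polyC hornerXsubC subr_eq0 => /eqP ->.
by exists x.
Qed.


Let S := {fraction (fps K)}.
Let ka : {rmorphism K -> S} := @tofrac (fps K) \o @fpsC K.
Local Notation tX := (tofrac (fX K)).

Lemma ord_expD (z : K) (j : 'I_n) : n.-primitive_root z -> z ^+ (j + 1 : 'I_n)%R = z ^+ j * z.
Proof. by move=> pz; rewrite -exprSr -(prim_expr_mod pz j.+1); congr (z ^+ _); rewrite -[j.+1]addn1 -modnDmr. Qed.

(** The n expansions at infinity differ by t -> t/z with z a root of unity; pulled back through the
    place they number the roots by Z/n. Taking coefficients of order t^-D turns relations between
    the roots into relations between leading coefficients. *)
Lemma inf_place : exists (z : K) (x : 'I_n -> L),
  [/\ n.-primitive_root z, forall j, x j \in zs, forall x0, x0 \in zs -> exists j, x0 = x j,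
   (forall D (R : 'I_n -> {poly K}), (forall j, (size (R j) <= D.+1)%N) ->
      \sum_j ev (R j) (x j) = 0 -> \sum_j (R j)`_D * z ^+ (j * D) = 0) &
   exists g : {rmorphism L -> L}, (forall c, g c%:A = c%:A) /\ forall j, g (x j) = x (j + 1)].
Proof.
have [v v0 hv] := inf_branch charK sP isT.
have [z pz] := prim_root_ex charK (ltn0Sn n'.+1).
have z0 : z != 0 by apply: contra_eq_neq (prim_expr_order pz) => ->; rewrite expr0n eq_sym oner_eq0.
pose w (j : 'I_n) := fpsC (z ^+ j) * frot (z ^+ j)^-1 v.
have hw j : hom n P (w j) = 1.
  rewrite hom_frot ?expf_neq0 // hv rmorph1 mulr1 -exprM mulnC exprM (prim_expr_order pz).
  by rewrite expr1n rmorph1.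
have w0 j : (w j)`@0 = z ^+ j * v`@0 by rewrite fcoefCM /= expr0 mul1r.
have tX0 : tX != 0 by rewrite tofrac_eq0 fX_neq0.
pose y j : S := tofrac (w j) / tX.
have yP j : (map_poly ka P).[y j] = (tX ^+ n)^-1.
  apply: (mulIf (expf_neq0 n tX0)); rewrite mulVf ?expf_neq0 // homE ?sP //.
  by rewrite hw rmorph1.
have tr r : (tX ^+ n)^-1 != ka r.
  apply/negP => /eqP e; have : tX ^+ n * ka r = 1 by rewrite -e mulfV ?expf_neq0.
  rewrite -rmorphXn -rmorphM -tofrac1 => /eqP; rewrite tofrac_eq => /eqP.
  move/(congr1 (fun f => f`@0)); rewrite fcoefXnM /= => /esym/eqP; by rewrite oner_eq0.
have [M [h [h1 h2]]] := place L tr.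
have /choice[x hx] j : exists x, x \in zs /\ h x = (y j)%:A.
  by have [x xz e] := lift_root h1 (yP j); exists x.
have alg_inj (c d : S) : c%:A = d%:A :> M -> c = d.
  by move=> e; apply: (fmorph_inj (in_alg M)); exact: e.
have inf D (R : 'I_n -> {poly K}) : (forall j, (size (R j) <= D.+1)%N) ->
      \sum_j ev (R j) (x j) = 0 -> \sum_j (R j)`_D * z ^+ (j * D) = 0.
  move=> sR /(congr1 h); rewrite rmorph0 rmorph_sum => e.
  have {}e : \sum_j (map_poly ka (R j)).[y j] = 0.
    apply: alg_inj; rewrite scale0r -e scaler_suml; apply: eq_bigr => j _.
    by rewrite (h2 _ _ (y j)) // (hx j).2.
  have {}e : tofrac (\sum_j hom D (R j) (w j)) = 0.
    transitivity ((\sum_j (map_poly ka (R j)).[y j]) * tX ^+ D); last by rewrite e mul0r.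
    by rewrite rmorph_sum mulr_suml; apply: eq_bigr => j _; rewrite /= -homE.
  have {}e : \sum_j hom D (R j) (w j) = 0 by apply/eqP; rewrite -tofrac_eq0 e.
  apply: (mulIf (expf_neq0 D v0)); rewrite mul0r -[RHS](fcoef0 K 0) -e fcoef_sum mulr_suml.
  by apply: eq_bigr => j _; rewrite hom0 w0 exprMn exprM mulrA.
have xinj : injective x.
  move=> i j e; have := (hx i).2; rewrite e (hx j).2 => /alg_inj/(mulIf (invr_neq0 tX0))/eqP.
  rewrite tofrac_eq => /eqP/(congr1 (fun f => f`@0)); rewrite !w0 => /(mulIf v0)/eqP.
  by rewrite (eq_prim_root_expr pz) !modn_small // => /eqP/ord_inj.
have enumz x0 : x0 \in zs -> exists j, x0 = x j.
  move=> x0z; have [[j]|nx] := pselect (exists j, x0 = x j); first by exists j.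
  have PFL0 : map_poly (in_alg L) PF != 0 by rewrite map_poly_eq0 PF_neq0.
  have : (size (x0 :: codom x) < size (map_poly (in_alg L) PF))%N.
    apply: max_poly_roots => //=.
      rewrite (eqp_root eL) root_prod_XsubC x0z /=; apply/allP => _ /codomP[j ->].
      by rewrite (eqp_root eL) root_prod_XsubC (hx j).1.
    rewrite map_inj_uniq // enum_uniq andbT; apply/negP => /codomP[j e]; by apply: nx; exists j.
  rewrite size_map_poly /= size_codom card_ord /PF size_polyDl ?size_map_poly ?sP ?ltnn //.
  by rewrite size_polyN size_polyC; case: (_ != 0).
(* conjugating t |-> t/z by the place h gives the n-cycle *)
have zi0 : z^-1 != 0 by rewrite invr_eq0.
have [|s sE] := @frac_lift _ S (@tofrac (fps K) \o frot z^-1 : {rmorphism fps K -> S}).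
  move=> d /= /eqP; rewrite tofrac_eq0 => /eqP e.
  by rewrite -(frot1 d) -(mulfV z0) -frot_comp e raddf0.
have sy j : s (y j) = y (j + 1).
  have ws : w (j + 1) = fpsC z * frot z^-1 (w j).
    by rewrite /w ord_expD // !rmorphM /= frotC frot_comp invfM [_ * z^-1]mulrC mulrCA mulrA.
  have kz : (tofrac (fpsC z^-1))^-1 = tofrac (fpsC z).
    by rewrite -[LHS]/((ka z^-1)^-1) -fmorphV invrK.
  rewrite /y fmorph_div !sE /= frotX ws.
  by rewrite [tofrac (_ * fX K)]rmorphM [tofrac (fpsC z * _)]rmorphM /= invfM kz mulrA [_ * tofrac (fpsC z)]mulrC.
have sX : s (tX ^+ n)^-1 = (tX ^+ n)^-1.
  rewrite fmorphV rmorphXn /= sE /= frotX rmorphM exprMn -rmorphXn -rmorphXn /= exprVn prim_expr_order //.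
  by rewrite invr1 ?(rmorph1, mul1r) ?(rmorph1, mul1r) ?(rmorph1, mul1r).
have sk c : s (ka c) = ka c by rewrite /= sE /= frotC.
have sp (p : {poly K}) : s ((map_poly ka p).[(tX ^+ n)^-1]) = (map_poly ka p).[(tX ^+ n)^-1].
  rewrite -horner_map /= sX -map_poly_comp; congr (_.[_]).
  by apply: eq_map_poly => c /=; apply: sk.
have hc (c : KK) : exists w, h c%:A = w%:A /\ s w = w.
  have [m [d [d0 ->]]] := frac_numden c.
  exists ((map_poly ka m).[(tX ^+ n)^-1] / (map_poly ka d).[(tX ^+ n)^-1]).
  by rewrite fmorph_div !sp -!in_algE !fmorph_div /= -!h1.
(* The place maps L into the Laurent field itself, not merely into its extension M, so the rotation
   s acts on the image. [C] records this together with the stability of the image under s; it holds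
   for constants and roots and passes to sums and products. *)
pose C (u : L) := exists w u', [/\ h u = w%:A & h u' = (s w)%:A].
have CL u : C u.
  have : u \in <<1 & zs>>%VS by rewrite gL memvf.
  have hA (p q : S) : (p * q)%:A = p%:A * q%:A :> M by rewrite -scalerAl mul1r scalerA.
  apply: (@gen_ind _ L zs C) => [c|x0 x0z|u1 u2 [w1 [u1' [e1 e1']]] [w2 [u2' [e2 e2']]]|u1 u2 [w1 [u1' [e1 e1']]] [w2 [u2' [e2 e2']]]].
  - by have [w0' [e e']] := hc c; exists w0', c%:A; rewrite e'.
  - have [j ->] := enumz _ x0z; exists (y j), (x (j + 1)).
    by rewrite (hx j).2 sy (hx (j + 1)).2.
  - by exists (w1 + w2), (u1' + u2'); rewrite !rmorphD e1 e2 e1' e2' /= -!scalerDl.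
  - by exists (w1 * w2), (u1' * u2'); rewrite !rmorphM e1 e2 e1' e2' /= -!hA.
have /choice[g0 hg] u : exists u', exists w, h u = w%:A /\ h u' = (s w)%:A.
  by have [wu [u' e]] := CL u; exists u', wu.
have g0E u wu : h u = wu%:A -> h (g0 u) = (s wu)%:A.
  by move=> e; have [w' [e1 ->]] := hg u; rewrite (alg_inj w' wu) // -e1 e.
have hA (p q : S) : (p * q)%:A = p%:A * q%:A :> M by rewrite -scalerAl mul1r scalerA.
have [||g gE] := @mk_rmorph L L g0.
- move=> p q; apply: (fmorph_inj h); have [wp [ep ep']] := hg p; have [wq [eq eq']] := hg q.
  have e1 : h (p - q) = (wp - wq)%:A by rewrite rmorphB /= ep eq scalerBl.
  by rewrite (g0E _ _ e1) [s _]rmorphB [h (_ - _)]rmorphB /= ep' eq' scalerBl.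
- split=> [|p q]; apply: (fmorph_inj h).
    have e1 : h 1 = 1%:A by rewrite rmorph1 scale1r.
    by rewrite (g0E _ _ e1) !rmorph1 scale1r.
  have [wp [ep ep']] := hg p; have [wq [eq eq']] := hg q.
  have e1 : h (p * q) = (wp * wq)%:A by rewrite rmorphM /= ep eq hA.
  by rewrite (g0E _ _ e1) [s _]rmorphM [h (_ * _)]rmorphM /= ep' eq' hA.
exists z, x; split=> //; first by move=> j; apply: (hx j).1.
exists g; split=> [c|j]; rewrite gE; apply: (fmorph_inj h).
  by have [wc [e e']] := hc c; rewrite (g0E _ wc) // e' e.
by rewrite (g0E _ (y j)) ?sy ?(hx _).2.
Qed.
End Roots.
End Package.
End Monodromy.

(** * Permutations of the branches and the integer relation at z = 0 *)

Module MonodromyAction.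
Import all_boot all_order all_algebra all_field.
Import cyclic boolp ring.
Import PowerSeries Moments MomentBranches FieldEmbedding Monodromy.
Set Implicit Arguments. Unset Strict Implicit. Unset Printing Implicit Defensive.
Import GRing.Theory.
Local Open Scope ring_scope.
Local Notation "p ^^" := (map_poly (@fpsC _) p) (at level 2, format "p ^^").

Section Package.
Variable K : closedFieldType.
Hypothesis charK : [pchar K] =i pred0.
Variables (P : {poly K}) (n' : nat).
Local Notation n := n'.+2.
Hypothesis sP : size P = n.+1.
Local Notation KK := {fraction {poly K}}.
Local Notation tf := (@tofrac {poly K}).
Local Notation PF := (PF P).

Section Roots.
Variables (L : splittingFieldType KK) (zs : seq L).
Hypothesis eL : map_poly (in_alg L) PF %= \prod_(y <- zs) ('X - y%:P).
Hypothesis gL : <<1 & zs>>%VS = fullv.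
Variable x : 'I_n -> L.
Local Notation x0 := (x (0 : 'I_n)).
Hypothesis xz : forall j, x j \in zs.
Hypothesis zx : forall y, y \in zs -> exists j, y = x j.
Hypothesis x0t : forall R : {poly K}, ev R x0 = 0 -> R = 0.

Lemma ev_x j : ev P (x j) = zL L.
Proof. by have := xz j; rewrite (mem_zs eL) => /eqP. Qed.

Lemma evD R S (y : L) : ev (R + S) y = ev R y + ev S y.
Proof. by rewrite /ev rmorphD hornerD. Qed.
Lemma evB R S (y : L) : ev (R - S) y = ev R y - ev S y.
Proof. by rewrite /ev rmorphB hornerD hornerN. Qed.
Lemma evM R S (y : L) : ev (R * S) y = ev R y * ev S y.
Proof. by rewrite /ev rmorphM hornerM. Qed.
Lemma evX (y : L) : ev 'X y = y.
Proof. by rewrite /ev map_polyX hornerX. Qed.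
Lemma evC c (y : L) : ev c%:P y = iK L c.
Proof. by rewrite /ev map_polyC hornerC. Qed.
Lemma evXn R k (y : L) : ev (R ^+ k) y = ev R y ^+ k.
Proof. by rewrite /ev rmorphXn /= horner_exp. Qed.
Lemma ev_comp R S (y : L) : ev (R \Po S) y = ev R (ev S y).
Proof. by rewrite /ev map_comp_poly horner_comp. Qed.
Lemma ev_sum (I : Type) (r : seq I) (p : pred I) (F : I -> {poly K}) (y : L) :
  ev (\sum_(i <- r | p i) F i) y = \sum_(i <- r | p i) ev (F i) y.
Proof. by rewrite /ev rmorph_sum horner_sum. Qed.
Lemma tf_ev (p : {poly K}) j : (tf p)%:A = ev p (ev P (x j)).
Proof. by rewrite ev_x tfL. Qed.

Definition RtoK : {rmorphism {poly K} -> L} := in_alg L \o tf.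

Lemma x_integral j : integralOver RtoK (x j).
Proof.
pose q : {poly {poly K}} := map_poly polyC ((lead_coef P)^-1 *: P) - ((lead_coef P)^-1 *: 'X)%:P.
have lc0 : lead_coef P != 0 by rewrite lead_coef_eq0 -size_poly_eq0 sP.
have sm : size (map_poly polyC ((lead_coef P)^-1 *: P)) = n.+1.
  by rewrite size_map_polyC size_scale ?invr_eq0 // sP.
exists q.
  rewrite monicE /q lead_coefDl; last by rewrite size_polyN sm size_polyC; case: (_ != 0).
  by rewrite lead_coef_map_inj ?rmorph0 //; [rewrite lead_coefZ mulVf | apply: polyC_inj].
rewrite /root /q rmorphB /= map_polyC hornerD hornerN hornerC /= -map_poly_comp.
have -> : map_poly (RtoK \o polyC) ((lead_coef P)^-1 *: P) = map_poly (iK L) ((lead_coef P)^-1 *: P).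
  by apply: eq_map_poly.
rewrite -/(ev _ _) -mul_polyC evM evC ev_x -mul_polyC /RtoK /= tofracM.
by rewrite -[(_ * _)%:A]/(in_alg L _) rmorphM subrr.
Qed.

Lemma ev_integral R (y : L) : integralOver RtoK y -> integralOver RtoK (ev R y).
Proof.
move=> hy; elim/poly_ind: R => [|R c IH]; first by rewrite /ev rmorph0 horner0; apply: integral0.
rewrite evD evM evX evC; apply: integral_add; first exact: integral_mul.
exact: (integral_id RtoK c%:P).
Qed.

Lemma frac_in_x0 (w : L) : w \in <<1; x0>>%VS ->
  exists U D : {poly K}, D != 0 /\ w * ev D x0 = ev U x0.
Proof.
case/Fadjoin_polyP => p /polyOver1P[q ->] ->.
have Pnc : (1 < size P)%N by rewrite sP.
elim/poly_ind: q => [|q c [U [D [D0 e]]]].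
  by exists 0, 1; rewrite rmorph0 horner0 mul0r /ev rmorph0 horner0 oner_eq0.
have [m [d [d0 ec]]] := frac_numden c.
exists (U * 'X * (d \Po P) + D * (m \Po P)), (D * (d \Po P)).
have dP0 : d \Po P != 0 by rewrite comp_poly_eq0.
have cP : c%:A * ev (d \Po P) x0 = ev (m \Po P) x0.
  rewrite !ev_comp -!tf_ev -!in_algE -rmorphM /= ec divfK ?tofrac_eq0 //.
split; first by rewrite mulf_neq0.
rewrite evD !evM evX -e -cP rmorphD rmorphM /= map_polyX map_polyC hornerD hornerM hornerX hornerC /=.
by ring.
Qed.

(** K[x0] is integrally closed. Write w = U/D with D of least degree. A root r of D is not a root of
    U, by minimality, but substituting r in the cleared integral equation leaves only U(r)^m = 0. *)
Lemma integral_poly_x0 (w : L) : w \in <<1; x0>>%VS -> integralOver RtoK w ->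
  exists R, w = ev R x0.
Proof.
move=> /frac_in_x0[U0 [D0 [nD0 e0]]] [q mq rq].
pose A k := `[< exists U D : {poly K}, [/\ D != 0, w * ev D x0 = ev U x0 & size D = k] >].
have exA : exists k, A k by exists (size D0); apply/asboolP; exists U0, D0.
case: (ex_minnP exA) => k /asboolP[U [D [nD e sD]]] min.
have [sD1|sD1] := eqVneq (size D) 1%N.
  have /size_poly1P[c c0 Dc] : size D == 1%N by apply/eqP.
  have ic0 : iK L c != 0 by rewrite fmorph_eq0.
  exists (c^-1%:P * U); by rewrite evM -e Dc !evC fmorphV mulrCA mulVf ?mulr1.
have /closed_rootP[r rD] := sD1.
have [rU|rU] := boolP (root U r).
  have /factor_theorem[D1 eD] := rD; have /factor_theorem[U1 eU] := rU.
  have nD1 : D1 != 0 by apply: contraNneq nD => h; rewrite eD h mul0r.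
  have : A (size D1).
    apply/asboolP; exists U1, D1; split=> //.
    have nz : ev ('X - r%:P) x0 != 0.
      by apply/eqP => /x0t/eqP; rewrite polyXsubC_eq0.
    by apply: (mulIf nz); rewrite -mulrA -!evM -eD -eU.
  by move/min; rewrite -sD eD size_Mmonic ?monicXsubC // size_XsubC addn2 ltnn.
pose m := (size q).-1.
have sq : size q = m.+1 by rewrite prednK // size_poly_gt0 monic_neq0.
have E0 : \sum_(i < m.+1) (q`_i \Po P) * U ^+ i * D ^+ (m - i) = 0.
  apply: x0t; rewrite ev_sum.
  have hq : (map_poly RtoK q).[w] * ev D x0 ^+ m = 0 by rewrite (rootP rq) mul0r.
  rewrite -[RHS]hq (horner_coef_wide _ (_ : (_ <= m.+1)%N)); last by rewrite -sq size_poly.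
  rewrite mulr_suml; apply: eq_bigr => i _; rewrite coef_map !evM !evXn -e exprMn ev_comp -tf_ev /=.
  have im : (i <= m)%N by rewrite -ltnS.
  have eD : ev D x0 ^+ m = ev D x0 ^+ i * ev D x0 ^+ (m - i) by rewrite -exprD subnKC.
  by rewrite eD; ring.
have := congr1 (fun p => p.[r]) E0; rewrite /= horner0 horner_sum big_ord_recr /= big1 ?add0r => [|i _].
  rewrite subnn expr0 mulr1 hornerM horner_exp.
  have -> : q`_m = 1 by rewrite -[RHS](monicP mq) lead_coefE.
  rewrite -[1]/(1%:P) comp_polyC hornerC mul1r => /eqP; rewrite expf_eq0 => /andP[_ h].
  by case/negP: rU.
rewrite !hornerM [X in _ * X]horner_exp (rootP rD) expr0n subn_eq0 leqNgt ltn_ord mulr0 //.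
Qed.

(** L is Galois over K(z), being a splitting field in characteristic 0, hence also over K(z)(x0). *)
Lemma fix_x0 (w : L) : (forall g : {rmorphism L -> L}, (forall c, g c%:A = c%:A) -> g x0 = x0 -> g w = w) ->
  w \in <<1; x0>>%VS.
Proof.
move=> fixw.
have gal1 : galois 1 {:L}.
  apply/and3P; split; first exact: sub1v.
    apply/separableP => y _; apply: pcharf0_separable => q; rewrite pchar_lalg.
    by rewrite (fmorph_pchar (tf \o polyC : {rmorphism K -> KK})); apply: charK.
  apply/splitting_normalField; first exact: sub1v.
  exists (map_poly (in_alg L) PF); first by apply/polyOver1P; exists PF.
  by exists zs.
have galM : galois <<1; x0>> {:L}.
  by apply: galoisS gal1; rewrite subv_adjoin subvf.
rewrite -(galois_fixedField galM); apply/fixedFieldP; first exact: memvf.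
move=> g gG.
have [||h hE] := @mk_rmorph L L g.
- by move=> u v; rewrite raddfB.
- by split=> [|u v]; rewrite ?rmorph1 ?rmorphM.
rewrite -hE; apply: fixw => [c|]; rewrite hE.
  by rewrite linearZ /= rmorph1.
by apply: (fixed_gal (subvf _) gG); rewrite memv_adjoin.
Qed.

(** The relation of [mom_relation] concerns the coefficients at multiples of N. Summing over all
    rotations t -> z^s t, z a primitive N-th root of unity, kills the other coefficients and yields
    an honest linear relation between branches. *)
Lemma zero_place (a b : K) : P.[a] = 0 -> P.[b] = 0 -> exists f : 'I_n -> int,
  (forall R, allmom a b P R -> \sum_j (f j)%:~R * ev R (x j) = 0) /\
  (forall R, \sum_j (f j)%:~R * ev R (x j) = 0 -> R.[a] = R.[b]).
Proof.
move=> Pa Pb; have P0 : P != 0 by rewrite -size_poly_eq0 sP.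
have [N [ya [yb [N0 ya0 yb0 [yaP ybP] rel]]]] := mom_relation charK Pa Pb P0.
have [z pz] := prim_root_ex charK N0.
pose S := {fraction (fps K)}.
pose ka : {rmorphism K -> S} := @tofrac (fps K) \o @fpsC K.
have tr r : tofrac (fX K ^+ N) != ka r.
  apply/negP; rewrite tofrac_eq => /eqP/(congr1 (fun f => f`@N)).
  rewrite fcoefXn eqxx fcoefC; case: N N0 {rel yaP ybP pz} => // k _ /eqP; by rewrite oner_eq0.
have [M [h [h1 h2]]] := place charK L tr.
have alg_inj (c d : S) : c%:A = d%:A :> M -> c = d.
  by move=> e; apply: (fmorph_inj (in_alg M)); exact: e.
have kE R y : (map_poly ka R).[tofrac y] = tofrac (R^^.[y]).
  by rewrite -horner_map -map_poly_comp.
have pick y (s : 'I_N) : P^^.[y] = fX K ^+ N -> exists j, h (x j) = (tofrac (frot (z ^+ s) y))%:A.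
  move=> yP; have [|x1 x1z hx1] := lift_root eL h1 (y := tofrac (frot (z ^+ s) y)).
    rewrite kE -frot_horner yP rmorphXn /= frotX exprMn -rmorphXn -exprM mulnC exprM.
    by rewrite (prim_expr_order pz) expr1n rmorph1 mul1r.
  by have [j ej] := zx x1z; exists j; rewrite -ej.
have /choice[A hA] s : exists j, h (x j) = (tofrac (frot (z ^+ (s : 'I_N)) ya))%:A by apply: pick.
have /choice[B hB] s : exists j, h (x j) = (tofrac (frot (z ^+ (s : 'I_N)) yb))%:A by apply: pick.
(* Each rotated expansion is the image of some branch; f_j counts how often branch j arises from b
   minus how often it arises from a. *)
pose f (j : 'I_n) : int := \sum_s ((B s == j)%:R - (A s == j)%:R).
pose d R := R^^.[yb] - R^^.[ya].
have fE R : h (\sum_j (f j)%:~R * ev R (x j)) = (tofrac (\sum_(s < N) frot (z ^+ s) (d R)))%:A.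
  have -> : \sum_j (f j)%:~R * ev R (x j) = \sum_(s < N) (ev R (x (B s)) - ev R (x (A s))).
    have pk (j0 : 'I_n) : ev R (x j0) = \sum_j ((j0 == j)%:R : int)%:~R * ev R (x j).
      rewrite (bigD1 j0) //= eqxx mul1r big1 ?addr0 // => j; rewrite eq_sym => /negPf ->.
      by rewrite mul0r.
    rewrite (eq_bigr (fun s => \sum_j (((B s == j)%:R - (A s == j)%:R) : int)%:~R * ev R (x j))).
      rewrite exchange_big; apply: eq_bigr => j _ /=; rewrite -mulr_suml; congr (_ * _).
      by rewrite /f rmorph_sum.
    move=> s _; rewrite {1}(pk (B s)) {1}(pk (A s)) -sumrB; apply: eq_bigr => j _.
    by rewrite rmorphB mulrBl.
  rewrite !rmorph_sum scaler_suml; apply: eq_bigr => s _.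
  rewrite rmorphB (h2 _ _ _ (hA s)) (h2 _ _ _ (hB s)) !kE -scalerBl; congr (_ *: _).
  rewrite -[LHS]tofracB /=; congr (tofrac _).
  by rewrite /d raddfB -!frot_horner.
have cE R k : (\sum_(s < N) frot (z ^+ s) (d R))`@k = (\sum_(s < N) (z ^+ k) ^+ s) * (d R)`@k.
  rewrite fcoef_sum mulr_suml; apply: eq_bigr => s _; rewrite /= -!exprM mulnC //.
have dM R : \sum_j (f j)%:~R * ev R (x j) = 0 <-> (forall l, (d R)`@(N * l) = 0).
  split=> [e l|e].
    move/(congr1 h): e; rewrite rmorph0 fE => e.
    have {}e : tofrac (\sum_(s < N) frot (z ^+ s) (d R)) = 0 :> S by apply: alg_inj; rewrite scale0r.
    have /(congr1 (fun f => f`@(N * l))) : \sum_(s < N) frot (z ^+ s) (d R) = 0.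
      by apply/eqP; rewrite -tofrac_eq0 e.
    rewrite cE fcoef0 exprM (prim_expr_order pz) expr1n => /eqP.
    rewrite (eq_bigr (fun=> 1)) => [|s _]; last by rewrite expr1n.
    by rewrite sumr_const card_ord mulf_eq0 (natr_c0 charK) eqn0Ngt N0 => /eqP.
  apply: (fmorph_inj h); rewrite rmorph0 fE.
  have -> : \sum_(s < N) frot (z ^+ s) (d R) = 0; last by rewrite rmorph0 scale0r.
  apply: fpsP => k; rewrite cE fcoef0.
  have [/dvdnP[l ->]|nk] := boolP (N %| k)%N; first by rewrite mulnC e mulr0.
  have zk : z ^+ k - 1 != 0 by rewrite subr_eq0 -(prim_order_dvd pz).
  apply/eqP; rewrite mulf_eq0; apply/orP; left; apply/eqP/(mulfI zk).
  by rewrite mulr0 -subrX1 -exprM mulnC exprM (prim_expr_order pz) expr1n subrr.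
exists f; split=> [R MR|R /dM e].
  by apply/dM => l; rewrite fcoefB rel // subrr.
have := e 0%N; rewrite muln0 fcoefB !fcoef_horner0 ya0 yb0 => /eqP.
by rewrite subr_eq0 => /eqP ->.
Qed.
End Roots.

(** What the later argument needs of the Galois theory. [mG] consists of permutations of the
    branches induced by automorphisms over K(z), [m_inf] is the place at infinity, and [mG_fix]
    combines Galois theory with integral closure: a stabiliser-invariant sum is a polynomial in
    branch 0. [mf] is the integer relation at z = 0, and its vanishing on R forces R(a) = R(b). *)
Record monod (a b : K) := Monod {
  mL : fieldType;
  mi : {rmorphism K -> mL};
  mx : 'I_n -> mL;
  mev R j := (map_poly mi R).[mx j];
  mz : K;
  mz_prim : n.-primitive_root mz;
  mG : ('I_n -> 'I_n) -> Prop;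
  mG_inj s : mG s -> injective s;
  mG_comp s t : mG s -> mG t -> mG (s \o t);
  mG_shift : mG (fun j => j + 1);
  mG_rel s R : mG s -> \sum_j mev (R j) j = 0 -> \sum_j mev (R j) (s j) = 0;
  mG_fix R : (forall s, mG s -> s 0 = 0 -> \sum_j mev (R j) (s j) = \sum_j mev (R j) j) ->
    exists S, \sum_j mev (R j) j = mev S 0;
  m_inf D (R : 'I_n -> {poly K}) : (forall j, (size (R j) <= D.+1)%N) ->
    \sum_j mev (R j) j = 0 -> \sum_j (R j)`_D * mz ^+ (j * D) = 0;
  m_P j : mev P j = mev P 0;
  mf : 'I_n -> int;
  mf_mom R : allmom a b P R -> \sum_j (mf j)%:~R * mev R j = 0;
  mf_end R : \sum_j (mf j)%:~R * mev R j = 0 -> R.[a] = R.[b]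
}.

(** The record lives in [Type] while its ingredients come from existence statements, whence the form
    [exists m, True]. *)
Theorem monod_ex a b : P.[a] = 0 -> P.[b] = 0 -> exists m : monod a b, True.
Proof.
move=> Pa Pb; have [L [zs [eL gL]]] := split_field (PF_neq0 sP).
have [z [x [pz xz zx inf [g0 [g0A g0x]]]]] := inf_place charK sP eL gL.
have x0t (R : {poly K}) : ev R (x (0 : 'I_n)) = 0 -> R = 0.
  move=> e; apply/eqP; rewrite -lead_coef_eq0; apply/eqP.
  have := inf (size R).-1 (fun j => if j == 0 then R else 0).
  rewrite (bigD1 0) //= e big1 ?addr0 => [|j /negPf ->]; last by rewrite /ev rmorph0 horner0.
  rewrite (bigD1 0) //= big1 ?addr0 => [|j /negPf ->]; last by rewrite coef0 mul0r.
  rewrite mul0n mulr1 lead_coefE; apply=> // j.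
  by case: eqP => _; rewrite ?size_poly0 // leqSpred.
have [f [f1 f2]] := zero_place eL zx Pa Pb.
pose G (s : 'I_n -> 'I_n) := exists g : {rmorphism L -> L}, (forall c, g c%:A = c%:A) /\ forall j, g (x j) = x (s j).
have xinj : injective x.
  move=> i j e; apply/eqP/negPn/negP => ij; have ji : j != i by rewrite eq_sym.
  have := inf 1%N (fun k => if k == i then 'X else if k == j then - 'X else 0).
  rewrite (bigD1 i) // (bigD1 j) //= !eqxx (negPf ji) big1 ?addr0; last first.
    by move=> k /andP[/negPf -> /negPf ->]; rewrite /ev rmorph0 horner0.
  rewrite (bigD1 i) // (bigD1 j) //= !eqxx (negPf ji) big1 ?addr0; last first.
    by move=> k /andP[/negPf -> /negPf ->]; rewrite coef0 mul0r.
  rewrite /ev rmorphN /= !map_polyX hornerN !hornerX e subrr coefN coefX mulN1r mul1r !muln1.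
  move=> h; have {}h : z ^+ i - z ^+ j = 0.
    apply: h => // k; case: eqP => _; first by rewrite size_polyX.
    by case: eqP => _; rewrite ?size_polyN ?size_polyX ?size_poly0.
  move/eqP: h; rewrite subr_eq0 (eq_prim_root_expr pz) !modn_small // => /eqP/ord_inj e'.
  by rewrite e' eqxx in ij.
have gev (g : {rmorphism L -> L}) R j k : (forall c, g c%:A = c%:A) -> g (x j) = x k -> g (ev R (x j)) = ev R (x k).
  move=> gA gx; rewrite /ev -horner_map gx -map_poly_comp; congr (_.[_]).
  by apply: eq_map_poly => c; rewrite /= gA.
unshelve eexists (@Monod a b L (iK L) x z pz G _ _ _ _ _ _ _ f f1 f2) => //.
- by move=> s [g [gA gx]] i j e; apply/xinj/(fmorph_inj g); rewrite !gx e.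
- move=> s t [g [gA gx]] [g' [gA' gx']].
  by exists (g \o g'); split=> [c|j] /=; rewrite ?gA' ?gA // gx' gx.
- by exists g0.
- move=> s R [g [gA gx]] /(congr1 g); rewrite rmorph0 rmorph_sum => e; rewrite -[RHS]e.
  by apply: eq_bigr => j _; apply/esym/(gev g (R j) j (s j) gA (gx j)).
- move=> R fixR; pose w := \sum_j ev (R j) (x j).
  have : w \in <<1; x (0%R : 'I_n)>>%VS.
    apply: (fix_x0 eL gL) => g gA gx0.
    have /choice[s hs] j : exists k, g (x j) = x k.
      apply: (zx); rewrite (mem_zs eL); have := ev_x eL xz j => e.
      rewrite -/(iK L) /zL -(gA (tofrac 'X)) -/(zL L) -e /ev -horner_map -map_poly_comp.
      by apply/eqP; congr (_.[_]); apply: eq_map_poly => c; rewrite /= gA.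
    rewrite /w rmorph_sum -[RHS](fixR s); first by apply: eq_bigr => j _; apply: (gev g (R j) j (s j) gA (hs j)).
      by exists g.
    by apply: xinj; rewrite -hs.
  case/(integral_poly_x0 eL xz x0t); last by move=> S e; exists S.
  apply: (big_ind (integralOver (RtoK L))); [exact: integral0 | exact: integral_add|].
  by move=> j _; apply: ev_integral; apply: (x_integral eL xz).
- by move=> j; apply: etrans (ev_x eL xz j) (esym (ev_x eL xz 0)).
Qed.
End Package.
End MonodromyAction.

(** * Block systems, closing right factors and the moment dichotomy *)

Module BlockSystems.
Import all_boot all_order all_algebra all_fingroup all_field.
Import cyclic boolp ring.
Import SchurRing SchurQuotient SchurCyclic PowerSeries Moments Monodromy MonodromyAction.
Set Implicit Arguments. Unset Strict Implicit. Unset Printing Implicit Defensive.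
Import GRing.Theory.
Local Open Scope ring_scope.

(** Take t to be the part of n prime to k. A prime dividing n then divides exactly one of k and m
    t. *)
Lemma coprime_lift k m n : (0 < n)%N -> (0 < k)%N -> coprime k m -> (m %| n)%N -> exists t, coprime (k + m * t) n.
Proof.
move=> n0 k0 km mn; exists (n`_(\pi(k)^'))%N; apply/negPn/negP => ncop.
have g1 : (1 < gcdn (k + m * n`_(\pi(k)^')) n)%N.
  by rewrite ltn_neqAle gcdn_gt0 n0 orbT andbT eq_sym.
pose p := pdiv (gcdn (k + m * n`_(\pi(k)^')) n).
have pp : prime p by apply: pdiv_prime.
have := pdiv_dvd (gcdn (k + m * n`_(\pi(k)^')) n); rewrite -/p dvdn_gcd => /andP[p1 p2].
have [pk|pk] := boolP (p %| k)%N.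
  move: p1; rewrite dvdn_addr // Euclid_dvdM // => /orP[pm|pt].
    by have := dvdn_gcd p k m; rewrite pk pm (eqP km) dvdn1 => /eqP p11; rewrite p11 in pp.
  by have := pnat_dvd pt (part_pnat (\pi(k)^') n); rewrite pnatE // inE /= mem_primes pp k0 pk.
have : (p %| m * n`_(\pi(k)^'))%N.
  rewrite dvdn_mull //; have : (p %| n`_(\pi(k)) * n`_(\pi(k)^'))%N by rewrite partnC.
  rewrite Euclid_dvdM // => /orP[h|//].
  have := pnat_dvd h (part_pnat (\pi(k)) n); rewrite pnatE // inE /= mem_primes => /and3P[_ _ h'].
  by rewrite h' in pk.
by move=> h; move: p1; rewrite dvdn_addl // (negPf pk).
Qed.

Lemma intr_c0 (K : fieldType) (charK : [pchar K] =i pred0) (i : int) : (i%:~R == 0 :> K) = (i == 0).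
Proof. by case: i => k; rewrite ?NegzE ?rmorphN ?oppr_eq0 (natr_c0 charK). Qed.

(** Galois conjugation of roots of unity. Irreducibility of the cyclotomic polynomial over the
    rationals is known inside [algC]; divisibility and Bezout identities with cleared denominators
    transfer it to an arbitrary field of characteristic 0. *)
Lemma int_poly_unity (K : fieldType) (charK : [pchar K] =i pred0) n (z : K) u (f : {poly int}) :
  n.-primitive_root z -> coprime u n ->
  (map_poly intr f).[z] = 0 -> (map_poly intr f).[z ^+ u] = 0.
Proof.
move=> pz cu fz.
have n0 := prim_order_gt0 pz.
have cyc0 y : n.-primitive_root y -> (map_poly intr 'Phi_n).[y] = 0 :> K.
  move=> py; have := congr1 (fun p => (map_poly intr p).[y]) (prod_Cyclotomic n0).
  rewrite /= rmorph_prod horner_prod rmorphB rmorph1 /= map_polyXn !hornerE prim_expr_order // subrr.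
  move/eqP; rewrite prodf_seq_eq0 => /hasP[d dn /= /eqP hd].
  have {}dn : (d %| n)%N by rewrite dvdn_divisors in dn *.
  have d0 : (0 < d)%N := dvdn_gt0 n0 dn.
  suff -> : n = d by [].
  apply/eqP; rewrite eqn_dvd dn andbT (prim_order_dvd py).
  have := congr1 (fun p => (map_poly intr p).[y]) (prod_Cyclotomic d0).
  rewrite /= rmorph_prod horner_prod rmorphB rmorph1 /= map_polyXn !hornerE.
  rewrite (bigD1_seq d) ?divisors_uniq //=; last by rewrite -dvdn_divisors.
  by rewrite hd mul0r => /esym/eqP; rewrite subr_eq0.
have [w pw] := C_prim_root_exists n0.
pose toQ : {poly int} -> {poly rat} := map_poly intr.
have [q [e1 _] irrq] := minCpolyP w.
have {e1} eq : q = toQ 'Phi_n.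
  have : map_poly ratr q = map_poly ratr (toQ 'Phi_n) :> {poly algC}.
    rewrite -e1 (minCpoly_cyclotomic pw) -(Cintr_Cyclotomic pw) -map_poly_comp.
    by apply: eq_map_poly => i; rewrite /= ratr_int.
  by move/(map_poly_inj (ratr : {rmorphism rat -> algC})).
have toQ_inj : injective toQ by apply: map_inj_poly => //; apply: intr_inj.
have toQZ (c : int) p : toQ (c *: p) = c%:~R *: toQ p.
  by rewrite /toQ -!mul_polyC rmorphM /= map_polyC.
have toQM p r : toQ (p * r) = toQ p * toQ r by rewrite /toQ rmorphM.
have toQD p r : toQ (p + r) = toQ p + toQ r by rewrite /toQ rmorphD.
have scale (p : {poly rat}) : exists r (c : int), c != 0 /\ c%:~R *: p = toQ r.
  have [r [c c0 ->]] := rat_poly_scale p; exists r, c; split=> //.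
  by rewrite scalerA divff ?scale1r // intr_eq0.
have evN (p : {poly int}) (c : int) y : (map_poly intr (c *: p)).[y] = c%:~R * (map_poly intr p).[y] :> K.
  by rewrite -mul_polyC rmorphM /= map_polyC hornerM hornerC.
have [|ndv] := boolP (q %| toQ f).
  case/dvdpP => r er; have [r' [c [c0 ec]]] := scale r.
  have e : c *: f = r' * 'Phi_n.
    by apply: toQ_inj; rewrite toQZ toQM er -ec -eq scalerAl.
  have := congr1 (fun p => (map_poly intr p).[z ^+ u]) e.
  rewrite /= evN rmorphM hornerM cyc0 ?prim_root_exp_coprime // mulr0 => /eqP.
  by rewrite mulf_eq0 intr_c0 // (negPf c0) => /eqP.
have cop : coprimep q (toQ f).
  pose d := gcdp q (toQ f); have dq : d %| q by apply: dvdp_gcdl.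
  have q0 : q != 0 by rewrite eq -(rmorph0 (map_poly intr)) (inj_eq toQ_inj) monic_neq0 // Cyclotomic_monic.
  have : root (map_poly ratr q : {poly algC}) w by rewrite irrq.
  case/dvdpP: (dq) => r er; rewrite {1}er rmorphM rootM !irrq => /orP[h|h].
    rewrite /coprimep -/d; have r0 : r != 0 by apply: contraNneq q0 => r0; rewrite er r0 mul0r.
    have d0 : d != 0 by apply: contraNneq q0 => d0; rewrite er d0 mulr0.
    have := dvdp_leq r0 h; rewrite {1}er size_mul // -(prednK (_ : 0 < size d)%N) ?size_poly_gt0 // addnS /=.
    rewrite -{2}[size r]addn0 leq_add2l leqn0 => /eqP e; by rewrite -(prednK (_ : 0 < size d)%N) ?size_poly_gt0 // e.
  by case/negP: ndv; apply: dvdp_trans h (dvdp_gcdr _ _).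
have [[u1 u2] /= /eqpP[[c1 c2] /= /andP[c10 c20]]] := Bezout_coprimepP _ _ cop.
have [U1 [d1 [d10 e1]]] := scale (c1 *: u1); have [U2 [d2 [d20 e2]]] := scale (c1 *: u2).
have [U3 [d3 [d30 e3]]] := scale (c2%:P).
move=> bz; have e : (d2 * d3) *: (U1 * 'Phi_n) + (d1 * d3) *: (U2 * f) = (d1 * d2) *: U3.
  apply: toQ_inj; rewrite toQD !toQZ !toQM -e1 -e2 -e3 -eq.
  rewrite -!scalerAl !scalerA.
  transitivity ((d1 * d2 * d3)%:~R *: (c1 *: (u1 * q + u2 * toQ f))).
    rewrite !scalerDr !scalerA; congr (_ *: _ + _ *: _); rewrite !intrM; ring.
  by rewrite bz -intrM; congr (_ *: _); rewrite alg_polyC.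
have := congr1 (fun p => (map_poly intr p).[z]) e.
rewrite /= rmorphD hornerD !evN !rmorphM !hornerM fz cyc0 // !mulr0 addr0 => /esym/eqP.
rewrite !mulf_eq0 /= !intr_c0 // (negPf d10) (negPf d20) /=.
have : exists c, c != 0 /\ U3 = c%:P.
  have : size (toQ U3) = 1%N by rewrite -e3 size_scale ?intr_eq0 // size_polyC c20.
  rewrite size_map_inj_poly ?rmorph0 //; last exact: intr_inj.
  by move/eqP/size_poly1P => [c c0 ->]; exists c.
by move=> [c [c0 ->]]; rewrite map_polyC hornerC intr_c0 // (negPf c0).
Qed.

Section Blocks.
Variable K : closedFieldType.
Hypothesis charK : [pchar K] =i pred0.
Variables (P : {poly K}) (n' : nat) (a b : K).
Local Notation n := n'.+2.
Hypothesis sP : size P = n.+1.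
Variable m : monod P n' a b.
Local Notation ev R j := (@mev _ _ _ _ _ m R j).
Local Notation z := (mz m).
Local Notation G := (mG m).
Local Notation I := 'I_n.
Let pz : n.-primitive_root z := mz_prim m.
Let n0K : (n%:R : K) != 0. Proof. by rewrite (natr_c0 charK). Qed.

Lemma evD R S j : ev (R + S) j = ev R j + ev S j.
Proof. by rewrite /mev rmorphD hornerD. Qed.
Lemma evB R S j : ev (R - S) j = ev R j - ev S j.
Proof. by rewrite /mev rmorphB hornerD hornerN. Qed.
Lemma evZ c R j : ev (c *: R) j = mi m c * ev R j.
Proof. by rewrite /mev -mul_polyC rmorphM /= map_polyC hornerM hornerC. Qed.
Lemma evC c j : ev c%:P j = mi m c.
Proof. by rewrite /mev map_polyC hornerC. Qed.
Lemma ev0 j : ev 0 j = 0. Proof. by rewrite /mev rmorph0 horner0. Qed.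
Lemma evXn R k j : ev (R ^+ k) j = ev R j ^+ k.
Proof. by rewrite /mev rmorphXn /= horner_exp. Qed.
Lemma ev_comp R S j : ev (R \Po S) j = (map_poly (mi m) R).[ev S j].
Proof. by rewrite /mev map_comp_poly horner_comp. Qed.

Definition chi (k i : I) : K := z ^+ (i * k).
Lemma chiC k i : chi k i = chi i k. Proof. by rewrite /chi mulnC. Qed.
Lemma chiD k i j : chi k (i + j) = chi k i * chi k j.
Proof. by rewrite /chi !exprM -exprMn -exprD prim_expr_mod. Qed.
Lemma chi0 k : chi k 0 = 1. Proof. by rewrite /chi mul0n. Qed.
Lemma z0 : z != 0.
Proof. by apply: contra_eq_neq (prim_expr_order pz) => ->; rewrite expr0n eq_sym oner_eq0. Qed.
Lemma chi_neq0 k i : chi k i != 0. Proof. by rewrite expf_neq0 // z0. Qed.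
Lemma chiN k i : chi k (- i) = (chi k i)^-1.
Proof. by apply: (mulIf (chi_neq0 k i)); rewrite -chiD addNr chi0 mulVf // chi_neq0. Qed.
Lemma chiMn k i u : chi k (i *+ u) = chi k i ^+ u.
Proof. by elim: u => [|u IH]; rewrite ?mulr0n ?chi0 // mulrS chiD IH exprS. Qed.
Lemma chiMnC k i u : chi (k *+ u) i = chi k (i *+ u).
Proof. by rewrite chiC chiMn chiMn chiC. Qed.
Lemma chi_sum i : \sum_k chi k i = if i == 0 then n%:R else 0.
Proof.
case: eqP => [->|/eqP i0].
  by rewrite (eq_bigr (fun=> 1)) => [|k _]; rewrite ?chi0 // sumr_const card_ord.
have zi : z ^+ i - 1 != 0.
  by rewrite subr_eq0 -(prim_order_dvd pz) /dvdn modn_small // -[0%N]/((0 : I) : nat).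
apply: (mulfI zi); rewrite mulr0 (eq_bigr (fun k : I => (z ^+ i) ^+ k)); last by move=> k _; rewrite -exprM.
by rewrite -subrX1 -exprM mulnC exprM (prim_expr_order pz) expr1n subrr.
Qed.
Lemma mulu_inj u : coprime u n -> injective (fun j : I => j *+ u).
Proof.
move=> cu i j /eqP; rewrite -subr_eq0 -mulrnBl => /eqP e; apply/eqP; rewrite -subr_eq0; apply/eqP.
move: (i - j) e => {i j} i /(congr1 (fun j => chi 1 j)); rewrite chiMn chi0 /chi muln1 -exprM.
move/eqP; rewrite -(prim_order_dvd pz) Gauss_dvdl 1?coprime_sym // /dvdn modn_small // => /eqP i0.
exact: val_inj.
Qed.

Lemma mG_inv s : G s -> exists t, [/\ G t, cancel s t & cancel t s].
Proof.
move=> Gs; pose p := perm (mG_inj Gs).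
have Gp k : G (fun x => iter k.+1 p x).
  elim: k => [|k IH]; first by rewrite (_ : (fun x => _) = s) //; apply: funext => x; rewrite /= permE.
  by rewrite (_ : (fun x => _) = s \o (fun x => iter k.+1 p x)); [apply: mG_comp|apply: funext => x; rewrite /= permE].
(* [G] is only known to be closed under composition, so the inverse must be a positive iterate;
   doubling the order guarantees this even for the identity. *)
have [k hk] : exists k, (#[p]%g + #[p]%g)%N = k.+2.
  by exists (#[p]%g + #[p]%g).-2; case: #[p]%g (order_gt0 p) => // o _; rewrite addnS.
have e x : iter k.+2 p x = x.
  by rewrite -hk -permX expgD expg_order mulg1 perm1.
exists (fun x => iter k.+1 p x); split=> //.
  by move=> x; have := e x; rewrite iterSr permE.
by move=> x; have := e x; rewrite iterS permE.
Qed.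

Lemma mG_shifts t : G (fun j => j + t).
Proof.
have h k : G (fun j : I => j + (k.+1)%:R).
  elim: k => [|k IH]; first exact: mG_shift.
  rewrite (_ : (fun j => _) = (fun j : I => j + 1) \o (fun j => j + k.+1%:R)); first exact: (mG_comp (mG_shift m)).
  by apply: funext => j; rewrite /= -[k.+2%:R]natr1 addrA.
have e : t = (t + n')%N.+2%:R.
  by rewrite -addnS -addnS Zp_nat; apply: val_inj; rewrite /= modnDr modn_small.
rewrite e; exact: h.
Qed.

Definition four (c : I -> K) k := \sum_j c j * chi k j.
(** Circulant kernels c(i - j) invariant under [G], with c also invariant under the units mod n.
    Closure under convolution and under pointwise product makes this a Schur ring in two dual ways;
    [erel] groups the characters on which all Fourier transforms agree, that is the dual ring. *)
Definition inA (c : I -> K) := (forall s, G s -> forall i j, c (s i - s j) = c (i - j)) /\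
  (forall u, coprime u n -> forall j, c (j *+ u) = c j).
Definition conv (c d : I -> K) i := \sum_j c (i - j) * d j.

Lemma four_conv c d k : four (conv c d) k = four c k * four d k.
Proof.
rewrite /four /conv mulr_sumr (eq_bigr (fun i => \sum_j (c (i - j) * chi k (i - j)) * (d j * chi k j))).
  rewrite exchange_big /=; apply: eq_bigr => j _; rewrite -mulr_suml; congr (_ * _).
  by rewrite (reindex_inj (addIr j)) /=; apply: eq_bigr => i _; rewrite addrK.
move=> i _; rewrite mulr_suml; apply: eq_bigr => j _.
by rewrite -{2}(subrK j i) chiD; ring.
Qed.

Lemma inA_conv c d : inA c -> inA d -> inA (conv c d).
Proof.
move=> [c1 c2] [d1 d2]; split=> [s Gs i j|u cu j]; rewrite /conv.
  have si := mG_inj Gs.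
  rewrite (reindex_inj (inj_comp (addIr (- s j)) si)) [RHS](reindex_inj (addIr (- j))) /=.
  by apply: eq_bigr => l _; rewrite !opprB !addrA !subrK c1 // d1.
rewrite (reindex_inj (mulu_inj cu)); apply: eq_bigr => l _.
by rewrite -mulrnBl c2 // d2.
Qed.
Lemma inA_lin x y c d : inA c -> inA d -> inA (fun i => x * c i + y * d i).
Proof. by move=> [c1 c2] [d1 d2]; split=> [s Gs i j|u cu j]; rewrite ?c1 ?d1 ?c2 ?d2. Qed.
Lemma inA_mul c d : inA c -> inA d -> inA (fun i => c i * d i).
Proof. by move=> [c1 c2] [d1 d2]; split=> [s Gs i j|u cu j]; rewrite ?c1 ?d1 ?c2 ?d2. Qed.
Lemma inA_sum (x : I -> K) (c : I -> I -> K) : (forall k, inA (c k)) -> inA (fun i => \sum_k x k * c k i).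
Proof.
move=> h; split=> [s Gs i j|u cu j]; apply: eq_bigr => k _.
  by rewrite (h k).1.
by rewrite (h k).2.
Qed.
Definition dlt (i : I) : K := (i == 0)%:R.
Lemma inA_dlt : inA dlt.
Proof.
split=> [s Gs i j|u cu j]; rewrite /dlt.
  by rewrite !subr_eq0 (inj_eq (mG_inj Gs)).
by rewrite -{1}(mul0rn _ u) (inj_eq (mulu_inj cu)).
Qed.
Lemma inA_one : inA (fun=> 1). Proof. by split. Qed.
Lemma four_dlt k : four dlt k = 1.
Proof.
rewrite /four (bigD1 0) //= /dlt eqxx chi0 mulr1 big1 ?addr0 // => i /negPf ->.
by rewrite mul0r.
Qed.
Lemma four_lin x y c d k : four (fun i => x * c i + y * d i) k = x * four c k + y * four d k.
Proof. by rewrite /four !mulr_sumr -big_split; apply: eq_bigr => j _ /=; ring. Qed.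
Lemma four_inv c i : n%:R * c i = \sum_k four c k * chi k (- i).
Proof.
transitivity (\sum_j c j * \sum_k chi k (j - i)).
  rewrite (bigD1 i) //= subrr chi_sum eqxx big1 ?addr0 ?[_ * n%:R]mulrC // => j ji.
  by rewrite chi_sum subr_eq0 (negPf ji) mulr0.
rewrite (eq_bigr (fun j => \sum_k c j * chi k j * chi k (- i))).
  by rewrite exchange_big; apply: eq_bigr => k _; rewrite /four mulr_suml.
by move=> j _; rewrite mulr_sumr; apply: eq_bigr => k _; rewrite chiD mulrA.
Qed.

Definition erel : rel I := fun k k' => `[< forall c, inA c -> four c k = four c k' >].
Lemma erelP k k' : reflect (forall c, inA c -> four c k = four c k') (erel k k').
Proof. exact: asboolP. Qed.

Lemma four_mulu c k u : inA c -> coprime u n -> four c (k *+ u) = four c k.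
Proof.
move=> [_ c2] cu; rewrite /four [RHS](reindex_inj (mulu_inj cu)).
by apply: eq_bigr => j _; rewrite c2 // chiMnC.
Qed.

Lemma sep_list k0 (s : seq I) : exists c, [/\ inA c, four c k0 = 1 &
  forall k', k' \in s -> ~~ erel k0 k' -> four c k' = 0].
Proof.
elim: s => [|k1 s [c [Ac c0 cs]]]; first by exists dlt; split=> //; [exact: inA_dlt|exact: four_dlt].
have [e1|ne] := boolP (erel k0 k1).
  exists c; split=> // k'; rewrite inE => /predU1P[->|]; [by rewrite e1|exact: cs].
have [d [Ad dk]] : exists d, inA d /\ four d k0 != four d k1.
  apply: contrapT => h; case/negP: ne; apply/erelP => d Ad; apply: contrapT => /eqP ne.
  by apply: h; exists d.
rewrite -subr_eq0 in dk; pose u := (four d k0 - four d k1)^-1.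
pose d' i := u * d i + (- u * four d k1) * dlt i.
have Ad' : inA d' by apply: inA_lin => //; apply: inA_dlt.
have d'E k : four d' k = u * (four d k - four d k1) by rewrite four_lin four_dlt; ring.
exists (conv c d'); split; first exact: inA_conv.
  by rewrite four_conv c0 d'E mulVf // mulr1.
move=> k'; rewrite inE four_conv => /predU1P[->|k's] nk; first by rewrite d'E subrr !mulr0.
by rewrite cs // mul0r.
Qed.

Lemma erefl_e k : erel k k. Proof. exact/erelP. Qed.
Lemma erel_sym k k' : erel k k' -> erel k' k.
Proof. by move/erelP => h; apply/erelP => c /h ->. Qed.
Lemma erel_trans k k' k'' : erel k k' -> erel k' k'' -> erel k k''.
Proof. by move=> /erelP h /erelP h'; apply/erelP => c Ac; rewrite h // h'. Qed.

(** Convolving separating elements gives, for each k0, an element whose transform is the indicator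
    of the class of k0. Their sum with weights h(k0) over the class size has transform h. *)
Lemma sep (h : I -> K) : (forall k k', erel k k' -> h k = h k') -> exists2 c, inA c & forall k, four c k = h k.
Proof.
move=> he; have /choice[u hu] k0 := sep_list k0 (enum I).
have uE k0 k : four (u k0) k = (erel k0 k)%:R.
  have [A1 u1 u0] := hu k0; case: (boolP (erel k0 k)) => e; last by rewrite u0 ?mem_enum.
  by have /erelP := e; move=> /(_ _ A1) <-.
pose N k : K := #|[pred k' | erel k' k]|%:R.
have N0 k : N k != 0.
  rewrite (natr_c0 charK) -lt0n; apply/card_gt0P; exists k; exact: erefl_e.
exists (fun i => \sum_k0 (h k0 / N k0) * u k0 i).
  by apply: inA_sum => k; have [] := hu k.
move=> k; transitivity (\sum_k0 (h k0 / N k0) * four (u k0) k).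
  rewrite /four; under eq_bigr do rewrite mulr_suml.
  rewrite exchange_big; apply: eq_bigr => k0 _ /=; rewrite mulr_sumr.
  by apply: eq_bigr => j _; rewrite mulrA.
transitivity (\sum_(k0 | erel k0 k) h k / N k).
  rewrite [RHS]big_mkcond; apply: eq_bigr => k0 _; rewrite uE; case: ifP => e; last by rewrite mulr0.
  rewrite mulr1 (he k0 k) //; congr (_ / _); rewrite /N; congr (_%:R); apply: eq_card => k'; rewrite !inE.
  by apply/idP/idP => e'; [apply: erel_trans e' e|apply: erel_trans e' (erel_sym e)].
rewrite sumr_const -[_ *+ _]mulr_natr -/(N k) mulrAC -mulrA divff ?mulr1 //.
Qed.

(** Under the Fourier transform the pointwise product becomes n^-1 times convolution, which gives
    [sr_conv]. The transform of the constant 1 isolates the trivial character. Rationality is the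
    invariance under units, after a unit modulo the order of x is lifted to one mod n. *)
Lemma sr_blocks : sring (erel : rel I).
Proof.
split.
- by move=> x y; rewrite !FinRing.zmodMgE addrC.
- exact: erefl_e.
- exact: erel_sym.
- exact: erel_trans.
- move=> x y exy; apply/erelP => c Ac.
  have : y \in <[x]>%g by rewrite exy cycle_id.
  case/cycleP => k0 ek; rewrite FinRing.zmodXgE in ek.
  pose o := #[x]%g; have on : (o %| n)%N by have := order_dvdG (in_setT x); rewrite cardsT card_ord.
  have [k [k0' ek' ck]] : exists k, [/\ (0 < k)%N, y = x *+ k & coprime k o].
    exists (k0 + o)%N; rewrite addn_gt0 order_gt0 orbT; split=> //.
      by rewrite mulrnDr -ek -FinRing.zmodXgE expg_order FinRing.zmod1gE addr0.
    rewrite coprime_sym /coprime gcdnDr -/(coprime _ _) -generator_coprime /generator exy.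
    by rewrite ek -FinRing.zmodXgE.
  have [t ct] := coprime_lift (ltn0Sn n'.+1) k0' ck on.
  have -> : y = x *+ (k + o * t).
    by rewrite mulrnDr mulrnA -[x *+ o]FinRing.zmodXgE expg_order FinRing.zmod1gE mul0rn addr0.
  by rewrite four_mulu.
- move=> x /erelP/(_ _ inA_one); rewrite FinRing.zmod1gE /four.
  under eq_bigr do rewrite mul1r chiC.
  under [X in _ = X -> _]eq_bigr do rewrite mul1r chiC.
  by rewrite !chi_sum eqxx; case: eqP => // _ /esym/eqP; rewrite (negPf n0K).
- move=> X Y iX iY w w' ew.
  have [c Ac cE] := sep (h := fun k => (k \in X)%:R) (fun k k' e => congr1 (fun b : bool => b%:R) (iX k k' e)).
  have [d Ad dE] := sep (h := fun k => (k \in Y)%:R) (fun k k' e => congr1 (fun b : bool => b%:R) (iY k k' e)).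
  have key v : (scount X Y v)%:R = n%:R * four (fun i => c i * d i) v :> K.
    transitivity (\sum_x four c x * four d (v - x)).
      rewrite /scount -sum1_card natr_sum big_mkcond /=; apply: eq_bigr => x _.
      rewrite cE dE inE FinRing.zmodMgE FinRing.zmodVgE addrC; case: (x \in X); rewrite /= ?mul0r // mul1r.
      by case: (_ \in Y).
    transitivity (\sum_i \sum_j c i * d j * chi v j * \sum_x chi x (i - j)).
      rewrite (eq_bigr (fun x => \sum_i \sum_j c i * d j * chi v j * chi x (i - j))).
        rewrite exchange_big; apply: eq_bigr => i _; rewrite exchange_big; apply: eq_bigr => j _.
        by rewrite mulr_sumr.
      move=> x _; rewrite /four mulr_suml; apply: eq_bigr => i _; rewrite mulr_sumr; apply: eq_bigr => j _.
      by rewrite [chi (v - x) j]chiC !chiD !chiN -[chi j v]chiC [chi j x]chiC; ring.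
    rewrite /four mulr_sumr; apply: eq_bigr => i _; rewrite (bigD1 i) //= subrr chi_sum eqxx big1 ?addr0.
      by ring.
    by move=> j ji; rewrite chi_sum subr_eq0 eq_sym (negPf ji) mulr0.
  by apply: (natr_c0_inj charK); rewrite /= !key; move/erelP: ew => -> //; apply: inA_mul.
Qed.

(** Orthogonality to the whole [G]-orbit of the relation [mf]. The values on the branches of a
    polynomial with vanishing moments form such a vector. *)
Definition perp (A : fieldType) (v : I -> A) := forall s, G s -> \sum_j (mf m j)%:~R * v (s j) = 0.

Lemma perp_comp (A : fieldType) (v : I -> A) s : G s -> perp v -> perp (v \o s).
Proof. by move=> Gs pv t Gt; apply: (pv (s \o t)); apply: mG_comp. Qed.

Lemma perp_sum (A : fieldType) (J : Type) (r : seq J) (p : pred J) (x : J -> A) (v : J -> I -> A) :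
  (forall k, p k -> perp (v k)) -> perp (fun i => \sum_(k <- r | p k) x k * v k i).
Proof.
move=> pv s Gs; under eq_bigr do rewrite mulr_sumr.
rewrite exchange_big big1 // => k pk; under eq_bigr do rewrite mulrCA.
by rewrite -mulr_sumr pv // mulr0.
Qed.

Definition Sp : pred I := fun k => `[< perp (chi k) >].
(** The kernel of the projection onto the [perp] space. Since [G] contains the shifts, that space is
    spanned by the characters in it, and the projection is circulant. *)
Definition cproj (j : I) : K := n%:R^-1 * \sum_(k | Sp k) chi k j.

Lemma perp_hat (A : fieldType) (i0 : {rmorphism K -> A}) (v : I -> A) k :
  perp v -> \sum_j v j * i0 (chi k (- j)) != 0 -> Sp k.
Proof.
move=> pv h; apply/asboolP => s Gs; apply/eqP; rewrite -(fmorph_eq0 i0).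
apply/eqP/(mulIf h); rewrite mul0r rmorph_sum mulr_suml.
transitivity (\sum_t i0 (chi k (- t)) * \sum_l (mf m l)%:~R * v (s l + t)).
  under [RHS]eq_bigr do rewrite mulr_sumr; rewrite exchange_big; apply: eq_bigr => l _.
  rewrite mulr_sumr (reindex_inj (addrI (s l))); apply: eq_bigr => t _ /=.
  rewrite rmorphM rmorph_int /= opprD !chiD !rmorphM chiN fmorphV.
  have := chi_neq0 k (s l); rewrite -(fmorph_eq0 i0) => h0.
  by field.
rewrite big1 // => t _; rewrite (pv (fun l => s l + t)) ?mulr0 //.
exact: (mG_comp (mG_shifts t) Gs).
Qed.

Lemma perp_cproj (A : fieldType) (i0 : {rmorphism K -> A}) (v : I -> A) i :
  perp v -> \sum_j i0 (cproj (i - j)) * v j = v i.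
Proof.
move=> pv; have n0A : (n%:R : A) != 0 by rewrite -(rmorph_nat i0) fmorph_eq0.
transitivity (n%:R^-1 * \sum_k i0 (chi k i) * \sum_j v j * i0 (chi k (- j))).
  rewrite [X in _ = _ * X](bigID Sp) /= [X in _ + X]big1 ?addr0 => [|k nk].
    rewrite (eq_bigr (fun j => n%:R^-1 * \sum_(k | Sp k) i0 (chi k i) * (v j * i0 (chi k (- j))))).
      rewrite -mulr_sumr exchange_big; congr (_ * _); apply: eq_bigr => k _.
      by rewrite mulr_sumr.
    move=> j _; rewrite /cproj rmorphM fmorphV rmorph_nat -mulrA; congr (_ * _).
    rewrite rmorph_sum mulr_suml; apply: eq_bigr => k _.
    by rewrite chiD rmorphM; ring.
  have [->|h] := eqVneq (\sum_j v j * i0 (chi k (- j))) 0; first by rewrite mulr0.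
  by rewrite (perp_hat pv h) in nk.
apply: (mulfI n0A); rewrite mulVKf //.
transitivity (\sum_j v j * \sum_k i0 (chi k (i - j))).
  under eq_bigr do rewrite mulr_sumr; rewrite exchange_big; apply: eq_bigr => j _.
  by rewrite mulr_sumr; apply: eq_bigr => k _; rewrite chiD rmorphM; ring.
rewrite (bigD1 i) //= subrr -rmorph_sum chi_sum eqxx rmorph_nat big1 ?addr0 1?mulrC // => j ji.
by rewrite -rmorph_sum chi_sum subr_eq0 eq_sym (negPf ji) rmorph0 mulr0.
Qed.

(** The relation has integer coefficients, so its vanishing at a root of unity passes to the
    conjugates. This is the source of rationality. *)
Lemma Sp_mulu1 k u : coprime u n -> Sp k -> Sp (k *+ u).
Proof.
move=> cu /asboolP pk; apply/asboolP => s Gs.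
pose F : {poly int} := \sum_j (mf m j)%:P * 'X^(s j).
have FE y : (map_poly intr F).[y] = \sum_j (mf m j)%:~R * y ^+ (s j) :> K.
  rewrite rmorph_sum horner_sum; apply: eq_bigr => j _.
  by rewrite rmorphM /= map_polyC map_polyXn hornerM hornerC hornerXn.
have e1 : (map_poly intr F).[z ^+ k] = 0 :> K.
  by rewrite FE -[RHS](pk s Gs); apply: eq_bigr => j _; rewrite /chi -exprM mulnC.
have pk' := exp_prim_root pz k.
have cu' : coprime u (n %/ gcdn k n).
  by apply: coprime_dvdr cu; rewrite dvdn_div // dvdn_gcdr.
have := int_poly_unity charK pk' cu' e1; rewrite FE => e2; rewrite -[RHS]e2.
by apply: eq_bigr => j _; congr (_ * _); rewrite chiMnC chiMn /chi -!exprM; congr (_ ^+ _); rewrite [RHS]mulnA [RHS]mulnC mulnA.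
Qed.

Lemma mulr_mod (k : I) u v : u = v %[mod n] -> k *+ u = k *+ v.
Proof. by move=> e; apply: val_inj; rewrite !Zp_mulrn /= -modnMmr e modnMmr. Qed.

Lemma Sp_mulu k u : coprime u n -> Sp (k *+ u) = Sp k.
Proof.
move=> cu; apply/idP/idP; last exact: Sp_mulu1.
have e : k = (k *+ u) *+ (u ^ (totient n).-1).
  rewrite -mulrnA -expnS prednK ?totient_gt0 // (@mulr_mod k _ 1) ?mulr1n //.
  exact: Euler_exp_totient.
by move/(@Sp_mulu1 _ (u ^ (totient n).-1)); rewrite -e; apply; rewrite coprimeXl.
Qed.

Lemma cproj_u u j : coprime u n -> cproj (j *+ u) = cproj j.
Proof.
move=> cu; rewrite /cproj [in RHS](reindex_inj (mulu_inj cu)) /=; congr (_ * _).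
by apply: eq_big => k; rewrite ?Sp_mulu // chiMnC.
Qed.
Lemma cproj_sym j : cproj (- j) = cproj j.
Proof.
have e : - j = j *+ n'.+1.
  by apply/eqP; rewrite eq_sym -subr_eq0 opprK -mulrSr -mulr_natr (_ : n%:R = 0) ?mulr0 //; apply: val_inj; rewrite Zp_nat /= modnn.
by rewrite e cproj_u // coprimenS.
Qed.

Lemma perp_col j : perp (fun i => cproj (i - j)).
Proof.
rewrite (_ : (fun i => _) = (fun i => \sum_(k | Sp k) (n%:R^-1 * chi k (- j)) * chi k i)).
  by apply: perp_sum => k /asboolP.
by apply: funext => i; rewrite /cproj mulr_sumr; apply: eq_bigr => k _; rewrite chiD; ring.
Qed.

(** Both [cproj] and its conjugate by s are symmetric, have their columns in the [perp] space and
    act as the identity on it. Composing them in the two possible ways shows that they coincide. *)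
Lemma inA_cproj : inA cproj.
Proof.
split=> [s Gs|u cu j]; last exact: cproj_u.
have [t [Gt st ts]] := mG_inv Gs.
pose c' i j := cproj (s i - s j).
have c's i j : c' i j = c' j i by rewrite /c' -cproj_sym opprB.
have cs i j : cproj (i - j) = cproj (j - i) by rewrite -cproj_sym opprB.
have p' j : perp (fun i => c' i j) by apply: (perp_comp Gs (perp_col (s j))).
have id' v i : perp v -> \sum_j c' i j * v j = v i.
  move=> pv; have := perp_cproj (idfun : {rmorphism K -> K}) (s i) (perp_comp Gt pv).
  rewrite /= st => <-; rewrite [RHS](reindex_inj (can_inj st)); apply: eq_bigr => j _ /=.
  by rewrite st.
move=> i j; rewrite -/(c' i j).
transitivity (\sum_l c' i l * cproj (l - j)); last by rewrite (id' _ _ (perp_col j)).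
rewrite c's -(perp_cproj (idfun : {rmorphism K -> K}) j (p' i)).
by apply: eq_bigr => l _; rewrite /= mulrC cs c's.
Qed.

Lemma allmom_perp R : allmom a b P R -> perp (fun j => ev R j).
Proof.
move=> MR s Gs; have := @mG_rel _ _ _ _ _ m s (fun j => (mf m j)%:~R *: R) Gs.
rewrite (eq_bigr (fun j => (mf m j)%:~R * ev R j)) => [|j _]; last by rewrite evZ rmorph_int.
move/(_ (mf_mom m MR)) => e; rewrite -[RHS]e; apply: eq_bigr => j _.
by rewrite evZ rmorph_int.
Qed.

Lemma perp_end R : perp (fun j => ev R j) -> R.[a] = R.[b].
Proof.
move=> pR; apply: (mf_end (m := m)); have := pR _ (mG_shifts 0).
by under eq_bigr do rewrite addr0.
Qed.


(** Take leading coefficients at infinity in the identity that [cproj] reproduces R at branch 0: the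
    degree of R mod n becomes a frequency of the projection. *)
Lemma four_cproj_perp R : R != 0 -> perp (fun j => ev R j) -> four cproj (inZp (size R).-1) = 1.
Proof.
move=> R0 pR; set D := (size R).-1.
have := perp_cproj (mi m) 0 pR => e.
have := @m_inf _ _ _ _ _ m D (fun j => cproj (0 - j) *: R - (if j == 0 then R else 0)).
have -> : \sum_j ev (cproj (0 - j) *: R - (if j == 0 then R else 0)) j = 0.
  under eq_bigr do rewrite evB evZ; rewrite sumrB e (bigD1 0) //= big1 ?addr0 ?subrr // => j /negPf ->.
  by rewrite ev0.
have sR (j : I) : (size ((cproj (0 - j) *: R - (if j == 0 then R else 0))%R) <= D.+1)%N.
  apply: leq_trans (size_polyD _ _) _; rewrite geq_max size_polyN (leq_trans (size_scale_leq _ _)) ?leqSpred //.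
  by case: eqP => _; rewrite ?size_poly0 // leqSpred.
move/(_ sR erefl).
have RD : R`_D != 0 by rewrite /D -lead_coefE lead_coef_eq0.
under eq_bigr do rewrite coefB coefZ mulrBl; rewrite sumrB [X in _ - X](bigD1 0) //= mul0n mulr1.
rewrite [X in _ - (_ + X)]big1 ?addr0 => [|j /negPf ->]; last by rewrite coef0 mul0r.
move=> h; apply: (mulfI RD); rewrite mulr1; move/eqP: h; rewrite subr_eq0 => /eqP e2; rewrite -[RHS]e2.
rewrite /four mulr_sumr; apply: eq_bigr => j _; rewrite sub0r cproj_sym /chi.
have -> : z ^+ (j * (inZp D : I)) = z ^+ (j * D) by rewrite /= !(mulnC j) !exprM prim_expr_mod.
by ring.
Qed.

Lemma rel_fam (F : I -> {poly K}) W s : \sum_j ev (F j) j = ev W 0 -> G s -> \sum_j ev (F j) (s j) = ev W (s 0).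
Proof.
move=> e Gs; have := @mG_rel _ _ _ _ _ m s (fun j => F j - (if j == 0 then W else 0)) Gs.
have d (t : I -> I) : \sum_j ev (F j - (if j == 0 then W else 0)) (t j) = \sum_j ev (F j) (t j) - ev W (t 0).
  under eq_bigr do rewrite evB; rewrite sumrB; congr (_ - _).
  by rewrite (bigD1 0) //= big1 ?addr0 // => j /negPf ->; rewrite ev0.
have dd := d id; rewrite /= in dd; rewrite dd d e subrr => /(_ erefl)/eqP.
by rewrite subr_eq0 => /eqP.
Qed.

Lemma lead_fam (F : I -> {poly K}) W D : \sum_j ev (F j) j = ev W 0 -> (forall j, (size (F j) <= D.+1)%N) ->
  (size W <= D.+1)%N /\ W`_D = \sum_j (F j)`_D * z ^+ (j * D).
Proof.
move=> e sF.
have key E : (forall j, (size (F j) <= E.+1)%N) -> (size W <= E.+1)%N -> W`_E = \sum_j (F j)`_E * z ^+ (j * E).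
  move=> sF' sW; have := @m_inf _ _ _ _ _ m E (fun j => F j - (if j == 0 then W else 0)).
  have -> : \sum_j ev (F j - (if j == 0 then W else 0)) j = 0.
    under eq_bigr do rewrite evB; rewrite sumrB e (bigD1 0) //= big1 ?addr0 ?subrr // => j /negPf ->.
    by rewrite ev0.
  have sR (j : I) : (size ((F j - (if j == 0 then W else 0))%R) <= E.+1)%N.
    apply: leq_trans (size_polyD _ _) _; rewrite geq_max size_polyN sF' /=.
    by case: eqP => _; rewrite ?size_poly0.
  move/(_ sR erefl); under eq_bigr do rewrite coefB mulrBl; rewrite sumrB [X in _ - X](bigD1 0) //= mul0n mulr1.
  rewrite [X in _ - (_ + X)]big1 ?addr0 => [|j /negPf ->]; last by rewrite coef0 mul0r.
  by move/eqP; rewrite subr_eq0 => /eqP.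
have [sW|sW] := leqP (size W) D.+1; first by split=> //; apply: key.
have sW1 : (size W = (size W).-1.+1)%N by rewrite prednK // (leq_trans _ sW).
have := key (size W).-1; rewrite -sW1 leqnn => h.
have sF2 (j : I) : (size (F j) <= size W)%N by apply: leq_trans (sF j) (ltnW sW).
move: (h sF2 isT); rewrite big1 => [|j _].
  by rewrite -lead_coefE => /eqP; rewrite lead_coef_eq0 => /eqP W0; rewrite W0 size_poly0 in sW.
rewrite nth_default ?mul0r //; apply: leq_trans (sF j) _; by rewrite -ltnS -sW1.
Qed.

(** The residue classes mod n/k, each with k branches, are permuted by [G]. Such block systems
    correspond to right factors of P of degree k, namely the polynomials of degree k constant on
    blocks. *)
Definition blk k := [/\ (0 < k)%N, (k %| n)%N & forall s, G s -> forall i j,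
  (n %/ k %| (s i - s j : I)%R)%N = (n %/ k %| (i - j : I)%R)%N].
Definition bconst k R := forall i j : I, (n %/ k %| (i - j : I)%R)%N -> ev R i = ev R j.

Lemma dvdI q (i j : I) : (q %| n)%N -> (q %| i)%N -> (q %| (i + j : I)%R)%N = (q %| j)%N.
Proof. by move=> qn qi; rewrite {1}/dvdn /= modn_dvdm // -/(dvdn q (i + j)) dvdn_addr. Qed.

(** Comparing leading terms of R at branches 0 and n/k gives z^((n/k) deg R) = 1, so k divides deg R
    and a multiple of a power of W can be subtracted. *)
Lemma blk_factor k (W R : {poly K}) : blk k -> size W = k.+1 -> bconst k W -> bconst k R -> exists A, R = A \Po W.
Proof.
move=> [k0 kn _] sW cW; have [s] := ubnP (size R); elim: s R => // s IH R; rewrite ltnS => sR cR.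
have [sR1|sR1] := leqP (size R) 1.
  by exists R; rewrite (size1_polyC sR1) comp_polyC.
pose D := (size R).-1; have sD : size R = D.+1 by rewrite prednK // ltnW.
have D0 : (0 < D)%N by rewrite -ltnS -sD.
have R0 : R != 0 by rewrite -size_poly_gt0 sD.
have RD : R`_D != 0 by rewrite /D -lead_coefE lead_coef_eq0.
have qn : (n %/ k %| n)%N by rewrite dvdn_div.
have e : \sum_j ev (if j == inZp (n %/ k) then R else 0) j = ev R 0.
  rewrite (bigD1 (inZp (n %/ k))) //= eqxx big1 ?addr0 => [|j /negPf ->]; last by rewrite ev0.
  by apply: cR; rewrite subr0 /= {1}/dvdn modn_dvdm // modnn.
have [|_ ] := lead_fam (D := D) e.
  by move=> j; case: eqP => _; rewrite ?size_poly0 ?sD.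
rewrite (bigD1 (inZp (n %/ k))) //= eqxx big1 ?addr0 => [|j /negPf ->]; last by rewrite coef0 mul0r.
rewrite -[LHS]mulr1 => /(mulfI RD)/esym; rewrite exprM (prim_expr_mod pz) -exprM => /eqP.
rewrite -(prim_order_dvd pz) -{1}(divnK kn) dvdn_pmul2l; last by rewrite divn_gt0 // dvdn_leq.
case/dvdnP => t Dt.
have W0 : W != 0 by rewrite -size_poly_gt0 sW.
have sWt : size (W ^+ t) = D.+1.
  have := size_exp W t; rewrite sW /= mulnC -Dt => <-; by rewrite prednK // size_poly_gt0 expf_neq0.
pose c := R`_D / lead_coef (W ^+ t).
have [||A eA] := IH (R - c *: W ^+ t).
- apply: leq_trans sR; rewrite sD ltnS; apply/leq_sizeP => i; rewrite leq_eqVlt => /orP[/eqP <-|iD].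
    rewrite coefB coefZ /c lead_coefE sWt /= divfK ?subrr //.
    by rewrite -[D]/(D.+1.-1) -sWt -lead_coefE lead_coef_eq0 expf_neq0.
  by rewrite coefB coefZ !nth_default ?mulr0 ?subrr // ?sWt ?sD.
- by move=> i j ij; rewrite !evB !evZ !evXn (cR i j) // (cW i j).
exists (A + c *: 'X^t); rewrite comp_polyD comp_polyZ comp_Xn_poly -eA subrK //.
Qed.

(** The k-th power sum over the block of branch 0 is a polynomial in that branch by [mG_fix]. At
    infinity all its terms contribute the same leading coefficient, so the degree is exactly k. *)
Lemma blk_W k : blk k -> exists2 W : {poly K}, size W = k.+1 & bconst k W.
Proof.
move=> [k0 kn Gk]; have qn : (n %/ k %| n)%N by rewrite dvdn_div.
pose F (j : I) : {poly K} := if (n %/ k %| j)%N then 'X^k else 0.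
have [s Gs s0|W eW] := @mG_fix _ _ _ _ _ m F.
  rewrite [RHS](reindex_inj (mG_inj Gs)); apply: eq_bigr => j _; rewrite /F.
  by have := Gk s Gs j 0; rewrite s0 !subr0 => ->.
have [|sW Wk] := lead_fam (D := k) eW.
  by move=> j; rewrite /F; case: ifP => _; rewrite ?size_poly0 // size_polyXn.
exists W; last first.
  move=> i j ij; have ei t : ev W t = \sum_l ev (F l) (l + t).
    by have := rel_fam eW (mG_shifts t); rewrite add0r.
  rewrite !ei [RHS](reindex_inj (addIr (i - j))); apply: eq_bigr => l _ /=.
  by rewrite /F [l + (i - j)]addrC dvdI // addrC addrA subrK addrC.
apply/eqP; rewrite eqn_leq sW ltnNge; apply/negP => /leq_sizeP/(_ k (leqnn k)); rewrite Wk => /eqP.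
rewrite (eq_bigr (fun j : I => ((n %/ k %| j)%N)%:R)) => [|j _].
  by rewrite -natr_sum (natr_c0 charK) (bigD1 ord0) //= dvdn0 addn_eq0.
rewrite /F; case: ifP => [/dvdnP[t jt]|_]; last by rewrite coef0 mul0r.
by rewrite coefXn eqxx mul1r jt -mulnA divnK // mulnC exprM (prim_expr_order pz) expr1n.
Qed.

Lemma blk_gcd k1 k2 : blk k1 -> blk k2 -> blk (gcdn k1 k2).
Proof.
move=> [p1 d1 g1] [p2 d2 g2].
have h d : (n %/ gcdn k1 k2 %| d)%N = (n %/ k1 %| d)%N && (n %/ k2 %| d)%N.
  rewrite !dvdn_divLR ?gcdn_gt0 ?p1 //; last by apply: dvdn_trans (dvdn_gcdl _ _) d1.
  by rewrite muln_gcdr dvdn_gcd.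
split; [by rewrite gcdn_gt0 p1|by apply: dvdn_trans (dvdn_gcdl _ _) d1|].
by move=> s Gs i j; rewrite !h g1 // g2.
Qed.

Lemma bconst_dvd k1 k2 R : (k2 %| n)%N -> (0 < k1)%N -> (k1 %| k2)%N -> bconst k2 R -> bconst k1 R.
Proof.
move=> kn k0 /dvdnP[t et] c i j ij; apply: c; apply: dvdn_trans ij.
have t0 : (0 < t)%N by case: t et kn => // ->; rewrite mul0n dvd0n.
apply/dvdnP; exists t; case/dvdnP: kn => u ->; rewrite mulnK ?et ?muln_gt0 ?t0 //.
by rewrite mulnA mulnK // mulnC.
Qed.

Lemma perp_map (v : I -> K) : perp v -> perp (fun i => mi m (v i)).
Proof.
move=> pv s Gs; rewrite -[RHS](rmorph0 (mi m)) -(pv s Gs) rmorph_sum; apply: eq_bigr => j _.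
by rewrite rmorphM rmorph_int.
Qed.

(** By [sring_gen] the class of deg R mod n contains a generator y of an invariant subgroup
    containing deg R; put k = gcd(n, y). The element of the ring whose transform is the indicator of
    that subgroup is supported on the multiples of n/k, so its [G]-invariance gives the block
    system. Projecting the block polynomial W by [cproj] keeps its leading coefficient, because y is
    a frequency of the projection, and lands in [perp], which forces equal values at a and b. *)
Theorem closing_factor R : R != 0 -> perp (fun j => ev R j) ->
  exists k (W : {poly K}), [/\ blk k, (k %| (size R).-1)%N, size W = k.+1, bconst k W & perp (fun j => ev W j)].
Proof.
move=> R0 pR; have cyc : cyclic [set: I] by apply/cyclicP; exists Zp1; apply: Zp_cycle.
have [y [exy iy xy]] := sring_gen sr_blocks cyc (inZp (size R).-1).
have f1 : four cproj y = 1 by rewrite -(erelP _ _ exy _ inA_cproj) four_cproj_perp.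
pose k := gcdn n y; have k0 : (0 < k)%N by rewrite gcdn_gt0.
have kn : (k %| n)%N by apply: dvdn_gcdl.
have yk : <[y]>%g = <[inZp k : I]>%g.
  apply/eqP; rewrite eqEsubset !cycle_subG; apply/andP; split.
    apply/cycleP; exists (y %/ k)%N; rewrite FinRing.zmodXgE; apply: val_inj.
    by rewrite Zp_mulrn /= modnMml mulnC divnK ?dvdn_gcdr // modn_small.
  have [t _ ht] := Bezoutr y (ltn0Sn n'.+1).
  have -> : (inZp k : I) = - (y *+ t).
    apply/eqP; rewrite -subr_eq0 opprK; apply/eqP/val_inj; rewrite /= Zp_mulrn /= modnDm.
    by move: ht; rewrite gcdnC [(t * y)%N]mulnC => /eqP.
  by rewrite -FinRing.zmodVgE groupV -FinRing.zmodXgE mem_cycle.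
have fk : four cproj (inZp k) = 1.
  by rewrite -f1; apply/esym/(erelP _ _ (sr_rat sr_blocks yk)); apply: inA_cproj.
have [c Ac cE] := sep (h := fun i => (i \in <[y]>%g)%:R) (fun i j e => congr1 (fun b : bool => b%:R) (iy i j e)).
have c0 j : (c j != 0) = (n %/ k %| j)%N.
  rewrite -[c j](mulKf n0K) four_inv mulf_eq0 invr_eq0 (negPf n0K) /=.
  have -> : \sum_i four c i * chi i (- j) = \sum_(i in <[y]>%g) chi i (- j).
    rewrite [RHS]big_mkcond; apply: eq_bigr => i _; rewrite cE; case: ifP; rewrite ?mul1r ?mul0r //.
  have cy : (chi y j == 1) = (n %/ k %| j)%N.
    rewrite /chi -(prim_order_dvd pz) dvdn_divLR // /k muln_gcdr dvdn_gcd [(n %| j * n)%N]dvdn_mull //.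
  rewrite -cy; have [e|ne] := eqVneq (chi y j) 1.
    rewrite (eq_bigr (fun=> 1)) => [|i /cycleP[t ->]]; last first.
      by rewrite FinRing.zmodXgE chiN chiMnC chiMn e expr1n invr1.
    by rewrite sumr_const (natr_c0 charK) -lt0n cardG_gt0.
  apply/negbTE; rewrite negbK; set S := \sum_(i in _) _.
  have : chi y (- j) * S = S.
    rewrite /S [RHS](reindex_inj (addIr y)) /= mulr_sumr; apply: eq_big => i.
      by rewrite -FinRing.zmodMgE groupMr // cycle_id.
    by move=> _; rewrite ![chi _ (- j)]chiC chiD mulrC.
  move/eqP; rewrite -subr_eq0 -[X in _ - X]mul1r -mulrBl mulf_eq0 subr_eq0 chiN => /orP[|//].
  by rewrite invr_eq1 (negPf ne).
have bk : blk k by split=> // s Gs i j; rewrite -!c0 Ac.1.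
have kD : (k %| (size R).-1)%N.
  case/cycleP: xy => t /(congr1 val); rewrite FinRing.zmodXgE Zp_mulrn /= => e.
  have : (k %| (size R).-1 %% n)%N by rewrite e /dvdn modn_dvdm // -/(dvdn _ _) dvdn_mulr // dvdn_gcdr.
  by rewrite /dvdn modn_dvdm.
have [W sW cW] := blk_W bk.
pose F j := cproj (- j) *: W.
have [s Gs s0|U eU] := @mG_fix _ _ _ _ _ m F.
  rewrite [RHS](reindex_inj (mG_inj Gs)); apply: eq_bigr => j _ /=; rewrite /F.
  by have := inA_cproj.1 s Gs 0 j; rewrite s0 !sub0r => ->.
have [|sU Uk] := lead_fam (D := k) eU.
  by move=> j; rewrite /F (leq_trans (size_scale_leq _ _)) // sW.
have eUi i : ev U i = \sum_j ev W j * mi m (cproj (i - j)).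
  have := rel_fam eU (mG_shifts i); rewrite add0r => <-.
  rewrite [RHS](reindex_inj (addIr i)); apply: eq_bigr => j _ /=.
  by rewrite /F evZ mulrC [j + i]addrC opprD addNKr.
have cU : bconst k U.
  move=> i j ij; rewrite -(add0r i) -(add0r j) -(rel_fam eU (mG_shifts i)) -(rel_fam eU (mG_shifts j)).
  apply: eq_bigr => l _; rewrite /F !evZ; congr (_ * _); apply: cW.
  by rewrite opprD addrACA subrr add0r.
have Wk : W`_k != 0 by rewrite -[k]/(k.+1.-1) -sW -lead_coefE lead_coef_eq0 -size_poly_eq0 sW.
have UWk : U`_k = W`_k.
  rewrite Uk -[RHS]mulr1 -fk /four mulr_sumr; apply: eq_bigr => j _.
  rewrite /F coefZ cproj_sym /chi.
  have -> : z ^+ (j * (inZp k : I)) = z ^+ (j * k) by rewrite /= !(mulnC j) !exprM prim_expr_mod.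
  by ring.
exists k, U; split=> //.
  apply/eqP; rewrite eqn_leq sU ltnNge; apply/negP => /leq_sizeP/(_ k (leqnn k)) /eqP.
  by rewrite UWk (negPf Wk).
rewrite (_ : (fun j => ev U j) = (fun i => \sum_j ev W j * mi m (cproj (i - j)))); last exact: funext.
apply: (@perp_sum _ _ (index_enum _) predT (fun j => ev W j) (fun j i => mi m (cproj (i - j)))) => j _.
by apply: perp_map; apply: perp_col.
Qed.

Lemma bconst_P k : bconst k P.
Proof. by move=> i j _; rewrite (m_P m i) (m_P m j). Qed.

(** The change of variables w = W(x) makes every moment an integral with coinciding end points. *)
Lemma perp_comp_poly (A W : {poly K}) : P != 0 -> P.[a] = 0 -> P.[b] = 0 -> (exists Phi, P = Phi \Po W) -> W.[a] = W.[b] ->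
  allmom a b P (A \Po W).
Proof.
move=> P0 Pa Pb [Phi eP] Wab j; rewrite /mom deriv_comp eP -(rmorphXn (comp_poly W)) mulrA -comp_polyM.
have e : (prim (Phi ^+ j * A^`()) \Po W)^`() = ((Phi ^+ j * A^`()) \Po W) * W^`().
  rewrite deriv_comp; congr ((_ \Po _) * _); apply/polyP => i.
  rewrite coef_deriv coef_prim /= -[_ *+ _]mulr_natr divfK //.
  by rewrite (natr_c0 charK).
by rewrite -e (pint_deriv charK) !horner_comp Wab subrr.
Qed.

(* evaluation at the points [x_i] separates the fibres of [Q], so all weighted fibre sums vanish *)
Lemma interp (Q : {poly K}) (w : I -> mL m) : (forall i j, ev Q i = ev Q j -> w i = w j) ->
  exists F : {poly mL m}, forall i, F.[ev Q i] = w i.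
Proof.
move=> hw; suff h (s : seq I) : exists F : {poly mL m}, forall i, i \in s -> F.[ev Q i] = w i.
  by have [F hF] := h (enum I); exists F => i; apply: hF; rewrite mem_enum.
elim: s => [|i s [F hF]]; first by exists 0.
have [/hasP[j js /eqP e]|no] := boolP (has (fun j => ev Q j == ev Q i) s).
  by exists F => l; rewrite inE => /predU1P[->|/hF//]; rewrite -e hF // (hw _ _ e).
pose T : {poly mL m} := \prod_(j <- s) ('X - (ev Q j)%:P).
have T0 : T.[ev Q i] != 0.
  rewrite horner_prod prodf_seq_neq0; apply/allP => j js /=; rewrite hornerXsubC subr_eq0.
  by apply: contra no => /eqP e; apply/hasP; exists j => //; rewrite e.
exists (F + ((w i - F.[ev Q i]) / T.[ev Q i]) *: T) => l; rewrite hornerD hornerZ inE => /predU1P[->|ls].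
  by rewrite divfK // addrC subrK.
have T1 : T.[ev Q l] = 0.
  by apply/eqP; rewrite horner_prod prodf_seq_eq0; apply/hasP; exists l => //=; rewrite hornerXsubC subrr.
by rewrite hF // T1 mulr0 addr0.
Qed.

Lemma subgroup_dvd (H : pred I) : H 0 -> (forall i j, H i -> H j -> H (i - j)) ->
  exists k, [/\ (0 < k)%N, (k %| n)%N & forall i, H i = (n %/ k %| i)%N].
Proof.
move=> H0 HB; have HN i : H i -> H (- i) by move=> Hi; rewrite -sub0r; apply: HB.
have HD i j : H i -> H j -> H (i + j) by move=> Hi Hj; rewrite -[j]opprK; apply: HB => //; apply: HN.
have Hn i t : H i -> H (i *+ t) by move=> Hi; elim: t => [|t IH]; rewrite ?mulr0n // mulrS HD.
pose A q := [&& (0 < q)%N, (q %| n)%N & H (inZp q)].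
have exA : exists q, A q.
  by exists n; rewrite /A dvdnn /= (_ : inZp n = 0) //; apply: val_inj; rewrite /= modnn.
case: (ex_minnP exA) => q /and3P[q0 qn Hq] min.
have qk : (n %/ (n %/ q) = q)%N.
  by case/dvdnP: qn => t e; rewrite e mulnK // mulKn //; case: t e.
exists (n %/ q)%N; split; [by rewrite divn_gt0 // dvdn_leq|by apply: dvdn_div|].
move=> i; rewrite qk; apply/idP/idP => [Hi|/dvdnP[t e]]; last first.
  have -> : i = inZp q *+ t; last exact: Hn.
  by apply: val_inj; rewrite Zp_mulrn /= modnMml mulnC -e modn_small.
have g0 : (0 < gcdn q i)%N by rewrite gcdn_gt0 q0.
have gn : (gcdn q i %| n)%N := dvdn_trans (dvdn_gcdl _ _) qn.
have [t _ ht] := Bezoutl i q0.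
have Hg : H (inZp (gcdn q i)).
  have -> : (inZp (gcdn q i) : I) = (inZp q *+ ((gcdn q i + t * i) %/ q)) - i *+ t.
    apply/eqP; rewrite eq_sym subr_eq; apply/eqP/val_inj; rewrite /= !Zp_mulrn /= modnMml modnDm.
    by rewrite mulnC divnK // [(i * t)%N]mulnC.
  by apply: HB; apply: Hn.
have /min le : A (gcdn q i) by rewrite /A g0 gn Hg.
have -> : q = gcdn q i by apply/eqP; rewrite eqn_leq le dvdn_leq ?dvdn_gcdl.
exact: dvdn_gcdr.
Qed.

Definition CC (P Q : {poly K}) := exists A B W, [/\ P = A \Po W, Q = B \Po W & W.[a] = W.[b]].

(** The branches on which Q takes its value at branch 0 form a block; let W be its polynomial. On
    the branches W is a polynomial in Q, by interpolation over the splitting field, and the relation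
    [mf] annihilates every power of Q. So it annihilates W, and W(a) = W(b). This provides
    polynomial equations for the Composition Condition. *)
Theorem bimoment_CC Q : (forall j, allmom a b P (Q ^+ j)) -> CC P Q.
Proof.
move=> MQ; pose H i := ev Q i == ev Q 0.
have sh i j t : ev Q i = ev Q j -> ev Q (i + t) = ev Q (j + t).
  move=> e; have := @mG_rel _ _ _ _ _ m (fun l => l + t) (fun l => (if l == i then Q else 0) - (if l == j then Q else 0)) (mG_shifts t).
  have d (s : I -> I) : \sum_l ev ((if l == i then Q else 0) - (if l == j then Q else 0)) (s l) = ev Q (s i) - ev Q (s j).
    under eq_bigr do rewrite evB; rewrite sumrB; congr (_ - _).
      by rewrite (bigD1 i) //= eqxx big1 ?addr0 // => l /negPf ->; rewrite ev0.
    by rewrite (bigD1 j) //= eqxx big1 ?addr0 // => l /negPf ->; rewrite ev0.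
  by rewrite (d id) d e subrr => /(_ erefl)/eqP; rewrite subr_eq0 => /eqP.
have HE i j : (ev Q i == ev Q j) = H (i - j).
  apply/eqP/eqP => [/(sh _ _ (- j))|/(sh _ _ j)]; rewrite ?subrr // subrK add0r //.
have [||k [k0 kn Hk]] := @subgroup_dvd H.
- by rewrite /H.
- move=> i j /eqP Hi /eqP Hj; rewrite -HE Hi Hj //.
have bk : blk k.
  split=> // s Gs i j; rewrite -!Hk -!HE.
  have tr s' i' j' : G s' -> ev Q i' = ev Q j' -> ev Q (s' i') = ev Q (s' j').
    move=> Gs' e; have := @mG_rel _ _ _ _ _ m s' (fun l => (if l == i' then Q else 0) - (if l == j' then Q else 0)) Gs'.
    have d (t : I -> I) : \sum_l ev ((if l == i' then Q else 0) - (if l == j' then Q else 0)) (t l) = ev Q (t i') - ev Q (t j').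
      under eq_bigr do rewrite evB; rewrite sumrB; congr (_ - _).
        by rewrite (bigD1 i') //= eqxx big1 ?addr0 // => l /negPf ->; rewrite ev0.
      by rewrite (bigD1 j') //= eqxx big1 ?addr0 // => l /negPf ->; rewrite ev0.
    by rewrite (d id) d e subrr => /(_ erefl)/eqP; rewrite subr_eq0 => /eqP.
  have [t [Gt st ts]] := mG_inv Gs.
  by apply/eqP/eqP => [/(tr _ _ _ Gt)|/(tr _ _ _ Gs)]; rewrite ?st.
have [W sW cW] := blk_W bk.
have cQ : bconst k Q by move=> i j; rewrite -Hk -HE => /eqP.
have [A eA] := blk_factor bk sW cW (bconst_P (k := k)).
have [B eB] := blk_factor bk sW cW cQ.
exists A, B, W; split=> //; apply: (mf_end (m := m)).
have [F hF] := interp (Q := Q) (w := fun i => ev W i) (fun i j e => cW i j (etrans (esym (Hk _)) (etrans (esym (HE i j)) (introT eqP e)))).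
under eq_bigr do rewrite -hF horner_coef mulr_sumr.
rewrite exchange_big big1 //= => t _.
under eq_bigr do rewrite mulrCA -evXn.
by rewrite -mulr_sumr (mf_mom m (MQ t)) mulr0.
Qed.

(** Two right factors of P with coprime degrees a1 < a2 over a common right factor V of degree g
    that does not close up, while the smaller of the two does; k is the remaining cofactor of the
    degree. *)
Definition Struct P a1 a2 g k := exists V A1 A2 F1 F2 : {poly K},
  [/\ [/\ size V = g.+1, V.[a] != V.[b], size A1 = a1.+1 & size A2 = a2.+1],
      [/\ coprime a1 a2, (1 < a1)%N & (a1 < a2)%N],
      A1.[V.[a]] = A1.[V.[b]],
      P = F1 \Po (A1 \Po V) /\ P = F2 \Po (A2 \Po V) & (size P).-1 = (k * a1 * a2 * g)%N].

Definition closing k := blk k /\ exists2 W : {poly K}, size W = k.+1 & bconst k W /\ W.[a] = W.[b].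

Lemma closing_pair k1 k2 : closing k1 -> closing k2 -> ~ closing (gcdn k1 k2) -> (k1 < k2)%N ->
  (1 < k1 %/ gcdn k1 k2)%N ->
  let g := gcdn k1 k2 in Struct P (k1 %/ g) (k2 %/ g) g (n %/ (k1 %/ g * k2)).
Proof.
move=> [b1 [W1 s1 [c1 e1]]] [b2 [W2 s2 [c2 e2]]] nc lt lt1 g.
have [p1 d1 _] := b1; have [p2 d2 _] := b2.
have g0 : (0 < g)%N by rewrite gcdn_gt0 p1.
have bg := blk_gcd b1 b2; have [V sV cV] := blk_W bg.
have [A1 eA1] := blk_factor bg sV cV (bconst_dvd d1 g0 (dvdn_gcdl k1 k2) c1).
have [A2 eA2] := blk_factor bg sV cV (bconst_dvd d2 g0 (dvdn_gcdr k1 k2) c2).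
have [F1 eF1] := blk_factor b1 s1 c1 (bconst_P (k := k1)).
have [F2 eF2] := blk_factor b2 s2 c2 (bconst_P (k := k2)).
have szA (A W : {poly K}) k : size W = k.+1 -> (0 < k)%N -> W = A \Po V -> (g %| k)%N -> size A = (k %/ g).+1.
  move=> sW kk e gk; have := size_comp_poly A V; rewrite -e sW sV /= => ->; rewrite mulnK // prednK //.
  by rewrite size_poly_gt0; apply: contraTneq kk => A0; move: sW; rewrite e A0 comp_poly0 size_poly0.
exists V, A1, A2, F1, F2; split.
- split=> //.
  + by apply/negP => /eqP eV; apply: nc; split=> //; exists V.
  + by apply: szA eA1 _ => //; apply: dvdn_gcdl.
  + by apply: szA eA2 _ => //; apply: dvdn_gcdr.
- split=> //; last by rewrite ltn_divLR ?dvdn_gcdl // divnK ?dvdn_gcdr.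
  by rewrite /coprime -(eqn_pmul2r g0) mul1n muln_gcdl !divnK ?dvdn_gcdl ?dvdn_gcdr.
- by rewrite -!horner_comp -eA1.
- by rewrite -eA1 -eA2.
rewrite sP /= -!mulnA divnK ?dvdn_gcdr // divnK //.
have -> : (k1 %/ g * k2 = lcmn k1 k2)%N by rewrite /lcmn divn_mulAC ?dvdn_gcdl.
by rewrite dvdn_lcm d1.
Qed.

Definition mid : K := (a + b) / 2%:R.
Definition refl_pt : {poly K} := (a + b)%:P - 'X.
Definition even_mid (E : {poly K}) := E \Po refl_pt = E.
Definition odd_mid (E : {poly K}) := E \Po refl_pt = - E.
Definition good4 a1 g k := ~ [/\ a1 = 2, g = 1 & k = 1]%N.
(** The structures with (a1, g, k) = (2, 1, 1), excluded by [good4], have too many parameters. There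
    P is a multiple of the square of a W odd about the midpoint, and Q splits into an even part and
    a polynomial in W. *)
Definition Exc P Q := exists W c E B, [/\ P = c *: W ^+ 2, odd_mid W, (2 < size W)%N, Q = E + (B \Po W) & even_mid E].

Lemma closing_factor' R : R != 0 -> perp (fun j => ev R j) ->
  exists k (W : {poly K}), [/\ closing k, (k %| (size R).-1)%N, size W = k.+1, bconst k W & W.[a] = W.[b]].
Proof.
move=> R0 pR; have [k [W [bk kd sW cW pW]]] := closing_factor R0 pR.
by exists k, W; split=> //; [split=> //; exists W => //; split=> //; apply: perp_end|apply: perp_end].
Qed.

Lemma closing_n : P.[a] = 0 -> P.[b] = 0 -> closing n.
Proof.
move=> Pa Pb; split; last by exists P => //; split; [apply: bconst_P|rewrite Pa Pb].
by split=> // s Gs i j; rewrite divnn /= !dvd1n.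
Qed.

Section Peel.
Hypotheses (Pa : P.[a] = 0) (Pb : P.[b] = 0).
Let P0 : P != 0. Proof. by rewrite -size_poly_gt0 sP. Qed.

(** A closing factor W of degree dividing deg R exists, so a multiple of a power of W cancels the
    leading term and still has vanishing moments. Hence R is a sum of polynomials in closing
    factors. *)
Lemma peel (C : {poly K} -> Prop) : C 0 -> (forall x y, C x -> C y -> C (x + y)) ->
  (forall k (W A : {poly K}), closing k -> size W = k.+1 -> bconst k W -> W.[a] = W.[b] -> C (A \Po W)) ->
  forall R, allmom a b P R -> C R.
Proof.
move=> C0 CD CW R; have [s] := ubnP (size R); elim: s R => // s IH R; rewrite ltnS => sR MR.
have [->//|R0] := eqVneq R 0.
have [k [W [ck /dvdnP[t Dt] sW cW eW]]] := closing_factor' R0 (allmom_perp MR).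
have k0 : (0 < k)%N by case: ck => -[].
have W0 : W != 0 by rewrite -size_poly_gt0 sW.
have sR0 : (0 < size R)%N by rewrite size_poly_gt0.
have sWt : size (W ^+ t) = size R.
  have := size_exp W t; rewrite sW /= mulnC -Dt => e.
  by rewrite -(prednK sR0) -e prednK // size_poly_gt0 expf_neq0.
pose c := lead_coef R / lead_coef (W ^+ t).
have eWt : c *: W ^+ t = (c *: 'X^t) \Po W by rewrite comp_polyZ comp_Xn_poly.
rewrite -(subrK (c *: W ^+ t) R); apply: (CD); last by rewrite eWt; apply: CW ck _ _ _.
apply: IH; last first.
  move=> j; rewrite raddfB /= MR eWt (perp_comp_poly _ P0 Pa Pb _ eW) ?subrr //.
  by apply: (blk_factor ck.1 sW cW); apply: bconst_P.
apply: leq_trans sR; rewrite -(prednK sR0) ltnS; apply/leq_sizeP => i; rewrite leq_eqVlt => /orP[/eqP <-|iD].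
  rewrite coefB coefZ /c -[in X in _ - _ * X]sWt -!lead_coefE divfK ?subrr // lead_coef_eq0 expf_neq0 //.
by rewrite coefB coefZ !nth_default ?mulr0 ?subrr // ?sWt -(prednK sR0).
Qed.

Lemma quadE (W : {poly K}) : size W = 3%N -> exists u v w : K, u != 0 /\ W = u%:P * 'X^2 + v%:P * 'X + w%:P.
Proof.
move=> sW; exists W`_2, W`_1, W`_0; split.
  by rewrite -[2%N]/(3.-1) -sW -lead_coefE lead_coef_eq0 -size_poly_eq0 sW.
apply/polyP => i; rewrite !coefD !coefCM coefXn coefX coefC.
case: i => [|[|[|i]]]; rewrite /= ?mulr0 ?mulr1 ?addr0 ?add0r //.
by rewrite nth_default // sW.
Qed.

Lemma even_quad (W : {poly K}) : size W = 3%N -> W.[a] = W.[b] -> a != b -> even_mid W.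
Proof.
move=> sW eW ab; rewrite /even_mid /refl_pt; have [u [v [w [_ eWq]]]] := quadE sW.
have h : u * (a + b) + v = 0.
  have ab' : a - b != 0 by rewrite subr_eq0.
  apply: (mulIf ab'); rewrite mul0r; transitivity (W.[a] - W.[b]); last by rewrite eW subrr.
  by rewrite eWq !(hornerD, hornerM, hornerC, hornerX, hornerXn); ring.
have h1 : v = - (u * (a + b)) by apply/eqP; rewrite -addr_eq0 addrC h.
rewrite eWq h1 !comp_polyD !comp_polyM !comp_polyC ?comp_polyX ?comp_Xn_poly !polyCN !polyCM !polyCD; ring.
Qed.

Lemma even_comp (A W : {poly K}) : even_mid W -> even_mid (A \Po W).
Proof. by rewrite /even_mid -comp_polyA => ->. Qed.

(** Let k0 be the least closing degree. If it divides all closing degrees, every peeled term is a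
    polynomial in the factor of degree k0, which is composition. Otherwise some closing degree k2 is
    not a multiple of k0, and by minimality gcd(k0, k2) does not close, which produces a
    [Struct]. *)
Theorem moment_dichotomy Q : a != b -> allmom a b P Q ->
  [\/ CC P Q, (exists a1 a2 g k, Struct P a1 a2 g k /\ good4 a1 g k) | Exc P Q].
Proof.
move=> ab MQ.
have c1 : ~ closing 1.
  case=> _ [W sW [_ eW]]; have W1 : W`_1 != 0 by rewrite -[1%N]/(2.-1) -sW -lead_coefE lead_coef_eq0 -size_poly_eq0 sW.
  have e : W = (W`_1)%:P * 'X + (W`_0)%:P.
    apply/polyP => i; rewrite !coefD !coefCM coefX coefC.
    by case: i => [|[|i]]; rewrite /= ?mulr0 ?mulr1 ?addr0 ?add0r // nth_default // sW.
  move/eqP: eW; rewrite e !hornerE (inj_eq (addIr _)) -subr_eq0 -mulrBr mulf_eq0 (negPf W1) subr_eq0 /=.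
  by rewrite (negPf ab).
have exA : exists k, `[< closing k >] by exists n; apply/asboolP; apply: closing_n.
case: (ex_minnP exA) => k0 /asboolP ck0 min.
have [b0 [W0 s0 [cW0 e0]]] := ck0; have [p0 d0 _] := b0.
have [all|/existsNP[k2 /not_implyP[ck2 nd]]] := pselect (forall k, closing k -> (k0 %| k)%N).
  constructor 1; have [B eB] : exists B, Q = B \Po W0.
    apply: (peel (C := fun R => exists B, R = B \Po W0)) MQ.
    - by exists 0; rewrite comp_poly0.
    - by move=> x y [A ->] [B ->]; exists (A + B); rewrite comp_polyD.
    - move=> k W A ck sW cW eW; have [b1 _] := ck; have [_ dk _] := b1.
      have [B eB] := blk_factor b0 s0 cW0 (bconst_dvd dk p0 (all _ ck) cW).
      by exists (A \Po B); rewrite eB comp_polyA.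
  have [A eA] := blk_factor b0 s0 cW0 (bconst_P (k := k0)).
  by exists A, B, W0.
have [b2 _] := ck2; have [p2 d2 _] := b2.
have lt02 : (k0 < k2)%N.
  rewrite ltn_neqAle min ?andbT; last by apply/asboolP.
  by apply/eqP => e; apply: nd; rewrite e.
have gk0 : (gcdn k0 k2 < k0)%N.
  rewrite ltn_neqAle dvdn_leq ?dvdn_gcdl // andbT; apply/eqP => e; apply: nd; rewrite -e; exact: dvdn_gcdr.
have g0 : (0 < gcdn k0 k2)%N by rewrite gcdn_gt0 p0.
have ncg : ~ closing (gcdn k0 k2) by move=> cg; move: gk0; rewrite ltnNge min //; apply/asboolP.
have l1 : (1 < k0 %/ gcdn k0 k2)%N by rewrite ltn_divRL ?dvdn_gcdl // mul1n.
have S1 := closing_pair ck0 ck2 ncg lt02 l1.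
have [[e1 e2 e3]|gd] := pselect [/\ k0 %/ gcdn k0 k2 = 2, gcdn k0 k2 = 1 & n %/ (k0 %/ gcdn k0 k2 * k2) = 1]%N; last first.
  by constructor 2; do 4 eexists; split; [exact: S1|exact: gd].
have k02 : (k0 = 2)%N by rewrite -(divnK (dvdn_gcdl k0 k2)) e1 e2.
have n2 : (n = 2 * k2)%N.
  have := closing_pair ck0 ck2 ncg lt02 l1; case=> V [A1 [A2 [F1 [F2 [_ _ _ _]]]]].
  by rewrite sP e3 e1 e2 divn1 muln1 mul1n /=.
subst k0.
have k2odd : odd k2 by apply/negPn/negP => h; apply: nd; rewrite dvdn2.
have evW0 := even_quad s0 e0 ab.
have [good|ngood] := pselect (exists a1 a2 g k, Struct P a1 a2 g k /\ good4 a1 g k); first by constructor 2.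
(* Another odd closing degree would pair with 2 to give a [Struct] outside the excluded pattern. *)
have odd_k k : closing k -> odd k -> (k = k2)%N.
  move=> ck ok; have [bk _] := ck; have [pk dk _] := bk.
  have g1 : gcdn 2 k = 1%N by apply/eqP; rewrite -/(coprime 2 k) coprime2n.
  have lk : (2 < k)%N.
    have : (2 <= k)%N by apply: min; apply/asboolP.
    by rewrite leq_eqVlt => /predU1P[e|//]; move: ok; rewrite -e.
  have := @closing_pair 2 k ck0 ck; rewrite g1 => /(_ c1 lk isT) /= S2.
  apply: contrapT => ne; apply: ngood; do 4 eexists; split; first exact: S2.
  rewrite /good4 !divn1 => -[_ _ e4]; apply: ne; case: S2 => V [A1 [A2 [F1 [F2 [_ _ _ _]]]]].
  rewrite sP /= !divn1 e4 muln1 mul1n => e5; apply/eqP; by rewrite -(eqn_pmul2l (isT : 0 < 2)%N) -e5 n2.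
have [_ [W2 s2 [cW2 ew2]]] := ck2.
have [A eA] := blk_factor b2 s2 cW2 (bconst_P (k := k2)).
have [F0 eF0] := blk_factor b0 s0 cW0 (bconst_P (k := 2%N)).
have evP : even_mid P by rewrite eF0; apply: even_comp.
have sA : size A = 3%N.
  have := size_comp_poly A W2; rewrite -eA sP s2 /= n2 => /eqP; rewrite eqn_pmul2r // => /eqP e.
  by rewrite -(prednK (_ : 0 < size A)%N) -?e // size_poly_gt0; apply: contraNneq P0 => A0; rewrite eA A0 comp_poly0.
have [u [v [w1 [u0 eAq]]]] := quadE sA.
(* Completing the square in the quadratic left factor. *)
pose w : K := v / (2%:R * u); pose W := W2 + w%:P.
have n2K : (2%:R : K) != 0 by rewrite (natr_c0 charK).
pose c0 := w1 - u * (w * w).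
have ePW : P = u%:P * W ^+ 2 + c0%:P.
  have e1w : v%:P = 2%:R * u%:P * w%:P :> {poly K}.
    by rewrite -polyC_natr -!polyCM /w; congr (_%:P); field; rewrite n2K u0.
  rewrite [LHS]eA eAq !comp_polyD !comp_polyM !comp_polyC ?comp_polyX ?comp_Xn_poly e1w /W /c0 polyCB !polyCM; ring.
have sW : size W = k2.+1.
  by rewrite /W size_polyDl // s2 (leq_ltn_trans (size_polyC_leq1 _)) // ltnS.
have eW2 : W2 = W - w%:P by rewrite /W addrK.
have Wba : W.[b] = W.[a] by rewrite /W !hornerD !hornerC ew2.
clearbody W.
(* Reflection fixes P, hence W up to sign. The degree is odd, so the leading coefficient changes
   sign and W is odd; this also gives W(a) = 0 and removes the constant [c0]. *)
have oddW : odd_mid W.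
  have : (W \Po refl_pt) ^+ 2 = W ^+ 2.
    have A2p : u%:P != 0 :> {poly K} by rewrite polyC_eq0.
    apply: (mulfI A2p); apply: (addIr c0%:P); rewrite -ePW -[RHS]evP ePW.
    by rewrite [RHS]comp_polyD [in RHS]comp_polyM !comp_polyC [in RHS](rmorphXn (comp_poly refl_pt)).
  move/eqP; rewrite eqf_sqr => /orP[/eqP h|/eqP //].
  have : lead_coef (W \Po refl_pt) = - lead_coef W.
    rewrite lead_coef_comp; last by rewrite /refl_pt -opprB size_polyN size_XsubC.
    rewrite /refl_pt -opprB lead_coefN lead_coefXsubC sW /= -signr_odd k2odd; ring.
  rewrite h => /eqP; rewrite -subr_eq0 opprK -mulr2n -mulr_natl mulf_eq0 (negPf n2K) lead_coef_eq0 /= => /eqP W00.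
  by rewrite W00 size_poly0 in sW.
have Wa : W.[a] = 0.
  have := congr1 (fun p => p.[a]) oddW; rewrite /= horner_comp /refl_pt hornerD hornerN hornerC hornerX hornerN [a + b]addrC addrK.
  rewrite Wba; move/eqP; rewrite -subr_eq0 opprK -mulr2n -mulr_natl mulf_eq0 (negPf n2K) /= => /eqP //.
have c00 : c0 = 0 by move: Pa; rewrite ePW hornerD hornerM horner_exp Wa !hornerC expr0n mulr0 add0r.
(* Peeled terms are sorted by the parity of the closing degree: even degrees give polynomials in
   [W0], even about the midpoint, and the only odd degree [k2] gives polynomials in W. *)
have [E [B [eQ eE]]] : exists E B, Q = E + (B \Po W) /\ even_mid E.
  apply: (peel (C := fun R => exists E B, R = E + (B \Po W) /\ even_mid E)) MQ.
  - by exists 0, 0; rewrite comp_poly0 add0r /even_mid comp_poly0.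
  - move=> x y [E1 [B1 [-> h1]]] [E2 [B2 [-> h2]]]; exists (E1 + E2), (B1 + B2); split.
      by rewrite comp_polyD; ring.
    by rewrite /even_mid comp_polyD h1 h2.
  - move=> k Wk Ak ck sWk cWk eWk; have [bk _] := ck; have [pk dk _] := bk.
    have [ok|ek] := boolP (odd k).
      have [B eB] : exists B, Wk = B \Po W2 by rewrite (odd_k _ ck ok) in cWk; apply: blk_factor cWk.
      exists 0, ((Ak \Po B) \Po ('X - w%:P)); split; last by rewrite /even_mid comp_poly0.
      by rewrite add0r eB -!comp_polyA comp_polyB comp_polyX comp_polyC -eW2.
    have d2k : (2 %| k)%N by rewrite dvdn2.
    have [B eB] := blk_factor b0 s0 cW0 (bconst_dvd dk (isT : 0 < 2)%N d2k cWk).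
    exists (Ak \Po Wk), 0; rewrite comp_poly0 addr0; split=> //; apply: even_comp.
    by rewrite eB; apply: even_comp.
constructor 3; exists W, u, E, B; split=> //; last by rewrite sW !ltnS (leq_trans _ lt02).
by rewrite ePW c00 addr0 mul_polyC.
Qed.
End Peel.
End Blocks.
End BlockSystems.

(** * Functions of finitely many parameters and algebraic dependence *)

Module FiniteGeneration.
Import all_boot all_order all_algebra.
Import boolp ring.
Set Implicit Arguments. Unset Strict Implicit. Unset Printing Implicit Defensive.
Import GRing.Theory.
Local Open Scope ring_scope.

Section Gen.
Variables (X : Type) (K : fieldType) (J0 : finType) (h : J0 -> X -> K).

Inductive gen : (X -> K) -> Prop :=
| gen_const c : gen (fun=> c)
| gen_var i : gen (h i)
| gen_add f g : gen f -> gen g -> gen (fun x => f x + g x)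
| gen_mul f g : gen f -> gen g -> gen (fun x => f x * g x).

Lemma gen_ext f g : (forall x, f x = g x) -> gen f -> gen g.
Proof. by move=> /funext ->. Qed.
Lemma gen_sum (J : Type) (s : seq J) (p : pred J) (f : J -> X -> K) : (forall j, p j -> gen (f j)) ->
  gen (fun x => \sum_(j <- s | p j) f j x).
Proof.
move=> hf; elim: s => [|j s IH]; first by apply: gen_ext (gen_const 0) => x; rewrite big_nil.
case pj: (p j); last by apply: gen_ext IH => x; rewrite big_cons pj.
by apply: gen_ext (gen_add (hf j pj) IH) => x; rewrite big_cons pj.
Qed.
Lemma gen_exp f k : gen f -> gen (fun x => f x ^+ k).
Proof.
move=> hf; elim: k => [|k IH]; first by apply: gen_ext (gen_const 1) => x; rewrite expr0.
by apply: gen_ext (gen_mul hf IH) => x; rewrite exprS.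
Qed.
Lemma gen_scale c f : gen f -> gen (fun x => c * f x).
Proof. exact: gen_mul (gen_const c). Qed.
Lemma gen_sub f g : gen f -> gen g -> gen (fun x => f x - g x).
Proof. by move=> hf hg; apply: gen_ext (gen_add hf (gen_scale (-1) hg)) => x; rewrite mulN1r. Qed.

Definition monom E (be : {ffun J0 -> 'I_E.+1}) x := \prod_i h i x ^+ be i.
Definition sp E (f : X -> K) := exists c : {ffun J0 -> 'I_E.+1} -> K, forall x, f x = \sum_be c be * monom be x.

Lemma sp_ext E f g : (forall x, f x = g x) -> sp E f -> sp E g.
Proof. by move=> /funext ->. Qed.
Lemma sp_add E f g : sp E f -> sp E g -> sp E (fun x => f x + g x).
Proof.
move=> [c hc] [d hd]; exists (fun be => c be + d be) => x.
by rewrite hc hd -big_split; apply: eq_bigr => be _; rewrite mulrDl.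
Qed.
Lemma sp_scale E a f : sp E f -> sp E (fun x => a * f x).
Proof.
move=> [c hc]; exists (fun be => a * c be) => x.
by rewrite hc mulr_sumr; apply: eq_bigr => be _; rewrite mulrA.
Qed.
Lemma sp_0 E : sp E (fun=> 0).
Proof. by exists (fun=> 0) => x; rewrite big1 // => be _; rewrite mul0r. Qed.
Lemma sp_sum E (J : Type) (s : seq J) (f : J -> X -> K) : (forall j, sp E (f j)) -> sp E (fun x => \sum_(j <- s) f j x).
Proof.
move=> hf; elim: s => [|j s IH]; first by apply: sp_ext (sp_0 E) => x; rewrite big_nil.
by apply: sp_ext (sp_add (hf j) IH) => x; rewrite big_cons.
Qed.
Lemma sp_monom E (al : J0 -> nat) : (forall i, (al i <= E)%N) -> sp E (fun x => \prod_i h i x ^+ al i).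
Proof.
move=> le; pose be : {ffun J0 -> 'I_E.+1} := [ffun i => inord (al i)]; exists (fun b => (b == be)%:R) => x.
rewrite (bigD1 be) // eqxx mul1r [X in _ = _ + X]big1 ?addr0; last by move=> b /negPf ->; rewrite mul0r.
by apply: eq_bigr => i _; rewrite ffunE inordK // ltnS.
Qed.
Lemma sp_mul E1 E2 f g : sp E1 f -> sp E2 g -> sp (E1 + E2) (fun x => f x * g x).
Proof.
move=> [c hc] [d hd].
apply: (@sp_ext _ (fun x => \sum_be \sum_ga (c be * d ga) * \prod_i h i x ^+ (be i + ga i))).
  move=> x; rewrite hc hd mulr_suml; apply: eq_bigr => be _; rewrite mulr_sumr; apply: eq_bigr => ga _.
  rewrite /monom mulrACA -big_split /=; congr (_ * _); apply: eq_bigr => i _; exact: exprD.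
apply: sp_sum => be; apply: sp_sum => ga; apply: sp_scale; apply: sp_monom => i.
by rewrite leq_add // -ltnS.
Qed.
Lemma sp_const E c : sp E (fun=> c).
Proof.
apply: (@sp_ext _ (fun x => c * \prod_i h i x ^+ 0)); last by apply: sp_scale; apply: (@sp_monom E (fun=> 0%N)).
by move=> x; rewrite big1 ?mulr1.
Qed.
Lemma sp_mono E E' f : (E <= E')%N -> sp E f -> sp E' f.
Proof.
move=> le hf; rewrite -(subnK le) addnC; apply: sp_ext (sp_mul hf (sp_const (E' - E) 1)) => x.
by rewrite mulr1.
Qed.
Lemma gen_sp f : gen f -> exists E, sp E f.
Proof.
elim=> [c|i|f1 f2 _ [E1 s1] _ [E2 s2]|f1 f2 _ [E1 s1] _ [E2 s2]].
- by exists 0%N; apply: sp_const.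
- exists 1%N; apply: (@sp_ext _ (fun x => \prod_j h j x ^+ (j == i))); last first.
    by apply: sp_monom => j; case: (_ == _).
  by move=> x; rewrite (bigD1 i) //= eqxx expr1 big1 ?mulr1 // => j /negPf ->.
- exists (E1 + E2)%N; apply: sp_add; [apply: sp_mono s1; apply: leq_addr|apply: sp_mono s2; apply: leq_addl].
- by exists (E1 + E2)%N; apply: sp_mul.
Qed.
Lemma sp_exp E f k : sp E f -> sp (k * E) (fun x => f x ^+ k).
Proof.
move=> hf; elim: k => [|k IH]; first by apply: sp_ext (sp_const _ 1) => x; rewrite expr0.
by rewrite mulSn; apply: sp_ext (sp_mul hf IH) => x; rewrite exprS.
Qed.

(* the monomials in the [f j] outnumber the box of monomials containing them *)
Theorem gen_dependent k (f : 'I_k -> X -> K) : (#|J0| < k)%N -> (forall j, gen (f j)) ->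
  exists B (e : {ffun 'I_k -> 'I_B} -> K), (exists al, e al != 0) /\
    forall x, \sum_al e al * \prod_j f j x ^+ al j = 0.
Proof.
move=> rk gf.
have /choice[E0 hE0] j : exists E, sp E (f j) by apply: gen_sp.
pose E := (\max_j E0 j)%N.
have hE j : sp E (f j) by apply: sp_mono (hE0 j); apply: leq_bigmax.
(* B exceeds (kE+1)^r, r the number of parameters. As D+1 <= B (kE+1), the (D+1)^r available
   monomials are fewer than B^(r+1) <= B^k, the number of monomials in the f_j. *)
pose B := ((k * E).+1 ^ #|J0|).+1; pose D := (k * (B * E))%N.
have hm (al : {ffun 'I_k -> 'I_B}) : sp D (fun x => \prod_j f j x ^+ al j).
  have : sp (\sum_(j <- index_enum 'I_k) al j * E) (fun x => \prod_(j <- index_enum 'I_k) f j x ^+ al j).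
    elim: (index_enum _) => [|j s IH]; first by apply: sp_ext (sp_const _ 1) => x; rewrite big_nil.
    rewrite big_cons; apply: sp_ext (sp_mul (sp_exp (al j) (hE j)) IH) => x; by rewrite big_cons.
  apply: sp_mono; apply: leq_trans (_ : \sum_(j < k) B * E <= _)%N; last by rewrite sum_nat_const card_ord.
  by apply: leq_sum => j _; rewrite leq_mul2r ltnW ?orbT // ltn_ord.
have /choice[c hc] := hm.
pose T1 := {ffun 'I_k -> 'I_B}; pose T2 := {ffun J0 -> 'I_D.+1}.
pose M : 'M[K]_(#|T1|, #|T2|) := \matrix_(i, j) c (enum_val i) (enum_val j).
have lt : (#|T2| < #|T1|)%N.
  rewrite !card_ffun !card_ord.
  have mono u v e : (u <= v)%N -> (u ^ e <= v ^ e)%N.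
    by move=> uv; elim: e => // e IH; rewrite !expnS leq_mul.
  apply: leq_ltn_trans (_ : (B * (k * E).+1) ^ #|J0| < _)%N.
    by apply: mono; rewrite /D mulnCA mulnS addnC -addn1 leq_add2l.
  apply: leq_trans (_ : B ^ #|J0|.+1 <= _)%N; last by rewrite leq_pexp2l.
  by rewrite expnMn expnS mulnC ltn_pmul2r ?expn_gt0 // ltnS.
have : kermx M != 0.
  by rewrite -mxrank_eq0 mxrank_ker -lt0n subn_gt0 (leq_ltn_trans (rank_leq_col _)).
case/rowV0Pn => v /sub_kermxP vM v0; exists B, (fun al => v 0 (enum_rank al)); split.
  have /existsP[i vi] : [exists i, v 0 i != 0].
    apply: contraT => /existsPn hv; case/negP: v0; apply/eqP/rowP => i; rewrite mxE.
    by have := hv i; rewrite negbK => /eqP.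
  by exists (enum_val i); rewrite enum_valK.
move=> x; under eq_bigr do rewrite hc mulr_sumr.
rewrite exchange_big big1 //= => be _.
have := congr1 (fun m : 'rV[K]_#|T2| => m 0 (enum_rank be)) vM; rewrite !mxE /= => e.
rewrite (eq_bigr (fun al => (v 0 (enum_rank al) * c al be) * monom be x)); last by move=> al _; rewrite mulrA.
rewrite -mulr_suml (_ : \sum_al _ = 0) ?mul0r // -[RHS]e (reindex_onto (@enum_val _ _) (@enum_rank _)) /=; last by move=> i _; rewrite enum_rankK.
apply: eq_big => [i|i _]; first by rewrite enum_valK eqxx.
by rewrite !mxE enum_rankK enum_valK.
Qed.
End Gen.

Section GenP.
Variables (X : Type) (K : fieldType) (J0 : finType) (h : J0 -> X -> K).
Definition genP (p : X -> {poly K}) := forall i, gen h (fun x => (p x)`_i).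
Lemma genP_const q : genP (fun=> q). Proof. by move=> i; apply: gen_const. Qed.
Lemma genP_add p q : genP p -> genP q -> genP (fun x => p x + q x).
Proof. by move=> hp hq i; apply: gen_ext (gen_add (hp i) (hq i)) => x; rewrite coefD. Qed.
Lemma genP_mul p q : genP p -> genP q -> genP (fun x => p x * q x).
Proof.
move=> hp hq i; apply: (gen_ext (f := fun x => \sum_(j < i.+1) (p x)`_j * (q x)`_(i - j))).
  by move=> x; rewrite coefM.
by apply: gen_sum => j _; apply: gen_mul.
Qed.
Lemma genP_scale f p : gen h f -> genP p -> genP (fun x => f x *: p x).
Proof. by move=> hf hp i; apply: gen_ext (gen_mul hf (hp i)) => x; rewrite coefZ. Qed.
Lemma genP_ext p q : (forall x, p x = q x) -> genP p -> genP q.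
Proof. by move=> /funext ->. Qed.
Lemma genP_exp p k : genP p -> genP (fun x => p x ^+ k).
Proof.
move=> hp; elim: k => [|k IH]; first by apply: genP_ext (genP_const 1) => x; rewrite expr0.
by apply: genP_ext (genP_mul hp IH) => x; rewrite exprS.
Qed.
Lemma genP_sum (J : Type) (s : seq J) (p : J -> X -> {poly K}) : (forall j, genP (p j)) -> genP (fun x => \sum_(j <- s) p j x).
Proof.
move=> hp i; apply: (gen_ext (f := fun x => \sum_(j <- s) (p j x)`_i)); first by move=> x; rewrite coef_sum.
by apply: gen_sum => j _; apply: hp.
Qed.
Lemma genP_horner (p : X -> {poly K}) c : (exists n, forall x, (size (p x) <= n)%N) -> genP p -> gen h (fun x => (p x).[c]).
Proof.
move=> [n sp] hp; apply: (gen_ext (f := fun x => \sum_(i < n) (p x)`_i * c ^+ i)).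
  by move=> x; rewrite (horner_coef_wide _ (sp x)).
by apply: gen_sum => i _; apply: gen_mul; [apply: hp|apply: gen_const].
Qed.
Lemma genP_comp (p q : X -> {poly K}) n : (forall x, (size (p x) <= n)%N) -> genP p -> genP q -> genP (fun x => p x \Po q x).
Proof.
move=> sp hp hq; apply: (genP_ext (p := fun x => \sum_(i < n) (p x)`_i *: q x ^+ i)).
  move=> x; rewrite comp_polyE (big_ord_widen _ (fun i => (p x)`_i *: q x ^+ i) (sp x)) [LHS](bigID (fun i : 'I_n => (i < size (p x))%N)) /=.
  by rewrite [X in _ + X]big1 ?addr0 // => i; rewrite -leqNgt => h'; rewrite nth_default // scale0r.
by apply: genP_sum => i; apply: genP_scale; [apply: hp|apply: genP_exp].
Qed.
End GenP.
End FiniteGeneration.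

(** * The complex numbers as an algebraically closed field *)

Module ComplexField.
Import all_boot all_order all_algebra.
Import boolp reals Rstruct.
Import complex closed_field.
Import Reals Lra.
Import Coquelicot.
Set Implicit Arguments. Unset Strict Implicit. Unset Printing Implicit Defensive.
Import GRing.Theory.
Local Open Scope ring_scope.

(** A synonym on which the algebraic structures are placed; its operations are convertible to the
    analytic ones, and closedness is transported from [complex R]. *)
Definition CK : Type := C.
HB.instance Definition _ := gen_eqMixin CK.
HB.instance Definition _ := gen_choiceMixin CK.
Lemma CK_add0 : left_id (RtoC 0 : CK) (Cplus : CK -> CK -> CK). Proof. exact: Cplus_0_l. Qed.
Lemma CK_addN : left_inverse (RtoC 0 : CK) (Copp : CK -> CK) (Cplus : CK -> CK -> CK).
Proof. by move=> x; rewrite Cplus_comm; apply: Cplus_opp_r. Qed.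
HB.instance Definition _ := GRing.isZmodule.Build CK (Cplus_assoc : associative (Cplus : CK -> CK -> CK)) Cplus_comm CK_add0 CK_addN.
Lemma CK_mul1 : left_id (RtoC 1 : CK) (Cmult : CK -> CK -> CK). Proof. exact: Cmult_1_l. Qed.
Lemma CK_mulD : left_distributive (Cmult : CK -> CK -> CK) (Cplus : CK -> CK -> CK).
Proof. by move=> x y z; apply: Cmult_plus_distr_r. Qed.
Lemma CK_10 : (RtoC 1 : CK) != (RtoC 0 : CK).
Proof. by apply/eqP => -[] /R1_neq_R0. Qed.
HB.instance Definition _ := GRing.Zmodule_isComNzRing.Build CK (Cmult_assoc : associative (Cmult : CK -> CK -> CK)) Cmult_comm CK_mul1 CK_mulD CK_10.
Lemma CK_mulV (x : CK) : x != 0 -> (Cinv x : CK) * x = 1.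
Proof. by move/eqP => x0; rewrite mulrC; apply: Cinv_r. Qed.
Lemma CK_inv0 : (Cinv (0 : CK) : CK) = 0.
Proof. by rewrite /Cinv /= /Rdiv !Rmult_0_l Ropp_0 Rmult_0_l. Qed.
HB.instance Definition _ := GRing.ComNzRing_isField.Build CK CK_mulV CK_inv0.
Definition toCx (x : CK) : complex R := Complex x.1 x.2.
Definition ofCx (x : complex R) : CK := let: Complex u v := x in (u, v).
Lemma toCx_zmod : zmod_morphism toCx.
Proof. by move=> [x1 x2] [y1 y2]. Qed.
Lemma toCx_monoid : monoid_morphism toCx.
Proof. by split=> // [[x1 x2]] [y1 y2]. Qed.
HB.instance Definition _ := GRing.isZmodMorphism.Build CK (complex R) toCx toCx_zmod.
HB.instance Definition _ := GRing.isMonoidMorphism.Build CK (complex R) toCx toCx_monoid.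
Lemma toCxK : cancel toCx ofCx. Proof. by case. Qed.
Lemma ofCxK : cancel ofCx toCx. Proof. by case. Qed.
Lemma CK_closed : GRing.closed_field_axiom CK.
Proof.
move=> n P n0; have [x hx] := @solve_monicpoly (complex R) n (fun i => toCx (P i)) n0.
exists (ofCx x); apply: (can_inj toCxK); rewrite rmorphXn /= ofCxK hx rmorph_sum.
by apply: eq_bigr => i _; rewrite rmorphM rmorphXn /= ofCxK.
Qed.
HB.instance Definition _ := Field_isAlgClosed.Build CK CK_closed.

Lemma CK_char0 : [pchar CK] =i pred0.
Proof.
move=> p; apply/negbTE/negP => /andP[pp] /eqP h.
have e n : (n%:R : CK) = (INR n, 0%R).
  elim: n => [|n IH] //; rewrite mulrS IH S_INR; apply: injective_projections; rewrite /=; [exact: Rplus_comm|exact: Rplus_0_l].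
move: h; rewrite e => -[] h; have : INR 0 = INR p by rewrite h.
by move/INR_eq => p0; rewrite -p0 in pp.
Qed.
End ComplexField.

(** * Counting the parameters of a polynomial with two decompositions *)

Module CoefficientCount.
Import all_boot all_order all_algebra.
Import boolp ring zify.
Import Moments FiniteGeneration.
Set Implicit Arguments. Unset Strict Implicit. Unset Printing Implicit Defensive.
Import GRing.Theory.
Local Open Scope ring_scope.

Section Rev.
Variable K : fieldType.
(** The reversal X^w p(1/X), so that expansion at infinity becomes expansion at 0 and leading
    coefficients come first. *)
Definition revn w (p : {poly K}) : {poly K} := \sum_(i < w.+1) p`_i *: 'X^(w - i).
Lemma revn_coef w p j : (revn w p)`_j = if (j <= w)%N then p`_(w - j) else 0.
Proof.
rewrite /revn coef_sum; case: leqP => jw.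
  have wj : (w - j < w.+1)%N by rewrite ltnS leq_subr.
  rewrite (bigD1 (Ordinal wj)) //= coefZ coefXn subKn // eqxx mulr1 big1 ?addr0 // => i ni.
  rewrite coefZ coefXn; case: eqP => [e|]; last by rewrite mulr0.
  by case/eqP: ni; apply: val_inj; rewrite /= e subKn // -ltnS.
rewrite big1 // => i _; rewrite coefZ coefXn; case: eqP => [e|]; last by rewrite mulr0.
by move: jw; rewrite e ltnNge leq_subr.
Qed.
Lemma revn_sum w (J : Type) (s : seq J) (F : J -> {poly K}) : revn w (\sum_(j <- s) F j) = \sum_(j <- s) revn w (F j).
Proof.
apply/polyP => i; rewrite coef_sum revn_coef; case: leqP => h.
  by rewrite coef_sum; apply: eq_bigr => j _; rewrite revn_coef h.
by rewrite big1 // => j _; rewrite revn_coef leqNgt h.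
Qed.
Lemma revnZ w c p : revn w (c *: p) = c *: revn w p.
Proof. by apply/polyP => i; rewrite coefZ !revn_coef; case: leqP; rewrite ?coefZ ?mulr0. Qed.
Lemma revnXn w i : (i <= w)%N -> revn w 'X^i = 'X^(w - i).
Proof.
move=> iw; apply/polyP => j; rewrite revn_coef !coefXn; case: leqP => jw.
  have -> // : ((w - j)%N == i) = (j == (w - i)%N).
  by apply/eqP/eqP => ?; lia.
by case: eqP => // e; move: jw; rewrite e ltnNge leq_subr.
Qed.
Lemma revn1 w : revn w 1 = 'X^w.
Proof. by rewrite -(expr0 'X) revnXn // subn0. Qed.
Lemma poly_sumE w (p : {poly K}) : (size p <= w.+1)%N -> p = \sum_(i < w.+1) p`_i *: 'X^i.
Proof.
move=> sp; apply/polyP => i; rewrite coef_sum.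
have [iw|wi] := ltnP i w.+1.
  rewrite (bigD1 (Ordinal iw)) //= coefZ coefXn eqxx mulr1 big1 ?addr0 // => j nj.
  rewrite coefZ coefXn; case: eqP => [e|]; last by rewrite mulr0.
  by case/eqP: nj; apply: val_inj.
rewrite nth_default ?(leq_trans sp) // big1 // => j _; rewrite coefZ coefXn; case: eqP => [e|]; last by rewrite mulr0.
by move: (ltn_ord j); rewrite -e ltnNge wi.
Qed.
Lemma revnM w1 w2 (p q : {poly K}) : (size p <= w1.+1)%N -> (size q <= w2.+1)%N ->
  revn (w1 + w2) (p * q) = revn w1 p * revn w2 q.
Proof.
move=> sp sq; rewrite {1}(poly_sumE sp) {1}(poly_sumE sq) mulr_suml revn_sum [revn w1 p]/revn [revn w2 q]/revn mulr_suml.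
apply: eq_bigr => i _; rewrite !mulr_sumr revn_sum; apply: eq_bigr => j _.
rewrite -!scalerAl -!scalerAr !revnZ; congr (_ *: (_ *: _)).
have iw : (i <= w1)%N by rewrite -ltnS. have jw : (j <= w2)%N by rewrite -ltnS.
by rewrite -exprD revnXn ?leq_add // -exprD; congr ('X^_); lia.
Qed.
Lemma size_expW w (u : {poly K}) e : (size u <= w.+1)%N -> (size (u ^+ e) <= (w * e).+1)%N.
Proof.
move=> su; apply: leq_trans (size_poly_exp_leq _ _) _; rewrite ltnS leq_mul2r; apply/orP; right.
by rewrite -subn1 leq_subLR add1n.
Qed.
Lemma revn_exp w (u : {poly K}) e : (size u <= w.+1)%N -> revn (w * e) (u ^+ e) = revn w u ^+ e.
Proof.
move=> su; elim: e => [|e IH]; first by rewrite muln0 !expr0 revn1 expr0.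
by rewrite mulnS !exprS revnM // ?IH // size_expW.
Qed.
(** The top coefficient M_(D-l) first enters at index w l. This delay makes the system for the
    coefficients of u and M triangular. *)
Lemma revn_comp w D (u M : {poly K}) j : (size u <= w.+1)%N -> (size M <= D.+1)%N ->
  (revn (w * D) (M \Po u))`_j =
  \sum_(l < D.+1) M`_(D - l) * (if (w * l <= j)%N then (revn w u ^+ (D - l))`_(j - w * l) else 0).
Proof.
move=> su sM; rewrite comp_polyE.
have -> : \sum_(i < size M) M`_i *: u ^+ i = \sum_(i < D.+1) M`_i *: u ^+ i.
  rewrite (big_ord_widen _ (fun i => M`_i *: u ^+ i) sM) [RHS](bigID (fun i : 'I_D.+1 => (i < size M)%N)) /=.
  by rewrite [X in _ + X]big1 ?addr0 // => i; rewrite -leqNgt => h'; rewrite nth_default // scale0r.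
rewrite revn_sum coef_sum (reindex_inj rev_ord_inj); apply: eq_bigr => l _ /=.
rewrite subSS revnZ coefZ; congr (_ * _).
have lD : (l <= D)%N by rewrite -ltnS.
have e : (w * D = w * l + w * (D - l))%N by rewrite -mulnDr subnKC.
rewrite e -[u ^+ _]mul1r revnM ?size_poly1 ?size_expW // revn_exp //.
by rewrite revn1 coefXnM ltnNge; case: leqP.
Qed.
End Rev.

Section Tri.
Variables (X : Type) (K : fieldType) (J : finType) (h : J -> X -> K).
Hypothesis charK : [pchar K] =i pred0.
Local Notation gen := (gen h).

Lemma exp_gen (U : X -> {poly K}) D j : (forall s, (s <= j)%N -> gen (fun x => (U x)`_s)) ->
  gen (fun x => (U x ^+ D)`_j).
Proof.
elim: D j => [|D IH] j gU; first by apply: gen_ext (gen_const _ (j == 0)%:R) => x; rewrite expr0 coef1.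
apply: (gen_ext (f := fun x => \sum_(s < j.+1) (U x)`_s * (U x ^+ D)`_(j - s))).
  by move=> x; rewrite exprS coefM.
apply: gen_sum => s _; apply: gen_mul; first by apply: gU; rewrite -ltnS.
by apply: IH => t ts; apply: gU; apply: leq_trans ts (leq_subr _ _).
Qed.

(** A D-th root with constant term 1 is computed coefficient by coefficient: coefficient j+1 of U^D
    is D times that of U plus a polynomial in earlier ones. *)
Lemma root_gen (U : X -> {poly K}) D m : (0 < D)%N -> (forall x, (U x)`_0 = 1) ->
  (forall j, (j <= m)%N -> gen (fun x => (U x ^+ D)`_j)) -> forall j, (j <= m)%N -> gen (fun x => (U x)`_j).
Proof.
move=> D0 U0 gD; elim/ltn_ind => -[_ _|j IH jm]; first by apply: gen_ext (gen_const _ 1) => x; rewrite U0.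
have DK : (D%:R : K) != 0 by rewrite (natr_c0 charK) -lt0n.
have e0 D1 x : (U x ^+ D1)`_0 = 1 by rewrite -horner_coef0 horner_exp horner_coef0 U0 expr1n.
have key D1 : gen (fun x => (U x ^+ D1)`_j.+1 - D1%:R * (U x)`_j.+1).
  elim: D1 => [|D1 IHD]; first by apply: gen_ext (gen_const _ 0) => x; rewrite expr0 coef1 mul0r subr0.
  apply: (gen_ext (f := fun x => ((U x ^+ D1)`_j.+1 - D1%:R * (U x)`_j.+1) + \sum_(s < j) (U x)`_s.+1 * (U x ^+ D1)`_(j - s))).
    move=> x; rewrite exprS coefM big_ord_recl big_ord_recr /= U0 mul1r subn0 /bump /= add1n subnn e0 mulr1.
    under [in RHS]eq_bigr do rewrite /bump /= add1n subSS.
    by rewrite -natr1; ring.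
  apply: gen_add => //; apply: gen_sum => s _; apply: gen_mul.
    by apply: IH; [rewrite ltnS|apply: leq_trans jm; rewrite ltnW // ltnS].
  apply: exp_gen => t ts; apply: IH; last by apply: leq_trans jm; apply: leqW; apply: leq_trans ts (leq_subr _ _).
  by rewrite ltnS (leq_trans ts) // leq_subr.
apply: (gen_ext (f := fun x => D%:R^-1 * ((U x ^+ D)`_j.+1 - ((U x ^+ D)`_j.+1 - D%:R * (U x)`_j.+1)))).
  by move=> x; rewrite opprB addrC subrK mulKf.
by apply: gen_scale; apply: gen_sub; [apply: gD|apply: key].
Qed.

Section Comp.
Variables (w D : nat) (u M : X -> {poly K}).
Hypotheses (w0 : (0 < w)%N) (D0 : (0 < D)%N).
Hypothesis su : forall x, (size (u x) <= w.+1)%N.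
Hypothesis sM : forall x, (size (M x) <= D.+1)%N.
Hypothesis u1 : forall x, (u x)`_w = 1.
Hypothesis M1 : forall x, (M x)`_D = 1.
Let U x := revn w (u x).
Let psi x := revn (w * D) (M x \Po u x).
Lemma U0 x : (U x)`_0 = 1. Proof. by rewrite revn_coef subn0 u1. Qed.
Lemma UD0 e x : (U x ^+ e)`_0 = 1. Proof. by rewrite -horner_coef0 horner_exp horner_coef0 U0 expr1n. Qed.
Lemma psiE x j : (psi x)`_j = \sum_(l < D.+1) (M x)`_(D - l) * (if (w * l <= j)%N then (U x ^+ (D - l))`_(j - w * l) else 0).
Proof. by rewrite /psi revn_comp. Qed.

Lemma psi_low x j : (j < w)%N -> (psi x)`_j = (U x ^+ D)`_j.
Proof.
move=> jw; rewrite psiE big_ord_recl /= muln0 !subn0 M1 mul1r big1 ?addr0 // => i _.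
by rewrite /bump /= add1n leqNgt (leq_trans jw) ?mulr0 // mulnS leq_addr.
Qed.

Lemma psi_gen j : (forall s, (s <= j)%N -> gen (fun x => (U x)`_s)) ->
  (forall l, (w * l <= j)%N -> (l <= D)%N -> gen (fun x => (M x)`_(D - l))) -> gen (fun x => (psi x)`_j).
Proof.
move=> gU gM; apply: (gen_ext (f := fun x => \sum_(l < D.+1) (M x)`_(D - l) * (if (w * l <= j)%N then (U x ^+ (D - l))`_(j - w * l) else 0))).
  by move=> x; rewrite psiE.
apply: gen_sum => l _; case: leqP => hl; last by apply: gen_ext (gen_const _ 0) => x; rewrite mulr0.
apply: gen_mul; first by apply: gM => //; rewrite -ltnS.
by apply: exp_gen => s hs; apply: gU; apply: leq_trans hs (leq_subr _ _).
Qed.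

Lemma coefM_gen l : (l <= D)%N -> (forall s, (s <= w * l)%N -> gen (fun x => (U x)`_s)) ->
  (forall l', (l' < l)%N -> gen (fun x => (M x)`_(D - l'))) -> gen (fun x => (psi x)`_(w * l)) ->
  gen (fun x => (M x)`_(D - l)).
Proof.
move=> lD gU gM gp.
have lD' : (l < D.+1)%N by [].
apply: (gen_ext (f := fun x => (psi x)`_(w * l) - \sum_(i < D.+1 | (i < l)%N) (M x)`_(D - i) * (U x ^+ (D - i))`_(w * l - w * i))).
  move=> x; rewrite psiE (bigD1 (Ordinal lD')) //= leqnn subnn UD0 mulr1 [X in _ + X - _](bigID (fun i : 'I_D.+1 => (i < l)%N)) /=.
  rewrite [X in _ + (_ + X) - _]big1 ?addr0; last first.
    move=> i /andP[ni il]; rewrite leq_mul2l eqn0Ngt w0 /=; case: leqP => h'; last by rewrite mulr0.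
    by case/eqP: ni; apply: val_inj => /=; lia.
  rewrite (eq_big (fun i : 'I_D.+1 => (i < l)%N) (fun i => (M x)`_(D - i) * (U x ^+ (D - i))`_(w * l - w * i))).
  - by rewrite addrK.
  - by move=> i; rewrite andb_idl // => il; apply/eqP => /(congr1 val) /= e; move: il; rewrite e ltnn.
  - by move=> i /andP[_ il]; rewrite leq_mul2l ltnW ?orbT.
apply: gen_sub => //; apply: gen_sum => i il; apply: gen_mul; first exact: gM.
by apply: exp_gen => s hs; apply: gU; apply: leq_trans hs (leq_subr _ _).
Qed.

(** The first w coefficients of the composite determine u as a D-th root, and those at multiples of
    w then determine M from the top. No new coefficient of M enters at an index that is not a
    multiple of w, so the value there is forced. *)
Lemma tri i : (forall x, (u x)`_0 = 0) -> (w <= i)%N -> ~~ (w %| i)%N -> (i < w * D)%N ->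
  (forall j, (j < i)%N -> gen (fun x => (psi x)`_j)) -> gen (fun x => (psi x)`_i).
Proof.
move=> u0 wi wni iN gp.
have gU s : gen (fun x => (U x)`_s).
  have [sw|ws] := ltnP s w.
    apply: (@root_gen U D s) => //; first exact: U0.
    move=> j js; have jw : (j < w)%N by apply: leq_ltn_trans sw.
    by apply: gen_ext (gp j (leq_trans jw wi)) => x; rewrite psi_low.
  apply: gen_ext (gen_const _ 0) => x; rewrite revn_coef; case: leqP => // ws'.
  by rewrite (_ : (w - s = 0)%N) ?u0 //; apply/eqP; rewrite subn_eq0.
have gM l : (w * l < i)%N -> gen (fun x => (M x)`_(D - l)).
  elim/ltn_ind: l => l IH li; apply: coefM_gen => //.
  - by have := ltn_trans li iN; rewrite ltn_pmul2l // => /ltnW.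
  - by move=> l' ll; apply: IH => //; apply: leq_ltn_trans li; rewrite leq_mul2l ltnW ?orbT.
  - exact: gp.
apply: psi_gen => // l; rewrite leq_eqVlt => /predU1P[e|li] _; last exact: gM.
by rewrite -e dvdn_mulr in wni.
Qed.
End Comp.
End Tri.

Section Norm.
Variables (K : closedFieldType) (a b : K).
Hypothesis charK : [pchar K] =i pred0.
Definition SStruct (P : {poly K}) (a1 a2 g k : nat) : Prop := exists V A1 A2 F1 F2 : {poly K},
  [/\ [/\ size V = g.+1, V.[a] != V.[b], size A1 = a1.+1 & size A2 = a2.+1],
      [/\ coprime a1 a2, (1 < a1)%N & (a1 < a2)%N],
      A1.[V.[a]] = A1.[V.[b]],
      P = F1 \Po (A1 \Po V) /\ P = F2 \Po (A2 \Po V) & (size P).-1 = (k * a1 * a2 * g)%N].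

(** Affine changes are used up by making V take the values 1 and -1 at a and b, u_i monic without
    constant term, and M_i monic. [lineV] is affine with these two values, so V - [lineV] is
    divisible by (X - a)(X - b); the quotient [nfS] holds the remaining freedom in V. *)
Record nf := NF { nfc : K; nfS : {poly K}; nfu1 : {poly K}; nfu2 : {poly K}; nfM1 : {poly K}; nfM2 : {poly K} }.
Definition lineV : {poly K} := (2%:R / (a - b)) *: 'X - ((a + b) / (a - b))%:P.
Definition nfV (x : nf) : {poly K} := lineV + ('X - a%:P) * ('X - b%:P) * nfS x.
Definition nfP (x : nf) : {poly K} := nfc x *: ((nfM1 x \Po nfu1 x) \Po nfV x).
Definition nf_ok (a1 a2 g k : nat) (x : nf) : Prop :=
  [/\ (size (nfS x) <= g.-1)%N,
      [/\ size (nfu1 x) = a1.+1, (nfu1 x)`_a1 = 1, (nfu1 x)`_0 = 0 & (nfu1 x).[1] = (nfu1 x).[-1]],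
      [/\ size (nfu2 x) = a2.+1, (nfu2 x)`_a2 = 1 & (nfu2 x)`_0 = 0],
      [/\ size (nfM1 x) = (k * a2).+1, (nfM1 x)`_(k * a2) = 1, size (nfM2 x) = (k * a1).+1 & (nfM2 x)`_(k * a1) = 1] &
      nfM1 x \Po nfu1 x = nfM2 x \Po nfu2 x /\ (nfM1 x \Po nfu1 x).[1] = 0].

Lemma comp_inj (V F G : {poly K}) : (1 < size V)%N -> F \Po V = G \Po V -> F = G.
Proof.
move=> sV /eqP; rewrite -subr_eq0 -comp_polyB comp_poly_eq0 // subr_eq0 => /eqP //.
Qed.

Lemma monic_right (F A : {poly K}) n : size A = n.+1 -> (0 < n)%N ->
  exists M u al be, [/\ F \Po A = M \Po u, size u = n.+1, u`_n = 1, u`_0 = 0 & al != 0 /\ A = al *: u + be%:P].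
Proof.
move=> sA n0; have A0 : A`_n != 0 by rewrite -[n]/(n.+1.-1) -sA -lead_coefE lead_coef_eq0 -size_poly_eq0 sA.
pose al := A`_n; pose be := A`_0; pose u := al^-1 *: (A - be%:P).
have eA : A = al *: u + be%:P by rewrite /u scalerA divff // scale1r subrK.
exists (F \Po (al *: 'X + be%:P)), u, al, be; split=> //.
- by rewrite -comp_polyA comp_polyD comp_polyZ comp_polyX comp_polyC -eA.
- by rewrite size_scale ?invr_eq0 // size_polyDl // size_polyN sA (leq_ltn_trans (size_polyC_leq1 _)) // ltnS.
- by rewrite coefZ coefB coefC eqn0Ngt n0 subr0 mulVf.
- by rewrite coefZ coefB coefC subrr mulr0.
Qed.

Lemma SStruct_nf P a1 a2 g k : a != b -> P != 0 -> P.[a] = 0 -> (0 < g)%N -> (0 < k)%N -> SStruct P a1 a2 g k ->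
  exists2 x : nf, nf_ok a1 a2 g k x & P = nfP x.
Proof.
move=> ab P0 Pa g0 k0 [V [A1 [A2 [F1 [F2 [[sV Vab sA1 sA2] [cop a11 a12] clo [eP1 eP2] dP]]]]]].
have ab' : a - b != 0 by rewrite subr_eq0.
have a10 : (0 < a1)%N by apply: ltnW.
have a20 : (0 < a2)%N by apply: leq_ltn_trans a12.
have n2K : (2%:R : K) != 0 by rewrite (natr_c0 charK).
pose dv := (V.[a] - V.[b]) / 2%:R; pose sv := (V.[a] + V.[b]) / 2%:R.
have dv0 : dv != 0 by rewrite mulf_neq0 ?invr_eq0 // subr_eq0.
pose V1 := dv^-1 *: (V - sv%:P); pose aff : {poly K} := dv *: 'X + sv%:P.
have eV : V = aff \Po V1.
  by rewrite /aff comp_polyD comp_polyZ comp_polyX comp_polyC /V1 scalerA divff // scale1r subrK.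
have V1a : V1.[a] = 1 by rewrite /V1 hornerZ hornerD hornerN hornerC /dv /sv; field; rewrite n2K subr_eq0.
have V1b : V1.[b] = -1 by rewrite /V1 hornerZ hornerD hornerN hornerC /dv /sv; field; rewrite n2K subr_eq0.
have sV1 : size V1 = g.+1.
  by rewrite size_scale ?invr_eq0 // size_polyDl // size_polyN sV (leq_ltn_trans (size_polyC_leq1 _)) // ltnS.
have saff : size aff = 2%N.
  by rewrite /aff size_polyDl ?size_scale ?size_polyX // (leq_ltn_trans (size_polyC_leq1 _)).
have sB (A : {poly K}) n : size A = n.+1 -> size (A \Po aff) = n.+1.
  by move=> sA; rewrite size_comp_poly2 ?saff.
have [M1 [u1 [al1 [be1 [e1 su1 lu1 zu1 [al10 eA1]]]]]] := monic_right F1 (sB _ _ sA1) a10.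
have [M2 [u2 [al2 [be2 [e2 su2 lu2 zu2 [al20 eA2]]]]]] := monic_right F2 (sB _ _ sA2) a20.
have PV1 : P = (M1 \Po u1) \Po V1 by rewrite -e1 -!comp_polyA -eV.
have PV2 : P = (M2 \Po u2) \Po V1 by rewrite -e2 -!comp_polyA -eV.
have M12 : M1 \Po u1 = M2 \Po u2 by apply: (@comp_inj V1); rewrite ?sV1 ?ltnS // -PV1.
have M10 : M1 != 0 by apply: contraNneq P0 => h; rewrite PV1 h !comp_poly0.
have M20 : M2 != 0 by apply: contraNneq P0 => h; rewrite PV2 h !comp_poly0.
have szM (M u : {poly K}) n n' : M != 0 -> size u = n.+1 -> (0 < n)%N -> P = (M \Po u) \Po V1 -> (size P).-1 = (n' * n * g)%N -> size M = n'.+1.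
  move=> nM su n0 e eN; have := size_comp_poly (M \Po u) V1; rewrite -e eN sV1 /= => /eqP.
  rewrite eqn_pmul2r // size_comp_poly su /= eqn_pmul2r // => /eqP ->.
  by rewrite prednK // size_poly_gt0.
have sM1 : size M1 = (k * a2).+1 by apply: (szM _ _ _ _ M10 su1 a10 PV1); rewrite dP; congr (_ * _)%N; exact: mulnAC.
have sM2 : size M2 = (k * a1).+1 by apply: (szM _ _ _ _ M20 su2 a20 PV2).
pose c := lead_coef M1; have c0 : c != 0 by rewrite lead_coef_eq0.
have lc12 : lead_coef M2 = c.
  have := congr1 lead_coef M12; rewrite !lead_coef_comp ?su1 ?su2 ?ltnS // !lead_coefE su1 su2 /= lu1 lu2 !expr1n !mulr1.
  by rewrite -!lead_coefE.
have /dvdpP[Sq eS] : ('X - a%:P) * ('X - b%:P) %| V1 - lineV.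
  rewrite Gauss_dvdp ?coprimep_XsubC ?root_XsubC 1?eq_sym // !dvdp_XsubCl /root !hornerD !hornerN V1a V1b.
  rewrite /lineV !hornerD !hornerN !hornerZ !hornerX !hornerC.
  by apply/andP; split; apply/eqP; field.
exists (NF c Sq u1 u2 (c^-1 *: M1) (c^-1 *: M2)); last first.
  rewrite /nfP /nfV /= PV1 !comp_polyZ scalerA divff // scale1r; congr (_ \Po _).
  by rewrite mulrC -eS addrC subrK.
split=> /=.
- have [->|Sq0] := eqVneq Sq 0; first by rewrite size_poly0.
  have : (size (Sq * (('X - a%:P) * ('X - b%:P)))%R <= maxn g.+1 2)%N.
    rewrite -eS; apply: leq_trans (size_polyD _ _) _; rewrite geq_max size_polyN sV1 leq_maxl /=.
    apply: leq_trans (leq_maxr _ _); rewrite /lineV; apply: leq_trans (size_polyD _ _) _.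
    rewrite geq_max size_polyN (leq_trans (size_scale_leq _ _)) ?size_polyX //=.
    by rewrite (leq_trans (size_polyC_leq1 _)).
  rewrite size_mul ?mulf_neq0 ?polyXsubC_eq0 // size_mul ?polyXsubC_eq0 // !size_XsubC.
  by move: (size Sq) => s; clear -g0; rewrite (_ : (2 + 2).-1 = 3)%N // => h; move: h g0; lia.
- split=> //.
  have : (A1 \Po aff).[1] = (A1 \Po aff).[-1].
    have ea : aff.[1] = V.[a] by rewrite /aff !hornerE /dv /sv; field.
    have eb : aff.[-1] = V.[b] by rewrite /aff !hornerE /dv /sv; field.
    by rewrite !horner_comp ea eb.
  rewrite eA1 !hornerD !hornerZ !hornerC => /addIr/(mulfI al10) //.
- by [].
- rewrite !size_scale ?invr_eq0 // sM1 sM2; split=> //; rewrite coefZ.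
    by rewrite -[(k * a2)%N]/((k * a2).+1.-1) -sM1 -lead_coefE mulVf.
  by rewrite -[(k * a1)%N]/((k * a1).+1.-1) -sM2 -lead_coefE lc12 mulVf.
- split; first by rewrite !comp_polyZ M12.
  by rewrite comp_polyZ hornerZ -V1a -horner_comp -PV1 Pa mulr0.
Qed.

Section NfGen.
Variables (X : Type) (J : finType) (h : J -> X -> K) (a1 a2 g k : nat) (x : X -> nf).
Hypotheses (cop : coprime a1 a2) (a11 : (1 < a1)%N) (a12 : (a1 < a2)%N) (k0 : (0 < k)%N).
Hypothesis ok : forall t, nf_ok a1 a2 g k (x t).
Hypothesis gc : gen h (fun t => nfc (x t)).
Hypothesis gS : forall i, (i < g.-1)%N -> gen h (fun t => (nfS (x t))`_i).
Hypothesis gu : forall i, (i < a1 - 2)%N -> gen h (fun t => (nfu1 (x t))`_i.+2).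
Hypothesis gm : forall i, (i < a2.-1 %/ a1)%N -> gen h (fun t => (nfM1 (x t))`_(k * a2 - i.+1)).
Hypothesis gt : forall i, (i < k.-1)%N -> gen h (fun t => (nfM1 (x t))`_(k * a2 - a2 * i.+1)).

Lemma gen_eq0 (f : X -> K) c : (forall t, f t = c) -> gen h f.
Proof. by move=> e; apply: gen_ext (gen_const _ c) => t; rewrite e. Qed.

Lemma nf_u1 i : gen h (fun t => (nfu1 (x t))`_i).
Proof.
have [ia|ia] := ltnP a1 i.
  by apply: (@gen_eq0 _ 0) => t; case: (ok t) => _ [su _ _ _] _ _ _; rewrite nth_default // su.
have [->|ia'] := eqVneq i a1; first by apply: (@gen_eq0 _ 1) => t; case: (ok t) => _ [_ -> _ _] _ _ _.
case: i ia ia' => [|[|i]] ia ia'.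
- by apply: (@gen_eq0 _ 0) => t; case: (ok t) => _ [_ _ -> _] _ _ _.
(* The coefficient of X is not a parameter: u1(1) = u1(-1) means that the odd coefficients sum to
   zero. *)
- apply: (gen_ext (f := fun t => - \sum_(i < a1.+1 | odd i && (1 < i)%N) (nfu1 (x t))`_i)); last first.
    apply: (gen_ext (f := fun t => 0 - \sum_(i < a1.+1 | odd i && (1 < i)%N) (nfu1 (x t))`_i)); first by move=> t; rewrite sub0r.
    apply: gen_sub; first exact: gen_const.
    apply: gen_sum => j /andP[_ j1].
    have [ea|ja] := eqVneq (j : nat) a1; first by apply: (@gen_eq0 _ 1) => t; rewrite ea; case: (ok t) => _ [_ -> _ _] _ _ _.
    have jl := ltn_ord j.
    by case: (j : nat) j1 ja jl => [|[|m]] // _ ja jl; apply: gu; lia.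
  move=> t; case: (ok t) => _ [su _ _ e1] _ _ _.
  have n2K : (2%:R : K) != 0 by rewrite (natr_c0 charK).
  have /eqP := e1; rewrite -subr_eq0 !horner_coef su -sumrB => /eqP e2.
  have : 2%:R * \sum_(i < a1.+1 | odd i) (nfu1 (x t))`_i = 0.
    rewrite -[RHS]e2 mulr_sumr [RHS](bigID (fun i : 'I_a1.+1 => odd i)) /= [X in _ = _ + X]big1 ?addr0.
      by apply: eq_bigr => i oi; rewrite expr1n -signr_odd oi expr1; ring.
    by move=> i oi; rewrite expr1n -signr_odd (negbTE oi) expr0 subrr.
  move/eqP; rewrite mulf_eq0 (negbTE n2K) /= => /eqP e3.
  have o1 : (1 < a1.+1)%N by [].
  move: e3; rewrite (bigD1 (Ordinal o1)) //= => /eqP; rewrite addr_eq0 => /eqP ->; congr (- _).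
  apply: eq_bigl => i; rewrite -val_eqE /=; case: (odd i) / boolP => //= oi.
  by case: (i : nat) oi => [|[|]].
- by apply: gu; lia.
Qed.

Let D := (k * a2)%N.
Let psi t := revn (a1 * D) (nfM1 (x t) \Po nfu1 (x t)).
Let U1 s : gen h (fun t => (revn a1 (nfu1 (x t)))`_s).
Proof.
apply: (gen_ext (f := fun t => if (s <= a1)%N then (nfu1 (x t))`_(a1 - s) else 0)).
  by move=> t; rewrite revn_coef.
by case: leqP => _; [apply: nf_u1|apply: gen_const].
Qed.

(** Coefficient D - l of M1 is read at index a1 l of the composite. For a1 l < a2 it is a parameter.
    If a2 divides l < D it is one too. For l = D it follows from vanishing at 1, the value of V at
    a. Otherwise a2 does not divide a1 l, and the second decomposition forces it by [tri]. *)
Lemma nf_M1 l : (l <= D)%N -> gen h (fun t => (nfM1 (x t))`_(D - l)).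
Proof.
have a10 : (0 < a1)%N by apply: ltnW.
have a20 : (0 < a2)%N by apply: leq_ltn_trans a12.
have D0 : (0 < D)%N by rewrite muln_gt0 k0.
have su1 t : (size (nfu1 (x t)) <= a1.+1)%N by case: (ok t) => _ [-> _ _ _] _ _ _.
have sM1 t : (size (nfM1 (x t)) <= D.+1)%N by case: (ok t) => _ _ _ [-> _ _ _] _.
have u1l t : (nfu1 (x t))`_a1 = 1 by case: (ok t) => _ [_ -> _ _] _ _ _.
have M1l t : (nfM1 (x t))`_D = 1 by case: (ok t) => _ _ _ [_ -> _ _] _.
elim/ltn_ind: l => l IH lD.
have [->|l0] := posnP l; first by rewrite subn0; apply: (@gen_eq0 _ 1).
have [al|al] := ltnP (a1 * l) a2.
  have e : l = l.-1.+1 by rewrite prednK.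
  rewrite e; apply: gm; rewrite -ltnS -e ltnS leq_divRL // mulnC; lia.
have [eD|nD] := eqVneq l D.
  rewrite eD subnn.
  apply: (gen_ext (f := fun t => 0 - \sum_(i < D) (nfM1 (x t))`_i.+1 * (nfu1 (x t)).[1] ^+ i.+1)).
    move=> t; case: (ok t) => _ _ _ _ [_]; rewrite horner_comp (horner_coef_wide _ (sM1 t)) big_ord_recl expr0 mulr1.
    by move/eqP; rewrite addr_eq0 => /eqP ->; rewrite sub0r.
  apply: gen_sub; first exact: gen_const.
  apply: gen_sum => i _; apply: gen_mul.
    have -> : i.+1 = (D - (D - i.+1))%N by rewrite subKn.
    by apply: IH; rewrite ?leq_subr // eD; have := ltn_ord i; lia.
  by apply: gen_exp; apply: genP_horner; [exists a1.+1|move=> s; apply: nf_u1].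
have ltD : (l < D)%N by rewrite ltn_neqAle nD.
have [dv|ndv] := boolP (a2 %| l)%N.
  case/dvdnP: dv => t et; have t0 : (0 < t)%N by rewrite lt0n; apply: contraTneq l0 => ht; rewrite et ht.
  have -> : (D - l = k * a2 - a2 * t.-1.+1)%N by rewrite prednK // et mulnC.
  by apply: gt; move: ltD; rewrite et /D ltn_pmul2r //; lia.
refine (@coefM_gen X K J h a1 D (fun t => nfu1 (x t)) (fun t => nfM1 (x t)) _ _ _ _ _ l _ _ _ _) => //.
  by move=> l' ll; apply: IH => //; apply: ltnW; apply: ltn_trans ltD.
have ew : (a1 * D = a2 * (k * a1))%N by rewrite /D; lia.
apply: (gen_ext (f := fun t => (revn (a2 * (k * a1)) (nfM2 (x t) \Po nfu2 (x t)))`_(a1 * l))).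
  by move=> t; case: (ok t) => _ _ _ _ [-> _]; rewrite ew.
apply: (@tri X K J h charK a2 (k * a1) (fun t => nfu2 (x t)) (fun t => nfM2 (x t))) => //.
- by rewrite muln_gt0 k0.
- by move=> t; case: (ok t) => _ _ [-> _ _] _ _.
- by move=> t; case: (ok t) => _ _ _ [_ _ -> _] _.
- by move=> t; case: (ok t) => _ _ [_ -> _] _ _.
- by move=> t; case: (ok t) => _ _ _ [_ _ _ ->] _.
- by move=> t; case: (ok t) => _ _ [_ _ ->] _ _.
- by rewrite Gauss_dvdr // coprime_sym.
- by rewrite -ew ltn_pmul2l.
move=> j jl.
apply: (gen_ext (f := fun t => (revn (a1 * D) (nfM1 (x t) \Po nfu1 (x t)))`_j)).
  by move=> t; case: (ok t) => _ _ _ _ [-> _]; rewrite ew.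
apply: (@psi_gen X K J h a1 D (fun t => nfu1 (x t)) (fun t => nfM1 (x t))) => // l' lj l'D.
apply: IH => //; rewrite -(ltn_pmul2l a10); exact: leq_ltn_trans jl.
Qed.

Lemma nf_genP : genP h (fun t => nfP (x t)).
Proof.
apply: genP_scale => //.
have gM : genP h (fun t => nfM1 (x t)).
  move=> i; have [Di|iD] := ltnP D i.
    by apply: (@gen_eq0 _ 0) => t; case: (ok t) => _ _ _ [sM _ _ _] _; rewrite nth_default // sM.
  by have := nf_M1 (leq_subr i D); rewrite subKn.
have s1 t : (size (nfM1 (x t) \Po nfu1 (x t)) <= (D * a1).+1)%N.
  by case: (ok t) => _ [su _ _ _] _ [sM _ _ _] _; apply: leq_trans (size_comp_poly_leq _ _) _; rewrite sM su.
apply: (genP_comp s1).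
  apply: (@genP_comp _ _ _ _ _ _ D.+1) => //; last exact: nf_u1.
  by move=> t; case: (ok t) => _ _ _ [-> _ _ _] _.
apply: genP_add; first exact: genP_const.
apply: genP_mul; first exact: genP_const.
move=> i; have [ig|gi] := ltnP i g.-1; first exact: gS.
by apply: (@gen_eq0 _ 0) => t; case: (ok t) => sS _ _ _ _; rewrite nth_default // (leq_trans sS).
Qed.
End NfGen.

Definition nfh (a1 a2 g k : nat) (j : unit + 'I_g.-1 + 'I_(a1 - 2) + 'I_(a2.-1 %/ a1) + 'I_k.-1) (x : nf) : K :=
  match j with
  | inl (inl (inl (inl _))) => nfc x
  | inl (inl (inl (inr i))) => (nfS x)`_i
  | inl (inl (inr i)) => (nfu1 x)`_i.+2
  | inl (inr i) => (nfM1 x)`_(k * a2 - i.+1)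
  | inr i => (nfM1 x)`_(k * a2 - a2 * i.+1)
  end.

Lemma nfh_genP (X : Type) (J : finType) (h : J -> X -> K) (a1 a2 g k : nat) (x : X -> nf) :
  coprime a1 a2 -> (1 < a1)%N -> (a1 < a2)%N -> (0 < k)%N -> (forall t, nf_ok a1 a2 g k (x t)) ->
  (forall j, gen h (fun t => @nfh a1 a2 g k j (x t))) -> genP h (fun t => nfP (x t)).
Proof.
move=> cop a11 a12 k0 ok gh; apply: (@nf_genP X J h a1 a2 g k x) => //.
- exact: (gh (inl (inl (inl (inl tt))))).
- by move=> i ig; apply: (gh (inl (inl (inl (inr (Ordinal ig)))))).
- by move=> i ig; apply: (gh (inl (inl (inr (Ordinal ig))))).
- by move=> i ig; apply: (gh (inl (inr (Ordinal ig)))).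
- by move=> i ig; apply: (gh (inr (Ordinal ig))).
Qed.

(** From g + k <= g k + 1 it is enough that 6 (g k - 1 + a1 - 2 + m) <= g k a1 a2 with m the integer
    part of (a2 - 1)/a1. For a1 = 2 and g k = 1 this fails as soon as a2 >= 5, since m is about
    a2/2; hence the excluded case. *)
Lemma nf_count (a1 a2 g k : nat) : coprime a1 a2 -> (1 < a1)%N -> (a1 < a2)%N -> (0 < k)%N -> (0 < g)%N ->
  ~ [/\ a1 = 2, g = 1 & k = 1]%N ->
  (#|{: unit + 'I_g.-1 + 'I_(a1 - 2) + 'I_(a2.-1 %/ a1) + 'I_k.-1}| <= (k * a1 * a2 * g) %/ 6 + 1)%N.
Proof.
move=> cop a11 a12 k0 g0 ng; rewrite !card_sum card_unit !card_ord.
have hm : (a1 * (a2.-1 %/ a1) <= a2.-1)%N by rewrite mulnC leq_divM.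
set m := (_ %/ a1)%N in hm *.
have gk : (g + k <= g * k + 1)%N by nia.
have key : (6 * (g * k - 1 + (a1 - 2) + m) <= (g * k) * (a1 * a2))%N.
  have s0 : (0 < g * k)%N by rewrite muln_gt0 g0.
  have [e2|n2] := eqVneq a1 2%N.
    have s2 : (1 < g * k)%N.
      rewrite ltn_neqAle s0 andbT eq_sym muln_eq1; apply/negP => /andP[/eqP gg /eqP kk]; exact: ng.
    move: (g * k)%N s2 => s s2; subst a1; clearbody m; nia.
  move: (g * k)%N s0 => s s0; clearbody m.
  have k1 : (6 * (a1 - 2 + m) <= a1 * a2)%N.
    have [e3|n3] := eqVneq a1 3%N; first by subst a1; lia.
    have a14 : (4 <= a1)%N by move: a11 n2 n3; lia.
    have : (4 * m <= a2.-1)%N by nia.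
    have [e4|n4] := eqVneq a1 4%N; first by subst a1; lia.
    have [e5|n5] := eqVneq a1 5%N; first by subst a1; lia.
    have a16 : (6 <= a1)%N by lia.
    by move=> h4; nia.
  have a1a2 : (6 <= a1 * a2)%N by nia.
  nia.
have : (g * k - 1 + (a1 - 2) + m <= (k * a1 * a2 * g) %/ 6)%N.
  rewrite leq_divRL // mulnC; apply: leq_trans key _; nia.
by lia.
Qed.
End Norm.
End CoefficientCount.

(** * Covering non-composition pairs by families with few parameters *)

Module ParameterCover.
Import all_boot all_order all_algebra.
Import boolp ring zify.
Import Moments MonodromyAction BlockSystems FiniteGeneration CoefficientCount.
Set Implicit Arguments. Unset Strict Implicit. Unset Printing Implicit Defensive.
Import GRing.Theory.
Local Open Scope ring_scope.

Lemma gen_pull (X X' : Type) (K : fieldType) (J J' : finType) (h : J -> X -> K) (h' : J' -> X' -> K) (phi : X' -> X) :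
  forall f, gen h f -> (forall j, gen h' (fun t => h j (phi t))) -> gen h' (fun t => f (phi t)).
Proof.
move=> f + hv; elim=> [c|j|f1 f2 _ g1 _ g2|f1 f2 _ g1 _ g2].
- exact: gen_const.
- exact: hv.
- exact: gen_add.
- exact: gen_mul.
Qed.

Section Cover.
Variables (K : closedFieldType) (a b : K).
Hypotheses (charK : [pchar K] =i pred0) (ab : a != b).

(** The points of X may carry auxiliary polynomials besides the parameters; what is required is that
    the coefficients of p be polynomials in the N functions h. *)
Definition fam1 N (F : {poly K} -> Prop) : Prop :=
  exists (X : Type) (J : finType) (h : J -> X -> K) (p : X -> {poly K}),
    [/\ (#|J| <= N)%N, genP h p & forall P, F P -> exists x, P = p x].
Definition fam2 N (F : {poly K} -> {poly K} -> Prop) : Prop :=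
  exists (X : Type) (J : finType) (h : J -> X -> K) (p q : X -> {poly K}),
    [/\ (#|J| <= N)%N, genP h p, genP h q & forall P Q, F P Q -> exists x, P = p x /\ Q = q x].

Lemma fam1_pair N1 N2 F1 F2 : fam1 N1 F1 -> fam1 N2 F2 -> fam2 (N1 + N2) (fun P Q => F1 P /\ F2 Q).
Proof.
move=> [X1 [J1 [h1 [p1 [c1 g1 s1]]]]] [X2 [J2 [h2 [p2 [c2 g2 s2]]]]].
pose h (j : J1 + J2) (x : X1 * X2) := match j with inl j => h1 j x.1 | inr j => h2 j x.2 end.
exists (X1 * X2)%type, (J1 + J2)%type, h, (fun x => p1 x.1), (fun x => p2 x.2); split.
- by rewrite card_sum leq_add.
- by move=> i; apply: (@gen_pull _ _ _ _ _ h1 h fst _ (g1 i)) => j; apply: (gen_var h (inl j)).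
- by move=> i; apply: (@gen_pull _ _ _ _ _ h2 h snd _ (g2 i)) => j; apply: (gen_var h (inr j)).
- by move=> P Q [/s1[x1 ->] /s2[x2 ->]]; exists (x1, x2).
Qed.

Definition goodF (t : nat * nat * nat * nat) d (P : {poly K}) : Prop :=
  let: (a1, a2, g, k) := t in
  [/\ SStruct a b P a1 a2 g k, good4 a1 g k, P.[a] = 0, P != 0 & [/\ (0 < g)%N, (0 < k)%N & (size P <= d.+1)%N]].

Lemma goodF_fam t d : fam1 (d %/ 6 + 1) (goodF t d).
Proof.
case: t => [[[a1 a2] g] k].
case: (pselect (exists P, goodF (a1, a2, g, k) d P)) => [[P0]|nP]; last first.
  exists void, void, (fun _ _ => 0), (fun=> 0); split=> //.
  - by rewrite card_void.
  - exact: genP_const.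
  - by move=> P hP; case: nP; exists P.
case=> [[V [A1 [A2 [F1 [F2 [_ [cop a11 a12] _ _ dP]]]]]] g4 _ Pn [g0 k0 sz]].
exists {x : nf K | nf_ok a1 a2 g k x}, [the finType of (unit + 'I_g.-1 + 'I_(a1 - 2) + 'I_(a2.-1 %/ a1) + 'I_k.-1)%type],
  (fun j x => @nfh K a1 a2 g k j (sval x)), (fun x => nfP a b (sval x)); split.
- apply: leq_trans (nf_count cop a11 a12 k0 g0 g4) _; rewrite leq_add2r leq_div2r // -dP.
  by move: sz; case: (size P0).
- apply: (@nfh_genP K a b charK _ _ _ a1 a2 g k) => //; first by move=> t; case: t.
  by move=> j; apply: (gen_var (fun j (x : {x : nf K | nf_ok a1 a2 g k x}) => @nfh K a1 a2 g k j (sval x)) j).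
- move=> P [S _ Pa Pn' [_ _ _]]; have [x ok e] := SStruct_nf charK ab Pn' Pa g0 k0 S.
  by exists (exist _ x ok).
Qed.

Let mid : K := (a + b) / 2%:R.
Let n2K : (2%:R : K) != 0. Proof. by rewrite (natr_c0 charK). Qed.
Let tau : {poly K} := 'X + mid%:P.
Let tau' : {poly K} := 'X - mid%:P.
Let ref : {poly K} := refl_pt a b.
Lemma tauK' : tau \Po tau' = 'X.
Proof. by rewrite /tau comp_polyD comp_polyX comp_polyC /tau' subrK. Qed.
Lemma refE : ref = (mid *+ 2)%:P - 'X.
Proof. by rewrite /ref /refl_pt -[mid *+ 2]mulr_natr /mid divfK. Qed.
Lemma sref : size ref = 2%N.
Proof. by rewrite refE addrC size_polyDl ?size_polyN ?size_polyX // (leq_ltn_trans (size_polyC_leq1 _)). Qed.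
Lemma ref_tau : ref \Po tau = tau \Po - 'X.
Proof.
rewrite refE comp_polyB comp_polyX comp_polyC /tau comp_polyD comp_polyX comp_polyC.
by rewrite mulr2n polyCD opprD addrACA subrr addr0 addrC.
Qed.
Lemma comp_NN (B W : {poly K}) : B \Po - W = (B \Po - 'X) \Po W.
Proof. by rewrite -comp_polyA raddfN /= comp_polyX. Qed.

Lemma even_sq (S : {poly K}) : S \Po - 'X = S -> exists A, S = A \Po 'X ^+ 2.
Proof.
move=> eS; have eo := poly_even_odd S.
have e2 : S \Po - 'X = (even_poly S \Po 'X^2) - (odd_poly S \Po 'X^2) * 'X.
  by rewrite -{1}eo comp_polyD comp_polyM -!comp_polyA comp_polyX !comp_Xn_poly sqrrN mulrN.
exists (even_poly S).
have : (odd_poly S \Po 'X^2) * 'X = 0.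
  have : 2%:R *: ((odd_poly S \Po 'X^2) * 'X) = 0.
    have /eqP := eS; rewrite e2 -[X in _ == X]eo -subr_eq0 opprD addrACA subrr add0r -opprD oppr_eq0.
    by rewrite -mulr2n -scaler_nat => /eqP.
  by move/eqP; rewrite scaler_eq0 (negbTE n2K) => /eqP.
by move=> h; rewrite -{1}eo h addr0.
Qed.

Lemma even_mid_sq (S : {poly K}) : even_mid a b S -> exists A, S = A \Po tau' ^+ 2.
Proof.
move=> eS; have [|A eA] := @even_sq (S \Po tau); first by rewrite -comp_polyA -ref_tau comp_polyA eS.
exists A; have := congr1 (fun p => p \Po tau') eA.
by rewrite /= -!comp_polyA tauK' comp_polyXr rmorphXn /= comp_polyX.
Qed.

(** The common right factor is the square of the distance to the midpoint, which takes equal values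
    at a and b. *)
Lemma even_CC (P Q : {poly K}) : even_mid a b P -> even_mid a b Q -> CC a b P Q.
Proof.
move=> /even_mid_sq[A eA] /even_mid_sq[B eB]; exists A, B, (tau' ^+ 2); split=> //.
by rewrite !horner_exp /tau' !hornerE /mid; field.
Qed.

Lemma CC_sym (P Q : {poly K}) : CC a b P Q -> CC a b Q P.
Proof. by move=> [A [B [W [h1 h2 h3]]]]; exists B, A, W. Qed.

(** Twice the odd part of Q about the midpoint, moved to the origin. It removes the even summand in
    [Exc] and leaves a polynomial in W alone. *)
Definition asym (Q : {poly K}) : {poly K} := (Q - (Q \Po ref)) \Po tau.
(** The exceptional pairs seen from Q: u is the monic recentred W, a right factor of the rescaled
    [asym Q], hence determined by Q and s. The scalars c and s are the two further parameters. *)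
Definition excF (w D : nat) (P Q : {poly K}) : Prop := exists (c s : K) (u M : {poly K}),
  [/\ P = c *: (u ^+ 2 \Po tau'), s *: asym Q = M \Po u,
      [/\ size u = w.+1, u`_w = 1 & u`_0 = 0], size M = D.+1 /\ M`_D = 1 & (0 < w)%N /\ (0 < D)%N].

Lemma Exc_excF d (P Q : {poly K}) : Exc a b P Q -> P != 0 -> (size P <= d.+1)%N -> (size Q <= d.+1)%N ->
  even_mid a b P /\ (even_mid a b Q \/ exists w D : 'I_d.+1, excF w D P Q).
Proof.
move=> [W [c [E [B [eP oW sW eQ eE]]]]] P0 sP sQ.
have ePe : even_mid a b P.
  by rewrite /even_mid eP comp_polyZ rmorphXn /=; congr (_ *: _); rewrite [_ \Po _]oW sqrrN.
split=> //.
pose M0 := B - (B \Po - 'X).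
have eR : Q - (Q \Po ref) = M0 \Po W.
  rewrite eQ comp_polyD [E \Po _]eE -comp_polyA [W \Po _]oW comp_NN /M0 comp_polyB.
  by rewrite opprD addrACA subrr add0r.
have [M00|M0n] := eqVneq M0 0.
  by left; apply/esym/eqP; rewrite -subr_eq0 eR M00 comp_poly0.
right.
have M0h : M0.[0] = 0 by rewrite /M0 hornerD hornerN horner_comp hornerN hornerX oppr0 subrr.
have sM0 : (1 < size M0)%N.
  rewrite ltnNge; apply/negP => h; case/eqP: M0n; move: M0h.
  by rewrite (size1_polyC h) hornerC => ->.
pose W1 := W \Po tau.
have stau : size tau = 2%N by rewrite /tau size_polyDl ?size_polyX // (leq_ltn_trans (size_polyC_leq1 _)).
have stau' : size tau' = 2%N by rewrite /tau' size_XsubC.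
have sW1 : size W1 = size W by rewrite size_comp_poly2 ?stau.
have W1n : W1 != 0 by rewrite -size_poly_eq0 sW1; case: (size W) sW.
have W1N : W1 \Po - 'X = - W1 by rewrite /W1 -comp_polyA -ref_tau comp_polyA [W \Po ref]oW raddfN.
have W10 : W1`_0 = 0.
  have := congr1 (fun p => p.[0]) W1N; rewrite /= horner_comp !hornerN hornerX oppr0 -horner_coef0 => /eqP.
  by rewrite -addr_eq0 -mulr2n -mulr_natl mulf_eq0 (negbTE n2K) => /eqP.
pose om := lead_coef W1; have om0 : om != 0 by rewrite lead_coef_eq0.
pose u := om^-1 *: W1; pose w := (size W).-1.
have ew : size W = w.+1 by rewrite /w prednK //; case: (size W) sW.
have w0 : (0 < w)%N by rewrite /w; case: (size W) sW => [|[]].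
have su : size u = w.+1 by rewrite size_scale ?invr_eq0 // sW1.
have eW1 : W1 = (om *: 'X) \Po u by rewrite comp_polyZ comp_polyX /u scalerA divff // scale1r.
pose M1 := M0 \Po (om *: 'X); pose l := lead_coef M1.
have sM1 : size M1 = size M0 by rewrite size_comp_poly2 // size_scale // size_polyX.
have l0 : l != 0 by rewrite lead_coef_eq0 -size_poly_eq0 sM1 size_poly_eq0.
pose D := (size M0).-1; have eD : size M0 = D.+1 by rewrite /D prednK // ltnW.
have D0 : (0 < D)%N by rewrite /D; case: (size M0) sM0 => [|[]].
have eA : asym Q = M1 \Po u by rewrite /asym eR /M1 -!comp_polyA -eW1.
have sR : ((D * w) <= d)%N.
  have : (size (Q - (Q \Po ref))%R <= d.+1)%N.
    apply: leq_trans (size_polyD _ _) _; rewrite size_polyN geq_max sQ size_comp_poly2 ?sref ?sQ //.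
  rewrite eR; have := size_comp_poly M0 W; rewrite eD ew /= => <-.
  by case: (size _).
have wd : (w < d.+1)%N by rewrite ltnS; apply: leq_trans sR; rewrite leq_pmull.
have Dd : (D < d.+1)%N by rewrite ltnS; apply: leq_trans sR; rewrite leq_pmulr.
exists (Ordinal wd), (Ordinal Dd), (c * om ^+ 2), l^-1, u, (l^-1 *: M1); split=> //=.
- have eW : W = om *: (u \Po tau').
    by rewrite -comp_polyZ /u scalerA divff // scale1r /W1 -comp_polyA tauK' comp_polyXr.
  by rewrite eP {1}eW exprZn scalerA rmorphXn.
- by rewrite eA comp_polyZ.
- split=> //; last by rewrite coefZ W10 mulr0.
  by rewrite coefZ /om lead_coefE sW1 ew mulVf // -[w]/(w.+1.-1) -ew -sW1 -lead_coefE.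
- split; first by rewrite size_scale ?invr_eq0 // sM1.
  by rewrite coefZ -[D]/(D.+1.-1) -eD -sM1 -lead_coefE mulVf.
Qed.

(** The leading coefficients of s times [asym Q] are those of u^D, so u is recovered as a D-th root
    at infinity and P = c u^2, recentred, needs only c and s beyond Q. *)
Lemma excF_fam N F w D d : fam1 N F ->
  fam2 (N + 2) (fun P Q => [/\ F Q, (size Q <= d.+1)%N & excF w D P Q]).
Proof.
move=> [X [J [h0 [p [cJ gp sur]]]]].
pose Y := (X * (K * K) * ({poly K} * {poly K}))%type.
pose okY (y : Y) := let: (x, (c, s), (u, M)) := y in
  [/\ (size (p x) <= d.+1)%N, s *: asym (p x) = M \Po u, [/\ size u = w.+1, u`_w = 1 & u`_0 = 0],
     size M = D.+1 /\ M`_D = 1 & (0 < w)%N /\ (0 < D)%N].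
pose X' := {y : Y | okY y}.
pose h (j : J + bool) (y : X') := match j with inl j => h0 j (sval y).1.1 | inr true => (sval y).1.2.1 | inr false => (sval y).1.2.2 end.
have gq : genP h (fun y : X' => p (sval y).1.1).
  by move=> i; apply: (@gen_pull _ _ _ _ _ h0 h (fun y : X' => (sval y).1.1) _ (gp i)) => j; apply: (gen_var h (inl j)).
case: (pselect (0 < w /\ 0 < D)%N) => [[w0 D0]|nw]; last first.
  exists void, void, (fun _ _ => 0), (fun=> 0), (fun=> 0); split=> //; try exact: genP_const.
  - by rewrite card_void.
  - by move=> P Q [_ _ [c [s [u [M [_ _ _ _ h']]]]]].
have gu : genP h (fun y : X' => (sval y).2.1).
  pose u (y : X') := (sval y).2.1; pose M (y : X') := (sval y).2.2.
  have su y : (size (u y) <= w.+1)%N by rewrite /u; case: y => -[[x [c s]] [v m]] /= [_ _ [-> _ _] _ _].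
  have sM y : (size (M y) <= D.+1)%N by rewrite /M; case: y => -[[x [c s]] [v m]] /= [_ _ _ [-> _] _].
  have ul y : (u y)`_w = 1 by rewrite /u; case: y => -[[x [c s]] [v m]] /= [_ _ [_ -> _] _ _].
  have Ml y : (M y)`_D = 1 by rewrite /M; case: y => -[[x [c s]] [v m]] /= [_ _ _ [_ ->] _].
  have u0 y : (u y)`_0 = 0 by rewrite /u; case: y => -[[x [c s]] [v m]] /= [_ _ [_ _ ->] _ _].
  have e y : (sval y).1.2.2 *: asym (p (sval y).1.1) = M y \Po u y.
    by rewrite /u /M; case: y => -[[x [c s]] [v m]] /= [_ -> _ _ _].
  have gas : genP h (fun y : X' => (sval y).1.2.2 *: asym (p (sval y).1.1)).
    apply: genP_scale; first exact: (gen_var h (inr false)).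
    have sp (y : X') : (size (p (sval y).1.1) <= d.+1)%N by case: y => -[[x [c s]] [v m]] /= [].
    rewrite /asym; apply: (@genP_comp _ _ _ _ _ _ d.+1); last exact: genP_const.
      move=> y; apply: leq_trans (size_polyD _ _) _; rewrite size_polyN geq_max sp size_comp_poly2 ?sref ?sp //.
    apply: (genP_ext (p := fun y : X' => p (sval y).1.1 + (-1) *: (p (sval y).1.1 \Po ref))).
      by move=> y; rewrite scaleN1r.
    apply: genP_add => //; apply: genP_scale; first exact: gen_const.
    by apply: (genP_comp sp) => //; apply: genP_const.
  have gU j : (j <= w.-1)%N -> gen h (fun y => (revn w (u y))`_j).
    apply: (root_gen charK D0); first by move=> y; rewrite revn_coef subn0 ul.
    move=> i iw; have iw' : (i < w)%N by rewrite -(prednK w0).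
    apply: (gen_ext (f := fun y => if (i <= w * D)%N then ((sval y).1.2.2 *: asym (p (sval y).1.1))`_(w * D - i) else 0)).
      by move=> y; rewrite -(psi_low su sM Ml) // -e revn_coef.
    by case: leqP => _; [apply: gas|apply: gen_const].
  move=> i; have [wi|iw] := ltnP w i.
    by apply: gen_ext (gen_const _ 0) => y; rewrite nth_default // (leq_trans (su y)).
  case: (posnP i) => [->|i0]; first by apply: gen_ext (gen_const _ 0) => y; rewrite -/(u y) u0.
  have hj : (w - i <= w.-1)%N by move: i0 w0; clear; lia.
  by apply: gen_ext (gU _ hj) => y; rewrite revn_coef leq_subr subKn.
exists X', (J + bool)%type, h, (fun y => (sval y).1.2.1 *: ((sval y).2.1 ^+ 2 \Po tau')), (fun y => p (sval y).1.1); split=> //.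
- by rewrite card_sum card_bool leq_add2r.
- apply: genP_scale; first exact: (gen_var h (inr true)).
  apply: (@genP_comp _ _ _ _ _ _ (w * 2).+1); first 1 last.
  + exact: genP_exp.
  + exact: genP_const.
  + by move=> y; apply: size_expW; case: y => -[[x [c s]] [v m]] /= [_ _ [-> _ _] _ _].
move=> P Q [/sur[x ->] sQ [c [s [u [M [eP e hu hM hw]]]]]].
have ok : okY ((x, (c, s)), (u, M)) by [].
by exists (exist _ _ ok).
Qed.

Definition q4n d (t : 'I_d.+1 * 'I_d.+1 * 'I_d.+1 * 'I_d.+1) : nat * nat * nat * nat :=
  (t.1.1.1 : nat, t.1.1.2 : nat, t.1.2 : nat, t.2 : nat).

(** The degree is k a1 a2 g. If a1 = 2 then g k >= 2 and a2 >= 3; if a1 >= 3 then a2 >= 4. Either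
    way it is at least 12, which is where the threshold on d comes from. *)
Lemma SStruct_goodF d (P : {poly K}) : P != 0 -> P.[a] = 0 -> P.[b] = 0 -> (size P <= d.+1)%N ->
  (exists a1 a2 g k, Struct a b P a1 a2 g k /\ good4 a1 g k) ->
  (12 <= d)%N /\ exists t, goodF (@q4n d t) d P.
Proof.
move=> P0 Pa Pb sP [a1 [a2 [g [k [S g4]]]]].
have sP3 : (2 < size P)%N.
  apply: (@max_poly_roots _ P [:: a; b]) => //=; first by rewrite /root Pa Pb eqxx.
  by rewrite inE ab.
have [_ [_ [_ [_ [_ [_ [cop a11 a12] _ _ dP]]]]]] := S.
have n0 : (0 < k * a1 * a2 * g)%N by rewrite -dP; case: (size P) sP3 => [|[]].
have nd : (k * a1 * a2 * g <= d)%N by rewrite -dP; case: (size P) sP.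
move: n0; rewrite !muln_gt0 => /andP[/andP[/andP[k0 a10] a20] g0].
have kd : (k < d.+1)%N by rewrite ltnS; apply: leq_trans nd; rewrite -!mulnA leq_pmulr // !muln_gt0 a10 a20.
have gd : (g < d.+1)%N by rewrite ltnS; apply: leq_trans nd; rewrite leq_pmull // !muln_gt0 k0 a10.
have a2d : (a2 < d.+1)%N by rewrite ltnS; apply: leq_trans nd; rewrite mulnAC leq_pmull // !muln_gt0 k0 a10.
have a1d : (a1 < d.+1)%N by apply: leq_ltn_trans a2d; exact: ltnW.
split; last by exists (Ordinal a1d, Ordinal a2d, Ordinal gd, Ordinal kd).
apply: leq_trans nd.
have [e2|n2] := eqVneq a1 2%N.
  have gk : (1 < g * k)%N.
    rewrite ltn_neqAle muln_gt0 g0 k0 !andbT eq_sym muln_eq1; apply/negP => /andP[/eqP gg /eqP kk]; exact: g4.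
  by rewrite e2; move: gk; rewrite (_ : (k * 2 * a2 * g = (g * k) * (2 * a2))%N); [move: (g * k)%N => s; nia|lia].
have : (12 <= a1 * a2)%N by nia.
have gk : (0 < g * k)%N by rewrite muln_gt0 g0.
rewrite (_ : (k * a1 * a2 * g = (g * k) * (a1 * a2))%N); last by lia.
by move: (g * k)%N (a1 * a2)%N gk => s r; nia.
Qed.

Definition coverT d : finType :=
  ((('I_d.+1 * 'I_d.+1 * 'I_d.+1 * 'I_d.+1) * ('I_d.+1 * 'I_d.+1 * 'I_d.+1 * 'I_d.+1)) +
   (bool * ('I_d.+1 * 'I_d.+1 * 'I_d.+1 * 'I_d.+1) * ('I_d.+1 * 'I_d.+1)))%type.
(** Either both polynomials have good double decompositions, or one has and the other is exceptional
    over it; the boolean tells which. Finitely many degree patterns occur. *)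
Definition coverF d (t : coverT d) (P Q : {poly K}) : Prop :=
  match t with
  | inl (x, y) => goodF (q4n x) d P /\ goodF (q4n y) d Q
  | inr (false, x, (w, D)) => [/\ goodF (q4n x) d Q, (size Q <= d.+1)%N & excF w D P Q]
  | inr (true, x, (w, D)) => [/\ goodF (q4n x) d P, (size P <= d.+1)%N & excF w D Q P]
  end.

Lemma coverF_fam d (t : coverT d) : (12 <= d)%N -> fam2 (d %/ 3 + 2) (@coverF d t).
Proof.
move=> d12.
have mono N N' F : (N <= N')%N -> fam2 N F -> fam2 N' F.
  by move=> NN [X [J [h [p [q [c g1 g2 s]]]]]]; exists X, J, h, p, q; split=> //; apply: leq_trans NN.
case: t => [[x y]|[[[] x] [w D]]] /=.
- by apply: (mono (d %/ 6 + 1 + (d %/ 6 + 1))%N); [lia|apply: fam1_pair; apply: goodF_fam].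
- apply: (mono (d %/ 6 + 1 + 2)%N); first by lia.
  have [X [J [h [p [q [c g1 g2 s]]]]]] := excF_fam w D d (@goodF_fam (q4n x) d).
  by exists X, J, h, q, p; split=> // P Q /s[z [e1 e2]]; exists z.
- by apply: (mono (d %/ 6 + 1 + 2)%N); [lia|apply: excF_fam; apply: goodF_fam].
Qed.

(** The dichotomy is applied to (P, Q) and to (Q, P). If both are exceptional then both polynomials
    are even about the midpoint, and composition follows from [even_CC]. *)
Lemma bimoment_cover d (P Q : {poly K}) : (size P <= d.+1)%N -> (size Q <= d.+1)%N ->
  P.[a] = 0 -> P.[b] = 0 -> Q.[a] = 0 -> Q.[b] = 0 -> allmom a b P Q -> allmom a b Q P ->
  CC a b P Q \/ ((12 <= d)%N /\ exists t, @coverF d t P Q).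
Proof.
move=> sP sQ Pa Pb Qa Qb mP mQ.
have tr (S S' : {poly K}) : S.[a] = 0 -> S'.[a] = 0 -> S'.[b] = 0 -> S = 0 -> CC a b S S'.
  move=> Sa Sa' Sb' ->; exists 0, 'X, S'; split; rewrite ?comp_poly0 ?comp_polyX //.
  by rewrite Sa'.
have [P0|P0] := eqVneq P 0; first by left; apply: tr.
have [Q0|Q0] := eqVneq Q 0; first by left; apply: CC_sym; apply: tr.
have dich (S S' : {poly K}) : S != 0 -> S.[a] = 0 -> S.[b] = 0 -> allmom a b S S' ->
   [\/ CC a b S S', (exists a1 a2 g k, Struct a b S a1 a2 g k /\ good4 a1 g k) | Exc a b S S'].
  move=> S0 Sa Sb mS.
  have sS3 : (2 < size S)%N.
    apply: (@max_poly_roots _ S [:: a; b]) => //=; first by rewrite /root Sa Sb eqxx.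
    by rewrite inE ab.
  have [n sS] : exists n, size S = n.+3 by case: (size S) sS3 => [|[|[|n]]] // _; exists n.
  have [m _] := monod_ex charK sS Sa Sb.
  exact: (moment_dichotomy charK sS m Sa Sb ab mS).
case: (dich P Q P0 Pa Pb mP) => [|/(SStruct_goodF P0 Pa Pb sP)[d12 [t ht]]|eP]; first by left.
  case: (dich Q P Q0 Qa Qb mQ) => [/CC_sym|/(SStruct_goodF Q0 Qa Qb sQ)[_ [t' ht']]|eQ]; first by left.
    by right; split=> //; exists (inl (t, t')).
  have [evQ [evP|[w [D hw]]]] := Exc_excF eQ Q0 sQ sP; first by left; apply: even_CC.
  by right; split=> //; exists (inr (true, t, (w, D))).
have [evP [evQ|[w [D hw]]]] := Exc_excF eP P0 sP sQ; first by left; apply: even_CC.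
case: (dich Q P Q0 Qa Qb mQ) => [/CC_sym|/(SStruct_goodF Q0 Qa Qb sQ)[d12 [t' ht']]|eQ]; first by left.
  by right; split=> //; exists (inr (false, t', (w, D))).
by left; apply: even_CC => //; case: (Exc_excF eQ Q0 sQ sP).
Qed.
End Cover.
End ParameterCover.

(** * Zariski chains, closedness of COS and the dimension bound *)

Module ZariskiChain.
Import all_boot all_order all_algebra.
Import boolp ring zify.
Import Moments MonodromyAction BlockSystems FiniteGeneration CoefficientCount ParameterCover ComplexField.
Import Defs.
Set Implicit Arguments. Unset Strict Implicit. Unset Printing Implicit Defensive.
Import GRing.Theory.
Local Open Scope ring_scope.

Definition mpoly (f : Space -> CK) : Prop := is_mpoly f.
Lemma mp_ext (f g : Space -> CK) : (forall v, f v = g v) -> mpoly f -> mpoly g.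
Proof. by move=> e; rewrite (_ : f = g) //; apply: funext. Qed.
Lemma mp_const (c : CK) : mpoly (fun=> c). Proof. exact: mpoly_const. Qed.
Lemma mp_add (f g : Space -> CK) : mpoly f -> mpoly g -> mpoly (fun v => f v + g v).
Proof. exact: mpoly_add. Qed.
Lemma mp_mul (f g : Space -> CK) : mpoly f -> mpoly g -> mpoly (fun v => f v * g v).
Proof. exact: mpoly_mul. Qed.
Lemma mp_sum (I : Type) (s : seq I) (P : pred I) (F : I -> Space -> CK) : (forall i, P i -> mpoly (F i)) ->
  mpoly (fun v => \sum_(i <- s | P i) F i v).
Proof.
move=> hF; elim: s => [|i s IH]; first by apply: mp_ext (mp_const 0) => v; rewrite big_nil.
case Pi: (P i); last by apply: mp_ext IH => v; rewrite big_cons Pi.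
by apply: mp_ext (mp_add (hF i Pi) IH) => v; rewrite big_cons Pi.
Qed.
Lemma mp_prod (I : Type) (s : seq I) (P : pred I) (F : I -> Space -> CK) : (forall i, P i -> mpoly (F i)) ->
  mpoly (fun v => \prod_(i <- s | P i) F i v).
Proof.
move=> hF; elim: s => [|i s IH]; first by apply: mp_ext (mp_const 1) => v; rewrite big_nil.
case Pi: (P i); last by apply: mp_ext IH => v; rewrite big_cons Pi.
by apply: mp_ext (mp_mul (hF i Pi) IH) => v; rewrite big_cons Pi.
Qed.
Lemma mp_exp (f : Space -> CK) n : mpoly f -> mpoly (fun v => f v ^+ n).
Proof.
move=> hf; elim: n => [|n IH]; first by apply: mp_ext (mp_const 1) => v; rewrite expr0.
by apply: mp_ext (mp_mul hf IH) => v; rewrite exprS.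
Qed.

Definition vanish (V : Space -> Prop) (f : Space -> CK) : Prop := forall v, V v -> f v = 0.
Lemma zclosed_zero (f : Space -> CK) : mpoly f -> zclosed (fun v => f v = 0).
Proof.
move=> mf; exists (fun g => g = f); split=> [g ->|v] //; split=> [h g ->|h] //; exact: h.
Qed.
Lemma irr_mul V (f g : Space -> CK) : irreducible V -> mpoly f -> mpoly g ->
  vanish V (fun v => f v * g v) -> vanish V f \/ vanish V g.
Proof.
move=> [_ irr] mf mg h; apply: (irr _ _ (zclosed_zero mf) (zclosed_zero mg)) => v /h /eqP.
by rewrite mulf_eq0 => /orP[/eqP|/eqP]; [left|right].
Qed.
Lemma irr_exp V (f : Space -> CK) n : irreducible V -> mpoly f -> vanish V (fun v => f v ^+ n) -> vanish V f.
Proof.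
move=> irr mf; elim: n => [|n IH] h.
  by case: irr => -[v Vv] _; have /eqP := h v Vv; rewrite expr0 oner_eq0.
case: (@irr_mul V f (fun v => f v ^+ n) irr mf (mp_exp n mf)) => // v Vv; rewrite -exprS; exact: h.
Qed.
Lemma irr_prod V (I : Type) (s : seq I) (F : I -> Space -> CK) : irreducible V -> (forall i, mpoly (F i)) ->
  vanish V (fun v => \prod_(i <- s) F i v) -> exists i, vanish V (F i).
Proof.
move=> irr mF; elim: s => [|i s IH] h.
  by case: irr => -[v Vv] _; have /eqP := h v Vv; rewrite big_nil oner_eq0.
case: (@irr_mul V (F i) (fun v => \prod_(i <- s) F i v) irr (mF i) (mp_prod _ (fun i _ => mF i))) => [v Vv|hi|/IH //].
  by have := h v Vv; rewrite big_cons.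
by exists i.
Qed.

Section Indep.
Variables (W : nat -> Space -> Prop) (f : nat -> Space -> CK) (N : nat).
Hypothesis irrW : forall r, (r <= N)%N -> irreducible (W r).
Hypothesis subW : forall r, (r < N)%N -> sub (W r) (W r.+1).
Hypothesis mf : forall r, mpoly (f r).
Hypothesis f0 : forall r, (r < N)%N -> vanish (W r) (f r).
Hypothesis f1 : forall r, (r < N)%N -> ~ vanish (W r.+1) (f r).

(* divide by the lowest power of the last function, then restrict to the set where it vanishes *)
Lemma chain_indep r (E : finType) (S : pred E) (c : E -> CK) (al : E -> nat -> nat) : (r <= N)%N ->
  (forall e e', S e -> S e' -> (forall j, (j < r)%N -> al e j = al e' j) -> e = e') ->
  vanish (W r) (fun v => \sum_(e | S e) c e * \prod_(j < r) f j v ^+ al e j) ->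
  forall e, S e -> c e = 0.
Proof.
elim: r S => [|r IH] S rN inj h e Se.
  have [[v Wv] _] := irrW rN.
  have := h v Wv; rewrite (bigD1 e) //= big_ord0 mulr1 big1 ?addr0 // => e' /andP[Se' ne'].
  by case/eqP: ne'; apply: inj.
have [//|ce] := eqVneq (c e) 0.
pose S' e := S e && (c e != 0).
have S'e : S' e by rewrite /S' Se ce.
case: (arg_minnP (fun e => al e r) S'e) => e0 S'e0 emin.
pose t0 := al e0 r.
pose G v := \sum_(e | S' e) c e * ((\prod_(j < r) f j v ^+ al e j) * f r v ^+ (al e r - t0)).
have mG : mpoly G.
  apply: mp_sum => e' _; apply: mp_mul; first exact: mp_const.
  by apply: mp_mul; [apply: mp_prod => j _; apply: mp_exp|apply: mp_exp].
have hG : vanish (W r.+1) G.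
  case: (@irr_mul (W r.+1) (fun v => f r v ^+ t0) G (irrW rN) (mp_exp t0 (mf r)) mG) => // [v Wv|/(irr_exp (irrW rN) (mf r))/(f1 rN)] //.
  rewrite -[RHS](h v Wv) [RHS](bigID (fun e => c e != 0)) /= [X in _ = _ + X]big1 ?addr0; last first.
    by move=> e' /andP[_]; rewrite negbK => /eqP ->; rewrite mul0r.
  rewrite /G mulr_sumr; apply: eq_bigr => e' Se'; rewrite big_ord_recr /=.
  by rewrite -[in RHS](subnKC (emin e' Se')) exprD; ring.
have hr : vanish (W r) (fun v => \sum_(e | S' e && (al e r == t0)) c e * \prod_(j < r) f j v ^+ al e j).
  move=> v Wv; rewrite -[RHS](hG v (subW rN Wv)) /G [RHS](bigID (fun e => al e r == t0)) /= [X in _ = _ + X]big1 ?addr0.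
    by apply: eq_bigr => e' /andP[_ /eqP ->]; rewrite subnn expr0 mulr1.
  move=> e' /andP[Se' ne]; rewrite (f0 rN Wv) expr0n subn_eq0 leqNgt ltn_neqAle eq_sym ne (emin e' Se') /=.
  by rewrite !mulr0.
have c0 : c e0 = 0.
  apply: (IH (fun e => S' e && (al e r == t0)) (ltnW rN) _ hr); last by rewrite S'e0 eqxx.
  move=> e1 e2 /andP[/andP[S1 _] /eqP h1] /andP[/andP[S2 _] /eqP h2] h12; apply: inj => // j.
  by rewrite ltnS leq_eqVlt => /predU1P[->|/h12 //]; rewrite h1 h2.
by move: S'e0; rewrite /S' c0 eqxx andbF.
Qed.
End Indep.

Section Space.
Variables (a b : CK) (d : nat).
Hypothesis ab : a != b.
Definition pP (v : Space) : {poly CK} := \poly_(i < d.+1) (v.1 i : CK).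
Definition pQ (v : Space) : {poly CK} := \poly_(i < d.+1) (v.2 i : CK).
Lemma size_pP v : (size (pP v) <= d.+1)%N. Proof. exact: size_poly. Qed.
Lemma size_pQ v : (size (pQ v) <= d.+1)%N. Proof. exact: size_poly. Qed.
Lemma peval_horner (c : nat -> Complex.C) (x : CK) : peval c d x = (\poly_(i < d.+1) (c i : CK)).[x] :> CK.
Proof.
have ep m : (Complex.Cpow x m : CK) = x ^+ m by elim: m => [|m IHm] //=; rewrite exprS IHm.
rewrite horner_poly /peval; move: d => n; elim: n => [|n IH].
  by rewrite Hierarchy.sum_O big_ord1 expr0.
by rewrite Hierarchy.sum_Sn IH ep [RHS]big_ord_recr.
Qed.

Lemma poly_fun_eq (p q : {poly CK}) : (forall x, p.[x] = q.[x]) -> p = q.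
Proof.
move=> h; apply/eqP; rewrite -subr_eq0; apply: contraT => pq0.
pose s := [seq (i%:R : CK) | i <- iota 0 (size (p - q))].
have : (size s < size (p - q)%R)%N.
  apply: max_poly_roots => //; last by rewrite map_inj_uniq ?iota_uniq //; apply: natr_c0_inj CK_char0.
  by apply/allP => x _; rewrite /root hornerD hornerN h subrr.
by rewrite size_map size_iota ltnn.
Qed.

Lemma cpoly_horner (f : CK -> CK) : is_cpoly f -> exists p : {poly CK}, forall x, f x = p.[x].
Proof.
elim=> [k||f1 f2 _ [p hp] _ [q hq]|f1 f2 _ [p hp] _ [q hq]].
- by exists (k : CK)%:P => x; rewrite hornerC.
- by exists 'X => x; rewrite hornerX.
- by exists (p + q) => x; rewrite hornerD -hp -hq.
- by exists (p * q) => x; rewrite hornerM -hp -hq.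
Qed.
Lemma horner_cpoly (p : {poly CK}) : is_cpoly (fun x : Complex.C => p.[x : CK] : Complex.C).
Proof.
elim/poly_ind: p => [|p c IH].
  by rewrite (_ : (fun _ => _) = fun=> (0 : CK)); [apply: cpoly_const|apply: funext => x; rewrite horner0].
rewrite (_ : (fun _ => _) = fun x : Complex.C => Complex.Cplus (Complex.Cmult (p.[x : CK] : Complex.C) x) c).
  by apply: cpoly_add; [apply: cpoly_mul => //; apply: cpoly_id|apply: cpoly_const].
by apply: funext => x; rewrite hornerD hornerM hornerX hornerC.
Qed.

Lemma COS_CC v : COS_d a b d v <-> in_PdxPd a b d v /\ CC a b (pP v) (pQ v).
Proof.
split=> -[hin].
  move=> [Pt [Qt [W [/cpoly_horner[A hA] [/cpoly_horner[B hB] [/cpoly_horner[w hw] [ew [e1 e2]]]]]]]].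
  split=> //; exists A, B, w; split.
  - by apply: poly_fun_eq => x; rewrite horner_comp -hw -hA -e1 peval_horner.
  - by apply: poly_fun_eq => x; rewrite horner_comp -hw -hB -e2 peval_horner.
  - by rewrite -!hw.
move=> [A [B [w [e1 e2 ew]]]]; split=> //.
exists (fun x : Complex.C => A.[x : CK]), (fun x : Complex.C => B.[x : CK]), (fun x : Complex.C => w.[x : CK]).
split; first exact: horner_cpoly. split; first exact: horner_cpoly. split; first exact: horner_cpoly.
split=> //; split=> x; first by rewrite peval_horner -/(pP v) e1 horner_comp.
by rewrite peval_horner -/(pQ v) e2 horner_comp.
Qed.

Lemma in_P0 v : in_PdxPd a b d v -> [/\ (pP v).[a] = 0, (pP v).[b] = 0, (pQ v).[a] = 0 & (pQ v).[b] = 0].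
Proof. by move=> [[_ [h1 h2]] [_ [h3 h4]]]; split; rewrite -peval_horner. Qed.

Lemma CC_bimoment v : in_PdxPd a b d v ->
  (CC a b (pP v) (pQ v) <-> forall j, allmom a b (pP v) (pQ v ^+ j)).
Proof.
move=> /in_P0[Pa Pb Qa Qb]; have [P0|P0] := eqVneq (pP v) 0.
  split=> [_ j k|_].
    rewrite P0; case: k => [|k]; last by rewrite /mom exprS !mul0r raddf0.
    by rewrite /mom expr0 mul1r (pint_deriv CK_char0) !horner_exp Qa Qb subrr.
  by exists 0, 'X, (pQ v); rewrite P0 comp_poly0 comp_polyX Qa Qb.
have sP3 : (2 < size (pP v))%N.
  apply: (@max_poly_roots _ (pP v) [:: a; b]) => //=; first by rewrite /root Pa Pb eqxx.
  by rewrite inE ab.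
have [n sP] : exists n, size (pP v) = n.+3 by case: (size (pP v)) sP3 => [|[|[|n]]] // _; exists n.
have [m _] := monod_ex CK_char0 sP Pa Pb.
split=> [[A [B [w [e1 e2 ew]]]] j|h]; last exact: (bimoment_CC CK_char0 m).
have -> : pQ v ^+ j = (B ^+ j) \Po w by rewrite rmorphXn /= -e2.
by apply: perp_comp_poly => //; [exact: CK_char0|exists A].
Qed.

Definition coordh (j : 'I_d.+1 + 'I_d.+1) (v : Space) : CK := match j with inl i => v.1 i | inr i => v.2 i end.
Lemma gen_mp f : gen coordh f -> mpoly f.
Proof.
elim=> [c|[] j|f1 f2 _ g1 _ g2|f1 f2 _ g1 _ g2].
- exact: mp_const.
- exact: mpoly_fst.
- exact: mpoly_snd.
- exact: mp_add.
- exact: mp_mul.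
Qed.
Lemma genP_pP : genP coordh pP.
Proof.
move=> i; have [id|di] := ltnP i d.+1.
  by apply: gen_ext (gen_var coordh (inl (Ordinal id))) => v; rewrite coef_poly id.
by apply: gen_ext (gen_const _ 0) => v; rewrite coef_poly ltnNge di.
Qed.
Lemma genP_pQ : genP coordh pQ.
Proof.
move=> i; have [id|di] := ltnP i d.+1.
  by apply: gen_ext (gen_var coordh (inr (Ordinal id))) => v; rewrite coef_poly id.
by apply: gen_ext (gen_const _ 0) => v; rewrite coef_poly ltnNge di.
Qed.
Lemma mp_mom k j : mpoly (fun v => mom a b (pP v) k (pQ v ^+ j)).
Proof.
apply: gen_mp; pose F v := pP v ^+ k * (pQ v ^+ j)^`().
have gF : genP coordh F.
  apply: genP_mul; first by apply: genP_exp genP_pP.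
  move=> i; apply: gen_ext (gen_scale i.+1%:R (genP_exp j genP_pQ i.+1)) => v.
  by rewrite coef_deriv mulr_natl.
pose n := ((d * k).+1 + (d * j).+1)%N.
have sF v : (size (F v) <= n)%N.
  apply: leq_trans (size_polyMleq _ _) _; apply: leq_trans (leq_pred _) _; apply: leq_add.
    by apply: size_expW; apply: size_pP.
  apply: leq_trans (size_poly _ _) _; apply: leq_trans (leq_pred _) _.
  by apply: size_expW; apply: size_pQ.
have gp : genP coordh (fun v => prim (F v)).
  move=> i; apply: gen_ext (gen_scale (i%:R^-1) (gF i.-1)) => v.
  by rewrite coef_prim mulrC.
have sp : exists n, forall v, (size (prim (F v)) <= n)%N.
  by exists n.+1 => v; apply: leq_trans (size_poly _ _) _; rewrite ltnS sF.
apply: (gen_ext (f := fun v => (prim (F v)).[b] - (prim (F v)).[a])); first by [].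
by apply: gen_sub; apply: genP_horner.
Qed.

Lemma mp_horner x : mpoly (fun v => (pP v).[x]) /\ mpoly (fun v => (pQ v).[x]).
Proof.
split; apply: gen_mp; apply: genP_horner.
- by exists d.+1; apply: size_pP.
- exact: genP_pP.
- by exists d.+1; apply: size_pQ.
- exact: genP_pQ.
Qed.

(** Existence of a common right factor is replaced by the vanishing of the moments of all powers of
    Q, through [CC_bimoment]; these are polynomials in the coefficients. *)
Lemma COS_closed : zclosed (COS_d a b d).
Proof.
pose S (f : Space -> Complex.C) := [\/ exists2 i, (d < i)%N & f = (fun v => v.1 i) \/ f = (fun v => v.2 i),
  exists x, (x = a \/ x = b) /\ (f = (fun v => (pP v).[x]) \/ f = (fun v => (pQ v).[x])) |
  exists k j, f = fun v => mom a b (pP v) k (pQ v ^+ j)].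
exists S; split.
  move=> f [[i _ [] ->]|[x [_ [] ->]]|[k [j ->]]].
  - exact: mpoly_fst.
  - exact: mpoly_snd.
  - by case: (mp_horner x).
  - by case: (mp_horner x).
  - exact: mp_mom.
move=> v; split=> [/COS_CC[hin hCC] f|h].
  have [Pa Pb Qa Qb] := in_P0 hin; have hm := (CC_bimoment hin).1 hCC.
  case=> [[i di [] ->]|[x [[] -> [] ->]]|[k [j ->]]] //; last exact: hm.
    by case: hin => -[h _] _; apply: h; apply/ssrnat.ltP.
  by case: hin => _ [h _]; apply: h; apply/ssrnat.ltP.
have hin : in_PdxPd a b d v.
  split; split; try split.
  - by move=> i /ssrnat.ltP di; apply: (h (fun v => v.1 i)); constructor 1; exists i => //; left.
  - rewrite peval_horner; apply: (h (fun v => (pP v).[a])); constructor 2; exists a; split; by left.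
  - rewrite peval_horner; apply: (h (fun v => (pP v).[b])); constructor 2; exists b; split; by [right|left].
  - by move=> i /ssrnat.ltP di; apply: (h (fun v => v.2 i)); constructor 1; exists i => //; right.
  - rewrite peval_horner; apply: (h (fun v => (pQ v).[a])); constructor 2; exists a; split; by [left|right].
  - rewrite peval_horner; apply: (h (fun v => (pQ v).[b])); constructor 2; exists b; split; by right.
apply/COS_CC; split=> //; apply/(CC_bimoment hin) => j k.
by apply: (h (fun v => mom a b (pP v) k (pQ v ^+ j))); constructor 3; exists k, j.
Qed.

(** What is retained of a parametric center for both halves of the theorem. *)
Definition bimom (v : Space) : Prop :=
  in_PdxPd a b d v /\ allmom a b (pP v) (pQ v) /\ allmom a b (pQ v) (pP v).

Lemma bimom_COS v : (d <= 11)%coq_nat -> bimom v -> COS_d a b d v.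
Proof.
move=> /ssrnat.leP d11 [hin [h1 h2]]; apply/COS_CC; split=> //.
have [Pa Pb Qa Qb] := in_P0 hin.
case: (bimoment_cover CK_char0 ab (size_pP v) (size_pQ v) Pa Pb Qa Qb h1 h2) => // -[d12 _].
by have := leq_ltn_trans d11 d12; rewrite ltnn.
Qed.

Definition pair_space (P Q : {poly CK}) : Space := (fun i => P`_i, fun i => Q`_i).
Lemma pair_spaceK v : in_PdxPd a b d v -> pair_space (pP v) (pQ v) = v.
Proof.
move=> [[h1 _] [h2 _]]; rewrite [v]surjective_pairing; congr (_, _); apply: funext => i; rewrite coef_poly /=.
  by case: ltnP => // di; rewrite h1 //; apply/ssrnat.ltP.
by case: ltnP => // di; rewrite h2 //; apply/ssrnat.ltP.
Qed.

(** A chain of length k + 2, k = d/3 + 2, gives k + 1 functions with independent monomials on the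
    top set. On each covering family there are at most k parameters, so these functions satisfy a
    relation R_t that does not vanish on V. The product of the R_t vanishes on V outside COS; by
    irreducibility V lies in COS or some R_t vanishes on V, and both are excluded. *)
Lemma bimom_dim V : (12 <= d)%coq_nat -> irreducible V -> sub V bimom -> ~ sub V (COS_d a b d) ->
  dim_le V (Nat.div d 3 + 2).
Proof.
move=> /ssrnat.leP d12 irrV VB nVC [W [hW hs]].
have ed : Nat.div d 3 = (d %/ 3)%N.
  symmetry; apply: (PeanoNat.Nat.div_unique d 3 _ (d %% 3)%N); first by apply/ssrnat.ltP; apply: ltn_pmod.
  by rewrite multE plusE mulnC -divn_eq.
rewrite ed in hW hs.
set k := (d %/ 3 + 2)%coq_nat in hW hs.
have WV r v : (r <= k.+1)%N -> W r v -> V v.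
  by move=> rk Wv; have [_ [F [_ hF]]] := hW r (ssrnat.leP rk); case: (hF v).1.
have /choice[f hf] : forall r, exists f : Space -> CK, mpoly f /\ ((r <= k)%N -> vanish (W r) f /\ ~ vanish (W r.+1) f).
  move=> r; have [rk|kr] := leqP r k; last by exists (fun=> 0); split; first exact: mp_const.
  have [_ [F [[S [mS hS]] hF]]] := hW r (ssrnat.leP (leqW rk)).
  have [_ ns] := hs r (ssrnat.leP rk).
  apply: contrapT => no; apply: ns => v Wv; apply/hF; split; first by apply: WV Wv.
  apply/hS => g Sg; apply: contrapT => gv; apply: no; exists g; split; first exact: mS.
  move=> _; split; last by move=> /(_ v Wv).
  by move=> u /hF[_ /hS]; apply.
have hss r : (r < k.+1)%N -> sub (W r) (W r.+1).
  by rewrite ltnS => rk; case: (hs r (ssrnat.leP rk)).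
have indep := @chain_indep W f k.+1 (fun r rk => (hW r (ssrnat.leP rk)).1) hss
  (fun r => (hf r).1) (fun r rk => ((hf r).2 rk).1) (fun r rk => ((hf r).2 rk).2) k.+1.
have rel (t : coverT d) : exists R : Space -> CK, [/\ mpoly R, ~ vanish V R &
   forall v, V v -> coverF a b t (pP v) (pQ v) -> R v = 0].
  have [X [J [h [p [q [cJ gp gq sur]]]]]] := coverF_fam CK_char0 ab t d12.
  have gf (g : Space -> CK) : mpoly g -> gen h (fun x => g (pair_space (p x) (q x))).
    elim=> [c|i|i|f1 f2 _ g1 _ g2|f1 f2 _ g1 _ g2].
    - exact: gen_const.
    - exact: gp.
    - exact: gq.
    - exact: gen_add.
    - exact: gen_mul.
  have cJ' : (#|J| < k.+1)%N by rewrite ltnS.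
  have [B [e [[al0 e0] he]]] := gen_dependent cJ' (fun j : 'I_k.+1 => gf (f j) (hf j).1).
  exists (fun v => \sum_al e al * \prod_(j < k.+1) f j v ^+ al j); split.
  - apply: mp_sum => al _; apply: mp_mul; first exact: mp_const.
    by apply: mp_prod => j _; apply: mp_exp; case: (hf j).
  - move=> hv; case/eqP: e0.
    apply: (indep _ predT e (fun al j => al (inord j))) => // [al al' _ _ h'|v Wv].
      by apply/ffunP => j; apply: val_inj; have := h' j (ltn_ord j); rewrite /= !inord_val.
    rewrite -[RHS](hv v (WV _ _ (leqnn _) Wv)); apply: eq_bigr => al _; congr (_ * _).
    by apply: eq_bigr => j _; rewrite inord_val.
  - move=> v Vv /sur[x [e1 e2]]; rewrite -[RHS](he x) -e1 -e2 pair_spaceK //; exact: (VB v Vv).1.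
have /choice[R hR] := rel.
pose RR v := \prod_(t <- index_enum (coverT d)) R t v.
have mRR : mpoly RR by apply: mp_prod => t _; case: (hR t).
case: (irrV.2 _ _ COS_closed (zclosed_zero mRR)).
- move=> v Vv; have [hin [h1 h2]] := VB v Vv; have [Pa Pb Qa Qb] := in_P0 hin.
  case: (bimoment_cover CK_char0 ab (size_pP v) (size_pQ v) Pa Pb Qa Qb h1 h2) => [hCC|[_ [t ht]]].
    by left; apply/COS_CC.
  right; rewrite /RR (bigD1 t) //=; case: (hR t) => _ _ hz; by rewrite hz // mul0r.
- exact: nVC.
move=> hV; have [t ht] := irr_prod irrV (fun t => let: And3 m _ _ := hR t in m) hV.
by case: (hR t) => _ nv _; apply: nv.
Qed.
End Space.
End ZariskiChain.

(** * Solutions of the Abel equation and the first integral *)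

Module AbelFlow.
Import Reals Lra Lia.
Import Coquelicot.
Open Scope R_scope.

(** The sum norm instead of the modulus: it is linear on each sign pattern of the coordinates, so
    the real mean value theorem applies to it directly. *)
Definition N1 (z : C) : R := Rabs (fst z) + Rabs (snd z).
Lemma N1_ge0 z : 0 <= N1 z.
Proof. unfold N1; pose proof (Rabs_pos (fst z)); pose proof (Rabs_pos (snd z)); lra. Qed.
Lemma N1_0 : N1 (RtoC 0) = 0.
Proof. unfold N1; simpl; rewrite Rabs_R0; ring. Qed.
Lemma N1_RtoC r : N1 (RtoC r) = Rabs r.
Proof. unfold N1; simpl; rewrite Rabs_R0; ring. Qed.
Lemma N1_eq0 z : N1 z <= 0 -> z = RtoC 0.
Proof.
  unfold N1; destruct z as [x y]; simpl; intros H.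
  pose proof (Rabs_pos x); pose proof (Rabs_pos y).
  assert (Rabs x = 0) by lra. assert (Rabs y = 0) by lra.
  destruct (Req_dec x 0) as [->|hx]; [|pose proof (Rabs_no_R0 _ hx); lra].
  destruct (Req_dec y 0) as [->|hy]; [|pose proof (Rabs_no_R0 _ hy); lra].
  reflexivity.
Qed.
Lemma N1_plus z w : N1 (Cplus z w) <= N1 z + N1 w.
Proof.
  unfold N1; destruct z, w; simpl.
  pose proof (Rabs_triang r r1); pose proof (Rabs_triang r0 r2); lra.
Qed.
Lemma N1_opp z : N1 (Copp z) = N1 z.
Proof. unfold N1; destruct z; simpl; rewrite !Rabs_Ropp; reflexivity. Qed.
Lemma N1_minus_sym z w : N1 (Cminus z w) = N1 (Cminus w z).
Proof. rewrite <- N1_opp; f_equal; unfold Cminus; ring. Qed.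
Lemma N1_mult z w : N1 (Cmult z w) <= N1 z * N1 w.
Proof.
  unfold N1; destruct z as [a b], w as [c d]; simpl.
  replace (a * c - b * d) with (a * c + - (b * d)) by ring.
  pose proof (Rabs_triang (a * c) (- (b * d))) as H1; pose proof (Rabs_triang (a * d) (b * c)) as H2.
  rewrite Rabs_Ropp in H1; rewrite !Rabs_mult in H1, H2. nra.
Qed.
Lemma N1_pow z n : N1 (Cpow z n) <= N1 z ^ n.
Proof.
  induction n as [|n IH]; simpl.
  - unfold N1; simpl; rewrite Rabs_R1, Rabs_R0; lra.
  - eapply Rle_trans; [apply N1_mult|]. apply Rmult_le_compat_l; [apply N1_ge0|exact IH].
Qed.
Lemma N1_Cmod z : N1 z <= 2 * Cmod z.
Proof.
  unfold N1; pose proof (Rmax_Cmod z) as H.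
  pose proof (Rmax_l (Rabs (fst z)) (Rabs (snd z))); pose proof (Rmax_r (Rabs (fst z)) (Rabs (snd z))); lra.
Qed.
Lemma Cmod_N1 z : Cmod z <= N1 z.
Proof.
  unfold Cmod, N1. rewrite <- (sqrt_pow2 (Rabs (fst z) + Rabs (snd z))).
  2: pose proof (Rabs_pos (fst z)); pose proof (Rabs_pos (snd z)); lra.
  apply sqrt_le_1_alt. rewrite (pow2_abs (fst z)) || idtac.
  pose proof (Rabs_pos (fst z)); pose proof (Rabs_pos (snd z)).
  rewrite <- (pow2_abs (fst z)), <- (pow2_abs (snd z)). nra.
Qed.

Definition dC (f : R -> C) (t : R) (l : C) : Prop :=
  is_derive (fun s => fst (f s)) t (fst l) /\ is_derive (fun s => snd (f s)) t (snd l).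

Lemma dC_is_derive f t l : dC f t l -> is_derive f t l.
Proof.
  intros [H1 H2].
  apply (is_derive_ext (fun s => plus (scal (fst (f s)) ((1, 0) : C)) (scal (snd (f s)) ((0, 1) : C)))).
  - intros s; destruct (f s) as [x y]; simpl. unfold plus, scal; simpl. unfold prod_plus, prod_scal, scal; simpl.
    unfold plus, mult; simpl. unfold mult; simpl. f_equal; ring.
  - replace l with (plus (scal (fst l) ((1, 0) : C)) (scal (snd l) ((0, 1) : C))).
    + apply @is_derive_plus; apply @is_derive_scal_l; assumption.
    + destruct l as [x y]; simpl. unfold plus, scal; simpl. unfold prod_plus, prod_scal, scal; simpl.
      unfold plus, mult; simpl. unfold mult; simpl. f_equal; ring.
Qed.
Lemma is_derive_dC (f : R -> C) t (l : C) : is_derive f t l -> dC f t l.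
Proof.
  intros H; split.
  - exact (filterdiff_comp' f fst t (fun y => scal y l) fst H (filterdiff_linear fst is_linear_fst)).
  - exact (filterdiff_comp' f snd t (fun y => scal y l) snd H (filterdiff_linear snd is_linear_snd)).
Qed.
Lemma dC_const c t : dC (fun _ => c) t (RtoC 0).
Proof. split; simpl; apply @is_derive_const. Qed.
Lemma dC_plus f g t l m : dC f t l -> dC g t m -> dC (fun s => Cplus (f s) (g s)) t (Cplus l m).
Proof. intros [H1 H2] [H3 H4]; split; simpl; apply @is_derive_plus; assumption. Qed.
Lemma dC_opp f t l : dC f t l -> dC (fun s => Copp (f s)) t (Copp l).
Proof. intros [H1 H2]; split; simpl; apply @is_derive_opp; assumption. Qed.
Lemma dC_eq f t l m : l = m -> dC f t l -> dC f t m.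
Proof. intros ->; trivial. Qed.
Lemma dC_ext f g t l : (forall s, f s = g s) -> dC f t l -> dC g t l.
Proof.
  intros e [h1 h2]; split; [apply (is_derive_ext (fun s => fst (f s)))|apply (is_derive_ext (fun s => snd (f s)))]; trivial; intros; rewrite e; reflexivity.
Qed.
Lemma dC_mult f g t l m : dC f t l -> dC g t m -> dC (fun s => Cmult (f s) (g s)) t (Cplus (Cmult l (g t)) (Cmult (f t) m)).
Proof.
  intros [H1 H2] [H3 H4]; split; simpl.
  - replace (fst l * fst (g t) - snd l * snd (g t) + (fst (f t) * fst m - snd (f t) * snd m))
      with (minus (plus (mult (fst l) (fst (g t))) (mult (fst (f t)) (fst m))) (plus (mult (snd l) (snd (g t))) (mult (snd (f t)) (snd m)))).
    2: unfold minus, plus, opp, mult; simpl; ring.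
    apply @is_derive_minus; apply @is_derive_mult; try assumption; intros; apply Rmult_comm.
  - replace (fst l * snd (g t) + snd l * fst (g t) + (fst (f t) * snd m + snd (f t) * fst m))
      with (plus (plus (mult (fst l) (snd (g t))) (mult (fst (f t)) (snd m))) (plus (mult (snd l) (fst (g t))) (mult (snd (f t)) (fst m)))).
    2: unfold plus, mult; simpl; ring.
    apply @is_derive_plus; apply @is_derive_mult; try assumption; intros; apply Rmult_comm.
Qed.
Lemma dC_pow f t l n : dC f t l -> dC (fun s => Cpow (f s) n) t (Cmult (Cmult (RtoC (INR n)) (Cpow (f t) (pred n))) l).
Proof.
  intros H; induction n as [|n IH].
  - simpl. eapply dC_eq; [|apply dC_const]. ring.
  - eapply dC_eq; [|apply (dC_mult _ _ _ _ _ H IH)].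
    rewrite S_INR, RtoC_plus. destruct n; simpl; ring.
Qed.

(* mean value inequality, by testing against the sign patterns that realise the norm *)
Lemma dC_mvi f df g dg a b : a <= b ->
  (forall t, a <= t <= b -> dC f t (df t)) -> (forall t, a <= t <= b -> is_derive g t (dg t)) ->
  (forall t, a <= t <= b -> N1 (df t) <= dg t) -> N1 (Cminus (f b) (f a)) <= g b - g a.
Proof.
  intros ab Hf Hg Hle.
  assert (key : forall u v, Rabs u <= 1 -> Rabs v <= 1 ->
    u * fst (Cminus (f b) (f a)) + v * snd (Cminus (f b) (f a)) <= g b - g a).
  { intros u v hu hv.
    set (h := fun t => g t - (u * fst (f t) + v * snd (f t))).
    destruct (MVT_gen h a b (fun t => dg t - (u * fst (df t) + v * snd (df t)))) as [c [hc e]].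
    - rewrite Rmin_left, Rmax_right by lra. intros x hx. unfold h.
      assert (hx' : a <= x <= b) by lra. destruct (Hf x hx') as [h1 h2]. specialize (Hg x hx').
      apply @is_derive_minus; [assumption|]. apply @is_derive_plus; apply is_derive_scal; assumption.
    - rewrite Rmin_left, Rmax_right by lra. intros x hx. apply continuity_pt_filterlim.
      apply @ex_derive_continuous. destruct (Hf x hx) as [h1 h2]. specialize (Hg x hx).
      eexists. unfold h. apply @is_derive_minus; [eassumption|]. apply @is_derive_plus; apply is_derive_scal; eassumption.
    - rewrite Rmin_left, Rmax_right in hc by lra.
      specialize (Hle c hc). unfold N1 in Hle.
      assert (u * fst (df c) <= Rabs (fst (df c))).
      { eapply Rle_trans; [apply Rle_abs|]. rewrite Rabs_mult. pose proof (Rabs_pos (fst (df c))). nra. }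
      assert (v * snd (df c) <= Rabs (snd (df c))).
      { eapply Rle_trans; [apply Rle_abs|]. rewrite Rabs_mult. pose proof (Rabs_pos (snd (df c))). nra. }
      assert (0 <= h b - h a) by (rewrite e; apply Rmult_le_pos; lra).
      unfold h in *. unfold Cminus, Cplus, Copp; simpl. lra. }
  assert (E1 : Rabs 1 <= 1) by (rewrite Rabs_R1; lra).
  assert (E2 : Rabs (-1) <= 1) by (rewrite Rabs_left; lra).
  unfold N1.
  destruct (Rcase_abs (fst (Cminus (f b) (f a)))) as [h1|h1]; destruct (Rcase_abs (snd (Cminus (f b) (f a)))) as [h2|h2].
  - rewrite (Rabs_left _ h1), (Rabs_left _ h2). pose proof (key _ _ E2 E2). lra.
  - rewrite (Rabs_left _ h1), (Rabs_right _ h2). pose proof (key _ _ E2 E1). lra.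
  - rewrite (Rabs_right _ h1), (Rabs_left _ h2). pose proof (key _ _ E1 E2). lra.
  - rewrite (Rabs_right _ h1), (Rabs_right _ h2). pose proof (key _ _ E1 E1). lra.
Qed.

Lemma dC_lip f df S a b : (forall t, Rmin a b <= t <= Rmax a b -> dC f t (df t)) ->
  (forall t, Rmin a b <= t <= Rmax a b -> N1 (df t) <= S) -> N1 (Cminus (f b) (f a)) <= S * Rabs (b - a).
Proof.
  assert (W : forall a b, a <= b -> (forall t, a <= t <= b -> dC f t (df t)) ->
    (forall t, a <= t <= b -> N1 (df t) <= S) -> N1 (Cminus (f b) (f a)) <= S * (b - a)).
  { intros a' b' ab Hf HS. replace (S * (b' - a')) with (S * b' - S * a') by ring.
    apply (dC_mvi f df (fun t => S * t) (fun _ => S)); trivial.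
    intros t _. auto_derive; trivial; ring. }
  intros Hf HS. destruct (Rle_dec a b) as [ab|ab].
  - rewrite Rmin_left, Rmax_right in * by lra. rewrite Rabs_right by lra. apply W; trivial.
  - rewrite Rmin_right, Rmax_left in * by lra. rewrite Rabs_left by lra. rewrite N1_minus_sym.
    replace (- (b - a)) with (a - b) by ring. apply W; trivial; lra.
Qed.

Section Abel.
Variables p q : R -> C.

Definition field (t : R) (y : C) : C := Cplus (Cmult (p t) (Cpow y 3)) (Cmult (q t) (Cpow y 2)).
Definition sol (y : R -> C) : Prop := forall t, 0 <= t <= 1 -> dC y t (field t (y t)).

Variable phi : nat -> R -> C.
Hypothesis phi0 : forall t, phi 0 t = RtoC 0.
Hypothesis phi1 : forall t, phi 1 t = RtoC 1.
Hypothesis dphi : forall n t, dC (phi (S (S n))) t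
  (Copp (Cplus (Cmult (RtoC (INR (S n))) (Cmult (q t) (phi (S n) t))) (Cmult (RtoC (INR n)) (Cmult (p t) (phi n t))))).
Hypothesis phi_0 : forall n, phi (S (S n)) 0 = RtoC 0.

Fixpoint HS (y : R -> C) (n : nat) (t : R) : C :=
  match n with O => RtoC 0 | S m => Cplus (HS y m t) (Cmult (phi (S m) t) (Cpow (y t) (S m))) end.
(** The derivative of the truncated first integral along a solution: what remains after telescoping,
    divisible by y^(n+2). *)
Definition HE (y : R -> C) (n : nat) (t : R) : C :=
  Cmult (Cpow (y t) (S (S n)))
   (Cplus (Cplus (Cmult (RtoC (INR (S n))) (Cmult (q t) (phi (S n) t))) (Cmult (RtoC (INR n)) (Cmult (p t) (phi n t))))
     (Cmult (RtoC (INR (S n))) (Cmult (phi (S n) t) (Cmult (p t) (y t))))).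

(* all terms up to the truncation order telescope *)
Lemma HS_deriv y n t : dC y t (field t (y t)) -> dC (HS y (S n)) t (HE y n t).
Proof.
  intros H; induction n as [|n IH].
  - assert (d1 : dC (phi 1) t (RtoC 0)) by (apply (dC_ext (fun _ => RtoC 1)); [intros; symmetry; apply phi1|apply dC_const]).
    change (HS y 1) with (fun t => Cplus (RtoC 0) (Cmult (phi 1 t) (Cpow (y t) 1))).
    eapply dC_eq; [|apply dC_plus; [apply dC_const|apply dC_mult; [exact d1|apply (dC_pow y t _ 1 H)]]].
    unfold HE, field. rewrite phi1, phi0. simpl. ring.
  - change (HS y (S (S n))) with (fun t => Cplus (HS y (S n) t) (Cmult (phi (S (S n)) t) (Cpow (y t) (S (S n))))).
    eapply dC_eq; [|apply dC_plus; [exact IH|apply dC_mult; [apply dphi|apply (dC_pow y t _ (S (S n)) H)]]].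
    unfold HE, field. rewrite !S_INR, !RtoC_plus. simpl. ring.
Qed.

Lemma HS_0 y n : HS y (S n) 0 = y 0.
Proof.
  induction n as [|n IH].
  - simpl. rewrite phi1. ring.
  - change (HS y (S (S n)) 0) with (Cplus (HS y (S n) 0) (Cmult (phi (S (S n)) 0) (Cpow (y 0) (S (S n))))).
    rewrite IH, phi_0. ring.
Qed.
Lemma HS_1 y n : (forall m, (m < n)%nat -> phi (S (S m)) 1 = RtoC 0) -> HS y (S n) 1 = y 1.
Proof.
  induction n as [|n IH]; intros H.
  - simpl. rewrite phi1. ring.
  - change (HS y (S (S n)) 1) with (Cplus (HS y (S n) 1) (Cmult (phi (S (S n)) 1) (Cpow (y 1) (S (S n))))).
    rewrite IH by (intros; apply H; lia). rewrite H by lia. ring.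
Qed.

(** Bounds on [-1, 2], a neighbourhood of [0, 1], because derivatives at 0 and 1 are two-sided and
    constructed solutions must extend past both ends. *)
Variable M : R.
Hypothesis M1 : 1 <= M.
Hypothesis Mp : forall t, -1 <= t <= 2 -> N1 (p t) <= M.
Hypothesis Mq : forall t, -1 <= t <= 2 -> N1 (q t) <= M.

Lemma N1_INR n z : N1 (Cmult (RtoC (INR n)) z) <= INR n * N1 z.
Proof.
  eapply Rle_trans; [apply N1_mult|]. rewrite N1_RtoC, Rabs_right; [lra|apply Rle_ge, pos_INR].
Qed.

(** The majorant (1 + 2Mt)^n is chosen so that its derivative dominates both terms of the recursion;
    the mean value inequality then closes the induction. *)
Lemma phi_bound n t : 0 <= t <= 1 -> N1 (phi (S n) t) <= (1 + 2 * M * t) ^ n.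
Proof.
  revert t. induction n as [n IH] using (well_founded_induction Wf_nat.lt_wf). intros t ht.
  destruct n as [|n].
  { rewrite phi1, N1_RtoC, Rabs_R1; simpl; lra. }
  replace (phi (S (S n)) t) with (Cminus (phi (S (S n)) t) (phi (S (S n)) 0)) by (rewrite phi_0; ring).
  apply Rle_trans with ((1 + 2 * M * t) ^ (S n) - (1 + 2 * M * 0) ^ (S n)).
  2: replace (1 + 2 * M * 0) with 1 by ring; rewrite pow1; lra.
  apply (dC_mvi (phi (S (S n)))
    (fun t => Copp (Cplus (Cmult (RtoC (INR (S n))) (Cmult (q t) (phi (S n) t))) (Cmult (RtoC (INR n)) (Cmult (p t) (phi n t)))))
    (fun t => (1 + 2 * M * t) ^ (S n)) (fun t => INR (S n) * (2 * M) * (1 + 2 * M * t) ^ n)); try lra.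
  - intros s _; apply dphi.
  - intros s _. apply (is_derive_pow (fun t => 1 + 2 * M * t) (S n) s (2 * M)). auto_derive; trivial; ring.
  - intros s hs. rewrite N1_opp. eapply Rle_trans; [apply N1_plus|].
    assert (hs' : 0 <= s <= 1) by lra.
    assert (X1 : 1 <= 1 + 2 * M * s) by nra.
    assert (A : N1 (Cmult (q s) (phi (S n) s)) <= M * (1 + 2 * M * s) ^ n).
    { eapply Rle_trans; [apply N1_mult|]. apply Rmult_le_compat; try apply N1_ge0; [apply Mq; lra|apply IH; [lia|lra]]. }
    assert (B : INR n * N1 (Cmult (p s) (phi n s)) <= INR n * (M * (1 + 2 * M * s) ^ n)).
    { destruct n as [|n]; [simpl; lra|]. apply Rmult_le_compat_l; [apply pos_INR|].
      eapply Rle_trans; [apply N1_mult|]. apply Rmult_le_compat; try apply N1_ge0; [apply Mp; lra|].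
      eapply Rle_trans; [apply IH; [lia|lra]|]. apply Rle_pow; [exact X1|lia]. }
    pose proof (N1_INR (S n) (Cmult (q s) (phi (S n) s))) as E1.
    pose proof (N1_INR n (Cmult (p s) (phi n s))) as E2.
    pose proof (pos_INR n) as Pn. rewrite S_INR in *.
    assert (0 <= M * (1 + 2 * M * s) ^ n) by (apply Rmult_le_pos; [lra|apply pow_le; lra]).
    nra.
Qed.

Definition Kb := 1 + 2 * M.
Lemma phi_bound1 n t : 0 <= t <= 1 -> N1 (phi n t) <= Kb ^ n.
Proof.
  intros ht. assert (1 <= Kb) by (unfold Kb; lra). destruct n as [|n].
  - rewrite phi0, N1_0; simpl; lra.
  - eapply Rle_trans; [apply phi_bound; trivial|].
    apply Rle_trans with (Kb ^ n); [apply pow_incr; unfold Kb; nra|apply Rle_pow; [trivial|lia]].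
Qed.

Lemma HE_bound y n t r : 0 <= t <= 1 -> 0 <= r <= 1 -> N1 (y t) <= r ->
  N1 (HE y n t) <= 3 * INR (S n) * M * Kb ^ (S n) * r ^ (S (S n)).
Proof.
  intros ht hr hy. unfold HE.
  pose proof (phi_bound1 (S n) t ht) as B1. pose proof (phi_bound1 n t ht) as B0.
  assert (K1 : 1 <= Kb) by (unfold Kb; lra).
  assert (Kn : Kb ^ n <= Kb ^ (S n)) by (apply Rle_pow; [trivial|lia]).
  assert (K0 : 0 <= Kb ^ n) by (apply pow_le; lra).
  set (X := Kb ^ (S n)) in *.
  assert (Hp : N1 (p t) <= M) by (apply Mp; lra). assert (Hq : N1 (q t) <= M) by (apply Mq; lra).
  assert (P1 : N1 (Cpow (y t) (S (S n))) <= r ^ (S (S n))).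
  { eapply Rle_trans; [apply N1_pow|]. apply pow_incr; split; [apply N1_ge0|exact hy]. }
  assert (T1 : N1 (Cmult (RtoC (INR (S n))) (Cmult (q t) (phi (S n) t))) <= INR (S n) * (M * X)).
  { eapply Rle_trans; [apply N1_INR|]. apply Rmult_le_compat_l; [apply pos_INR|].
    eapply Rle_trans; [apply N1_mult|]. apply Rmult_le_compat; try apply N1_ge0; trivial. }
  assert (T2 : N1 (Cmult (RtoC (INR n)) (Cmult (p t) (phi n t))) <= INR (S n) * (M * X)).
  { eapply Rle_trans; [apply N1_INR|]. apply Rmult_le_compat; [apply pos_INR|apply N1_ge0|rewrite S_INR; lra|].
    eapply Rle_trans; [apply N1_mult|]. apply Rmult_le_compat; try apply N1_ge0; trivial; lra. }
  assert (T3 : N1 (Cmult (RtoC (INR (S n))) (Cmult (phi (S n) t) (Cmult (p t) (y t)))) <= INR (S n) * (M * X)).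
  { eapply Rle_trans; [apply N1_INR|]. apply Rmult_le_compat_l; [apply pos_INR|].
    eapply Rle_trans; [apply N1_mult|]. rewrite (Rmult_comm M). apply Rmult_le_compat; try apply N1_ge0; trivial.
    eapply Rle_trans; [apply N1_mult|]. pose proof (N1_ge0 (p t)); pose proof (N1_ge0 (y t)). nra. }
  eapply Rle_trans; [apply N1_mult|].
  apply Rle_trans with (r ^ (S (S n)) * (3 * (INR (S n) * (M * X)))).
  2: right; ring.
  apply Rmult_le_compat; try apply N1_ge0; trivial.
  eapply Rle_trans; [apply N1_plus|]. pose proof (N1_plus (Cmult (RtoC (INR (S n))) (Cmult (q t) (phi (S n) t))) (Cmult (RtoC (INR n)) (Cmult (p t) (phi n t)))). lra.
Qed.

Lemma HS_diff y n r : sol y -> 0 <= r <= 1 -> (forall t, 0 <= t <= 1 -> N1 (y t) <= r) ->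
  N1 (Cminus (HS y (S n) 1) (y 0)) <= 3 * INR (S n) * M * Kb ^ (S n) * r ^ (S (S n)).
Proof.
  intros Hs hr hy. rewrite <- (HS_0 y n).
  replace (3 * INR (S n) * M * Kb ^ (S n) * r ^ (S (S n))) with (3 * INR (S n) * M * Kb ^ (S n) * r ^ (S (S n)) * Rabs (1 - 0)).
  2: { replace (1 - 0) with 1 by ring. rewrite Rabs_R1; ring. }
  apply (dC_lip _ (HE y n)).
  - intros t ht. rewrite Rmin_left, Rmax_right in ht by lra. apply HS_deriv, Hs; lra.
  - intros t ht. rewrite Rmin_left, Rmax_right in ht by lra. apply HE_bound; [lra|lra|apply hy; lra].
Qed.

Lemma field_bound t y r : -1 <= t <= 2 -> 0 <= r <= 1 -> N1 y <= r -> N1 (field t y) <= 2 * M * r ^ 2.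
Proof.
  intros ht hr hy. unfold field.
  assert (A : forall s k, (2 <= k)%nat -> N1 s <= M -> N1 (Cmult s (Cpow y k)) <= M * r ^ 2).
  { intros s k hk hs. eapply Rle_trans; [apply N1_mult|].
    apply Rmult_le_compat; try apply N1_ge0; trivial.
    eapply Rle_trans; [apply N1_pow|]. apply Rle_trans with (r ^ k); [apply pow_incr; split; [apply N1_ge0|trivial]|].
    replace k with (2 + (k - 2))%nat by lia. rewrite pow_add.
    assert (0 <= r ^ (k - 2) <= 1).
    { split; [apply pow_le; lra|]. rewrite <- (pow1 (k - 2)). apply pow_incr; lra. }
    assert (0 <= r ^ 2) by (apply pow_le; lra). nra. }
  eapply Rle_trans; [apply N1_plus|].
  pose proof (A (p t) 3%nat ltac:(lia) (Mp t ht)). pose proof (A (q t) 2%nat ltac:(lia) (Mq t ht)). lra.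
Qed.

Lemma field_lip t y z r : -1 <= t <= 2 -> 0 <= r <= 1 -> N1 y <= r -> N1 z <= r ->
  N1 (Cminus (field t y) (field t z)) <= 5 * M * r * N1 (Cminus y z).
Proof.
  intros ht hr hy hz.
  replace (Cminus (field t y) (field t z)) with
    (Cmult (Cplus (Cmult (p t) (Cplus (Cmult y y) (Cplus (Cmult y z) (Cmult z z)))) (Cmult (q t) (Cplus y z))) (Cminus y z))
    by (unfold field, Cminus; simpl; ring).
  eapply Rle_trans; [apply N1_mult|]. apply Rmult_le_compat_r; [apply N1_ge0|].
  pose proof (N1_ge0 y); pose proof (N1_ge0 z).
  pose proof (N1_mult y y); pose proof (N1_mult y z); pose proof (N1_mult z z).
  assert (Q : N1 (Cplus (Cmult y y) (Cplus (Cmult y z) (Cmult z z))) <= 3 * r).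
  { eapply Rle_trans; [apply N1_plus|]. pose proof (N1_plus (Cmult y z) (Cmult z z)). nra. }
  pose proof (N1_plus y z).
  eapply Rle_trans; [apply N1_plus|].
  pose proof (N1_mult (p t) (Cplus (Cmult y y) (Cplus (Cmult y z) (Cmult z z)))).
  pose proof (N1_mult (q t) (Cplus y z)).
  pose proof (Mp t ht). pose proof (Mq t ht). pose proof (N1_ge0 (p t)). pose proof (N1_ge0 (q t)).
  pose proof (N1_ge0 (Cplus (Cmult y y) (Cplus (Cmult y z) (Cmult z z)))). pose proof (N1_ge0 (Cplus y z)).
  assert (N1 (p t) * N1 (Cplus (Cmult y y) (Cplus (Cmult y z) (Cmult z z))) <= M * (3 * r)) by (apply Rmult_le_compat; lra).
  assert (N1 (q t) * N1 (Cplus y z) <= M * (2 * r)) by (apply Rmult_le_compat; lra).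
  lra.
Qed.

Lemma dC_cont f t l : dC f t l -> forall e, 0 < e -> exists d, 0 < d /\ forall s, Rabs (s - t) < d -> N1 (Cminus (f s) (f t)) < e.
Proof.
  intros [H1 H2] e he.
  assert (A : forall g : R -> R, ex_derive g t -> exists d, 0 < d /\ forall s, Rabs (s - t) < d -> Rabs (g s - g t) < e / 2).
  { intros g Hg. assert (he2 : 0 < e / 2) by lra.
    destruct (proj1 (filterlim_locally _ _) (ex_derive_continuous g t Hg) (mkposreal _ he2)) as [d hd].
    exists d; split; [apply cond_pos|]. intros s hs. exact (hd s hs). }
  destruct (A (fun s => fst (f s)) (ex_intro _ _ H1)) as [d1 [p1 h1]].
  destruct (A (fun s => snd (f s)) (ex_intro _ _ H2)) as [d2 [p2 h2]].
  exists (Rmin d1 d2); split; [apply Rmin_pos; trivial|]. intros s hs.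
  specialize (h1 s (Rlt_le_trans _ _ _ hs (Rmin_l _ _))). specialize (h2 s (Rlt_le_trans _ _ _ hs (Rmin_r _ _))).
  unfold N1, Cminus, Cplus, Copp; simpl. unfold Rminus in *. lra.
Qed.

Lemma N1_tri_back z w : N1 z <= N1 w + N1 (Cminus z w).
Proof. replace z with (Cplus w (Cminus z w)) at 1 by (unfold Cminus; ring). apply N1_plus. Qed.

(* continuity argument: the integral bound on an initial interval is strictly better than the one assumed there *)
Lemma apriori y r : sol y -> 0 < r -> 8 * M * r <= 1 -> N1 (y 0) <= r / 4 -> forall t, 0 <= t <= 1 -> N1 (y t) <= r.
Proof.
  intros Hs hr hr8 h0.
  set (E := fun t => 0 <= t <= 1 /\ forall s, 0 <= s <= t -> N1 (y s) <= r).
  assert (E0 : E 0).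
  { split; [lra|]. intros s hs. replace s with 0 by lra. lra. }
  assert (better : forall T, E T -> N1 (y T) <= r / 2).
  { intros T [hT h]. 
    assert (N1 (Cminus (y T) (y 0)) <= 2 * M * r ^ 2 * Rabs (T - 0)).
    { apply (dC_lip y (fun t => field t (y t))); rewrite Rmin_left, Rmax_right by lra; intros t ht.
      - apply Hs; lra.
      - apply field_bound; [lra|nra|apply h; lra]. }
    rewrite Rabs_right in H by lra. pose proof (N1_tri_back (y T) (y 0)). 
    assert (2 * M * r ^ 2 * (T - 0) <= r / 4).
    { replace (2 * M * r ^ 2 * (T - 0)) with ((2 * M * r) * (r * T)) by (simpl; ring).
      apply Rle_trans with (1 / 4 * (r * T)); [apply Rmult_le_compat_r; nra|nra]. }
    lra. }
  destruct (completeness E) as [T [ub lub]].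
  { exists 1. intros t [ht _]; lra. }
  { exists 0; exact E0. }
  assert (T0 : 0 <= T) by (apply ub; exact E0).
  assert (T1 : T <= 1) by (apply lub; intros t [ht _]; lra).
  assert (below : forall s, 0 <= s < T -> N1 (y s) <= r).
  { intros s hs. destruct (Classical_Prop.classic (exists t, E t /\ s < t)) as [[t [[ht h] st]]|no].
    - apply h; lra.
    - exfalso. assert (T <= s); [|lra]. apply lub. intros t Et. destruct (Rle_dec t s); trivial.
      exfalso; apply no; exists t; split; trivial; lra. }
  assert (ET : E T).
  { split; [lra|]. intros s hs. destruct (Req_dec s T) as [->|ne]; [|apply below; lra].
    destruct (Rle_dec (N1 (y T)) r) as [h|h]; trivial. exfalso.
    destruct (dC_cont y T _ (Hs T ltac:(lra)) (N1 (y T) - r) ltac:(lra)) as [d [pd hd]].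
    destruct (Req_dec T 0) as [e|ne]; [rewrite e in h; lra|].
    set (s := Rmax 0 (T - d / 2)).
    assert (s < T) by (apply Rmax_lub_lt; lra). assert (0 <= s) by apply Rmax_l. assert (T - d / 2 <= s) by apply Rmax_r.
    assert (hs' : Rabs (s - T) < d) by (rewrite Rabs_left; lra).
    specialize (hd s hs'). rewrite N1_minus_sym in hd. pose proof (N1_tri_back (y T) (y s)). pose proof (below s ltac:(lra)). lra. }
  intros t ht. apply (proj2 ET). split; [lra|].
  destruct (Rle_dec 1 T) as [h|h]; [lra|]. exfalso.
  pose proof (better T ET) as hb.
  destruct (dC_cont y T _ (Hs T ltac:(lra)) (r / 2) ltac:(lra)) as [d [pd hd]].
  set (T' := Rmin 1 (T + d / 2)).
  assert (T < T') by (apply Rmin_glb_lt; lra). assert (T' <= 1) by apply Rmin_l. assert (T' <= T + d / 2) by apply Rmin_r.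
  assert (ET' : E T').
  { split; [lra|]. intros s hs. destruct (Rle_dec s T) as [h'|h']; [apply (proj2 ET); lra|].
    assert (hs' : Rabs (s - T) < d) by (rewrite Rabs_right; lra).
    specialize (hd s hs'). pose proof (N1_tri_back (y s) (y T)). lra. }
  specialize (ub T' ET'). lra.
Qed.

Lemma half_pow_le n : INR n * (1 / 4) ^ n <= (1 / 2) ^ n.
Proof.
  assert (INR n <= 2 ^ n).
  { induction n as [|n IH]; [simpl; lra|]. rewrite S_INR. simpl. assert (1 <= 2 ^ n) by (apply pow_R1_Rle; lra). lra. }
  replace ((1 / 2) ^ n) with (2 ^ n * (1 / 4) ^ n).
  - apply Rmult_le_compat_r; [apply pow_le; lra|trivial].
  - rewrite <- Rpow_mult_distr. f_equal; lra.
Qed.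

Lemma small_lim x b : (forall n, x <= b * (1 / 2) ^ n) -> x <= 0.
Proof.
  intros H. destruct (Rle_dec x 0) as [|h]; trivial. exfalso.
  assert (hx : 0 < x) by lra.
  assert (hb : 0 < b) by (pose proof (H O); simpl in *; lra).
  destruct (pow_lt_1_zero (1 / 2) ltac:(rewrite Rabs_right; lra) (x / b) ltac:(apply Rdiv_lt_0_compat; trivial)) as [N hN].
  specialize (hN N (Nat.le_refl N)). rewrite Rabs_right in hN by (apply Rle_ge, pow_le; lra).
  specialize (H N). assert (b * (1 / 2) ^ N < b * (x / b)) by (apply Rmult_lt_compat_l; trivial).
  replace (b * (x / b)) with x in H0 by (field; lra). lra.
Qed.

Lemma Cminus_eq z w : Cminus z w = RtoC 0 -> z = w.
Proof. intros H. replace z with (Cplus (Cminus z w) w) by (unfold Cminus; ring). rewrite H. ring. Qed.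

(** When all [phi] vanish at 1 the truncated first integral equals y(1) at 1 and y(0) at 0, for
    every order. Its variation along a small solution is the remainder, which tends to 0 as the
    order grows. *)
Theorem integral_center : (forall n, phi (S (S n)) 1 = RtoC 0) ->
  exists d, 0 < d /\ forall y, sol y -> N1 (y 0) < d -> y 1 = y 0.
Proof.
  (* With Kb r = 1/8 the remainder is at most a constant times (n+1) 8^-(n+1). Initial values below
     r/4 stay below r by [apriori]. *)
  intros H. set (r := / (8 * Kb)).
  assert (K1 : 3 <= Kb) by (unfold Kb; lra).
  assert (hK : Kb * r = 1 / 8) by (unfold r; field; lra).
  assert (hr : 0 < r) by (apply Rinv_0_lt_compat; lra).
  assert (hrM : 8 * M * r <= 1) by (unfold Kb in *; nra).
  exists (r / 4); split; [lra|]. intros y Hs h0.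
  apply Cminus_eq, N1_eq0, (small_lim _ (3 * M)). intros n.
  assert (hy : forall t, 0 <= t <= 1 -> N1 (y t) <= r) by (apply apriori; trivial; lra).
  rewrite <- (HS_1 y n) at 1 by (intros; apply H).
  eapply Rle_trans; [apply (HS_diff y n r); trivial; split; [lra|nra]|].
  replace (3 * INR (S n) * M * Kb ^ S n * r ^ S (S n)) with (3 * M * (r * (INR (S n) * (Kb * r) ^ (S n)))).
  2: { rewrite Rpow_mult_distr. simpl. ring. }
  apply Rmult_le_compat_l; [lra|]. rewrite hK.
  apply Rle_trans with (1 * (INR (S n) * (1 / 4) ^ S n)).
  - apply Rmult_le_compat; [lra| |nra|].
    + apply Rmult_le_pos; [apply pos_INR|apply pow_le; lra].
    + apply Rmult_le_compat_l; [apply pos_INR|]. apply pow_incr; lra.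
  - rewrite Rmult_1_l. eapply Rle_trans; [apply half_pow_le|]. simpl.
    assert (0 <= (1 / 2) ^ n) by (apply pow_le; lra). lra.
Qed.

Hypothesis cp : forall t, continuous (fun s => fst (p s)) t /\ continuous (fun s => snd (p s)) t.
Hypothesis cq : forall t, continuous (fun s => fst (q s)) t /\ continuous (fun s => snd (q s)) t.

Definition contC (f : R -> C) : Prop := forall t, continuous (fun s => fst (f s)) t /\ continuous (fun s => snd (f s)) t.
Lemma contC_plus f g : contC f -> contC g -> contC (fun t => Cplus (f t) (g t)).
Proof.
  intros Hf Hg t; destruct (Hf t), (Hg t); split; simpl.
  - apply (continuous_plus (fun s => fst (f s)) (fun s => fst (g s))); trivial.
  - apply (continuous_plus (fun s => snd (f s)) (fun s => snd (g s))); trivial.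
Qed.
Lemma contC_mult f g : contC f -> contC g -> contC (fun t => Cmult (f t) (g t)).
Proof.
  intros Hf Hg t; destruct (Hf t) as [f1 f2], (Hg t) as [g1 g2]; split; simpl.
  - apply (continuous_minus (fun s => fst (f s) * fst (g s)) (fun s => snd (f s) * snd (g s)));
      apply (continuous_mult (K := R_AbsRing)); trivial.
  - apply (continuous_plus (fun s => fst (f s) * snd (g s)) (fun s => snd (f s) * fst (g s)));
      apply (continuous_mult (K := R_AbsRing)); trivial.
Qed.
Lemma contC_field y : contC y -> contC (fun t => field t (y t)).
Proof.
  intros Hy. assert (H1 : contC (fun _ => RtoC 1)) by (intros t; split; apply continuous_const).
  assert (P : forall n, contC (fun t => Cpow (y t) n)).
  { induction n as [|n IH]; simpl; [exact H1|apply contC_mult; trivial]. }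
  apply contC_plus; apply contC_mult; auto.
Qed.
Lemma lip_contC f S : (forall s t, N1 (Cminus (f s) (f t)) <= S * Rabs (s - t)) -> contC f.
Proof.
  intros H t.
  assert (A : forall g : R -> R, (forall s, Rabs (g s - g t) <= S * Rabs (s - t)) -> continuous g t).
  { intros g hg. apply filterlim_locally. intros e.
    assert (S0 : 0 < Rabs S + 1) by (pose proof (Rabs_pos S); lra).
    exists (mkposreal (e / (Rabs S + 1)) (Rdiv_lt_0_compat _ _ (cond_pos e) S0)). intros s hs.
    change (Rabs (s - t) < e / (Rabs S + 1)) in hs. change (Rabs (g s - g t) < e).
    eapply Rle_lt_trans; [apply hg|]. pose proof (Rle_abs S). pose proof (Rabs_pos (s - t)).
    apply Rle_lt_trans with ((Rabs S + 1) * Rabs (s - t)); [nra|].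
    replace (pos e) with ((Rabs S + 1) * (e / (Rabs S + 1))) by (field; lra). apply Rmult_lt_compat_l; trivial. }
  split; apply A; intros s; specialize (H s t); unfold N1, Cminus, Cplus, Copp in H; simpl in H; unfold Rminus in *.
  - pose proof (Rabs_pos (snd (f s) + - snd (f t))); lra.
  - pose proof (Rabs_pos (fst (f s) + - fst (f t))); lra.
Qed.

Definition CI (f : R -> C) (t : R) : C := (RInt (fun s => fst (f s)) 0 t, RInt (fun s => snd (f s)) 0 t).
Lemma dCI f t : contC f -> dC (CI f) t (f t).
Proof.
  intros H; split; simpl.
  - apply (is_derive_RInt (fun s => fst (f s)) _ 0); [|apply H]. exists (mkposreal 1 Rlt_0_1). intros s _.
    apply @RInt_correct, @ex_RInt_continuous. intros; apply H.
  - apply (is_derive_RInt (fun s => snd (f s)) _ 0); [|apply H]. exists (mkposreal 1 Rlt_0_1). intros s _.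
    apply @RInt_correct, @ex_RInt_continuous. intros; apply H.
Qed.
Lemma CI_0 f : CI f 0 = RtoC 0.
Proof. unfold CI; rewrite !RInt_point; reflexivity. Qed.

(** Clamping the time makes the Picard iterates globally defined and Lipschitz, while near each
    point of [0, 1] the integral equation is unchanged and can be differentiated. *)
Definition clamp (t : R) : R := Rmax (-1) (Rmin 2 t).
Lemma clamp_in t : -1 <= clamp t <= 2.
Proof. unfold clamp; split; [apply Rmax_l|apply Rmax_lub; [lra|apply Rmin_l]]. Qed.
Lemma clamp_id t : -1 <= t <= 2 -> clamp t = t.
Proof. intros; unfold clamp; rewrite Rmin_right, Rmax_right by lra; trivial. Qed.
Lemma clamp_lip s t : Rabs (clamp s - clamp t) <= Rabs (s - t).
Proof.
  unfold clamp, Rmax, Rmin. repeat destruct Rle_dec; unfold Rabs; repeat destruct Rcase_abs; lra.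
Qed.

Lemma geom_lim (u : nat -> R) r : 0 <= r -> (forall n, Rabs (u (S n) - u n) <= r * (1 / 2) ^ n) ->
  forall n, Rabs (u n - real (Lim_seq u)) <= 2 * r * (1 / 2) ^ n.
Proof.
  intros hr H.
  assert (A : forall k n, Rabs (u (n + k)%nat - u n) <= 2 * r * (1 / 2) ^ n).
  { induction k as [|k IH]; intros n.
    - rewrite Nat.add_0_r, Rminus_diag_eq, Rabs_R0 by trivial.
      apply Rmult_le_pos; [lra|apply pow_le; lra].
    - replace (n + S k)%nat with (S n + k)%nat by lia. specialize (IH (S n)). specialize (H n). simpl in IH.
      replace (u (S n + k)%nat - u n) with ((u (S (n + k)) - u (S n)) + (u (S n) - u n)) by (simpl; ring).
      eapply Rle_trans; [apply Rabs_triang|]. lra. }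
  assert (F : ex_finite_lim_seq u).
  { apply ex_lim_seq_cauchy_corr. intros e.
    destruct (pow_lt_1_zero (1 / 2) ltac:(rewrite Rabs_right; lra) (e / (4 * r + 1)) ltac:(apply Rdiv_lt_0_compat; [apply cond_pos|lra])) as [N hN].
    exists N. intros n m hn hm.
    specialize (hN N (Nat.le_refl N)). rewrite Rabs_right in hN by (apply Rle_ge, pow_le; lra).
    replace n with (N + (n - N))%nat by lia. replace m with (N + (m - N))%nat by lia.
    replace (u (N + (n - N))%nat - u (N + (m - N))%nat) with ((u (N + (n - N))%nat - u N) + - (u (N + (m - N))%nat - u N)) by ring.
    eapply Rle_lt_trans; [apply Rabs_triang|]. rewrite Rabs_Ropp.
    pose proof (A (n - N)%nat N). pose proof (A (m - N)%nat N).
    assert ((4 * r + 1) * (1 / 2) ^ N < e).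
    { replace (pos e) with ((4 * r + 1) * (e / (4 * r + 1))) by (field; lra). apply Rmult_lt_compat_l; lra. }
    assert (0 <= (1 / 2) ^ N) by (apply pow_le; lra). lra. }
  apply Lim_seq_correct' in F. intros n.
  assert (L : is_lim_seq (fun k => Rabs (u n - u (n + k)%nat)) (Rabs (u n - real (Lim_seq u)))).
  { apply (is_lim_seq_abs _ (Finite (u n - real (Lim_seq u)))).
    apply (is_lim_seq_minus' (fun _ => u n) (fun k => u (n + k)%nat)); [apply is_lim_seq_const|].
    apply (is_lim_seq_ext (fun k => u (k + n)%nat)); [intros; f_equal; lia|].
    apply (is_lim_seq_incr_n u n); exact F. }
  assert (LE : Rbar_le (Rabs (u n - real (Lim_seq u))) (2 * r * (1 / 2) ^ n)).
  { apply (is_lim_seq_le (fun k => Rabs (u n - u (n + k)%nat)) (fun _ => 2 * r * (1 / 2) ^ n)); trivial.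
    - intros k. rewrite Rabs_minus_sym. apply A.
    - apply is_lim_seq_const. }
  exact LE.
Qed.

Section Picard.
Variable c : C.
Let r := N1 c.
(** Generous enough to give 2M(5r)^2 <= 2r, so the iterates stay in the ball of radius 5r, and 25Mr
    <= 1/4, so that one integration, of length at most 2, contracts by 1/2. *)
Hypothesis hr : 500 * M * r <= 1.
Fixpoint Y (n : nat) : R -> C :=
  match n with O => fun _ => c | S m => fun t => Cplus c (CI (fun s => field s (Y m s)) (clamp t)) end.
Definition Yl (t : R) : C := (real (Lim_seq (fun n => fst (Y n t))), real (Lim_seq (fun n => snd (Y n t)))).
Let r0 : 0 <= r. Proof. apply N1_ge0. Qed.
Let r1 : 0 <= 5 * r <= 1. Proof. pose proof r0. nra. Qed.

Lemma CI_lip f S s t : contC f -> (forall u, -1 <= u <= 2 -> N1 (f u) <= S) ->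
  N1 (Cminus (CI f (clamp s)) (CI f (clamp t))) <= S * Rabs (clamp s - clamp t).
Proof.
  intros Hc HS'. pose proof (clamp_in s); pose proof (clamp_in t).
  apply (dC_lip _ f); intros u hu; [apply dCI; trivial|apply HS'].
  unfold Rmin, Rmax in hu; repeat destruct Rle_dec; lra.
Qed.
Lemma clamp_0 : clamp 0 = 0. Proof. apply clamp_id; lra. Qed.
Lemma CI_bound f S t : contC f -> 0 <= S -> (forall u, -1 <= u <= 2 -> N1 (f u) <= S) -> N1 (CI f (clamp t)) <= 2 * S.
Proof.
  intros Hc S0 HS'. pose proof (CI_lip f S t 0 Hc HS') as H. rewrite clamp_0, CI_0 in H.
  replace (Cminus (CI f (clamp t)) (RtoC 0)) with (CI f (clamp t)) in H by (unfold Cminus; ring).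
  eapply Rle_trans; [exact H|]. pose proof (clamp_in t). rewrite Rmult_comm. apply Rmult_le_compat_r; trivial.
  unfold Rabs; destruct Rcase_abs; lra.
Qed.

Lemma Y_inv n : (forall t, N1 (Y n t) <= 5 * r) /\ (forall s t, N1 (Cminus (Y n s) (Y n t)) <= 1 * Rabs (s - t)).
Proof.
  assert (Q : 2 * M * (5 * r) ^ 2 <= 2 * r /\ 2 * M * (5 * r) ^ 2 <= 1).
  { pose proof r0; pose proof r1. replace (2 * M * (5 * r) ^ 2) with ((50 * M * r) * r) by (simpl; ring).
    assert (0 <= 50 * M * r) by (apply Rmult_le_pos; lra). split; nra. }
  induction n as [|n [IH1 IH2]]; simpl.
  - split; [intros; fold r; pose proof r0; lra|]. intros s t.
    replace (Cminus c c) with (RtoC 0) by (unfold Cminus; ring). rewrite N1_0, Rmult_1_l; apply Rabs_pos.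
  - assert (Hc : contC (fun s => field s (Y n s))) by (apply contC_field, (lip_contC _ 1), IH2).
    assert (Hb : forall u, -1 <= u <= 2 -> N1 (field u (Y n u)) <= 2 * M * (5 * r) ^ 2)
      by (intros; apply field_bound; trivial; apply r1).
    split.
    + intros t. eapply Rle_trans; [apply N1_plus|]. fold r.
      assert (N1 (CI (fun s => field s (Y n s)) (clamp t)) <= 2 * (2 * r)); [|lra].
      apply CI_bound; trivial; [pose proof r0; lra|]. intros; eapply Rle_trans; [apply Hb; trivial|lra].
    + intros s t. 
      replace (Cminus (Cplus c (CI (fun s => field s (Y n s)) (clamp s))) (Cplus c (CI (fun s => field s (Y n s)) (clamp t))))
        with (Cminus (CI (fun s => field s (Y n s)) (clamp s)) (CI (fun s => field s (Y n s)) (clamp t))) by (unfold Cminus; ring).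
      eapply Rle_trans; [apply (CI_lip _ 1); trivial; intros; eapply Rle_trans; [apply Hb; trivial|lra]|].
      apply Rmult_le_compat_l; [lra|apply clamp_lip].
Qed.
Lemma Y_contC n : contC (Y n).
Proof. apply (lip_contC _ 1), Y_inv. Qed.

Lemma CI_diff f g e t : contC f -> contC g -> 0 <= e -> (forall u, -1 <= u <= 2 -> N1 (Cminus (f u) (g u)) <= e) ->
  N1 (Cminus (CI f (clamp t)) (CI g (clamp t))) <= 2 * e.
Proof.
  intros Hf Hg he H.
  pose proof (dC_lip (fun t => Cplus (CI f t) (Copp (CI g t))) (fun t => Cplus (f t) (Copp (g t))) e 0 (clamp t)) as D.
  cbv beta in D. rewrite !CI_0 in D. pose proof (clamp_in t).
  assert (D' := D ltac:(intros; apply dC_plus; [|apply dC_opp]; apply dCI; trivial)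
    ltac:(intros u hu; apply H; unfold Rmin, Rmax in hu; repeat destruct Rle_dec; lra)).
  replace (Cminus (CI f (clamp t)) (CI g (clamp t))) with
    (Cminus (Cplus (CI f (clamp t)) (Copp (CI g (clamp t)))) (Cplus (RtoC 0) (Copp (RtoC 0)))) by (unfold Cminus; ring).
  eapply Rle_trans; [exact D'|]. rewrite (Rmult_comm 2). apply Rmult_le_compat_l; trivial.
  unfold Rabs; destruct Rcase_abs; lra.
Qed.

Lemma Y_step n t : N1 (Cminus (Y (S n) t) (Y n t)) <= 4 * r * (1 / 2) ^ n.
Proof.
  revert t; induction n as [|n IH]; intros t.
  - simpl. replace (Cminus (Cplus c (CI (fun s => field s c) (clamp t))) c) with (CI (fun s => field s c) (clamp t)) by (unfold Cminus; ring).
    assert (Q : 2 * M * (5 * r) ^ 2 <= 2 * r).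
    { pose proof r0. replace (2 * M * (5 * r) ^ 2) with ((50 * M * r) * r) by (simpl; ring).
      assert (0 <= 50 * M * r) by (apply Rmult_le_pos; lra). nra. }
    replace (4 * r * 1) with (2 * (2 * r)) by ring. apply CI_bound.
    + apply (contC_field (Y 0)), Y_contC.
    + pose proof r0; lra.
    + intros u hu. eapply Rle_trans; [apply (field_bound u c (5 * r)); trivial; fold r; pose proof r0; lra|exact Q].
  - change (Cminus (Y (S (S n)) t) (Y (S n) t)) with
      (Cminus (Cplus c (CI (fun s => field s (Y (S n) s)) (clamp t))) (Cplus c (CI (fun s => field s (Y n s)) (clamp t)))).
    replace (Cminus (Cplus c (CI (fun s => field s (Y (S n) s)) (clamp t))) (Cplus c (CI (fun s => field s (Y n s)) (clamp t))))
      with (Cminus (CI (fun s => field s (Y (S n) s)) (clamp t)) (CI (fun s => field s (Y n s)) (clamp t))) by (unfold Cminus; ring).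
    assert (0 <= (1 / 2) ^ n) by (apply pow_le; lra).
    replace (4 * r * (1 / 2) ^ S n) with (2 * (r * (1 / 2) ^ n)) by (simpl; field).
    apply CI_diff; try (apply contC_field, Y_contC).
    + apply Rmult_le_pos; trivial.
    + intros u hu. eapply Rle_trans; [apply (field_lip u _ _ (5 * r)); trivial; apply Y_inv|].
      specialize (IH u). pose proof (N1_ge0 (Cminus (Y (S n) u) (Y n u))).
      assert (0 <= 5 * M * (5 * r) <= 1 / 4) by (pose proof r0; nra). nra.
Qed.

Lemma Yl_lim n t : N1 (Cminus (Y n t) (Yl t)) <= 16 * r * (1 / 2) ^ n.
Proof.
  assert (A : forall m, Rabs (fst (Y (S m) t) - fst (Y m t)) <= 4 * r * (1 / 2) ^ m /\ Rabs (snd (Y (S m) t) - snd (Y m t)) <= 4 * r * (1 / 2) ^ m).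
  { intros m. pose proof (Y_step m t) as H. unfold N1, Cminus, Cplus, Copp in H; cbn [fst snd] in H. unfold Rminus.
    pose proof (Rabs_pos (fst (Y (S m) t) + - fst (Y m t))); pose proof (Rabs_pos (snd (Y (S m) t) + - snd (Y m t))); split; lra. }
  assert (r4 : 0 <= 4 * r) by (pose proof r0; lra).
  pose proof (geom_lim (fun m => fst (Y m t)) (4 * r) r4 (fun m => proj1 (A m)) n) as B1.
  pose proof (geom_lim (fun m => snd (Y m t)) (4 * r) r4 (fun m => proj2 (A m)) n) as B2.
  unfold N1, Cminus, Cplus, Copp, Yl; cbn [fst snd]. unfold Rminus in *. lra.
Qed.

Lemma small_lim' x a b : (forall n, x <= a + b * (1 / 2) ^ n) -> x <= a.
Proof. intros H. assert (x - a <= 0); [|lra]. apply (small_lim _ b). intros n. specialize (H n). lra. Qed.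

Lemma Yl_bound t : N1 (Yl t) <= 5 * r.
Proof.
  apply (small_lim' _ _ (16 * r)). intros n.
  pose proof (N1_tri_back (Yl t) (Y n t)) as H. rewrite N1_minus_sym in H.
  pose proof (Yl_lim n t). pose proof (proj1 (Y_inv n) t). lra.
Qed.
Lemma Yl_contC : contC Yl.
Proof.
  apply (lip_contC _ 1). intros s t. apply (small_lim' _ _ (32 * r)). intros n.
  pose proof (Yl_lim n s) as A; rewrite N1_minus_sym in A. pose proof (Yl_lim n t). pose proof (proj2 (Y_inv n) s t).
  replace (Cminus (Yl s) (Yl t)) with (Cplus (Cminus (Yl s) (Y n s)) (Cplus (Cminus (Y n s) (Y n t)) (Cminus (Y n t) (Yl t)))) by (unfold Cminus; ring).
  eapply Rle_trans; [apply N1_plus|]. pose proof (N1_plus (Cminus (Y n s) (Y n t)) (Cminus (Y n t) (Yl t))). lra.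
Qed.
Lemma Yl_eq t : Yl t = Cplus c (CI (fun s => field s (Yl s)) (clamp t)).
Proof.
  apply Cminus_eq, N1_eq0, (small_lim _ (24 * r)). intros n.
  assert (0 <= (1 / 2) ^ n) by (apply pow_le; lra).
  replace (Cminus (Yl t) (Cplus c (CI (fun s => field s (Yl s)) (clamp t)))) with
    (Cplus (Cminus (Yl t) (Y (S n) t)) (Cminus (CI (fun s => field s (Y n s)) (clamp t)) (CI (fun s => field s (Yl s)) (clamp t))))
    by (change (Y (S n) t) with (Cplus c (CI (fun s => field s (Y n s)) (clamp t))); unfold Cminus; ring).
  eapply Rle_trans; [apply N1_plus|].
  pose proof (Yl_lim (S n) t) as A. rewrite N1_minus_sym in A. simpl pow in A.
  assert (0 <= r * (1 / 2) ^ n) by (apply Rmult_le_pos; [pose proof r0; lra|trivial]).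
  assert (B : N1 (Cminus (CI (fun s => field s (Y n s)) (clamp t)) (CI (fun s => field s (Yl s)) (clamp t))) <= 2 * (4 * r * (1 / 2) ^ n)).
  { apply CI_diff; try apply contC_field; try apply Y_contC; try apply Yl_contC.
    - apply Rmult_le_pos; [pose proof r0; lra|trivial].
    - intros u hu. eapply Rle_trans; [apply (field_lip u _ _ (5 * r)); trivial; [apply Y_inv|apply Yl_bound]|].
      pose proof (Yl_lim n u). pose proof (N1_ge0 (Cminus (Y n u) (Yl u))).
      assert (0 <= 5 * M * (5 * r) <= 1 / 4) by (pose proof r0; nra). nra. }
  lra.
Qed.

Lemma picard : exists y, sol y /\ y 0 = c /\ forall t, N1 (y t) <= 5 * N1 c.
Proof.
  exists Yl; split; [|split].
  - intros t ht.
    assert (D : dC (fun s => Cplus c (CI (fun s => field s (Yl s)) s)) t (Cplus (RtoC 0) (field t (Yl t)))).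
    { apply dC_plus; [apply dC_const|]. apply (dCI (fun s => field s (Yl s))), contC_field, Yl_contC. }
    replace (Cplus (RtoC 0) (field t (Yl t))) with (field t (Yl t)) in D by ring.
    assert (L : locally t (fun s => Cplus c (CI (fun s => field s (Yl s)) s) = Yl s)).
    { exists (mkposreal 1 Rlt_0_1). intros s hs. change (Rabs (s - t) < 1) in hs.
      rewrite (Yl_eq s), clamp_id; trivial. unfold Rabs in hs; destruct Rcase_abs in hs; lra. }
    destruct D as [D1 D2]; split.
    + apply (is_derive_ext_loc (fun s => fst (Cplus c (CI (fun s => field s (Yl s)) s)))); trivial.
      revert L; apply filter_imp; intros s ->; reflexivity.
    + apply (is_derive_ext_loc (fun s => snd (Cplus c (CI (fun s => field s (Yl s)) s)))); trivial.
      revert L; apply filter_imp; intros s ->; reflexivity.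
  - rewrite Yl_eq, clamp_0, CI_0. ring.
  - apply Yl_bound.
Qed.
End Picard.

Lemma N1_mult_R A s : N1 (Cmult A (RtoC s)) = N1 A * Rabs s.
Proof.
  unfold N1; destruct A as [x y]; simpl. replace (x * s - y * 0) with (x * s) by ring. replace (x * 0 + y * s) with (y * s) by ring.
  rewrite !Rabs_mult; ring.
Qed.
Lemma small_lim0 a K x0 : 0 < x0 -> (forall x, 0 < x <= x0 -> a <= K * x) -> a <= 0.
Proof.
  intros hx H. destruct (Rle_dec a 0) as [|h]; trivial. exfalso. assert (ha : 0 < a) by lra.
  set (x := Rmin x0 (a / (2 * (Rabs K + 1)))).
  assert (hK : 0 < Rabs K + 1) by (pose proof (Rabs_pos K); lra).
  assert (0 < x) by (apply Rmin_pos; trivial; apply Rdiv_lt_0_compat; lra).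
  assert (x <= x0) by apply Rmin_l.
  assert (x <= a / (2 * (Rabs K + 1))) by apply Rmin_r.
  specialize (H x ltac:(lra)). pose proof (Rle_abs K).
  assert (K * x <= (Rabs K + 1) * x) by nra.
  assert ((Rabs K + 1) * x <= a / 2).
  { replace (a / 2) with ((Rabs K + 1) * (a / (2 * (Rabs K + 1)))) by (field; lra). apply Rmult_le_compat_l; lra. }
  lra.
Qed.

(* the lowest nonvanishing term would dominate the remainder for solutions of small amplitude *)
Theorem center_integral : (exists d, 0 < d /\ forall y, sol y -> N1 (y 0) < d -> y 1 = y 0) ->
  forall n, phi (S (S n)) 1 = RtoC 0.
Proof.
  intros [d [hd H]] n. induction n as [n IH] using (well_founded_induction Wf_nat.lt_wf).
  (* After division by x^(n+2), the estimate [HS_diff] of order n+1 at radius 5x is this constant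
     times x. The cap on x keeps the initial value below d and within the reach of [picard]. *)
  apply N1_eq0, (small_lim0 _ (3 * INR (S (S n)) * M * Kb ^ S (S n) * 5 ^ S (S (S n))) (Rmin (d / 2) (/ (500 * M)))).
  { apply Rmin_pos; [lra|apply Rinv_0_lt_compat; lra]. }
  intros x [hx hx0].
  assert (x1 : x <= d / 2) by (eapply Rle_trans; [exact hx0|apply Rmin_l]).
  assert (x2 : x <= / (500 * M)) by (eapply Rle_trans; [exact hx0|apply Rmin_r]).
  assert (x3 : 500 * M * x <= 1).
  { replace 1 with (500 * M * / (500 * M)) by (field; lra). apply Rmult_le_compat_l; lra. }
  assert (nx : N1 (RtoC x) = x) by (rewrite N1_RtoC, Rabs_right; lra).
  destruct (picard (RtoC x)) as [y [Hs [y0 hy]]]; [rewrite nx; exact x3|].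
  assert (y1 : y 1 = y 0) by (apply H; trivial; rewrite y0, nx; lra).
  assert (D := HS_diff y (S n) (5 * x) Hs ltac:(nra) ltac:(intros t _; rewrite <- nx; apply hy)).
  change (HS y (S (S n)) 1) with (Cplus (HS y (S n) 1) (Cmult (phi (S (S n)) 1) (Cpow (y 1) (S (S n))))) in D.
  rewrite (HS_1 y n IH), y1, y0 in D.
  replace (Cminus (Cplus (RtoC x) (Cmult (phi (S (S n)) 1) (Cpow (RtoC x) (S (S n))))) (RtoC x)) with
    (Cmult (phi (S (S n)) 1) (Cpow (RtoC x) (S (S n)))) in D by (unfold Cminus; ring).
  rewrite <- RtoC_pow, N1_mult_R in D. rewrite Rabs_right in D by (apply Rle_ge, pow_le; lra).
  rewrite Rpow_mult_distr in D.
  assert (px : 0 < x ^ S (S n)) by (apply pow_lt; trivial).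
  apply Rmult_le_reg_r with (x ^ S (S n)); trivial.
  eapply Rle_trans; [exact D|]. right. simpl. ring.
Qed.
End Abel.
End AbelFlow.

(** * From the first integral to the moments of P^k dQ and Q^k dP *)

Module IntegralRecursion.
Import all_boot all_order all_algebra.
Import boolp ring zify.
Import Moments MonodromyAction BlockSystems ComplexField ZariskiChain.
Set Implicit Arguments. Unset Strict Implicit. Unset Printing Implicit Defensive.
Import GRing.Theory.
Local Open Scope ring_scope.

Section Phi.
Variables (a b : CK).
Local Notation K := CK.
Let charK := CK_char0.
Let nat0 n : (n.+1%:R : K) != 0. Proof. by rewrite (natr_c0 charK). Qed.

Definition Pm (h : {poly K}) : {poly K} := prim h - ((prim h).[a])%:P.
Lemma PmD (f g : {poly K}) : Pm (f + g) = Pm f + Pm g.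
Proof. by rewrite /Pm raddfD /= hornerD polyCD opprD addrACA. Qed.
Lemma PmZ c (f : {poly K}) : Pm (c *: f) = c *: Pm f.
Proof. by rewrite /Pm linearZ /= hornerZ polyCM scalerBr mul_polyC. Qed.
Lemma Pm0 : Pm 0 = 0.
Proof. by rewrite /Pm raddf0 horner0 polyC0 subr0. Qed.
Lemma PmN (f : {poly K}) : Pm (- f) = - Pm f.
Proof. by rewrite -scaleN1r PmZ scaleN1r. Qed.
Lemma Pm_sum (I : Type) (s : seq I) (F : I -> {poly K}) : Pm (\sum_(i <- s) F i) = \sum_(i <- s) Pm (F i).
Proof. by elim: s => [|i s IH]; rewrite ?big_nil ?Pm0 // !big_cons PmD IH. Qed.
Lemma Pm_deriv (F : {poly K}) : Pm F^`() = F - F.[a]%:P.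
Proof. by rewrite /Pm (prim_deriv charK) hornerD hornerN hornerC polyCB opprB addrA subrK. Qed.
Lemma Pm_a h : (Pm h).[a] = 0.
Proof. by rewrite /Pm hornerD hornerN hornerC subrr. Qed.
Lemma deriv_Pm h : (Pm h)^`() = h.
Proof.
by rewrite /Pm derivB derivC subr0; apply/polyP => i; rewrite coef_deriv coef_prim /= -[_ *+ _]mulr_natr divfK ?nat0.
Qed.
Lemma Pm_uniq F h : F^`() = h -> F.[a] = 0 -> Pm h = F.
Proof. by move=> <- Fa; rewrite Pm_deriv Fa subr0. Qed.
Lemma Pm_b h : (Pm h).[b] = pint a b h.
Proof. by rewrite /Pm hornerD hornerN hornerC. Qed.

(* a two-term recursion driven by the powers of P expands over the iterated integrals of P ^+ j * Q' *)
Lemma expand_family (P Q : {poly K}) (be : nat -> {poly K}) (w v : nat -> K) (e : nat -> nat -> K) :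
  P.[a] = 0 -> P.[b] = 0 ->
  be 0 = - Pm (w 0 *: Q^`()) ->
  (forall i, be i.+1 = - Pm (w i.+1 *: (P ^+ i.+1 * Q^`()) + v i.+1 *: (P^`() * be i))) ->
  (forall i j, (j <= i)%N -> (i.+1 - j)%:R * e i.+1 j = - v i.+1 * e i j) ->
  (forall i, \sum_(j < i.+1) e i j = - w i) -> (forall i, e i i != 0) ->
  (forall i, (be i).[b] = 0) -> allmom a b P Q.
Proof.
move=> Pa Pb be0 beS ev ew e0 hb.
pose I j := Pm (P ^+ j * Q^`()).
have bE i : be i = \sum_(j < i.+1) e i j *: (P ^+ (i - j) * I j).
  elim: i => [|i IH].
    rewrite be0 big_ord1 /I subn0 !expr0 !mul1r PmZ -scaleNr; congr (_ *: _).
    by rewrite -ew big_ord1.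
  rewrite beS -PmN; apply: Pm_uniq; last first.
    by rewrite horner_sum big1 // => j _; rewrite hornerZ hornerM Pm_a !mulr0.
  rewrite raddf_sum /=.
  rewrite (eq_bigr (fun j : 'I_i.+2 => e i.+1 j *: (P ^+ i.+1 * Q^`()) + P^`() * ((i.+1 - j)%:R * e i.+1 j *: (P ^+ (i - j) * I j)))); last first.
    move=> j _; rewrite derivZ derivM deriv_Pm deriv_exp scalerDr addrC; congr (_ + _).
      by rewrite mulrA -exprD subnK // -ltnS.
    have -> : (i.+1 - j).-1 = (i - j)%N by lia.
    by rewrite mulrC -!mul_polyC polyCM -mulr_natl polyC_natr; ring.
  rewrite big_split /= -scaler_suml ew -mulr_sumr big_ord_recr /= subnn mul0r scale0r addr0.
  rewrite (eq_bigr (fun j : 'I_i.+1 => - v i.+1 *: (e i j *: (P ^+ (i - j) * I j)))); last first.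
    by move=> j _; have ji : (j <= i)%N := ltn_ord j; rewrite (ev _ _ ji) scalerA.
  by rewrite -scaler_sumr -IH opprD -!scaleNr -scalerAr.
move=> k; rewrite /mom -Pm_b; have := hb k; rewrite bE big_ord_recr /= subnn expr0 mul1r hornerD hornerZ horner_sum big1 ?add0r.
  by move/eqP; rewrite mulf_eq0 (negbTE (e0 k)) => /eqP.
move=> j _; rewrite hornerZ hornerM horner_exp Pb expr0n subn_eq0 leqNgt ltn_ord /= mul0r mulr0 //.
Qed.

(** The binomial coefficient with an arbitrary field element s on top; [gb_vander] is Vandermonde's
    identity for it. *)
Fixpoint gb (s : K) (m : nat) : K := if m is m'.+1 then gb s m' * (s - m'%:R) / m'.+1%:R else 1.
Lemma gb_left s m : gb (s + 1) m.+1 = gb s m * (s + 1) / m.+1%:R.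
Proof.
elim: m => [|m IH]; first by rewrite /= subr0.
rewrite [LHS](_ : _ = gb (s + 1) m.+1 * (s + 1 - m.+1%:R) / m.+2%:R) // IH.
rewrite [gb s m.+1](_ : _ = gb s m * (s - m%:R) / m.+1%:R) //.
by rewrite -[in X in _ - X](natr1 m) opprD addrACA subrr addr0; ring.
Qed.
Lemma gb_pascal s m : gb (s + 1) m.+1 = gb s m.+1 + gb s m.
Proof.
rewrite gb_left [gb s m.+1](_ : _ = gb s m * (s - m%:R) / m.+1%:R) //.
have e : gb s m = gb s m * m.+1%:R / m.+1%:R by rewrite mulfK.
rewrite [X in _ = _ + X]e -mulrDl -mulrDr -natr1; congr (_ * _ / _); ring.
Qed.
Lemma gb_vander s i m : gb (s + i%:R) m = \sum_(j < m.+1) 'C(i, j)%:R * gb s (m - j).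
Proof.
elim: i m => [|i IH] m.
  rewrite addr0 big_ord_recl bin0 mul1r subn0 big1 ?addr0 // => j _.
  by rewrite bin0n mul0r.
case: m => [|m]; first by rewrite big_ord1 bin0 mul1r.
rewrite -natr1 addrA gb_pascal !IH.
rewrite [RHS]big_ord_recl [X in X + _ = _]big_ord_recl !bin0 -addrA; congr (_ + _).
rewrite -big_split /=; apply: eq_bigr => j _.
by rewrite /bump /= !add1n binS natrD mulrDl subSS.
Qed.

Section Coefs.
Variables P Q : {poly K}.
(** The coefficient of y^n in the formal first integral of y' = P' y^3 + e Q' y^2, normalised to
    reduce to y at the point a. *)
Fixpoint phi (e : K) (n : nat) : {poly K} :=
  match n with
  | O => 0
  | S n1 => match n1 with
     | O => 1
     | S m => - Pm (n1%:R *: ((e *: Q^`()) * phi e n1) + m%:R *: (P^`() * phi e m))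
     end
  end.
Lemma phiSS e m : phi e m.+2 = - Pm (m.+1%:R *: ((e *: Q^`()) * phi e m.+1) + m%:R *: (P^`() * phi e m)).
Proof. by []. Qed.

(* [ph n j] is the coefficient of [e ^+ j] in [phi e n] *)
Fixpoint ph (n : nat) : nat -> {poly K} :=
  match n with
  | O => fun=> 0
  | S n1 => match n1 with
     | O => fun j => (j == 0)%:R
     | S m => fun j => - Pm (n1%:R *: (Q^`() * (if j is j'.+1 then ph n1 j' else 0)) + m%:R *: (P^`() * ph m j))
     end
  end.
Arguments phi : simpl never.
Arguments ph : simpl never.
Lemma ph10 : ph 1 0 = 1. Proof. by []. Qed.
Lemma phSS m j : ph m.+2 j = - Pm (m.+1%:R *: (Q^`() * (if j is j'.+1 then ph m.+1 j' else 0)) + m%:R *: (P^`() * ph m j)).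
Proof. by []. Qed.
Lemma ind2 (T : nat -> Prop) : T 0 -> T 1 -> (forall n, T n -> T n.+1 -> T n.+2) -> forall n, T n.
Proof. by move=> h0 h1 h n; suff [] : T n /\ T n.+1 by []; elim: n => [|n [h2 h3]]; split=> //; apply: h. Qed.

Lemma ph0 n j : (n <= j)%N -> ph n j = 0.
Proof.
elim/ind2: n j => [//|[]//|n IH1 IH2 j nj]; rewrite phSS IH1; last by apply: leq_trans nj; rewrite -addn2 leq_addr.
by case: j nj => // j nj; rewrite IH2 // !mulr0 !scaler0 addr0 Pm0 oppr0.
Qed.
Lemma phi_ph e N n : (n <= N)%N -> phi e n = \sum_(j < N) e ^+ j *: ph n j.
Proof.
elim/ind2: n => [_|N0|n IH1 IH2 nN].
- by rewrite big1 // => j _; rewrite scaler0.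
- by case: N N0 => // N _; rewrite big_ord_recl expr0 scale1r big1 ?addr0 // => j _; rewrite (_ : ph 1 _ = 0) ?scaler0.
rewrite phiSS IH1 ?IH2 //; [|exact: ltnW|by apply: leq_trans nN; rewrite -addn2 leq_addr].
transitivity (- \sum_(j < N) e ^+ j *: Pm (n.+1%:R *: (Q^`() * (if (j : nat) is j'.+1 then ph n.+1 j' else 0)) + n%:R *: (P^`() * ph n j))); last first.
  by rewrite -sumrN; apply: eq_bigr => j _; rewrite phSS scalerN.
congr (- _); under [RHS]eq_bigr do rewrite -PmZ; rewrite -Pm_sum; congr Pm.
under [RHS]eq_bigr do rewrite scalerDr; rewrite big_split /=; congr (_ + _).
  rewrite [RHS](eq_bigr (fun j : 'I_N => n.+1%:R *: (e ^+ j *: (Q^`() * (if (j : nat) is j'.+1 then ph n.+1 j' else 0))))); last first.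
    by move=> j _; rewrite !scalerA [_ * e ^+ _]mulrC.
  rewrite -scaler_sumr; congr (_ *: _).
  case: N nN {IH1 IH2} => // N nN; rewrite big_ord_recr big_ord_recl /= mulr0 scaler0 add0r.
  rewrite (@ph0 n.+1 N) // scaler0 addr0 mulr_sumr; apply: eq_bigr => j _.
  by rewrite /bump /= add1n exprS -scalerAr -!scalerAl scalerA mulrC.
rewrite mulr_sumr scaler_sumr; apply: eq_bigr => j _.
by rewrite -scalerAr scalerA mulrC -scalerA.
Qed.

Lemma ph_b n : (forall e, (phi e n).[b] = 0) -> forall j, (ph n j).[b] = 0.
Proof.
move=> h j; have [jn|nj] := ltnP j n; last by rewrite ph0 // horner0.
have e0 : \poly_(j < n) (ph n j).[b] = 0.
  apply: poly_fun_eq => e; rewrite horner_poly horner0 -[RHS](h e) (phi_ph e (leqnn n)) horner_sum.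
  by apply: eq_bigr => i _; rewrite hornerZ mulrC.
by have := congr1 (fun p : {poly K} => p`_j) e0; rewrite coef_poly jn coef0.
Qed.

Hypotheses (Pa : P.[a] = 0) (Pb : P.[b] = 0) (Qa : Q.[a] = 0) (Qb : Q.[b] = 0).
Hypothesis hphi : forall e n, (phi e n.+2).[b] = 0.

(** For eps = 0 the first integral is y (1 + 2 P y^2)^(-1/2), and these are its binomial
    coefficients. *)
Fixpoint cc (i : nat) : K := if i is i'.+1 then - (2 * i' + 1)%:R / i'.+1%:R * cc i' else 1.
Lemma Pm_exp (S : {poly K}) i : S.[a] = 0 -> Pm (S^`() * S ^+ i) = i.+1%:R^-1 *: S ^+ i.+1.
Proof.
move=> Sa; apply: Pm_uniq; last by rewrite hornerZ horner_exp Sa expr0n mulr0.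
by rewrite derivZ deriv_exp /= -scaler_nat scalerA mulVf // scale1r.
Qed.
Lemma ph_odd0 i : ph (2 * i + 1) 0 = cc i *: P ^+ i /\ ph (2 * i) 0 = 0.
Proof.
elim: i => [|i [IH1 IH2]]; first by rewrite expr0 scale1r.
have -> : (2 * i.+1 + 1 = (2 * i + 1).+2)%N by lia.
have -> : (2 * i.+1 = (2 * i).+2)%N by lia.
rewrite !phSS IH1 IH2 !mulr0 !scaler0 !add0r Pm0 oppr0; split=> //.
by rewrite -scalerAr !PmZ (Pm_exp i Pa) !scalerA -scaleNr; congr (_ *: _); rewrite /=; ring.
Qed.
(** It rewrites the inhomogeneous weight (2i+1) [cc i] as a binomial with top 1/2 + i, which
    Vandermonde then splits over j. *)
Lemma gb_half i : (- 2%:R) ^+ i * gb (2%:R^-1 + i%:R) i = (2 * i + 1)%:R * cc i.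
Proof.
elim: i => [|i IH]; first by rewrite !mul1r.
have n2 : (2%:R : K) != 0 by apply: nat0.
have -> : 2%:R^-1 + i.+1%:R = (2%:R^-1 + i%:R) + 1 :> K by rewrite -[i.+1%:R]natr1 addrA.
rewrite gb_left exprS.
transitivity ((- 2%:R) ^+ i * gb (2%:R^-1 + i%:R) i * ((- 2%:R) * (2%:R^-1 + i%:R + 1) / i.+1%:R)); first by ring.
rewrite IH /=.
have -> : - 2%:R * (2%:R^-1 + i%:R + 1) = - ((2 * i.+1 + 1)%:R : K).
  by rewrite mulNr !mulrDr divff // natrD natrM -[i.+1%:R]natr1; ring.
ring.
Qed.
Lemma gb_half_neq0 j : gb 2%:R^-1 j != 0.
Proof.
elim: j => [|j IH]; first exact: oner_neq0.
rewrite /= !mulf_neq0 ?invr_eq0 //; apply/negP => /eqP h.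
have n2 : (2%:R : K) != 0 by apply: nat0.
have : 2%:R * (2%:R^-1 - j%:R) = 0 :> K by rewrite h mulr0.
rewrite mulrBr divff // -natrM => /eqP; rewrite subr_eq0 -[1]/(1%:R) => /eqP /(natr_c0_inj charK); lia.
Qed.

(** Uses the part of degree one in Q. The homogeneous recursion fixes the coefficients e i j up to
    their diagonal values, and Vandermonde identifies the latter as multiples of binomials with top
    1/2. They do not vanish because 1/2 is not a natural number. *)
Lemma allmom_PQ : allmom a b P Q.
Proof.
apply: (@expand_family P Q (fun i => ph (2 * i).+2 1) (fun i => (2 * i + 1)%:R * cc i) (fun i => (2 * i)%:R)
  (fun i j => - (- 2%:R) ^+ i * 'C(i, j)%:R * gb 2%:R^-1 j)) => //.
- by rewrite muln0 add0n mulr1 phSS scale0r addr0 ph10 mulr1.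
- move=> i; rewrite phSS; congr (- Pm (_ + _)).
    have -> : (2 * i.+1).+1 = (2 * i.+1 + 1)%N by lia.
    by rewrite (ph_odd0 i.+1).1 -scalerAr scalerA [Q^`() * _]mulrC.
  by have -> : (2 * i.+1)%N = (2 * i).+2 by lia.
- move=> i j ji; have e : ((i.+1 - j)%:R * 'C(i.+1, j)%:R = i.+1%:R * 'C(i, j)%:R :> K) by rewrite -!natrM -mul_bin_down.
  rewrite natrM exprS.
  transitivity (2%:R * (- 2%:R) ^+ i * gb 2%:R^-1 j * ((i.+1 - j)%:R * 'C(i.+1, j)%:R)); first by ring.
  by rewrite e; ring.
- move=> i; rewrite -gb_half gb_vander -mulNr mulr_sumr (reindex_inj rev_ord_inj) /=; apply: eq_bigr => j _.
  have ji : (j <= i)%N by rewrite -ltnS.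
  by rewrite subSS bin_sub // mulrA.
- move=> i; rewrite binn mulr1 mulf_neq0 ?gb_half_neq0 // oppr_eq0 expf_neq0 // oppr_eq0; exact: nat0.
- by move=> i; apply: ph_b => e.
Qed.

(** The part free of P: for y' = q y^2 the first integral is y / (1 + Q y). *)
Lemma ph_top m : ph m.+1 m = (-1) ^+ m *: Q ^+ m.
Proof.
elim: m => [|m IH]; first by rewrite /= !expr0 scale1r.
rewrite phSS IH (ph0 (leqnSn m)) mulr0 scaler0 addr0 -scalerAr !PmZ (Pm_exp m Qa) !scalerA -scaleNr.
by congr (_ *: _); rewrite exprS mulrAC divff // mul1r mulN1r.
Qed.
(** Expand (1 - 1)^(m+2) and move its first two terms to the other side. *)
Lemma alt_bin m : \sum_(j < m.+1) (-1) ^+ j * 'C(m.+2, j.+2)%:R = m.+1%:R :> K.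
Proof.
have := exprDn (1 : K) (-1) m.+2; rewrite subrr expr0n /= => /esym.
rewrite big_ord_recl big_ord_recl /= /bump /= bin0 bin1 expr1n expr0 mulr1 mulr1n expr1 expr1n mul1r.
rewrite (eq_bigr (fun j : 'I_m.+1 => (-1) ^+ j * 'C(m.+2, j.+2)%:R)); last first.
  by move=> j _; rewrite !add1n expr1n mul1r -mulr_natr !exprS; ring.
by move/eqP; rewrite addrA addr_eq0 => /eqP h; apply: oppr_inj; rewrite -h mulNrn -[m.+2%:R]natr1; ring.
Qed.

(** Uses the part of degree one in P, next to the top degree in eps. The recursion is now solved by
    ordinary binomials C(i+2, j+2), and [alt_bin] checks their sum. *)
Lemma allmom_QP : allmom a b Q P.
Proof.
apply: (@expand_family Q P (fun m => ph m.+3 m) (fun m => m.+1%:R * (-1) ^+ m) (fun m => m.+2%:R)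
  (fun m j => - (-1) ^+ m * ((-1) ^+ j * 'C(m.+2, j.+2)%:R))) => //.
- by rewrite phSS mulr0 scaler0 add0r ph10 mulr1 expr0 mulr1.
- move=> i; rewrite phSS addrC; congr (- Pm (_ + _)).
  by rewrite ph_top -scalerAr scalerA [_ * P^`()]mulrC.
- move=> i j ji; have e : ((i.+1 - j)%:R * 'C(i.+3, j.+2)%:R = i.+3%:R * 'C(i.+2, j.+2)%:R :> K).
    by rewrite -!natrM -[(i.+1 - j)%N]/(i.+3 - j.+2)%N -mul_bin_down.
  transitivity (((-1) ^+ i * (-1) ^+ j : K) * ((i.+1 - j)%:R * 'C(i.+3, j.+2)%:R)); first by rewrite exprS; ring.
  by rewrite e; ring.
- by move=> i; rewrite -mulr_sumr alt_bin; ring.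
- by move=> i; rewrite binn mulr1 mulNr oppr_eq0 -exprD addnn -signr_odd odd_double oner_neq0.
- by move=> i; apply: ph_b => e.
Qed.
End Coefs.

(** Every iterated integral of polynomials in W is again a polynomial in W, so it takes equal values
    at a and b, and its value at a is 0. *)
Lemma phi_comp (P Q : {poly K}) e n : CC a b P Q -> (phi P Q e n.+2).[b] = 0.
Proof.
move=> [A [B [W [eP eQ eW]]]].
have key (F G : {poly K}) : exists H, Pm ((F \Po W) * (G \Po W)^`()) = H \Po W.
  exists (prim (F * G^`()) - ((prim (F * G^`())).[W.[a]])%:P).
  apply: Pm_uniq; last by rewrite horner_comp hornerD hornerN hornerC subrr.
  have dp : (prim (F * G^`()))^`() = F * G^`().
    by apply/polyP => i; rewrite coef_deriv coef_prim /= -[_ *+ _]mulr_natr divfK ?nat0.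
  by rewrite !deriv_comp derivB derivC subr0 dp comp_polyM mulrA.
have : exists F, phi P Q e n.+2 = F \Po W.
  elim/ind2: {n}(n.+2) => [||n [F1 e1] [F2 e2]].
  - by exists 0; rewrite comp_poly0.
  - by exists 1%:P; rewrite comp_polyC.
  have [H1 h1] := key F2 B; have [H2 h2] := key F1 A.
  exists (- ((n.+1%:R * e) *: H1 + n%:R *: H2)); rewrite phiSS e1 e2 PmD !PmZ -scalerAl PmZ.
  by rewrite [_^`() * (F2 \Po W)]mulrC [_^`() * (F1 \Po W)]mulrC {1}eQ {1}eP h1 h2 raddfN /= comp_polyD !comp_polyZ scalerA.
move=> [F eF]; rewrite eF horner_comp -eW -horner_comp -eF phiSS hornerN Pm_a oppr0 //.
Qed.
End Phi.
End IntegralRecursion.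

(** * Parametric centers, the moment conditions and composition *)

Module ParametricCenter.
Import all_boot all_order all_algebra.
Import boolp ring zify.
Import Moments MonodromyAction BlockSystems ComplexField ZariskiChain IntegralRecursion AbelFlow.
Import Defs.
Import Reals Lra.
Import Coquelicot.
Set Implicit Arguments. Unset Strict Implicit. Unset Printing Implicit Defensive.
Import GRing.Theory.
Local Open Scope ring_scope.

Lemma RtoC_INR n : RtoC (INR n) = (n%:R : CK) :> CK.
Proof.
elim: n => [|n IH]; first by [].
by rewrite S_INR RtoC_plus -natr1 -IH.
Qed.

Section Link.
Variables (a b : CK) (d : nat) (v : Space).
Hypothesis hin : in_PdxPd a b d v.
Let P : {poly CK} := pP d v.
Let Q : {poly CK} := pQ d v.
Let de : CK := b - a.

(** The vanishing of c beyond d matters at index d, where [pderiv] reads coefficient d+1 while the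
    truncated polynomial has none. *)
Lemma peval_deriv (c : nat -> C) (x : CK) : (forall i, (d < i)%coq_nat -> c i = RtoC 0) ->
  peval (pderiv c) d x = (\poly_(i < d.+1) (c i : CK))^`().[x] :> CK.
Proof.
move=> c0; rewrite peval_horner; congr (_.[x]); apply/polyP => i; rewrite coef_deriv !coef_poly /pderiv.
have [id|di] := ltnP i d.+1.
  rewrite -mulr_natl -RtoC_INR; case: ltnP => // ed.
  have c1 : c i.+1 = RtoC 0 by apply: c0; apply/ssrnat.ltP.
  by rewrite c1.
by rewrite ltnNge (leq_trans di) ?mul0rn // leqW.
Qed.
Lemma pevP x : peval (pderiv (fst v)) d x = P^`().[x : CK].
Proof. by rewrite (peval_deriv _ hin.1.1). Qed.
Lemma pevQ x : peval (pderiv (snd v)) d x = Q^`().[x : CK].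
Proof. by rewrite (peval_deriv _ hin.2.1). Qed.

Lemma dC_seg t : dC (seg a b) t de.
Proof.
apply: (@dC_eq _ _ (Cplus (RtoC 0) (Cplus (Cmult (RtoC 1) de) (Cmult (RtoC t) (RtoC 0))))).
  by rewrite Cplus_0_l Cmult_1_l Cmult_0_r Cplus_0_r.
apply: (dC_plus (fun _ => a)); first exact: dC_const.
apply: (dC_mult RtoC (fun _ => de)); last exact: dC_const.
by split; rewrite /=; [exact: is_derive_id|apply: is_derive_const].
Qed.
Lemma dC_poly (F : {poly CK}) t : dC (fun s => F.[seg a b s : CK] : C) t (de * F^`().[seg a b t : CK] : CK).
Proof.
elim/poly_ind: F => [|F c IH].
  apply: (dC_ext (fun _ => RtoC 0)); first by move=> s; rewrite horner0.
  apply: (@dC_eq _ _ (RtoC 0)); last exact: dC_const.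
  have -> : (0^`() : {poly CK}).[seg a b t : CK] = 0 by rewrite deriv0 horner0.
  by symmetry; apply: Cmult_0_r.
apply: (dC_ext (fun s => Cplus (Cmult (F.[seg a b s : CK] : C) (seg a b s)) (c : C))).
  by move=> s; rewrite hornerD hornerM hornerX hornerC.
apply: dC_eq; last by apply: dC_plus; [apply: dC_mult; [exact: IH|exact: dC_seg]|exact: dC_const].
rewrite derivD derivC derivM derivX mulr1 addr0 hornerD hornerM hornerX.
change ((de * F^`().[seg a b t : CK] * (seg a b t : CK) + F.[seg a b t : CK] * de + 0 : CK) =
  de * (F^`().[seg a b t : CK] * (seg a b t : CK) + F.[seg a b t : CK])).
have idn (x y z w : CK) : x * y * z + w * x + 0 = x * (y * z + w).
  by rewrite addr0 mulrDr mulrA [w * x]mulrC.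
exact: idn.
Qed.

Lemma bounded_seg : exists B : R, (0 <= B)%R /\ forall t, (-1 <= t <= 2)%R -> (N1 (seg a b t) <= B)%R.
Proof.
exists (N1 a + 2 * N1 de)%R; split.
  by have := N1_ge0 a; have := N1_ge0 de; lra.
move=> t ht; rewrite /seg; apply: Rle_trans (N1_plus _ _) _.
have := N1_mult (RtoC t) de; rewrite N1_RtoC; have := N1_ge0 de; change (Cminus b a) with (de : C).
have : (Rabs t <= 2)%R by apply: Rabs_le; lra.
by move=> h1 h2 h3; have h4 := Rmult_le_compat_r _ _ _ h2 h1; lra.
Qed.
Lemma bounded_poly (F : {poly CK}) : exists B : R, (0 <= B)%R /\
  forall t, (-1 <= t <= 2)%R -> (N1 (F.[seg a b t : CK]) <= B)%R.
Proof.
have [S [S0 hS]] := bounded_seg.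
elim/poly_ind: F => [|F c [B [B0 hB]]].
  by exists 0%R; split=> [|t _]; [exact: Rle_refl|rewrite horner0 N1_0; exact: Rle_refl].
exists (B * S + N1 c)%R; split.
  by have := N1_ge0 c; have := Rmult_le_pos _ _ B0 S0; lra.
move=> t ht; rewrite hornerD hornerM hornerX hornerC; apply: Rle_trans (N1_plus _ _) _.
apply: Rplus_le_compat_r; apply: Rle_trans (N1_mult _ _) _.
by apply: Rmult_le_compat; [exact: N1_ge0|exact: N1_ge0|exact: hB|exact: hS].
Qed.

Variable eps : CK.
Definition pF (t : R) : C := (de * P^`().[seg a b t : CK] : CK).
Definition qF (t : R) : C := (de * (eps * Q^`().[seg a b t : CK]) : CK).
Definition phiF (n : nat) (t : R) : C := ((phi a P Q eps n).[seg a b t : CK] : CK).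

Lemma abel_solE y : abel_sol a b d v eps y <-> sol pF qF y.
Proof.
have e t : Cmult (Cminus b a) (Cplus (Cmult (peval (pderiv (fst v)) d (seg a b t)) (Cpow (y t) 3))
     (Cmult eps (Cmult (peval (pderiv (snd v)) d (seg a b t)) (Cpow (y t) 2)))) = field pF qF t (y t).
  rewrite pevP pevQ /field /pF /qF; set u := P^`().[_]; set w := Q^`().[_].
  change ((de * (u * (Cpow (y t) 3 : CK) + eps * (w * (Cpow (y t) 2 : CK))) : CK) =
     (de * u * (Cpow (y t) 3 : CK) + de * (eps * w) * (Cpow (y t) 2 : CK))).
  by rewrite mulrDr !mulrA.
split=> h t ht.
  by apply: is_derive_dC; rewrite -e; apply: h.
by rewrite e; apply: dC_is_derive; apply: h.
Qed.

Lemma phiF_deriv n t : dC (phiF n.+2) t (Copp (Cplus (Cmult (RtoC (INR n.+1)) (Cmult (qF t) (phiF n.+1 t)))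
   (Cmult (RtoC (INR n)) (Cmult (pF t) (phiF n t))))).
Proof.
apply: dC_eq; last exact: dC_poly.
rewrite phiSS derivN deriv_Pm !RtoC_INR /qF /pF /phiF hornerN hornerD !hornerZ !hornerM hornerZ.
set u := P^`().[_]; set w := Q^`().[_]; set x := (phi a P Q eps n.+1).[_]; set z := (phi a P Q eps n).[_].
change (de * - (n.+1%:R * (eps * w * x) + n%:R * (u * z)) =
  - (n.+1%:R * (de * (eps * w) * x) + n%:R * (de * u * z)) :> CK).
by rewrite mulrN mulrDr; congr (- (_ + _)); rewrite mulrCA !mulrA.
Qed.
Lemma seg0 : seg a b 0 = a.
Proof. by rewrite /seg Cmult_0_l Cplus_0_r. Qed.
Lemma seg1 : seg a b 1 = b.
Proof. by rewrite /seg Cmult_1_l; change (a + (b - a) = b :> CK); rewrite addrC subrK. Qed.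

Lemma contC_poly (F : {poly CK}) (c : CK) t :
  continuous (fun s => fst (Cmult c (F.[seg a b s : CK] : C))) t /\ continuous (fun s => snd (Cmult c (F.[seg a b s : CK] : C))) t.
Proof.
have [h1 h2] := dC_mult _ _ _ _ _ (dC_const c t) (dC_poly F t).
by split; apply: ex_derive_continuous; [exists (fst (Cplus (Cmult (RtoC 0) (F.[seg a b t : CK] : C)) (Cmult c (de * F^`().[seg a b t : CK] : CK))))|
  exists (snd (Cplus (Cmult (RtoC 0) (F.[seg a b t : CK] : C)) (Cmult c (de * F^`().[seg a b t : CK] : CK))))].
Qed.

Lemma field_bounds : exists M, (1 <= M)%R /\ (forall t, (-1 <= t <= 2)%R -> (N1 (pF t) <= M)%R) /\
   forall t, (-1 <= t <= 2)%R -> (N1 (qF t) <= M)%R.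
Proof.
have [B1 [B10 h1]] := bounded_poly (de *: P^`()).
have [B2 [B20 h2]] := bounded_poly (de *: (eps *: Q^`())).
exists (1 + B1 + B2)%R; split; first by lra.
split=> t ht; first by have h := h1 t ht; rewrite hornerZ in h; apply: Rle_trans (h : (N1 (pF t) <= B1)%R) _; lra.
by have h := h2 t ht; rewrite !hornerZ in h; apply: Rle_trans (h : (N1 (qF t) <= B2)%R) _; lra.
Qed.

Lemma center_phi : (exists r, (0 < r)%R /\ forall y, sol pF qF y -> (N1 (y 0%R) < r)%R -> y 1%R = y 0%R) <->
  forall n, (phi a P Q eps n.+2).[b] = 0.
Proof.
have [M [M1 [hp hq]]] := field_bounds.
have f0 t : phiF 0 t = RtoC 0 by rewrite /phiF /= horner0.
have f1 t : phiF 1 t = RtoC 1 by rewrite /phiF /= hornerC.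
have f2 n : phiF n.+2 0 = RtoC 0 by rewrite /phiF seg0 phiSS hornerN Pm_a oppr0.
have e n : phiF n.+2 1 = (phi a P Q eps n.+2).[b] by rewrite /phiF seg1.
have cp t : continuous (fun s => fst (pF s)) t /\ continuous (fun s => snd (pF s)) t := contC_poly P^`() de t.
have cq t : continuous (fun s => fst (qF s)) t /\ continuous (fun s => snd (qF s)) t.
  have [c1 c2] := contC_poly (eps *: Q^`()) de t.
  by split; [move: c1|move: c2]; apply: continuous_ext => s; rewrite hornerZ.
split=> h.
  by move=> n; rewrite -e; apply: (@center_integral _ _ _ f0 f1 phiF_deriv f2 _ M1 hp hq cp cq h).
by apply: (@integral_center _ _ _ f0 f1 phiF_deriv f2 _ M1 hp hq) => n; rewrite e; apply: h.
Qed.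
End Link.

(** A center for every eps makes [phi] at b vanish identically in eps, hence each coefficient of a
    power of eps vanishes. *)
Lemma PCS_bimom (a b : CK) d v : PCS_d a b d v -> bimom a b d v.
Proof.
move=> [hin hc]; split=> //.
have [Pa Pb Qa Qb] := in_P0 hin.
have hphi eps n : (phi a (pP d v) (pQ d v) eps n.+2).[b] = 0.
  move: n; apply/(@center_phi a b d v eps).
  have [de [de0 hd]] := hc eps; exists de; split=> // y hs h0.
  apply: hd; first exact/(abel_solE hin).
  exact: Rle_lt_trans (Cmod_N1 _) h0.
by split; [apply: allmom_PQ|apply: allmom_QP].
Qed.

Lemma COS_PCS (a b : CK) d v : COS_d a b d v -> PCS_d a b d v.
Proof.
move=> /COS_CC[hin hCC]; split=> // eps.
have [r [r0 hr]] := (@center_phi a b d v eps).2 (fun n => phi_comp eps n hCC).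
(* The factor 2 pays for passing from the modulus to [N1]. *)
exists (r / 2)%R; split=> [|y hs h0]; first by lra.
apply: hr; first exact/(abel_solE hin).
by apply: Rle_lt_trans (N1_Cmod _) _; lra.
Qed.

Lemma CK_neq (a b : C) : a <> b -> (a : CK) != b.
Proof. by move=> ab; apply/eqP. Qed.
End ParametricCenter.

Require Import Defs.
From Stdlib Require Import Reals.
From Coquelicot Require Import Coquelicot.

Theorem theorem4p3 (a b : C) (hab : a <> b) :
  (forall d : nat, (d <= 11)%nat ->
     forall v : Space, PCS_d a b d v <-> COS_d a b d v) /\
  (forall d : nat, (12 <= d)%nat ->
     forall V : Space -> Prop, is_component (PCS_d a b d) V ->
       ~ sub V (COS_d a b d) ->
       dim_le V (Nat.div d 3 + 2)).
Proof.
pose proof (ParametricCenter.CK_neq hab) as ab.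
split; intros d hd.
- intros v; split; intros H.
  + apply (ZariskiChain.bimom_COS ab hd), ParametricCenter.PCS_bimom, H.
  + apply ParametricCenter.COS_PCS, H.
- intros V [VS [irr _]] nV. apply (ZariskiChain.bimom_dim ab hd irr); trivial.
  intros v Hv; apply ParametricCenter.PCS_bimom, VS, Hv.
Qed.
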